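(* Let $p\in(2,4)$ and $\alpha\in\mathbb{R}$. Then, for every $\mu>0$: (i) there exists a ground state at mass $\mu$, i.e. a function $u\in D_\mu$ such that $E(u)=\mathcal{E}(\mu)$; (ii) if $u$ is a ground state at mass $\mu$, written as $u=\phi_\lambda+q\mathcal{G}_\lambda$ for $\lambda>0$, then: (a) for any $\lambda>0$ both $\phi_\lambda$ and $q$ are not identically zero; (b) up to multiplication by a constant phase, $u$ is positive, radially symmetric, and decreasing along the radial direction; moreover (with the same choice of phase) $\phi_\lambda$ is nonnegative if $\lambda=\omega$, and positive if $\lambda>\omega$, where $\omega=\mu^{-1}\big(\|u\|_p^p-Q(u)\big)$.
   Context: Functions on $\mathbb{R}^2$ are complex valued and $\|\cdot\|_p$ is the norm of $L^p(\mathbb{R}^2)$. For $\lambda>0$, $\mathcal{G}_\lambda(\mathbf{x})=\frac{1}{2\pi}K_0(\sqrt{\lambda}|\mathbf{x}|)$ is the Green's function of $-\Delta+\lambda$ on $\mathbb{R}^2$ ($K_0$ is the modified Bessel function of the second kind of order $0$; $\mathcal{G}_\lambda$ is singular at the origin, so pointwise statements refer to $\mathbb{R}^2\setminus\{0\}$), and $$\theta_\lambda:=\frac{\log\left(\frac{\sqrt{\lambda}}{2}\right)+\gamma}{2\pi},$$ with $\gamma$ the Euler-Mascheroni constant. The energy space is $$D:=\{v\in L^2(\mathbb{R}^2):\exists q\in\mathbb{C},\ \lambda>0 \text{ such that } v-q\mathcal{G}_\lambda=:\phi_\lambda\in H^1(\mathbb{R}^2)\}.$$ For $v\in D$ the charge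 $q$ is uniquely determined by $v$ and does not depend on $\lambda$, and the decomposition $v=\phi_\lambda+q\mathcal{G}_\lambda$ with $\phi_\lambda\in H^1(\mathbb{R}^2)$ is available for every $\lambda>0$. The quadratic form $$Q(v):=\|\nabla\phi_\lambda\|_2^2+\lambda\big(\|\phi_\lambda\|_2^2-\|v\|_2^2\big)+(\alpha+\theta_\lambda)|q|^2,\qquad v\in D,$$ is independent of the choice of $\lambda>0$. The $\delta$-NLS energy is $E(v):=\frac12 Q(v)-\frac1p\|v\|_p^p$ for $v\in D$. For $\mu>0$, $D_\mu:=\{v\in D:\|v\|_2^2=\mu\}$ and $\mathcal{E}(\mu):=\inf_{v\in D_\mu}E(v)$. *)

(* Defs.v *)
From HB Require Import structures.
From mathcomp Require Import all_boot all_order all_algebra.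
From mathcomp Require Import all_classical all_reals all_analysis.
From mathcomp Require Import complex.

Set Implicit Arguments.
Unset Strict Implicit.
Unset Printing Implicit Defensive.

Import Order.TTheory GRing.Theory Num.Theory.
Import numFieldNormedType.Exports.

Local Open Scope classical_set_scope.
Local Open Scope ring_scope.
Local Open Scope complex_scope.

Section Plane.
Variable R : realType.

(* The max-norm of the product only matters for its topology. *)
Definition plane := (R * R)%type.

(* The same carrier, with the instance of the Borel sets of the line on which
   lebesgue_measure is defined. *)
Definition mplane := (measurableTypeR R * measurableTypeR R)%type.

Definition leb2 : {measure set mplane -> \bar R} :=
  (@lebesgue_measure R \x @lebesgue_measure R)%E.

(* The Euclidean norm: the library norm on R * R is the max-norm. *)
Definition enorm (x : plane) : R := Num.sqrt (x.1 ^+ 2 + x.2 ^+ 2).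

(* Elements of L^p(R^2) are represented by Borel functions, up to equality
   leb2-almost everywhere. *)
Definition cmeasurable (f : plane -> R[i]) : Prop :=
  measurable_fun [set: mplane] (fun x => complex.Re (f x)) /\
  measurable_fun [set: mplane] (fun x => complex.Im (f x)).

Definition ae_eq2 (f g : plane -> R[i]) : Prop := {ae leb2, forall x, f x = g x}.

Definition eLp_norm (p : R) (f : plane -> R[i]) : \bar R :=
  'N[leb2]_(p%:E)[EFin \o (@Normc.normc R \o f)]%E.

(* Junk value 0 when the norm is infinite; it is only applied to functions of
   L^2, and for p > 2 to functions of the energy space, which embeds in L^p. *)
Definition Lp_norm (p : R) (f : plane -> R[i]) : R := fine (eLp_norm p f).

Definition in_L2 (f : plane -> R[i]) : Prop :=
  cmeasurable f /\ (eLp_norm 2 f < +oo)%E.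

Definition e1 : plane := (1, 0).
Definition e2 : plane := (0, 1).

Fixpoint Ck (k : nat) (phi : plane -> R) : Prop :=
  continuous phi /\
  if k is k'.+1 then
    [/\ forall x, derivable phi x e1, forall x, derivable phi x e2,
        Ck k' ('D_e1 phi) & Ck k' ('D_e2 phi)]
  else True.

(* Real-valued C_c^oo functions on the plane. *)
Definition test_function (phi : plane -> R) : Prop :=
  (forall k, Ck k phi) /\ compact (closure [set x | phi x != 0]).

(* g is the distributional derivative of f along e; by linearity it suffices
   to test against real-valued functions. *)
Definition weak_derivative (e : plane) (f g : plane -> R[i]) : Prop :=
  forall phi, test_function phi ->
    (\int[leb2]_x (complex.Re (f x) * 'D_e phi x)) =
      - (\int[leb2]_x (complex.Re (g x) * phi x)) /\
    (\int[leb2]_x (complex.Im (f x) * 'D_e phi x)) =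
      - (\int[leb2]_x (complex.Im (g x) * phi x)).

Definition in_H1 (f : plane -> R[i]) : Prop :=
  [/\ in_L2 f,
      exists g, in_L2 g /\ weak_derivative e1 f g &
      exists g, in_L2 g /\ weak_derivative e2 f g].

(* For f in H^1, a representative of the weak partial derivative, which is
   unique up to almost-everywhere equality. *)
Definition weak_partial (e : plane) (f : plane -> R[i]) : plane -> R[i] :=
  xget (fun=> 0) [set g | in_L2 g /\ weak_derivative e f g].

(* The squared L^2 norm of the gradient. *)
Definition grad_norm2 (f : plane -> R[i]) : R :=
  Lp_norm 2 (weak_partial e1 f) ^+ 2 + Lp_norm 2 (weak_partial e2 f) ^+ 2.

(* For x > 0, the modified Bessel function of the second kind of order 0,
   K_0(x) = \int_0^oo exp(- x cosh t) dt. *)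
Definition besselK0 (x : R) : R :=
  \int[lebesgue_measure]_(t in `[0, +oo[)
    expR (- x * ((expR t + expR (- t)) / 2)).

Definition euler_gamma : R :=
  limn (fun n : nat => \sum_(1 <= k < n.+1) k%:R^-1 - ln n%:R).

(* The value at the origin is irrelevant. *)
Definition green (lam : R) (x : plane) : R :=
  besselK0 (Num.sqrt lam * enorm x) / (2 * pi).

Definition theta (lam : R) : R :=
  (ln (Num.sqrt lam / 2) + euler_gamma) / (2 * pi).

Definition minus_green (lam : R) (q : R[i]) (v : plane -> R[i]) :
    plane -> R[i] :=
  fun x => v x - q * (green lam x)%:C.

Definition energy_space : set (plane -> R[i]) :=
  [set v | in_L2 v /\
    exists (q : R[i]) (lam : R), 0 < lam /\ in_H1 (minus_green lam q v)].

(* For v in the energy space such a q exists, and it is unique. *)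
Definition delta_charge (v : plane -> R[i]) : R[i] :=
  xget 0 [set q | exists lam : R, 0 < lam /\ in_H1 (minus_green lam q v)].

(* phi_lambda, in the decomposition v = phi_lambda + q G_lambda. *)
Definition regular_part (lam : R) (v : plane -> R[i]) : plane -> R[i] :=
  minus_green lam (delta_charge v) v.

Definition quad_form_at (alpha lam : R) (v : plane -> R[i]) : R :=
  grad_norm2 (regular_part lam v)
  + lam * (Lp_norm 2 (regular_part lam v) ^+ 2 - Lp_norm 2 v ^+ 2)
  + (alpha + theta lam) * Normc.normc (delta_charge v) ^+ 2.

(* On the energy space, quad_form_at alpha lam v is the same for all lam > 0. *)
Definition quad_form (alpha : R) (v : plane -> R[i]) : R :=
  quad_form_at alpha 1 v.

Definition energy (alpha p : R) (v : plane -> R[i]) : R :=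
  2^-1 * quad_form alpha v - p^-1 * Lp_norm p v `^ p.

Definition mass_constraint (mu : R) : set (plane -> R[i]) :=
  [set v | energy_space v /\ Lp_norm 2 v ^+ 2 = mu].

Definition ground_level (alpha p mu : R) : \bar R :=
  ereal_inf [set (energy alpha p v)%:E | v in mass_constraint mu].

Definition ground_state (alpha p mu : R) (u : plane -> R[i]) : Prop :=
  mass_constraint mu u /\ (energy alpha p u)%:E = ground_level alpha p mu.

(* Pointwise properties on R^2 \ {0}. In R[i], z < w means that w - z is a
   positive real number; in particular 0 < z forces z to be real. *)
Definition pointwise_pos (f : plane -> R[i]) : Prop :=
  forall x : plane, x != 0 -> 0 < f x.

Definition pointwise_nonneg (f : plane -> R[i]) : Prop :=
  forall x : plane, x != 0 -> 0 <= f x.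

Definition radial (f : plane -> R[i]) : Prop :=
  forall x y : plane, x != 0 -> y != 0 -> enorm x = enorm y -> f x = f y.

Definition radially_decreasing (f : plane -> R[i]) : Prop :=
  forall x y : plane, x != 0 -> y != 0 -> enorm x < enorm y -> f y < f x.

End Plane.

(* Main.v *)
Require Import Defs.
From HB Require Import structures.
From mathcomp Require Import all_boot all_order all_algebra.
From mathcomp Require Import all_classical all_reals all_analysis.
From mathcomp Require Import complex measurable_realfun ring lra zify.

Set Implicit Arguments.
Unset Strict Implicit.
Unset Printing Implicit Defensive.

Import Order.TTheory GRing.Theory Num.Theory.
Import numFieldNormedType.Exports.

Local Open Scope classical_set_scope.
Local Open Scope ring_scope.

(** For real f in L^2, put D_t(f) = \iint k_t(x - y) (f x - f y)^2, where k_t is the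
heat kernel. Then f is in H^1 as soon as D_t(f) / (2 t) stays bounded as t -> 0, and
the limit is the squared norm of the gradient; so every rearrangement that decreases
D_t (modulus, truncation, polarization) decreases the gradient norm. The Green
function is the Laplace transform in time of the heat kernel, which yields its scalar
products and shows that it is not in H^1 whereas G_a - G_b is.

Existence. Let v_n = f_n + c_n G be a real minimizing sequence, with weak limit
v = f + c G. Since E(s v) <= s^2 E(v) for s >= 1, the functions of mass at most mu
satisfy E(w) >= (|w|^2 / mu) inf E; splitting the energy of v_n into those of v and
v_n - v gives E(v) <= (|v|^2 / mu) inf E, so a nonzero v, rescaled to mass mu, is a
minimizer. If v = 0, then c_n -> 0 because G is not in H^1, and inf E < 0 prevents the
f_n from vanishing: a translate of f_n has a nonzero limit.

Structure. At the frequency omega of v, let A = Q + omega |.|^2 and B = |.|_p^p; then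
A(v) = B(v). If A(v') <= A(v) and B(v') >= B(v), then v' rescaled to the mass of v
has energy at most E(v), with equality only if nothing changed. Taking
v' = |phi_omega| + |q| G_omega reduces the problem to real functions and forces a
common phase of phi_omega and q. Polarizing phi_omega with respect to half-planes
containing the origin shows that it is radially nonincreasing. The charge is nonzero
by a first-order variation along G_omega, and phi_lambda is nonzero by a first-order
variation of q G_lambda along a bump near the origin, where G_lambda is unbounded. *)

(** * Real integrals and square integrable functions *)

(** The heat kernel is explicit, obeys a semigroup law and decreases with the distance; gradients
    then enter only through double integrals of (f x - f y)^2, and a rearrangement inequality
    becomes an inequality between integrands. The obstacle is that G misses H^1 logarithmically, so
    that no Sobolev inequality applies to f + c G. Its substitute is D_t(G) = O(t^delta) for each
    delta < 1: comparing v with its heat flow on dyadic level sets bounds the p-th power as soon as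
    p - 2 < 2 delta, and delta = p/4 satisfies both conditions exactly because p < 4. The same
    estimate shows that a chargeless sequence whose local masses vanish has vanishing p-th power.
    The frequency omega is singled out because, with Green parameter omega, Q + omega |.|^2 equals
    |grad phi|^2 + omega |phi|^2 + (alpha + theta) |q|^2: phi and q are decoupled, and each can be
    modified without the other. Pointwise conclusions also come from heat flows: a polarization
    inequality holds off a null set depending on the half-plane, while its integrated form, between
    values of a heat flow, holds at every point. *)

Lemma EFin_cvg (R : realType) (u : nat -> R) (l : R) :
  u @ \oo --> l -> (fun n => (u n)%:E) @ \oo --> l%:E.
Proof. by move=> ul; apply: cvg_EFin => //; exact: nearW. Qed.

Notation mf f := (measurable_fun setT f).

Section integral_toolkit.
Context d (T : measurableType d) (R : realType) (mu : {measure set T -> \bar R}).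
Implicit Types f g h : T -> R.

Definition ig f := mu.-integrable setT (EFin \o f).
Definition II f : R := \int[mu]_x f x.

Lemma ig_mf f : ig f -> mf f.
Proof. by move=> /measurable_int/measurable_EFinP. Qed.

Lemma EFin_II f : ig f -> (\int[mu]_x (f x)%:E)%E = (II f)%:E.
Proof. by move=> fi; rewrite /II /Rintegral fineK//; exact: integrable_fin_num. Qed.

Lemma ge0_ig f : mf f -> (forall x, 0 <= f x) ->
  (\int[mu]_x (f x)%:E < +oo)%E -> ig f.
Proof.
move=> f1 f0 h; apply/integrableP; split; first exact/measurable_EFinP.
by under eq_integral do rewrite /= ger0_norm//.
Qed.

Lemma ig_lty f : ig f -> (forall x, 0 <= f x) -> (\int[mu]_x (f x)%:E < +oo)%E.
Proof. by move=> fi f0; rewrite EFin_II// ltry. Qed.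

Lemma ig_le f g : mf f -> (forall x, `|f x| <= g x) -> ig g -> ig f.
Proof.
move=> f1 fg; apply: le_integrable => //; first exact/measurable_EFinP.
by move=> x _ /=; rewrite lee_fin (le_trans (fg x))// ler_norm.
Qed.

Lemma igD f g : ig f -> ig g -> ig (fun x => f x + g x).
Proof.
move=> fi gi; have := integrableD measurableT fi gi.
by apply: eq_integrable => // x _ /=; rewrite EFinD.
Qed.

Lemma igN f : ig f -> ig (fun x => - f x).
Proof.
move=> fi; have := integrableN fi.
by apply: eq_integrable => // x _ /=; rewrite EFinN.
Qed.

Lemma igB f g : ig f -> ig g -> ig (fun x => f x - g x).
Proof. by move=> fi gi; apply: (igD fi); apply: igN. Qed.

Lemma igZ (k : R) f : ig f -> ig (fun x => k * f x).
Proof.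
move=> fi; have := integrableZl measurableT k fi.
by apply: eq_integrable => // x _ /=; rewrite EFinM.
Qed.

Lemma ig0 : ig (fun=> 0).
Proof. exact: integrable0. Qed.

Lemma ig_norm f : ig f -> ig (fun x => `|f x|).
Proof. by move=> fi; apply: integrable_norm. Qed.

Lemma IID f g : ig f -> ig g -> II (fun x => f x + g x) = II f + II g.
Proof. by move=> fi gi; rewrite /II RintegralD. Qed.

Lemma IIB f g : ig f -> ig g -> II (fun x => f x - g x) = II f - II g.
Proof. by move=> fi gi; rewrite /II RintegralB. Qed.

Lemma IIZ (k : R) f : ig f -> II (fun x => k * f x) = k * II f.
Proof. by move=> fi; rewrite /II RintegralZl. Qed.

Lemma IIN f : ig f -> II (fun x => - f x) = - II f.
Proof.
move=> fi; rewrite -mulN1r -IIZ//; congr II; apply/funext => x.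
by rewrite mulN1r.
Qed.

Lemma II_ge0 f : (forall x, 0 <= f x) -> 0 <= II f.
Proof. by move=> f0; apply: Rintegral_ge0. Qed.

Lemma II_le f g : ig f -> ig g -> (forall x, f x <= g x) -> II f <= II g.
Proof. by move=> fi gi fg; apply: le_Rintegral. Qed.

Lemma II0 : II (fun=> 0) = 0.
Proof. by rewrite /II /Rintegral integral0. Qed.

Lemma norm_II f : ig f -> `|II f| <= II (fun x => `|f x|).
Proof. by move=> fi; apply: le_normr_Rintegral. Qed.

Lemma ae_II f g : mf f -> mf g -> {ae mu, forall x, f x = g x} -> II f = II g.
Proof.
move=> f1 g1 fg; rewrite /II /Rintegral; congr fine.
apply: ae_eq_integral => //; [exact/measurable_EFinP|exact/measurable_EFinP|].
by apply: filterS fg => x /= -> _.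
Qed.

Lemma ae_ig f g : mf f -> mf g -> {ae mu, forall x, f x = g x} -> ig f -> ig g.
Proof.
move=> f1 g1 fg /integrableP[_ h]; apply/integrableP; split.
  exact/measurable_EFinP.
rewrite (ae_eq_integral (fun x => `|(EFin \o f) x|%E))//.
- by apply: measurableT_comp => //; apply/measurable_EFinP.
- by apply: measurableT_comp => //; apply/measurable_EFinP.
- by apply: filterS fg => x /= -> _.
Qed.

Lemma II_eq0 f : ig f -> (forall x, 0 <= f x) -> II f = 0 ->
  {ae mu, forall x, f x = 0}.
Proof.
move=> fi f0 h.
have := @ae_eq_integral_abs _ _ _ mu setT measurableT (EFin \o f).
case; first exact/measurable_EFinP/ig_mf.
move=> + _ => H; have {}H : ae_eq mu setT (EFin \o f) (cst 0%E).
  apply: H; transitivity (\int[mu]_x (f x)%:E)%E.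
    by apply: eq_integral => x _ /=; rewrite ger0_norm.
  by rewrite EFin_II// h.
by apply: filterS H => x /= /(_ I) [].
Qed.

Lemma II_dct (f_ : nat -> T -> R) f g : (forall n, mf (f_ n)) -> mf f ->
  {ae mu, forall x, f_ ^~ x @ \oo --> f x} -> ig g ->
  (forall n x, `|f_ n x| <= g x) ->
  ig f /\ (fun n => II (f_ n)) @ \oo --> II f.
Proof.
move=> mf_ mf1 fcv gi fg.
have [] := @dominated_convergence _ _ _ mu setT measurableT
  (fun n => EFin \o f_ n) (EFin \o f) (EFin \o g).
- by move=> n; apply/measurable_EFinP; exact: mf_.
- exact/measurable_EFinP.
- by apply: filterS fcv => x h _; exact: EFin_cvg.
- exact: gi.
- by apply: aeW => x n _ /=; rewrite lee_fin.
move=> fi _ h; split => //.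
have fni n : ig (f_ n) by apply: (ig_le _ (fg n)).
rewrite -[II f]/(fine (II f)%:E) -EFin_II//.
suff -> : (fun n => II (f_ n)) = fine \o (fun n => \int[mu]_x (f_ n x)%:E)%E.
  by apply: fine_cvg; rewrite fineK; [exact: h|exact: integrable_fin_num].
by apply/funext.
Qed.

(** The integral of the limit is kept in extended form because the bound is often what proves that
    the limit is integrable. *)
Lemma fatou_ae (f_ : nat -> T -> R) f (c : nat -> R) (l : R) :
  (forall n, mf (f_ n)) -> mf f -> (forall n x, 0 <= f_ n x) ->
  (forall x, 0 <= f x) ->
  {ae mu, forall x, f_ ^~ x @ \oo --> f x} ->
  (forall n, \int[mu]_x (f_ n x)%:E <= (c n)%:E)%E -> c @ \oo --> l ->
  (\int[mu]_x (f x)%:E <= l%:E)%E.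
Proof.
move=> mf_ mf1 f0_ f0 fcv fc cl.
have mlim : measurable_fun setT (fun x => limn_einf (fun n => (f_ n x)%:E)).
  rewrite /limn_einf; apply: measurableT_comp => //.
  apply: measurable_fun_limn_esup => n.
  by apply: measurableT_comp => //; apply/measurable_EFinP; exact: mf_.
apply: (@le_trans _ _ (\int[mu]_x limn_einf (fun n => (f_ n x)%:E))%E).
  apply: ae_ge0_le_integral => //.
  - by move=> x _; rewrite lee_fin.
  - exact/measurable_EFinP.
  - move=> x _; rewrite limn_einf_lim; apply: lime_ge; first exact: is_cvg_einfs.
    apply: nearW => n; apply: le_ereal_inf_tmp => _ [k _ <-].
    by rewrite lee_fin.
  - apply: filterS fcv => x h _.
    by have [-> _] := cvg_limn_einf_sup (EFin_cvg h).
apply: (le_trans (@fatou _ _ _ mu setT measurableT (fun n => EFin \o f_ n) _ _)).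
- by move=> n; apply/measurable_EFinP; exact: mf_.
- by move=> n x _; rewrite lee_fin.
have cl1 := EFin_cvg cl.
rewrite -(cvg_lim _ cl1)// limn_einf_lim; apply: lee_lim.
- exact: is_cvg_einfs.
- by apply/cvg_ex; exists l%:E.
- apply: nearW => n; apply: (le_trans _ (fc n)).
  by apply: ereal_inf_lbound; exists n => /=.
Qed.

End integral_toolkit.

Section limits.
Context {R : realType}.

Lemma cvg_seqP (u : nat -> R) (l : R) :
  u @ \oo --> l <->
  (forall e, 0 < e -> exists N, forall n, (N <= n)%N -> `|u n - l| <= e).
Proof.
split => [/cvgrPdist_le h e e0|h].
  have [N _ H] := h e e0; exists N => n Nn.
  by rewrite distrC; apply: H.
apply/cvgrPdist_le => e e0; have [N H] := h e e0.
by exists N => // n /= Nn; rewrite distrC; apply: H.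
Qed.

Lemma squeeze0 (u v : nat -> R) : (forall n, `|u n| <= v n) -> v @ \oo --> 0 ->
  u @ \oo --> 0.
Proof.
move=> uv /cvg_seqP h; apply/cvg_seqP => e e0; have [N H] := h e e0.
exists N => n /H; rewrite !subr0; apply: le_trans.
by rewrite (le_trans (uv n))// ler_norm.
Qed.

Lemma cvg_le (u : nat -> R) (l c : R) : u @ \oo --> l -> (forall n, u n <= c) -> l <= c.
Proof.
move=> ul uc; rewrite -(cvg_lim _ ul)//; apply: limr_le; last exact: nearW.
by apply/cvg_ex; exists l.
Qed.

Lemma cvg_ge (u : nat -> R) (l c : R) : u @ \oo --> l -> (forall n, c <= u n) -> c <= l.
Proof.
move=> ul uc; rewrite -(cvg_lim _ ul)//; apply: limr_ge; last exact: nearW.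
by apply/cvg_ex; exists l.
Qed.

Lemma cvg_sub_seq (u : nat -> R) (l : R) (s : nat -> nat) :
  (forall n, n <= s n)%N -> u @ \oo --> l -> (u \o s) @ \oo --> l.
Proof.
move=> sn /cvg_seqP h; apply/cvg_seqP => e e0; have [N H] := h e e0.
by exists N => n Nn; apply: H; exact: leq_trans (sn n).
Qed.

End limits.

Section L2.
Context d (T : measurableType d) (R : realType) (mu : {measure set T -> \bar R}).
Implicit Types f g h : T -> R.
Local Notation ig := (ig mu).
Local Notation II := (II mu).

Definition L2 f := mf f /\ ig (fun x => f x ^+ 2).
Definition nrm2 f := II (fun x => f x ^+ 2).
Definition ip f g := II (fun x => f x * g x).

Lemma L2P f : mf f -> (\int[mu]_x (f x ^+ 2)%:E < +oo)%E -> L2 f.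
Proof.
move=> f1 h; split => //; apply: ge0_ig => // [|x]; last exact: sqr_ge0.
exact: measurable_funX.
Qed.

Lemma L2_mul f g : L2 f -> L2 g -> ig (fun x => f x * g x).
Proof.
move=> [f1 f2] [g1 g2]; apply: (ig_le _ _ (igD f2 g2)).
  exact: measurable_funM.
move=> x; rewrite normrM -(real_normK (num_real (f x))) -(real_normK (num_real (g x))).
have := sqr_ge0 (`|f x| - `|g x|); rewrite sqrrB.
have := normr_ge0 (f x); have := normr_ge0 (g x).
move: `|f x| `|g x| => a b; nra.
Qed.

Lemma L2D f g : L2 f -> L2 g -> L2 (fun x => f x + g x).
Proof.
move=> fL gL; split; first by apply: measurable_funD; [case: fL|case: gL].
have h := igD (igD fL.2 (igZ 2 (L2_mul fL gL))) gL.2.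
by apply: eq_integrable h => // x _ /=; congr EFin; ring.
Qed.

Lemma L2Z k f : L2 f -> L2 (fun x => k * f x).
Proof.
move=> fL; split; first by apply: measurable_funM => //; case: fL.
have h := igZ (k ^+ 2) fL.2.
by apply: eq_integrable h => // x _ /=; congr EFin; ring.
Qed.

Lemma L2N f : L2 f -> L2 (fun x => - f x).
Proof.
move=> /(L2Z (-1)); congr L2; apply/funext => x; exact: mulN1r.
Qed.

Lemma L2B f g : L2 f -> L2 g -> L2 (fun x => f x - g x).
Proof. by move=> fL gL; apply: (L2D fL); exact: L2N. Qed.

Lemma L2_0 : L2 (fun=> 0).
Proof.
split; first exact: measurable_cst.
by have -> : (fun _ : T => (0 : R) ^+ 2) = (fun=> 0); [apply/funext => x; rewrite expr0n|exact: ig0].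
Qed.

Lemma L2_le f g : mf f -> (forall x, `|f x| <= `|g x|) -> L2 g -> L2 f.
Proof.
move=> f1 fg gL; split => //; apply: (ig_le _ _ gL.2).
  exact: measurable_funX.
by move=> x; rewrite normrX -(real_normK (num_real (g x))) lerXn2r ?nnegrE.
Qed.

Lemma L2_norm f : L2 f -> L2 (fun x => `|f x|).
Proof.
move=> fL; apply: (L2_le _ _ fL) => [|x]; last by rewrite normr_id.
by apply: measurableT_comp => //; case: fL.
Qed.

Lemma nrm2_ge0 f : 0 <= nrm2 f.
Proof. by apply: II_ge0 => x; exact: sqr_ge0. Qed.

Lemma ipC f g : ip f g = ip g f.
Proof. by congr II; apply/funext => x; rewrite mulrC. Qed.

Lemma ipff f : ip f f = nrm2 f.
Proof. by congr II; apply/funext => x; rewrite expr2. Qed.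

Lemma ipDl f g h : L2 f -> L2 g -> L2 h ->
  ip (fun x => f x + g x) h = ip f h + ip g h.
Proof.
move=> fL gL hL; rewrite /ip -IID; try exact: L2_mul.
by congr II; apply/funext => x; rewrite mulrDl.
Qed.

Lemma ipZl k f h : L2 f -> L2 h -> ip (fun x => k * f x) h = k * ip f h.
Proof.
move=> fL hL; rewrite /ip -IIZ; last exact: L2_mul.
by congr II; apply/funext => x; rewrite mulrA.
Qed.

Lemma ipBl f g h : L2 f -> L2 g -> L2 h ->
  ip (fun x => f x - g x) h = ip f h - ip g h.
Proof.
move=> fL gL hL; rewrite /ip -IIB; try exact: L2_mul.
by congr II; apply/funext => x; rewrite mulrBl.
Qed.

Lemma nrm2_lin (s : R) f g : L2 f -> L2 g ->
  nrm2 (fun x => f x + s * g x) = nrm2 f + 2 * s * ip f g + s ^+ 2 * nrm2 g.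
Proof.
move=> fL gL.
have i1 := fL.2; have i2 := igZ (2 * s) (L2_mul fL gL).
have i3 := igZ (s ^+ 2) gL.2.
rewrite /nrm2 /ip -(IIZ _ (L2_mul fL gL)) -(IIZ _ gL.2) -(IID i1 i2).
by rewrite -(IID (igD i1 i2) i3); congr II; apply/funext => x; ring.
Qed.

Lemma nrm2D f g : L2 f -> L2 g ->
  nrm2 (fun x => f x + g x) = nrm2 f + 2 * ip f g + nrm2 g.
Proof.
move=> fL gL; have := nrm2_lin 1 fL gL; rewrite expr1n mulr1 mul1r => <-.
by congr nrm2; apply/funext => x; rewrite mul1r.
Qed.

Lemma nrm2B f g : L2 f -> L2 g ->
  nrm2 (fun x => f x - g x) = nrm2 f - 2 * ip f g + nrm2 g.
Proof.
move=> fL gL; have := nrm2_lin (-1) fL gL.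
rewrite sqrrN expr1n mulrN1 mulNr mul1r => <-.
by congr nrm2; apply/funext => x; rewrite mulN1r.
Qed.

Lemma nrm2Z k f : L2 f -> nrm2 (fun x => k * f x) = k ^+ 2 * nrm2 f.
Proof.
move=> fL; rewrite /nrm2 -IIZ; last by case: fL.
by congr II; apply/funext => x; rewrite exprMn.
Qed.

Lemma cauchy_schwarz f g : L2 f -> L2 g -> ip f g ^+ 2 <= nrm2 f * nrm2 g.
Proof.
move=> fL gL.
have H s : 0 <= nrm2 f + 2 * s * ip f g + s ^+ 2 * nrm2 g.
  by rewrite -nrm2_lin//; exact: nrm2_ge0.
have := nrm2_ge0 g; rewrite le_eqVlt => /predU1P[g0|g0].
  rewrite -g0 mulr0 le_eqVlt; apply/orP; left; rewrite sqrf_eq0; apply/eqP.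
  (* When [nrm2 g] vanishes the polynomial is affine in s; unless its slope is 0, this s gives it
     the value -1. *)
  have := H (- (nrm2 f + 1) / (2 * ip f g)).
  rewrite -g0 mulr0 addr0; have [->//|i0] := eqVneq (ip f g) 0.
  have -> : 2 * (- (nrm2 f + 1) / (2 * ip f g)) * ip f g = - (nrm2 f + 1) by field.
  lra.
have := H (- ip f g / nrm2 g).
have -> : nrm2 f + 2 * (- ip f g / nrm2 g) * ip f g +
    (- ip f g / nrm2 g) ^+ 2 * nrm2 g = nrm2 f - ip f g ^+ 2 / nrm2 g.
  by field; rewrite gt_eqF.
by rewrite subr_ge0 ler_pdivrMr.
Qed.

Lemma norm_ip_le f g (a b : R) : L2 f -> L2 g -> 0 <= a -> 0 <= b ->
  nrm2 f <= a ^+ 2 -> nrm2 g <= b ^+ 2 -> `|ip f g| <= a * b.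
Proof.
move=> fL gL a0 b0 fa gb; rewrite -(ler_sqr (normr_ge0 _)) ?nnegrE ?mulr_ge0//.
rewrite real_normK ?num_real// exprMn (le_trans (cauchy_schwarz fL gL))//.
by apply: ler_pM => //; exact: nrm2_ge0.
Qed.

Lemma nrm2D_le f g : L2 f -> L2 g ->
  nrm2 (fun x => f x + g x) <= 2 * nrm2 f + 2 * nrm2 g.
Proof.
move=> fL gL; rewrite nrm2D//; have := nrm2_ge0 (fun x => f x - g x).
rewrite nrm2B//; lra.
Qed.

Lemma nrm2B_le f g : L2 f -> L2 g ->
  nrm2 (fun x => f x - g x) <= 2 * nrm2 f + 2 * nrm2 g.
Proof.
move=> fL gL; rewrite nrm2B//; have := nrm2_ge0 (fun x => f x + g x).
rewrite nrm2D//; lra.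
Qed.

Lemma nrm2_eq0 f : L2 f -> nrm2 f = 0 -> {ae mu, forall x, f x = 0}.
Proof.
move=> fL h; have := II_eq0 fL.2 (fun x => sqr_ge0 (f x)) h.
by apply: filterS => x /eqP; rewrite sqrf_eq0 => /eqP.
Qed.

Lemma ae_nrm2 f g : mf f -> mf g -> {ae mu, forall x, f x = g x} -> nrm2 f = nrm2 g.
Proof.
move=> f1 g1 fg; apply: ae_II; [exact: measurable_funX..|].
by apply: filterS fg => x /= ->.
Qed.

Lemma ae_L2 f g : mf f -> mf g -> {ae mu, forall x, f x = g x} -> L2 f -> L2 g.
Proof.
move=> f1 g1 fg [_ f2]; split => //; apply: (ae_ig _ _ _ f2);
  [exact: measurable_funX..|].
by apply: filterS fg => x /= ->.
Qed.

Lemma ae_ip f f' g g' : mf f -> mf f' -> mf g -> mf g' ->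
  {ae mu, forall x, f x = f' x} ->
  {ae mu, forall x, g x = g' x} -> ip f g = ip f' g'.
Proof.
move=> f1 f2 g1 g2 ff gg; apply: ae_II; [exact: measurable_funM..|].
by apply: filterS2 ff gg => x /= -> ->.
Qed.

Lemma nrm2_cvg0_ip (f_ : nat -> T -> R) f g : (forall n, L2 (f_ n)) -> L2 f -> L2 g ->
  (fun n => nrm2 (fun x => f_ n x - f x)) @ \oo --> 0 ->
  (fun n => ip (f_ n) g) @ \oo --> ip f g.
Proof.
move=> fL_ fL gL /cvg_seqP h; apply/cvg_seqP => e e0.
pose b := Num.sqrt (nrm2 g) + 1.
have b0 : 0 < b by rewrite ltr_wpDl// sqrtr_ge0.
have [N H] := h ((e / b) ^+ 2) (exprn_gt0 _ (divr_gt0 e0 b0)).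
exists N => n /H; rewrite subr0 ger0_norm ?nrm2_ge0// => Hn.
rewrite -ipBl//.
have -> : e = e / b * b by rewrite divfK// gt_eqF.
apply: norm_ip_le => //; [exact: L2B|by rewrite divr_ge0// ltW|exact: ltW|].
rewrite -(sqr_sqrtr (nrm2_ge0 g)) lerXn2r ?nnegrE ?sqrtr_ge0 ?(ltW b0)//.
by rewrite lerDl.
Qed.

(** With D = f_n - f, split |D g| <= min(|D g|, K g^2) + D^2 / K. The first term tends to 0 by
    dominated convergence for fixed K; the second has integral at most M'/K, uniformly in n. *)
Lemma ae_bounded_weak_cvg (f_ : nat -> T -> R) f g (M : R) :
  (forall n, L2 (f_ n)) -> L2 f -> L2 g -> (forall n, nrm2 (f_ n) <= M) ->
  {ae mu, forall x, f_ ^~ x @ \oo --> f x} ->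
  (fun n => ip (f_ n) g) @ \oo --> ip f g.
Proof.
move=> fL_ fL gL fM fcv.
pose D n x := f_ n x - f x; pose M' := 2 * M + 2 * nrm2 f.
have DL n : L2 (D n) by exact: L2B.
have DM n : nrm2 (D n) <= M'.
  by apply: (le_trans (nrm2B_le (fL_ n) fL)); rewrite lerD2r ler_pM2l.
have M0 : 0 <= M' by exact: le_trans (nrm2_ge0 _) (DM 0%N).
apply/cvg_seqP => e e0.
(* This choice keeps the uniform term M'/K below e/2. *)
pose K := 2 * (M' + 1) / e.
have K0 : 0 < K by rewrite divr_gt0// mulr_gt0// ltr_wpDl.
pose h n x := Num.min `|D n x * g x| (K * g x ^+ 2).
have gK : ig (fun x => K * g x ^+ 2) by apply: igZ; case: gL.
have h0 n x : 0 <= h n x.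
  by rewrite le_min normr_ge0 mulr_ge0 ?sqr_ge0 ?ltW.
have mh n : mf (h n).
  apply: measurable_minr; last exact: ig_mf gK.
  apply: measurableT_comp => //; apply: measurable_funM.
    by case: (DL n).
  by case: gL.
have [_ /cvg_seqP hcv] : ig (fun=> 0 : R) /\ (fun n => II (h n)) @ \oo --> II (fun=> 0).
  apply: (II_dct mh _ _ gK); first exact: measurable_cst.
    apply: filterS fcv => x /cvg_seqP fx; apply/cvg_seqP => e1 e10.
    have g1 : 0 < `|g x| + 1 by rewrite ltr_wpDl.
    have [N H] := fx (e1 / (`|g x| + 1)) (divr_gt0 e10 g1).
    exists N => n /H Hn; rewrite subr0 ger0_norm// ge_min; apply/orP; left.
    rewrite normrM; apply: (@le_trans _ _ (e1 / (`|g x| + 1) * `|g x|)).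
      by apply: ler_wpM2r.
    rewrite mulrAC ler_pdivrMr//; apply: ler_wpM2l; first exact: ltW.
    by rewrite lerDl.
  by move=> n x; rewrite ger0_norm// ge_min lexx orbT.
have e2 : 0 < e / 2 by rewrite divr_gt0.
have [N H] := hcv _ e2; exists N => n /H; rewrite II0 subr0 ger0_norm ?II_ge0//.
move=> hn; rewrite -ipBl//; apply: (le_trans (norm_II (L2_mul (DL n) gL))).
have hi : ig (h n).
  by apply: (ig_le _ _ gK) => // x; rewrite ger0_norm// ge_min lexx orbT.
apply: (@le_trans _ _ (II (fun x => h n x + K^-1 * D n x ^+ 2))).
  apply: II_le => [||x].
  - exact/ig_norm/L2_mul.
  - by apply: igD => //; apply: igZ; case: (DL n).
  rewrite /h /=; case: (leP `|D n x * g x| (K * g x ^+ 2)) => _; first by rewrite lerDl mulr_ge0 ?sqr_ge0// invr_ge0 ltW.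
  rewrite -(ler_pM2l K0) mulrDr mulVKf ?gt_eqF// normrM.
  rewrite -(real_normK (num_real (D n x))) -(real_normK (num_real (g x))).
  have := sqr_ge0 (`|D n x| - K * `|g x|).
  have := normr_ge0 (g x); have := normr_ge0 (D n x).
  move: `|D n x| `|g x| => a b; nra.
rewrite IID//; last by apply: igZ; case: (DL n).
rewrite IIZ; last by case: (DL n).
rewrite (_ : e = e / 2 + e / 2); last by field.
apply: lerD => //; rewrite -[II _]/(nrm2 (D n)).
have Ke : K * (e / 2) = M' + 1 by rewrite /K; field; rewrite gt_eqF.
by rewrite ler_pdivrMl// Ke (le_trans (DM n))// lerDl.
Qed.

End L2.

(** * Almost everywhere limits and completeness of L^2 *)

Section ae_limits.
Context d (T : measurableType d) (R : realType) (mu : {measure set T -> \bar R}).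
Implicit Types f g h : T -> R.
Local Notation ig := (ig mu).
Local Notation II := (II mu).

(** The upper limit is measurable and defined at every point, so it supplies the limit function. *)
Lemma ae_limit (f_ : nat -> T -> R) : (forall n, mf (f_ n)) ->
  {ae mu, forall x, cvgn (f_ ^~ x)} ->
  exists f, mf f /\ {ae mu, forall x, f_ ^~ x @ \oo --> f x}.
Proof.
move=> mf_ h; exists (fun x => fine (limn_esup (fun n => (f_ n x)%:E))); split.
  apply: measurableT_comp => //.
  by apply: measurable_fun_limn_esup => n; apply/measurable_EFinP; exact: mf_.
apply: filterS h => x /cvg_ex[l hl].
by have [_ ->] := cvg_limn_einf_sup (EFin_cvg hl).
Qed.

Lemma geometric_cauchy (u : nat -> R) (C : R) :
  (forall n, `|u n.+1 - u n| <= C * 2^-1 ^+ n) -> cvgn u.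
Proof.
move=> h; have -> : u = (fun=> u 0%N) + series (telescope u).
  by apply/funext => n; exact: eq_sum_telescope.
apply: is_cvgD; first exact: is_cvg_cst.
apply: normed_cvg; apply: (@series_le_cvg _ _ (fun n => C * 2^-1 ^+ n)).
- by move=> n; exact: normr_ge0.
- by move=> n; exact: le_trans (normr_ge0 _) (h n).
- by [].
- apply: (@is_cvg_geometric_series _ C 2^-1).
  by rewrite ger0_norm ?invr_ge0// invf_lt1// ltr1n.
Qed.

Lemma sum_halves (n : nat) : \sum_(k < n) (2^-1 ^+ k : R) <= 2.
Proof.
suff -> : \sum_(k < n) (2^-1 ^+ k : R) = 2 - 2 * 2^-1 ^+ n.
  by rewrite gerBl mulr_ge0// exprn_ge0// invr_ge0.
elim: n => [|n IH]; first by rewrite big_ord0 expr0 mulr1 subrr.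
by rewrite big_ord_recr /= IH exprS; field.
Qed.

(** After multiplication by 4^n the squared increments still have integrals at most 2^-n, so their
    sum is finite almost everywhere; at such points the increments are O(2^-n). The weight W serves
    [rellich], where convergence is only local. *)
Lemma fast_cauchy (W : T -> R) (f_ : nat -> T -> R) : mf W -> (forall x, 0 < W x) ->
  (forall n, mf (f_ n)) ->
  (forall n, \int[mu]_x (W x * (f_ n.+1 x - f_ n x) ^+ 2)%:E <= (8^-1 ^+ n)%:E)%E ->
  exists f, mf f /\ {ae mu, forall x, f_ ^~ x @ \oo --> f x}.
Proof.
move=> mW W0 mf_ h; apply: ae_limit => //.
pose D n x := f_ n.+1 x - f_ n x.
pose g n x := (4 ^+ n * (W x * D n x ^+ 2))%:E.
have g0 n x : (0 <= g n x)%E.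
  rewrite /g lee_fin; apply: mulr_ge0; first exact: exprn_ge0.
  by apply: mulr_ge0; [exact: ltW|exact: sqr_ge0].
have mg n : measurable_fun setT (g n).
  apply/measurable_EFinP; apply: measurable_funM => //; apply: measurable_funM => //.
  by apply: measurable_funX; apply: measurable_funB.
have S : (\int[mu]_x (\sum_(n <oo) g n x) < +oo)%E.
  rewrite (integral_nneseries mu measurableT mg)//.
  apply: (@le_lt_trans _ _ 2%:E); last by rewrite ltry.
  apply: lime_le; first by apply: is_cvg_nneseries => n _ _; exact: integral_ge0.
  apply: nearW => n; rewrite big_mkord.
  apply: (@le_trans _ _ (\sum_(k < n) (2^-1 ^+ k)%:E)%E).
    apply: lee_sum => k _; rewrite /g.
    under eq_integral do rewrite EFinM.
    rewrite ge0_integralZl//; last 2 first.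
    - apply/measurable_EFinP; apply: measurable_funM => //.
      by apply: measurable_funX; apply: measurable_funB.
    - by move=> x _; rewrite lee_fin mulr_ge0 ?sqr_ge0// ltW.
    have -> : (2^-1 ^+ k : R)%:E = ((4 ^+ k)%:E * (8^-1 ^+ k)%:E)%E.
      by rewrite -EFinM -exprMn; congr (_ ^+ _)%:E; field.
    by rewrite lee_pmul2l ?lte_fin ?exprn_gt0//; exact: h.
  by rewrite sumEFin lee_fin; exact: sum_halves.
have mS : measurable_fun setT (fun x => \sum_(n <oo) g n x)%E.
  by apply: ge0_emeasurable_sum => // n x _ _; exact: g0.
have /integrable_ae : mu.-integrable setT (fun x => \sum_(n <oo) g n x)%E.
  apply/integrableP; split => //; under eq_integral do rewrite gee0_abs ?nneseries_ge0//.
  exact: S.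
move=> /(_ measurableT); apply: filterS => x /(_ I).
set s := (X in X \is a fin_num) => sf.
have gs n : (g n x <= s)%E.
  have := @nneseries_lim_ge _ (g^~ x) xpredT 0%N n.+1 (fun k _ _ => g0 k x).
  by apply: le_trans; rewrite big_nat_recr//= leeDr// sume_ge0.
apply: (@geometric_cauchy _ (Num.sqrt (fine s / W x))) => n.
have H : 4 ^+ n * (W x * D n x ^+ 2) <= fine s.
  by rewrite -lee_fin (fineK sf); exact: gs.
have s0 : 0 <= fine s by apply: fine_ge0; exact: le_trans (g0 0%N x) (gs 0%N).
rewrite -(ler_sqr (normr_ge0 _)) ?nnegrE ?mulr_ge0 ?sqrtr_ge0 ?exprn_ge0 ?invr_ge0//.
rewrite real_normK ?num_real// exprMn sqr_sqrtr ?(divr_ge0 s0 (ltW (W0 x)))//.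
rewrite -exprM mulnC exprM (_ : 2^-1 ^+ 2 = 4^-1); last by field.
rewrite exprVn ler_pdivlMr ?exprn_gt0// ler_pdivlMr//.
apply: le_trans H; rewrite /D le_eqVlt; apply/orP; left; apply/eqP; ring.
Qed.

(** A rapidly Cauchy subsequence converges almost everywhere, and Fatou's lemma carries the Cauchy
    estimate over to its limit. *)
Lemma L2_complete (f_ : nat -> T -> R) : (forall n, L2 mu (f_ n)) ->
  (forall e, 0 < e -> exists N, forall n m, (N <= n)%N -> (N <= m)%N ->
     nrm2 mu (fun x => f_ n x - f_ m x) <= e) ->
  exists f, L2 mu f /\ (fun n => nrm2 mu (fun x => f_ n x - f x)) @ \oo --> 0.
Proof.
move=> fL C.
have /choice [s hs] : forall k, exists N, forall n m, (N <= n)%N -> (N <= m)%N ->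
     nrm2 mu (fun x => f_ n x - f_ m x) <= 8^-1 ^+ k.
  by move=> k; apply: C; rewrite exprn_gt0// invr_gt0.
(* Partial sums lie beyond all earlier thresholds, whether or not the thresholds increase. *)
pose t k := (\sum_(i < k.+1) s i)%N.
have st k j : (k <= j)%N -> (s k <= t j)%N.
  by move=> kj; rewrite /t (bigD1 (Ordinal (kj : k < j.+1)%N))//= leq_addr.
have [] := @fast_cauchy (fun=> 1) (fun k => f_ (t k)).
- exact: measurable_cst.
- by move=> x.
- by move=> n; case: (fL (t n)).
- move=> n; under eq_integral do rewrite mul1r.
  have L := L2B (fL (t n.+1)) (fL (t n)).
  by rewrite (EFin_II L.2) lee_fin; apply: hs; apply: st.
move=> f [mf1 fcv].
have B k n : (s k <= n)%N -> (\int[mu]_x ((f_ n x - f x) ^+ 2)%:E <= (8^-1 ^+ k)%:E)%E.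
  move=> kn; apply: (@fatou_ae _ _ _ mu (fun j x => (f_ n x - f_ (t (j + k)) x) ^+ 2)
     _ (fun=> 8^-1 ^+ k)) => //.
  - move=> j; apply: measurable_funX; apply: measurable_funB; first by case: (fL n).
    by case: (fL (t (j + k))).
  - by apply: measurable_funX; apply: measurable_funB => //; case: (fL n).
  - by move=> j x; exact: sqr_ge0.
  - by move=> x; exact: sqr_ge0.
  - apply: filterS fcv => x hx; rewrite !expr2.
    have hx' : (fun j => f_ (t (j + k)) x) @ \oo --> f x.
      by apply: (@cvg_sub_seq _ (fun k => f_ (t k) x) _ (fun j => j + k)%N) => // j; exact: leq_addr.
    by apply: cvgM; apply: cvgB => //; exact: cvg_cst.
  - move=> j; rewrite (EFin_II (L2B (fL n) (fL _)).2) lee_fin.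
    by apply: hs => //; apply: st; rewrite leq_addl.
  - exact: cvg_cst.
have L n : (s 0 <= n)%N -> L2 mu (fun x => f_ n x - f x).
  move=> sn; apply: L2P; last exact: le_lt_trans (B 0%N n sn) (ltry _).
  by apply: measurable_funB => //; case: (fL n).
exists f; split.
  have := L2B (fL (s 0%N)) (L _ (leqnn _)); congr (L2 mu _).
  by apply/funext => x; rewrite opprB addrC subrK.
have h8 : (fun k => 8^-1 ^+ k : R) @ \oo --> 0.
  by apply: cvg_expr; rewrite ger0_norm ?invr_ge0// invf_lt1// ltr1n.
apply/cvg_seqP => e e0; have /cvg_seqP/(_ _ e0)[k /(_ _ (leqnn _))] := h8.
rewrite subr0 ger0_norm ?exprn_ge0 ?invr_ge0// => ke.
exists (maxn (s 0) (s k)) => n; rewrite geq_max => /andP[n0 nk].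
rewrite subr0 ger0_norm ?nrm2_ge0//; apply: (le_trans _ ke).
by rewrite -lee_fin -(EFin_II (L n n0).2); exact: B.
Qed.

End ae_limits.

(** * Measure preserving maps of the plane *)

Section measure_preserving.
Context d (T : measurableType d) (R : realType) (mu : {measure set T -> \bar R}).
Implicit Types (s : T -> T) (f : T -> R).

(** Invariance is stated on integrals of nonnegative functions, the form that combines with
    Tonelli's theorem; the statement for null sets is recovered from indicators in [minv_ae]. *)
Definition minv s := measurable_fun setT s /\
  forall f : T -> \bar R, measurable_fun setT f -> (forall x, 0 <= f x)%E ->
  (\int[mu]_x f (s x) = \int[mu]_x f x)%E.

Lemma minv_comp s t : minv s -> minv t -> minv (s \o t).
Proof.
move=> [ms hs] [mt ht]; split; first exact: measurableT_comp.
move=> f mf1 f0; rewrite -(hs f mf1 f0); apply: (ht (f \o s)) => [|x].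
  exact: measurableT_comp.
exact: f0.
Qed.

Lemma minv_ig s f : minv s -> ig mu f -> ig mu (f \o s).
Proof.
move=> [ms hs] fi; have f1 := ig_mf fi; apply/integrableP; split.
  by apply/measurable_EFinP; exact: measurableT_comp.
have := hs (fun x => `|f x|%:E); rewrite /= => ->.
- by have /integrableP[] := fi.
- by apply/measurable_EFinP; apply: measurableT_comp.
- by move=> x; rewrite lee_fin.
Qed.

Lemma minv_II s f : minv s -> mf f -> II mu (f \o s) = II mu f.
Proof.
move=> [ms hs] f1; rewrite /II /Rintegral; congr fine.
rewrite [LHS]integralE [RHS]integralE; congr (_ - _)%E.
- transitivity (\int[mu]_x (funepos (EFin \o f)) (s x))%E.
    by apply: eq_integral => x _; rewrite funepos.unlock.
  apply: (hs (funepos (EFin \o f))) => //.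
  by apply: measurable_funepos; exact/measurable_EFinP.
- transitivity (\int[mu]_x (funeneg (EFin \o f)) (s x))%E.
    by apply: eq_integral => x _; rewrite funeneg.unlock.
  apply: (hs (funeneg (EFin \o f))) => //.
  by apply: measurable_funeneg; exact/measurable_EFinP.
Qed.

Lemma minv_L2 s f : minv s -> L2 mu f -> L2 mu (f \o s).
Proof.
move=> hs [f1 f2]; split; first by apply: measurableT_comp => //; case: hs.
exact: (minv_ig hs f2).
Qed.

Lemma minv_nrm2 s f : minv s -> mf f -> nrm2 mu (f \o s) = nrm2 mu f.
Proof.
by move=> hs f1; apply: (minv_II hs (f := fun x => f x ^+ 2)); exact: measurable_funX.
Qed.

Lemma minv_ae s (P : T -> Prop) : minv s -> {ae mu, forall x, P x} ->
  {ae mu, forall x, P (s x)}.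
Proof.
move=> [ms hs] [N [mN N0 PN]]; exists (s @^-1` N); split.
- by rewrite -[X in measurable X]setTI; exact: ms.
- have msN : measurable (s @^-1` N) by rewrite -[X in measurable X]setTI; exact: ms.
  have h1 := integral_indic mu measurableT mN.
  have h2 := integral_indic mu measurableT msN.
  rewrite setIT in h2; rewrite setIT N0 in h1; rewrite -h2 -[RHS]h1.
  apply: (hs (EFin \o \1_N)) => [|x].
    by apply/measurable_EFinP; exact: measurable_indic.
  by rewrite lee_fin.
- by move=> x /= nP; apply: PN.
Qed.

(** Replacing F by F + F o s doubles its integral, so a comparison on each pair x, s x is enough.
    Infinite integrals are allowed, which lets the lemma be used for inner as well as outer
    integrals. *)
Lemma minv_le2 s (F G : T -> \bar R) : minv s ->
  measurable_fun setT F -> measurable_fun setT G ->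
  (forall x, 0 <= F x)%E -> (forall x, 0 <= G x)%E ->
  (forall x, F x + F (s x) <= G x + G (s x))%E ->
  (\int[mu]_x F x <= \int[mu]_x G x)%E.
Proof.
move=> [ms hs] mF mG F0 G0 h.
have D (H : T -> \bar R) : measurable_fun setT H -> (forall x, 0 <= H x)%E ->
    (\int[mu]_x (H x + H (s x)) = \int[mu]_x H x + \int[mu]_x H x)%E.
  move=> mH H0; rewrite ge0_integralD//; last exact: measurableT_comp.
  by rewrite hs.
have : (\int[mu]_x F x + \int[mu]_x F x <= \int[mu]_x G x + \int[mu]_x G x)%E.
  rewrite -!D//; apply: ge0_le_integral => //.
  - by move=> x _; rewrite adde_ge0.
  - by apply: emeasurable_funD => //; exact: measurableT_comp.
  - by apply: emeasurable_funD => //; exact: measurableT_comp.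
have := integral_ge0 mu (fun x (_ : setT x) => F0 x).
have := integral_ge0 mu (fun x (_ : setT x) => G0 x).
move: (\int[mu]_x F x)%E (\int[mu]_x G x)%E => [a||] [b||]//=; rewrite ?lee_fin ?leey//.
by move=> *; lra.
Qed.

End measure_preserving.

(** * Invariances of the Lebesgue measure of the plane *)

Section plane_measure.
Context {R : realType}.
Local Notation leb := (@lebesgue_measure R).
Local Notation P := (mplane R).
Local Notation mu := (leb2 R).

(** The boolean exponent treats translations and reflections together. The image measure agrees with
    Lebesgue measure on half-open intervals; a reflection exchanges the closed end and the open end,
    which does not change the length. *)
Lemma leb_affine (e : bool) (c : R) :
  minv leb (fun x : measurableTypeR R => ((-1) ^+ e * x + c : measurableTypeR R)).
Proof.
have ms : measurable_fun setT (fun x : measurableTypeR R => ((-1) ^+ e * x + c : measurableTypeR R)).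
  by apply: measurable_funD => //; exact: measurable_funM.
split => // f mf1 f0.
pose ms_mixin := isMeasurableFun.Build _ _ _ _ _ ms.
pose s : {mfun _ >-> _} := HB.pack (fun x : measurableTypeR R => ((-1) ^+ e * x + c : measurableTypeR R)) ms_mixin.
transitivity (\int[pushforward leb s]_y f y)%E.
  by rewrite ge0_integral_pushforward//.
apply: eq_measure_integral => A mA _; apply/esym.
apply: (@lebesgue_measure_unique R (pushforward leb s)) => // _ [[a b]] _ <-.
rewrite /pushforward [LHS]/= -[X in _ = X]/(leb (s @^-1` `]a, b]%classic)).
have -> : s @^-1` `]a, b]%classic =
    (if e then `[c - b, c - a[ else `]a - c, b - c])%classic.
  apply/seteqP; split => x; rewrite /s /=; case: (e) => /=;
    rewrite !in_itv/= ?expr1 ?expr0 => /andP[h1 h2]; apply/andP; split; lra.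
case: (e); rewrite !lebesgue_measure_itv/= !lte_fin.
  have -> : (c - b < c - a) = (a < b) by rewrite ltrD2l ltrN2.
  by case: ifP => // _; rewrite -!EFinB; congr EFin; lra.
rewrite ltrD2r; by case: ifP => // _; rewrite -!EFinB; congr EFin; lra.
Qed.

Lemma tonelli1 (f : P -> \bar R) : measurable_fun setT f -> (forall x, 0 <= f x)%E ->
  (\int[mu]_z f z = \int[leb]_x \int[leb]_y f (x, y))%E.
Proof. by move=> mf1 f0; exact: fubini_tonelli1. Qed.

Lemma tonelli2 (f : P -> \bar R) : measurable_fun setT f -> (forall x, 0 <= f x)%E ->
  (\int[mu]_z f z = \int[leb]_y \int[leb]_x f (x, y))%E.
Proof. by move=> mf1 f0; exact: fubini_tonelli2. Qed.

Lemma leb2_sigma_finite : sigma_finite setT mu.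
Proof.
exists (fun n => `]-n%:R, n%:R[%classic `*` `]-n%:R, n%:R[%classic).
  rewrite predeqE => -[x y]; split => // _.
  exists (Num.truncn (`|x| + `|y|)).+1 => //.
  have h := truncnS_gt (`|x| + `|y|).
  have x0 := normr_ge0 x; have y0 := normr_ge0 y.
  by split => /=; rewrite in_itv/= -ltr_norml; apply: le_lt_trans h; lra.
move=> n; split; first by apply: measurableX; exact: measurable_itv.
pose A : set (measurableTypeR R) := `]-n%:R, n%:R[%classic.
have mA : measurable A by exact: measurable_itv.
have -> : mu (A `*` A) = (leb A * leb A)%E by exact: product_measure1E.
rewrite !lebesgue_measure_itv/= lte_fin.
by case: ifP => _; rewrite -?EFinB -?EFinM ?mule0 ltry.
Qed.

(** The same measure as [leb2], in a form that carries the sigma-finiteness required by the theorems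
    of Fubini and Tonelli. *)
Definition leb2f : set P -> \bar R := (leb \x leb)%E.
HB.instance Definition _ := Measure.on leb2f.
HB.instance Definition _ := Measure_isSigmaFinite.Build _ _ _ leb2f leb2_sigma_finite.

(** A shear moves each horizontal line by a translation, possibly after a reflection, so Tonelli's
    theorem reduces the claim to [leb_affine]. *)
Lemma minv_pl1 (t : R -> R) (e : bool) : mf t ->
  minv mu (fun z : P => ((-1) ^+ e * z.1 + t z.2, z.2) : P).
Proof.
move=> mt.
have ms : measurable_fun setT (fun z : P => ((-1) ^+ e * z.1 + t z.2, z.2) : P).
  apply/measurable_fun_pairP; split => /=; last exact: measurable_snd.
  apply: measurable_funD; last by apply: measurableT_comp => //; exact: measurable_snd.
  by apply: measurable_funM => //; exact: measurable_fst.
split => // f mf1 f0; rewrite tonelli2//; last exact: measurableT_comp.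
rewrite tonelli2//; apply: eq_integral => y _.
have [_ h] := leb_affine e (t y).
apply: (h (fun x => f (x, y))) => //.
by apply: measurableT_comp => //; exact: pair2_measurable.
Qed.

Lemma minv_pl2 (t : R -> R) (e : bool) : mf t ->
  minv mu (fun z : P => (z.1, (-1) ^+ e * z.2 + t z.1) : P).
Proof.
move=> mt.
have ms : measurable_fun setT (fun z : P => (z.1, (-1) ^+ e * z.2 + t z.1) : P).
  apply/measurable_fun_pairP; split => /=; first exact: measurable_fst.
  apply: measurable_funD; last by apply: measurableT_comp => //; exact: measurable_fst.
  by apply: measurable_funM => //; exact: measurable_snd.
split => // f mf1 f0; rewrite tonelli1//; last exact: measurableT_comp.
rewrite tonelli1//; apply: eq_integral => x _.
have [_ h] := leb_affine e (t x).
apply: (h (fun y => f (x, y))) => //.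
by apply: measurableT_comp => //; exact: pair1_measurable.
Qed.

Lemma minv_shift (e : bool) (c : P) :
  minv mu (fun z : P => ((-1) ^+ e * z.1 + c.1, (-1) ^+ e * z.2 + c.2) : P).
Proof.
have h1 := @minv_pl1 (fun=> c.1) e (measurable_cst _).
have h2 := @minv_pl2 (fun=> c.2) e (measurable_cst _).
exact: (minv_comp h1 h2).
Qed.

(** The map is a flip of the second coordinate followed by the rotation of cosine C and sine S. The
    rotation is a product of three shears, of coefficients -tan, sin and -tan, the tangents being
    those of the half angle t = S / (1 + C); the half turn C = -1 is treated apart. *)
Lemma minv_lin (C S : R) : C ^+ 2 + S ^+ 2 = 1 ->
  minv mu (fun z : P => (C * z.1 + S * z.2, S * z.1 - C * z.2) : P).
Proof.
move=> CS.
have ml (t : R) : measurable_fun setT (fun x : R => t * x) by exact: measurable_funM.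
have [C1|C1] := eqVneq C (-1).
  have S0 : S = 0.
    by apply/eqP; rewrite -sqrf_eq0; apply/eqP; move: CS; rewrite C1; lra.
  have h1 := @minv_pl1 (fun=> 0) true (measurable_cst _).
  rewrite (_ : (fun _ => _) = (fun z : P => ((-1) ^+ true * z.1 + (fun=> 0) z.2, z.2) : P))//.
  by apply/funext => -[x y] /=; rewrite C1 S0; congr (_, _); ring.
have D0 : 1 + C != 0 by rewrite addrC addr_eq0.
pose t := S / (1 + C).
have h1 := @minv_pl1 (fun y => - t * y) false (ml _).
have h2 := @minv_pl2 (fun y => S * y) false (ml _).
have h3 := @minv_pl2 (fun=> 0) true (measurable_cst _).
have := minv_comp h1 (minv_comp h2 (minv_comp h1 h3)).
congr minv; apply/funext => -[x y] /=.
have e1 : t * S = 1 - C.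
  apply: (mulIf D0); rewrite /t mulrAC divfK//; move: CS; rewrite !expr2; lra.
have e2 : t * C = S - t by rewrite /t; field.
congr (_, _).
  transitivity ((1 - t * S) * x + (t + (t - t * S * t)) * y); first by ring.
  have e3 : t + (t - (1 - C) * t) = S by rewrite -[S](subrK t) -e2; ring.
  by rewrite e1 e3; ring.
transitivity (S * x + (t * S - 1) * y); first by ring.
by rewrite e1; ring.
Qed.

End plane_measure.

(** * The heat kernel *)

Section gauss1.
Context {R : realType}.
Local Notation leb := (@lebesgue_measure R).

(** The heat kernel of the line at time t, centred at m: the normal density of variance 2 t. *)
Definition g1 (t m x : R) : R :=
  (Num.sqrt (4 * pi * t))^-1 * expR (- (x - m) ^+ 2 / (4 * t)).

Lemma g1_ge0 t m x : 0 <= g1 t m x.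
Proof. by rewrite mulr_ge0 ?expR_ge0// invr_ge0 sqrtr_ge0. Qed.

Lemma mg1 t m : measurable_fun [set: measurableTypeR R] (g1 t m).
Proof.
apply: measurable_funM => //; apply: measurableT_comp => //.
apply: measurable_funM => //; apply: measurableT_comp => //.
by apply: measurable_funX; apply: measurable_funB.
Qed.

Lemma int_g1 t m : 0 < t -> (\int[leb]_x (g1 t m x)%:E = 1)%E.
Proof.
move=> t0; rewrite -(integral_normal_pdf m (Num.sqrt (2 * t))).
apply: eq_integral => x _; congr EFin.
have s0 : Num.sqrt (2 * t) != 0 by rewrite gt_eqF// sqrtr_gt0 mulr_gt0.
rewrite normal_pdfE// /normal_peak /normal_fun /g1.
rewrite sqr_sqrtr ?mulr_ge0 ?ltW//.
by congr ((Num.sqrt _)^-1 * expR (_ / _)); ring.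
Qed.

Lemma ig_g1 t m : 0 < t -> ig leb (g1 t m).
Proof.
move=> t0; apply: ge0_ig; [exact: mg1|exact: g1_ge0|].
by rewrite int_g1// ltry.
Qed.

Lemma II_g1 t m : 0 < t -> II leb (g1 t m) = 1.
Proof. by move=> t0; rewrite /II /Rintegral int_g1. Qed.

(** Completing the square in y. Only the second Gaussian still depends on y, so integration leaves
    the kernel at time s + r. *)
Lemma g1_conv s r x z y : 0 < s -> 0 < r ->
  g1 s x y * g1 r z y = g1 (s + r) z x * g1 (s * r / (s + r)) ((r * x + s * z) / (s + r)) y.
Proof.
move=> s0 r0; have sr : 0 < s + r by rewrite addr_gt0.
rewrite /g1 mulrACA [RHS]mulrACA -!expRD -!invfM.
have pp := pi_gt0 R.
rewrite -!sqrtrM ?mulr_ge0 ?ltW//.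
congr ((Num.sqrt _)^-1 * expR _).
  by field; rewrite gt_eqF.
by field; rewrite !gt_eqF.
Qed.

(* The second moment is squeezed between the difference quotients of the total mass in t. *)
Lemma g1_moment2 t m : 0 < t ->
  (\int[leb]_x ((x - m) ^+ 2 * g1 t m x)%:E = (2 * t)%:E)%E.
Proof.
move=> t0; have pp := pi_gt0 R.
(* With a = t^(-1/2) the total mass is the elementary function [Num.sqrt (4 * pi) / a], and [h]
   below is minus the derivative of [e] with respect to a^2. *)
pose e (a x : R) : R := expR (- (x - m) ^+ 2 / (4 * a ^- 2)).
have e_g1 (a x : R) : 0 < a -> e a x = Num.sqrt (4 * pi) / a * g1 (a ^- 2) m x.
  move=> a0; rewrite /e /g1.
  have -> : Num.sqrt (4 * pi * a ^- 2) = Num.sqrt (4 * pi) / a.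
    rewrite sqrtrM ?mulr_ge0 ?(ltW pp)//; congr (_ * _).
    by rewrite -exprVn sqrtr_sqr gtr0_norm ?invr_gt0.
  rewrite mulrA -[LHS]mul1r; congr (_ * _); field.
  by rewrite !gt_eqF// sqrtr_gt0 mulr_gt0.
have ige (a : R) : 0 < a -> ig leb (e a).
  move=> a0; rewrite (_ : e a = fun x => Num.sqrt (4 * pi) / a * g1 (a ^- 2) m x).
    by apply: igZ; apply: ig_g1; rewrite invr_gt0 exprn_gt0.
  by apply/funext => x; exact: e_g1.
have IIe (a : R) : 0 < a -> II leb (e a) = Num.sqrt (4 * pi) / a.
  move=> a0; rewrite (_ : e a = fun x => Num.sqrt (4 * pi) / a * g1 (a ^- 2) m x).
    by rewrite IIZ ?II_g1 ?mulr1 ?ig_g1 ?invr_gt0 ?exprn_gt0.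
  by apply/funext => x; exact: e_g1.
pose al := (Num.sqrt t)^-1.
have al0 : 0 < al by rewrite invr_gt0 sqrtr_gt0.
have tal : t = al ^- 2 by rewrite exprVn invrK sqr_sqrtr// ltW.
pose h x := (x - m) ^+ 2 * e al x / 4.
have mh : measurable_fun [set: measurableTypeR R] h.
  apply: measurable_funM => //; apply: measurable_funM.
    by apply: measurable_funX; exact: measurable_funB.
  exact: ig_mf (ige al al0).
have h0 x : 0 <= h x.
  by rewrite divr_ge0// mulr_ge0 ?sqr_ge0// expR_ge0.
have cvx (a b x : R) : 0 < a -> 0 < b ->
    (b ^+ 2 - a ^+ 2) * ((x - m) ^+ 2 * e b x / 4) <= e a x - e b x.
  move=> a0 b0; rewrite /e !invfM !invrK.
  set y := (x - m) ^+ 2.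
  have -> : - y * (4^-1 * a ^+ 2) = - y * (4^-1 * b ^+ 2) + (b ^+ 2 - a ^+ 2) * y / 4.
    by field.
  rewrite expRD; have := expR_ge1Dx ((b ^+ 2 - a ^+ 2) * y / 4).
  have := expR_ge0 (- y * (4^-1 * b ^+ 2)).
  move: (expR (- y * (4^-1 * b ^+ 2))) => E E0.
  move: (expR _) => F FF; have : E * (1 + (b ^+ 2 - a ^+ 2) * y / 4) <= E * F.
    by rewrite ler_wpM2l.
  by lra.
have up (c : R) : 0 < c -> c < al -> forall x, h x <= (al ^+ 2 - c ^+ 2)^-1 * (e c x - e al x).
  move=> c0 cal x; rewrite ler_pdivlMl; first exact: cvx.
  by rewrite subr_gt0 ltr_pXn2r// nnegrE ltW.
have hi : ig leb h.
  have c0 : 0 < al / 2 by rewrite divr_gt0.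
  have cal : al / 2 < al by rewrite ltr_pdivrMr// ltr_pMr// ltr1n.
  have G := igZ (al ^+ 2 - (al / 2) ^+ 2)^-1 (igB (ige _ c0) (ige _ al0)).
  refine (ig_le mh _ G).
  by move=> x; rewrite ger0_norm//; exact: up.
have U (c : R) : 0 < c -> c < al -> II leb h * (c * al * (al + c)) <= Num.sqrt (4 * pi).
  move=> c0 cal.
  have := II_le hi (igZ (al ^+ 2 - c ^+ 2)^-1 (igB (ige _ c0) (ige _ al0))) (up c c0 cal).
  rewrite IIZ ?igB ?ige// IIB ?ige// !IIe//.
  have d0 : 0 < al ^+ 2 - c ^+ 2 by rewrite subr_gt0 ltr_pXn2r// nnegrE ltW.
  have -> : (al ^+ 2 - c ^+ 2)^-1 * (Num.sqrt (4 * pi) / c - Num.sqrt (4 * pi) / al) =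
            Num.sqrt (4 * pi) / (c * al * (al + c)).
    by field; rewrite !gt_eqF//= addr_gt0.
  by rewrite ler_pdivlMr// !mulr_gt0// addr_gt0.
have V (c : R) : al < c -> Num.sqrt (4 * pi) <= II leb h * (c * al * (al + c)).
  move=> cal; have c0 : 0 < c by exact: lt_trans cal.
  have lo x : (c ^+ 2 - al ^+ 2)^-1 * (e al x - e c x) <= h x.
    rewrite ler_pdivrMl; last by rewrite subr_gt0 ltr_pXn2r// nnegrE ltW.
    by have := cvx c al x c0 al0; rewrite /h; lra.
  have := II_le (igZ (c ^+ 2 - al ^+ 2)^-1 (igB (ige _ al0) (ige _ c0))) hi lo.
  rewrite IIZ ?igB ?ige// IIB ?ige// !IIe//.
  have d0 : 0 < c ^+ 2 - al ^+ 2 by rewrite subr_gt0 ltr_pXn2r// nnegrE ltW.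
  have d1 : 0 < al + c by rewrite addr_gt0.
  have -> : (c ^+ 2 - al ^+ 2)^-1 * (Num.sqrt (4 * pi) / al - Num.sqrt (4 * pi) / c) =
            Num.sqrt (4 * pi) / (c * al * (al + c)).
    by field; rewrite !gt_eqF//= addr_gt0.
  by rewrite ler_pdivrMr// !mulr_gt0// addr_gt0.
have cc k : (fun n => al + k * (@harmonic R n)) @ \oo --> al.
  rewrite -[X in _ --> X]addr0 -[X in _ --> _ + X](mulr0 k).
  by apply: cvgD; [exact: cvg_cst|apply: cvgMr; exact: cvg_harmonic].
have cv k : (fun n => II leb h * ((al + k * harmonic n) * al * (al + (al + k * harmonic n))))
    @ \oo --> II leb h * (al * al * (al + al)).
  apply: cvgMr; apply: cvgM; first by apply: cvgMl; exact: cc.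
  by apply: cvgD; [exact: cvg_cst|exact: cc].
have hn n : 0 < (@harmonic R n) by rewrite /= invr_gt0.
have hn1 n : (@harmonic R n) <= 1 by rewrite /= invf_le1// ler1n.
have E : II leb h * (al * al * (al + al)) = Num.sqrt (4 * pi).
  apply/eqP; rewrite eq_le; apply/andP; split.
    apply: (cvg_le (cv (- (al / 2)))) => n.
    have := hn n; have := hn1 n; move: (harmonic n) => c c1 c0.
    by apply: U; nra.
  apply: (cvg_ge (cv (al / 2))) => n.
  by apply: V; rewrite ltrDl mulr_gt0// divr_gt0.
transitivity (\int[leb]_x (4 * (al / Num.sqrt (4 * pi)) * h x)%:E)%E.
  apply: eq_integral => x _; congr EFin; rewrite /h e_g1// -tal; field.
  by rewrite !gt_eqF// sqrtr_gt0 mulr_gt0.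
rewrite EFin_II ?igZ// IIZ//; congr EFin.
have s0 : 0 < Num.sqrt (4 * pi : R) by rewrite sqrtr_gt0 mulr_gt0.
have -> : II leb h = Num.sqrt (4 * pi) / (al * al * (al + al)).
  by rewrite -E; field; rewrite !gt_eqF// addr_gt0.
by rewrite tal; field; rewrite !gt_eqF// addr_gt0.
Qed.

End gauss1.

Lemma int_Zl d (T : measurableType d) (R : realType) (mu : {measure set T -> \bar R})
    (k : R) (f : T -> R) : mf f -> (forall x, 0 <= f x) -> 0 <= k ->
  (\int[mu]_x (k * f x)%:E = k%:E * \int[mu]_x (f x)%:E)%E.
Proof.
move=> mf1 f0 k0; under eq_integral do rewrite EFinM.
rewrite ge0_integralZl//; first exact/measurable_EFinP.
by move=> x _; rewrite lee_fin.
Qed.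

(** * The two-dimensional kernel and its moments *)

Section heat_kernel.
Context {R : realType}.
Local Notation leb := (@lebesgue_measure R).
Local Notation P := (mplane R).
Local Notation mu := (leb2 R).
Local Notation L := (measurableTypeR R).

Lemma int_prod (a b : R -> R) : measurable_fun [set: L] a -> measurable_fun [set: L] b ->
  (forall x, 0 <= a x) -> (forall x, 0 <= b x) ->
  (\int[mu]_z (a z.1 * b z.2)%:E = \int[leb]_x (a x)%:E * \int[leb]_x (b x)%:E)%E.
Proof.
move=> ma mb a0 b0; rewrite tonelli1; last 2 first.
- apply/measurable_EFinP; apply: measurable_funM.
    by apply: measurableT_comp ma _; exact: measurable_fst.
  by apply: measurableT_comp mb _; exact: measurable_snd.
- by move=> z; rewrite lee_fin mulr_ge0.
have ib0 : (0 <= \int[leb]_x (b x)%:E)%E by apply: integral_ge0 => x _; rewrite lee_fin.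
rewrite -ge0_integralZr//; last 2 first.
- exact/measurable_EFinP.
- by move=> x _; rewrite lee_fin.
by apply: eq_integral => x _; exact: (int_Zl leb mb b0 (a0 x)).
Qed.

(** The heat kernel of the plane as a product of one-dimensional kernels; its usual closed form is
    [kkE]. *)
Definition kk (t : R) (x y : P) : R := g1 t x.1 y.1 * g1 t x.2 y.2.
Definition d2 (x y : P) : R := (x.1 - y.1) ^+ 2 + (x.2 - y.2) ^+ 2.

Lemma kkE t x y : 0 < t -> kk t x y = (4 * pi * t)^-1 * expR (- d2 x y / (4 * t)).
Proof.
move=> t0; rewrite /kk /g1 mulrACA -expRD -invfM -expr2 sqr_sqrtr; last first.
  by rewrite !mulr_ge0 ?pi_ge0// ltW.
by congr (_ * expR _); rewrite /d2; field; rewrite gt_eqF.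
Qed.

Lemma g1_reflect t (a b : R) : g1 t a (2 * a - b) = g1 t a b.
Proof. by rewrite /g1 (_ : 2 * a - b - a = - (b - a)) ?sqrrN//; ring. Qed.

Lemma kk_ge0 t x y : 0 <= kk t x y.
Proof. by rewrite mulr_ge0 ?g1_ge0. Qed.

Lemma kk_gt0 t x y : 0 < t -> 0 < kk t x y.
Proof. by move=> t0; rewrite kkE// mulr_gt0 ?expR_gt0// invr_gt0 !mulr_gt0// pi_gt0. Qed.

Lemma kkC t x y : kk t x y = kk t y x.
Proof.
have sq (a b : R) : (a - b) ^+ 2 = (b - a) ^+ 2 by rewrite -sqrrN opprB.
by rewrite /kk /g1 (sq y.1) (sq y.2).
Qed.

Lemma d2_ge0 x y : 0 <= d2 x y.
Proof. by rewrite addr_ge0 ?sqr_ge0. Qed.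

Lemma kk_le t x y : 0 < t -> kk t x y <= (4 * pi * t)^-1.
Proof.
move=> t0; rewrite kkE// ger_pMr ?invr_gt0 ?mulr_gt0 ?pi_gt0//.
by rewrite -expR0 ler_expR mulNr oppr_le0 divr_ge0 ?d2_ge0// mulr_ge0// ltW.
Qed.

Lemma mkk t : measurable_fun setT (fun z : P * P => kk t z.1 z.2).
Proof.
have m11 : measurable_fun setT (fun z : P * P => z.1.1 : L).
  exact: (measurableT_comp measurable_fst measurable_fst).
have m12 : measurable_fun setT (fun z : P * P => z.1.2 : L).
  exact: (measurableT_comp measurable_snd measurable_fst).
have m21 : measurable_fun setT (fun z : P * P => z.2.1 : L).
  exact: (measurableT_comp measurable_fst measurable_snd).
have m22 : measurable_fun setT (fun z : P * P => z.2.2 : L).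
  exact: (measurableT_comp measurable_snd measurable_snd).
have H (a b : P * P -> L) : measurable_fun setT a -> measurable_fun setT b ->
    measurable_fun setT (fun z => g1 t (a z) (b z)).
  move=> ma mb; apply: measurable_funM => //; apply: measurableT_comp => //.
  apply: measurable_funM => //; apply: measurableT_comp => //.
  by apply: measurable_funX; apply: measurable_funB.
by apply: measurable_funM; apply: H.
Qed.

Lemma mkk1 t x : mf (kk t x).
Proof.
exact: (measurableT_comp (mkk t) (@pair1_measurable _ _ P P x)).
Qed.

Lemma int_kk t x : 0 < t -> (\int[mu]_y (kk t x y)%:E = 1)%E.
Proof.
move=> t0; rewrite (int_prod (mg1 t x.1) (mg1 t x.2)); try exact: g1_ge0.
by rewrite !int_g1// mule1.
Qed.

Lemma ig_kk t x : 0 < t -> ig mu (kk t x).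
Proof.
move=> t0; apply: ge0_ig; [exact: mkk1|exact: kk_ge0|].
by rewrite int_kk// ltry.
Qed.

Lemma II_kk t x : 0 < t -> II mu (kk t x) = 1.
Proof. by move=> t0; rewrite /II /Rintegral int_kk. Qed.

(** The semigroup law, obtained in each coordinate from [g1_conv]. *)
Lemma kk_conv s r x z : 0 < s -> 0 < r ->
  (\int[mu]_y (kk s x y * kk r z y)%:E = (kk (s + r) x z)%:E)%E.
Proof.
move=> s0 r0; have sr : 0 < s + r by rewrite addr_gt0.
have m0 : 0 < s * r / (s + r) by rewrite divr_gt0// mulr_gt0.
pose c (a b : R) := (r * a + s * b) / (s + r).
pose G1 y := g1 (s + r) z.1 x.1 * g1 (s * r / (s + r)) (c x.1 z.1) y.
pose G2 y := g1 (s + r) z.2 x.2 * g1 (s * r / (s + r)) (c x.2 z.2) y.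
transitivity (\int[mu]_y (G1 y.1 * G2 y.2)%:E)%E.
  by apply: eq_integral => y _; rewrite /kk mulrACA (@g1_conv _ s r x.1)// (@g1_conv _ s r x.2).
have iG (a b : R) : (\int[leb]_y (g1 (s + r) b a * g1 (s * r / (s + r)) (c a b) y)%:E
    = (g1 (s + r) b a)%:E)%E.
  by rewrite int_Zl ?int_g1 ?mule1 ?g1_ge0//; [exact: mg1|exact: g1_ge0].
have mG (a b : R) : measurable_fun [set: L]
    (fun y => g1 (s + r) b a * g1 (s * r / (s + r)) (c a b) y).
  by apply: measurable_funM => //; exact: mg1.
rewrite int_prod; [|exact: mG|exact: mG|by move=> y; rewrite mulr_ge0 ?g1_ge0..].
by rewrite !iG -EFinM kkC.
Qed.

Lemma ig_kk2 s r x z : 0 < s -> 0 < r -> ig mu (fun y => kk s x y * kk r z y).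
Proof.
move=> s0 r0; apply: ge0_ig; first by apply: measurable_funM; exact: mkk1.
  by move=> y; rewrite mulr_ge0 ?kk_ge0.
by rewrite kk_conv// ltry.
Qed.

Lemma L2_kk t x : 0 < t -> L2 mu (kk t x).
Proof.
move=> t0; split; first exact: mkk1.
have := ig_kk2 x x t0 t0; exact: eq_integrable.
Qed.

Lemma ip_kk s r x z : 0 < s -> 0 < r -> ip mu (kk s x) (kk r z) = kk (s + r) x z.
Proof. by move=> s0 r0; rewrite /ip /II /Rintegral kk_conv. Qed.

Lemma kkxx t x : 0 < t -> kk t x x = (4 * pi * t)^-1.
Proof. by move=> t0; rewrite kkE// /d2 !subrr expr0n addr0 oppr0 mul0r expR0 mulr1. Qed.

Lemma nrm2_kk t x : 0 < t -> nrm2 mu (kk t x) = (8 * pi * t)^-1.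
Proof.
move=> t0; rewrite -ipff ip_kk// kkxx ?addr_gt0//; congr (_^-1); ring.
Qed.

Lemma kk_moments t x : 0 < t ->
  ig mu (fun y => kk t x y * (x.1 - y.1) ^+ 2) /\
  ig mu (fun y => kk t x y * (x.2 - y.2) ^+ 2) /\
  II mu (fun y => kk t x y * (x.1 - y.1) ^+ 2) = 2 * t /\
  II mu (fun y => kk t x y * (x.2 - y.2) ^+ 2) = 2 * t.
Proof.
move=> t0.
have m2 (a : R) : measurable_fun [set: L] (fun y => (y - a) ^+ 2 * g1 t a y).
  apply: measurable_funM; last exact: mg1.
  by apply: measurable_funX; exact: measurable_funB.
have E1 : (\int[mu]_y (kk t x y * (x.1 - y.1) ^+ 2)%:E = (2 * t)%:E)%E.
  transitivity (\int[mu]_y ((y.1 - x.1) ^+ 2 * g1 t x.1 y.1 * g1 t x.2 y.2)%:E)%E.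
    by apply: eq_integral => y _; congr EFin; rewrite /kk; ring.
  rewrite (int_prod (m2 x.1) (mg1 t x.2)); last exact: g1_ge0.
    by rewrite g1_moment2// int_g1// mule1.
  by move=> y; rewrite mulr_ge0 ?sqr_ge0 ?g1_ge0.
have E2 : (\int[mu]_y (kk t x y * (x.2 - y.2) ^+ 2)%:E = (2 * t)%:E)%E.
  transitivity (\int[mu]_y (g1 t x.1 y.1 * ((y.2 - x.2) ^+ 2 * g1 t x.2 y.2))%:E)%E.
    by apply: eq_integral => y _; congr EFin; rewrite /kk; ring.
  rewrite (int_prod (mg1 t x.1) (m2 x.2)); [|exact: g1_ge0|].
    by rewrite g1_moment2// int_g1// mul1e.
  by move=> y; rewrite mulr_ge0 ?sqr_ge0 ?g1_ge0.
have M1 : mf (fun y : P => kk t x y * (x.1 - y.1) ^+ 2).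
  apply: measurable_funM; first exact: mkk1.
  by apply: measurable_funX; apply: measurable_funB => //; exact: measurable_fst.
have M2 : mf (fun y : P => kk t x y * (x.2 - y.2) ^+ 2).
  apply: measurable_funM; first exact: mkk1.
  by apply: measurable_funX; apply: measurable_funB => //; exact: measurable_snd.
split; first by apply: ge0_ig => //; [by move=> y; rewrite mulr_ge0 ?kk_ge0 ?sqr_ge0|rewrite E1 ltry].
split; first by apply: ge0_ig => //; [by move=> y; rewrite mulr_ge0 ?kk_ge0 ?sqr_ge0|rewrite E2 ltry].
by rewrite /II /Rintegral E1 E2.
Qed.

Lemma II_odd s (f : P -> R) : minv mu s -> ig mu f -> (forall x, f (s x) = - f x) ->
  II mu f = 0.
Proof.
move=> hs fi fs; have := minv_II hs (ig_mf fi).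
have -> : f \o s = (fun x => - f x) by apply/funext.
rewrite IIN//; lra.
Qed.

Lemma flip1 (x : P) : minv mu (fun y : P => (2 * x.1 - y.1, y.2) : P).
Proof.
have := @minv_pl1 R (fun=> 2 * x.1) true (measurable_cst _).
by congr minv; apply/funext => y; rewrite /= expr1 mulN1r addrC.
Qed.

Lemma flip2 (x : P) : minv mu (fun y : P => (y.1, 2 * x.2 - y.2) : P).
Proof.
have := @minv_pl2 R (fun=> 2 * x.2) true (measurable_cst _).
by congr minv; apply/funext => y; rewrite /= expr1 mulN1r addrC.
Qed.

Lemma kk_lin_ig t x (a b : R) : 0 < t ->
  ig mu (fun y => kk t x y * (a * (x.1 - y.1) + b * (x.2 - y.2)) ^+ 2).
Proof.
move=> t0; have [i1 [i2 _]] := kk_moments x t0.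
apply: (ig_le _ _ (igD (igZ (2 * a ^+ 2) i1) (igZ (2 * b ^+ 2) i2))).
  apply: measurable_funM; first exact: mkk1.
  apply: measurable_funX; apply: measurable_funD; apply: measurable_funM => //.
    by apply: measurable_funB => //; exact: measurable_fst.
  by apply: measurable_funB => //; exact: measurable_snd.
move=> y; rewrite ger0_norm; last by apply: mulr_ge0; [exact: kk_ge0|exact: sqr_ge0].
have := sqr_ge0 (a * (x.1 - y.1) - b * (x.2 - y.2)).
have := kk_ge0 t x y; move: (kk t x y) (x.1 - y.1) (x.2 - y.2) => k u v k0 h.
by have := mulr_ge0 k0 h; lra.
Qed.

(** The mixed moment vanishes by reflection of one coordinate about x, so the second moments are
    isotropic. This is where the normalization D_t / (2 t) comes from. *)
Lemma kk_moment_lin t x (a b : R) : 0 < t ->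
  II mu (fun y => kk t x y * (a * (x.1 - y.1) + b * (x.2 - y.2)) ^+ 2) =
  2 * t * (a ^+ 2 + b ^+ 2).
Proof.
move=> t0; have [i1 [i2 [e1 e2]]] := kk_moments x t0.
have i3 : ig mu (fun y => kk t x y * ((x.1 - y.1) * (x.2 - y.2))).
  have h := igZ 2^-1 (igB (kk_lin_ig x 1 1 t0) (igD i1 i2)).
  by apply: eq_integrable h => // y _ /=; congr EFin; field.
have e3 : II mu (fun y => kk t x y * ((x.1 - y.1) * (x.2 - y.2))) = 0.
  apply: (II_odd (flip1 x) i3) => y /=; rewrite /kk/=.
  rewrite g1_reflect.
  by ring.
transitivity (II mu (fun y => a ^+ 2 * (kk t x y * (x.1 - y.1) ^+ 2) +
    b ^+ 2 * (kk t x y * (x.2 - y.2) ^+ 2) +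
    2 * a * b * (kk t x y * ((x.1 - y.1) * (x.2 - y.2))))).
  by congr II; apply/funext => y; ring.
rewrite IID; [|by apply: igD; exact: igZ|exact: igZ].
rewrite IID; [|exact: igZ|exact: igZ].
by rewrite !IIZ// e1 e2 e3; ring.
Qed.

Lemma kk_odd t x : 0 < t ->
  ig mu (fun y => kk t x y * (x.1 - y.1)) /\ ig mu (fun y => kk t x y * (x.2 - y.2)) /\
  II mu (fun y => kk t x y * (x.1 - y.1)) = 0 /\ II mu (fun y => kk t x y * (x.2 - y.2)) = 0.
Proof.
move=> t0; have [i1 [i2 _]] := kk_moments x t0.
have H (w : P -> R) : mf w -> ig mu (fun y => kk t x y * w y ^+ 2) ->
    ig mu (fun y => kk t x y * w y).
  move=> mw wi; apply: (ig_le _ _ (igD (ig_kk x t0) wi)).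
    by apply: measurable_funM => //; exact: mkk1.
  move=> y; rewrite normrM ger0_norm ?kk_ge0// -[X in X + _]mulr1 -mulrDr.
  apply: ler_wpM2l; first exact: kk_ge0.
  rewrite -(real_normK (num_real (w y))).
  by have := normr_ge0 (w y); move: `|w y| => a a0; nra.
have j1 : ig mu (fun y => kk t x y * (x.1 - y.1)).
  by apply: H => //; apply: measurable_funB => //; exact: measurable_fst.
have j2 : ig mu (fun y => kk t x y * (x.2 - y.2)).
  by apply: H => //; apply: measurable_funB => //; exact: measurable_snd.
split=> //; split=> //; split.
- apply: (II_odd (flip1 x) j1) => y /=; rewrite /kk/=.
  rewrite g1_reflect.
  by ring.
- apply: (II_odd (flip2 x) j2) => y /=; rewrite /kk/=.
  rewrite g1_reflect.
  by ring.
Qed.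

End heat_kernel.

(** * Test functions and weak derivatives *)

Section smooth1.
Context {R : realType}.
Implicit Types u w : R -> R.

Fixpoint smooth (k : nat) u : Prop :=
  continuous u /\
  if k is k'.+1 then (forall x, derivable u x 1) /\ smooth k' ((derive1 u)) else True.

Lemma derivable1_continuous u : (forall x, derivable u x 1) -> continuous u.
Proof.
by move=> du x; apply: differentiable_continuous; exact/derivable1_diffP.
Qed.

Lemma smoothS_is k (u u' : R -> R) : (forall x : R, is_derive x (1 : R) u (u' x)) -> smooth k u' ->
  smooth k.+1 u.
Proof.
move=> du su; have D x : derivable u x 1 by apply: ex_derive.
split; first exact: derivable1_continuous.
split => //; rewrite (_ : (derive1 u) = u')//; apply/funext => x.
by rewrite derive1E derive_val.
Qed.

Lemma smoothSP k u : smooth k.+1 u -> (forall x, is_derive (x : R) (1 : R) u ((derive1 u) x)) /\ smooth k ((derive1 u)).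
Proof.
move=> [_ [D S]]; split => // x; apply: DeriveDef => //.
by rewrite derive1E.
Qed.

Lemma smooth_cont k u : smooth k u -> continuous u.
Proof. by case: k => [|k] []. Qed.

Lemma smoothW k u : smooth k.+1 u -> smooth k u.
Proof.
elim: k u => [|k IH] u; first by move=> [].
move=> /smoothSP [D S]; apply: (smoothS_is D); exact: IH.
Qed.

Lemma smooth_cst k (c : R) : smooth k (fun=> c).
Proof.
elim: k c => [|k IH] c; first by split => // x; exact: cvg_cst.
by apply: (@smoothS_is _ _ (fun=> 0)) => // x; exact: is_derive_cst.
Qed.

Lemma smoothD k u w : smooth k u -> smooth k w -> smooth k (fun x => u x + w x).
Proof.
elim: k u w => [|k IH] u w.
  by move=> [cu _] [cw _]; split => // x; apply: cvgD; [exact: cu|exact: cw].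
move=> /smoothSP [Du Su] /smoothSP [Dw Sw].
by apply: (@smoothS_is _ _ (fun x => (derive1 u) x + (derive1 w) x)) (IH _ _ Su Sw) => x; exact: is_deriveD.
Qed.

Lemma smoothM k u w : smooth k u -> smooth k w -> smooth k (fun x => u x * w x).
Proof.
elim: k u w => [|k IH] u w.
  by move=> [cu _] [cw _]; split => // x; apply: cvgM; [exact: cu|exact: cw].
move=> su sw; have [Du Su] := smoothSP su; have [Dw Sw] := smoothSP sw.
have D x : is_derive (x : R) (1 : R) (fun x => u x * w x)
  (u x * (derive1 w) x + w x * (derive1 u) x) by exact: is_deriveM.
exact: (smoothS_is D (smoothD (IH _ _ (smoothW su) Sw) (IH _ _ (smoothW sw) Su))).
Qed.

Lemma smooth_comp_affine k u (c d : R) : smooth k u -> smooth k (fun x => u (c * x + d)).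
Proof.
elim: k u => [|k IH] u.
  move=> [cu _]; split => // x; apply: (@continuous_comp _ _ _ (fun x => c * x + d) u).
    by apply: cvgD; [apply: cvgMr; exact: cvg_id|exact: cvg_cst].
  exact: cu.
move=> /smoothSP [Du Su].
have D x : is_derive (x : R) (1 : R) (fun x => u (c * x + d)) (derive1 u (c * x + d) * c).
  have h : is_derive (x : R) (1 : R) (fun x => c * x + d) c.
    have := is_deriveD (is_deriveZ c (is_derive_id x (1:R))) (is_derive_cst d x (1:R)).
    by rewrite addr0 => h; exact: (is_derive_eq h (mulr1 c)).
  exact: is_derive1_comp.
exact: (smoothS_is D (smoothM (IH _ Su) (smooth_cst k c))).
Qed.

Lemma smooth_expR k u : smooth k u -> smooth k (fun x => expR (u x)).
Proof.
elim: k u => [|k IH] u.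
  move=> [cu _]; split => // x; apply: (@continuous_comp _ _ _ u expR); first exact: cu.
  exact: continuous_expR.
move=> su; have [Du Su] := smoothSP su.
have D x : is_derive (x : R) (1 : R) (fun x => expR (u x)) (expR (u x) * derive1 u x).
  exact: is_derive1_comp.
exact: (smoothS_is D (smoothM (IH _ (smoothW su)) Su)).
Qed.

(* The functions s^-m exp(-1/s), extended by 0: their class is stable under derivation. *)
Definition flat (m : nat) (s : R) : R := if 0 < s then s ^- m * expR (- s^-1) else 0.

Lemma flat_ge0 m s : 0 <= flat m s.
Proof. by rewrite /flat; case: ifP => // s0; rewrite mulr_ge0 ?expR_ge0// invr_ge0 exprn_ge0// ltW. Qed.

(** The term of order m + 1 in the exponential series of 1/s beats s^-m by one power of s. *)
Lemma flat_le m s : flat m s <= m.+1`!%:R * `|s|.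
Proof.
rewrite /flat; case: ifP => [s0|_]; last by rewrite mulr_ge0.
rewrite (gtr0_norm s0) expRN ler_pdivrMr ?expR_gt0//.
have := @expR_ge1Dxn R s^-1 m; rewrite invr_ge0 => /(_ (ltW s0)) h.
have f0 : 0 < m.+1`!%:R :> R by rewrite ltr0n fact_gt0.
apply: (@le_trans _ _ (m.+1`!%:R * s * (s^-1 ^+ m.+1 / m.+1`!%:R))).
  rewrite exprS exprVn le_eqVlt; apply/orP; left; apply/eqP; field.
  by rewrite !gt_eqF// exprn_gt0.
apply: ler_wpM2l; first by rewrite mulr_ge0// ltW.
by apply: le_trans h; rewrite lerDr.
Qed.

Lemma inv_derive (s : R) : s != 0 -> is_derive (s : R) (1 : R) (fun y : R => y^-1) (- s ^- 2).
Proof.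
move=> s0; have D : derivable (id : R -> R) (s : R) (1 : R) by exact: derivable_id.
apply: DeriveDef; first exact: (@derivableV _ _ id).
have -> := @deriveV _ _ (id : R -> R) s (1 : R) s0 D.
by rewrite derive_id /GRing.scale/= mulr1.
Qed.

Lemma flat_derive m (s : R) :
  is_derive (s : R) (1 : R) (flat m) (flat m.+2 s - m%:R * flat m.+1 s).
Proof.
have [s0|s0|s0] := ltgtP s 0.
- have -> : flat m.+2 s - m%:R * flat m.+1 s = 0.
    by rewrite /flat !ltNge !(ltW s0)//= mulr0 subr0.
  have H : is_derive (s : R) (1 : R) (fun=> 0 : R) 0 by exact: is_derive_cst.
  apply: (near_eq_is_derive _ H).
  near=> y; rewrite /flat ltNge ltW//.
  by near: y; exact: lt_nbhsl.
- have -> : flat m.+2 s - m%:R * flat m.+1 s =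
      s^-1 ^+ m * (expR (- s^-1) * s ^- 2) + expR (- s^-1) * (m%:R * s^-1 ^+ m.-1 * - s ^- 2).
    rewrite /flat s0; case: m => [|m].
      by rewrite !mul0r subr0 mulr0 addr0 !expr0 mul1r mulrC.
    by rewrite /= !exprVn !exprS; field; rewrite !gt_eqF// exprn_gt0.
  have Di := inv_derive (lt0r_neq0 s0).
  have D1 := is_deriveX m Di.
  have D2 : is_derive (s : R) (1 : R) (fun y : R => expR (- y^-1)) (expR (- s^-1) * s ^- 2).
    have D3 := is_deriveN Di; rewrite opprK in D3.
    exact: (@is_derive1_comp _ expR (fun y => - y^-1)).
  have D4 := is_deriveM D1 D2.
  apply: (near_eq_is_derive _ (is_derive_eq D4 _)).
    apply: filterS (lt_nbhsr s0) => y y0.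
    by rewrite /flat y0 -exprVn exprfctE.
  by rewrite exprfctE /GRing.scale/=; ring.
- have -> : flat m.+2 s - m%:R * flat m.+1 s = 0.
    by rewrite /flat s0 ltxx mulr0 subr0.
  rewrite s0.
  (* The difference quotient at 0 is [flat m.+1 h], which is O(|h|) by [flat_le]. *)
  have C : (fun h : R => h^-1 *: ((flat m \o shift 0) (h *: (1 : R)) - flat m 0)) @ 0^' --> (0 : R).
    apply/cvgrPdist_le => e e0.
    have f0 : 0 < m.+2`!%:R :> R by rewrite ltr0n fact_gt0.
    near=> h; have h0 : h != 0 by near: h; exact: nbhs_dnbhs_neq.
    have he : `|h| < e / m.+2`!%:R by near: h; apply: dnbhs0_lt; rewrite divr_gt0.
    rewrite sub0r normrN /= addr0 /GRing.scale/= mulr1 {2}/flat ltxx subr0.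
    have -> : h^-1 * flat m h = flat m.+1 h.
      rewrite /flat; case: ifP => hp; last by rewrite mulr0.
      by rewrite exprS invfM mulrA.
    rewrite ger0_norm ?flat_ge0// (le_trans (flat_le _ _))//.
    by rewrite mulrC -ler_pdivlMr// ltW.
  apply: DeriveDef; first by apply/cvg_ex; exists 0.
  exact: (cvg_lim _ C).
Unshelve. all: by end_near. Qed.

Lemma smooth_flat k m : smooth k (flat m).
Proof.
elim: k m => [|k IH] m.
  split => //; apply: derivable1_continuous => x.
  by have := flat_derive m x; case.
apply: (smoothS_is (flat_derive m)).
have h := smoothM (smooth_cst k (- m%:R)) (IH m.+1).
have := smoothD (IH m.+2) h; congr smooth; apply/funext => x.
by rewrite mulNr.
Qed.

(* Smooth functions increasing pointwise to the indicator of ]a, b[. *)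
Definition bump (a b : R) (n : nat) (x : R) : R :=
  1 - expR (- n%:R * (flat 0 (x - a) * flat 0 (b - x))).

Lemma smooth_bump k a b n : smooth k (bump a b n).
Proof.
have h1 := @smooth_comp_affine k _ 1 (- a) (smooth_flat k 0).
have h2 := @smooth_comp_affine k _ (-1) b (smooth_flat k 0).
have h3 := smooth_expR (smoothM (smooth_cst k (- n%:R)) (smoothM h1 h2)).
have := smoothD (smooth_cst k 1) (smoothM (smooth_cst k (-1)) h3).
congr smooth; apply/funext => x; rewrite /bump mulN1r mul1r.
by rewrite (_ : -1 * x + b = b - x)//; ring.
Qed.

Lemma bump_out a b n x : ~~ (a < x < b) -> bump a b n x = 0.
Proof.
move=> h; rewrite /bump /flat !subr_gt0.
have [ax|_] := boolP (a < x); last by rewrite mul0r mulr0 expR0 subrr.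
have [xb|_] := boolP (x < b); last by rewrite !mulr0 expR0 subrr.
by move: h; rewrite ax xb.
Qed.

Lemma bump_itv a b n x : 0 <= bump a b n x <= 1.
Proof.
rewrite /bump subr_ge0 gerBl expR_ge0 andbT -[X in _ <= X]expR0 ler_expR.
by rewrite mulNr oppr_le0 !mulr_ge0 ?flat_ge0.
Qed.

Lemma bump_cvg a b x : (fun n => bump a b n x) @ \oo --> (\1_`]a, b[%classic x : R).
Proof.
rewrite indicE; have [|h] := boolP (a < x < b).
  move=> axb; rewrite mem_set/= ?in_itv//=; have /andP[ax xb] := axb.
  rewrite -[X in _ --> X]subr0; apply: cvgB; first exact: cvg_cst.
  set c := _ * _; have c0 : 0 < c.
    by rewrite /c /flat !subr_gt0 ax xb !expr0 invr1 !mul1r mulr_gt0 ?expR_gt0.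
  apply/cvg_seqP => e e0; exists (Num.truncn (e^-1 / c)).+1 => n nN.
  rewrite subr0 ger0_norm ?expR_ge0// mulNr expRN.
  rewrite -[leRHS]invrK lef_pV2 ?posrE ?expR_gt0 ?invr_gt0//.
  apply: (@le_trans _ _ (n%:R * c)).
    rewrite -ler_pdivrMr// ltW// (lt_le_trans (truncnS_gt _))//.
    by rewrite ler_nat.
  by apply: le_trans (expR_ge1Dx _); rewrite lerDr.
rewrite memNset/= ?in_itv//=; last exact/negP.
rewrite (_ : (fun n => _) = (fun=> 0)); first exact: cvg_cst.
by apply/funext => n; exact: bump_out.
Qed.

End smooth1.

Lemma bigcup_count_measurable d (T : measurableType d) (I : countType) (F : I -> set T) :
  (forall i, measurable (F i)) -> measurable (\bigcup_i F i).
Proof.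
move=> mF; pose G n := if unpickle n is Some i then F i else set0.
have -> : \bigcup_i F i = \bigcup_n G n.
  apply/seteqP; split => [x [i _ Fx]|x [n _]].
    by exists (pickle i) => //; rewrite /G pickleK.
  by rewrite /G; case: (unpickle n) => // i Fx; exists i.
by apply: bigcupT_measurable => n; rewrite /G; case: (unpickle n).
Qed.

(** * Borel measurability and partial derivatives on the plane *)

Section plane_functions.
Context {R : realType}.
Local Notation P := (mplane R).
Local Notation Q := (plane R).
Local Notation mu := (leb2 R).
Local Notation L := (measurableTypeR R).

Lemma plane_nbhsP (x : Q) (U : set Q) :
  nbhs x U <-> exists2 e : R, 0 < e & forall y : Q,
    `|x.1 - y.1| < e -> `|x.2 - y.2| < e -> U y.
Proof.
split.
  move=> /nbhs_ballP[e /= e0 h]; exists e => // y h1 h2; apply: h.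
  by split.
move=> [e e0 h]; apply/nbhs_ballP; exists e => // y [h1 h2].
exact: h.
Qed.

(** An open set is the countable union of the small rational squares that it contains. This connects
    the topology of [plane] with the product sigma-algebra of [mplane]. *)
Lemma open_plane_measurable (U : set Q) : open U -> measurable (U : set P).
Proof.
move=> oU.
pose B (p q : rat) (k : nat) : set P :=
  `](ratr p - k.+1%:R^-1), (ratr p + k.+1%:R^-1)[%classic `*`
  `](ratr q - k.+1%:R^-1), (ratr q + k.+1%:R^-1)[%classic.
pose F (i : rat * rat * nat) : set P :=
  if `[< B i.1.1 i.1.2 i.2 `<=` U >] then B i.1.1 i.1.2 i.2 else set0.
suff -> : (U : set P) = \bigcup_i F i.
  apply: bigcup_count_measurable => -[[p q] k]; rewrite /F; case: ifP => _.
    by apply: measurableX; exact: measurable_itv.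
  exact: measurable0.
apply/seteqP; split => [x Ux|x [i _]]; last first.
  by rewrite /F; case: ifPn => // /asboolP; exact.
have /plane_nbhsP[e e0 he] : nbhs (x : Q) U by exact: open_nbhs_nbhs.
pose k := Num.truncn (2 / e); pose d : R := k.+1%:R^-1.
have d0 : 0 < d by rewrite invr_gt0.
have de : 2 * d < e.
  by rewrite /d ltr_pdivrMr// mulrC -ltr_pdivrMr// truncnS_gt.
have [p hp] := @rat_in_itvoo R (x.1 - d) (x.1 + d) ltac:(lra).
have [q hq] := @rat_in_itvoo R (x.2 - d) (x.2 + d) ltac:(lra).
move: hp hq; rewrite !in_itv/= => /andP[p1 p2] /andP[q1 q2].
exists (p, q, k); first by [].
rewrite /F ifT.
  by split => /=; rewrite in_itv/= -/d; apply/andP; split; lra.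
apply/asboolP => y [/=]; rewrite !in_itv/= -/d => /andP[a1 a2] /andP[b1 b2].
by apply: he; rewrite ltr_norml; apply/andP; split; lra.
Qed.

Lemma continuous_mf (f : Q -> R) : continuous f -> measurable_fun [set: P] f.
Proof.
move=> cf; apply: (@measurability _ _ P R setT f _ (RGenOInfty.measurableE R)).
move=> _ [_ [a ->] <-].
rewrite setTI; apply: open_plane_measurable.
by apply: open_comp => // x _; exact: cf.
Qed.

(** The difference quotients along a basis vector are those of a section of f, which reduces partial
    derivatives to functions of one variable. *)
Let quotient1 (f : Q -> R) (x : Q) :
  (fun h : R => h^-1 *: ((f \o shift x) (h *: e1 R) - f x)) =
  (fun h : R => h^-1 *: (((fun s : R => f (s, x.2)) \o shift x.1) (h *: (1 : R)) - (fun s : R => f (s, x.2)) x.1)).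
Proof.
apply/funext => h /=; congr (_ *: (f _ - f _)); last by case: x.
by case: x => a b; congr (_, _) => /=; rewrite /GRing.scale/= ?mulr0 ?add0r.
Qed.

Lemma derivable_e1 (f : Q -> R) (x : Q) :
  derivable f x (e1 R) = derivable (fun s : R => f (s, x.2)) x.1 (1 : R).
Proof. by rewrite /derivable quotient1. Qed.

Lemma derive_e1 (f : Q -> R) (x : Q) :
  'D_(e1 R) f x = derive1 (fun s : R => f (s, x.2)) x.1.
Proof. by rewrite derive1E /derive quotient1. Qed.

Let quotient2 (f : Q -> R) (x : Q) :
  (fun h : R => h^-1 *: ((f \o shift x) (h *: e2 R) - f x)) =
  (fun h : R => h^-1 *: (((fun s : R => f (x.1, s)) \o shift x.2) (h *: (1 : R)) - (fun s : R => f (x.1, s)) x.2)).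
Proof.
apply/funext => h /=; congr (_ *: (f _ - f _)); last by case: x.
by case: x => a b; congr (_, _) => /=; rewrite /GRing.scale/= ?mulr0 ?add0r.
Qed.

Lemma derivable_e2 (f : Q -> R) (x : Q) :
  derivable f x (e2 R) = derivable (fun s : R => f (x.1, s)) x.2 (1 : R).
Proof. by rewrite /derivable quotient2. Qed.

Lemma derive_e2 (f : Q -> R) (x : Q) :
  'D_(e2 R) f x = derive1 (fun s : R => f (x.1, s)) x.2.
Proof. by rewrite derive1E /derive quotient2. Qed.

Lemma Ck_prod k (u w : R -> R) : smooth k u -> smooth k w ->
  Ck k (fun x : Q => u x.1 * w x.2).
Proof.
have cpr (a b : R -> R) : continuous a -> continuous b -> continuous (fun x : Q => a x.1 * b x.2).
  move=> ca cb x; apply: cvgM.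
    by apply: (@continuous_comp _ _ _ fst a); [exact: cvg_fst|exact: ca].
  by apply: (@continuous_comp _ _ _ snd b); [exact: cvg_snd|exact: cb].
elim: k u w => [|k IH] u w; first by move=> [cu _] [cw _]; split => //; exact: cpr.
move=> su sw; have [Du Su] := smoothSP su; have [Dw Sw] := smoothSP sw.
have D1 (x : Q) : is_derive (x.1 : R) (1 : R) (fun s : R => u s * w x.2) (derive1 u x.1 * w x.2).
  have h := is_deriveM (Du x.1) (is_derive_cst (w x.2) x.1 (1 : R)).
  by apply: (is_derive_eq h); rewrite scaler0 add0r /GRing.scale/= mulrC.
have D2 (x : Q) : is_derive (x.2 : R) (1 : R) (fun s : R => u x.1 * w s) (u x.1 * derive1 w x.2).
  have h := is_deriveM (is_derive_cst (u x.1) x.2 (1 : R)) (Dw x.2).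
  by apply: (is_derive_eq h); rewrite scaler0 addr0.
split; first by apply: cpr; [exact: smooth_cont su|exact: smooth_cont sw].
split.
- by move=> x; rewrite derivable_e1; case: (D1 x).
- by move=> x; rewrite derivable_e2; case: (D2 x).
- rewrite (_ : 'D_(e1 R) _ = fun x : Q => derive1 u x.1 * w x.2).
    by apply: IH => //; exact: smoothW.
  by apply/funext => x; rewrite derive_e1 derive1E; case: (D1 x).
- rewrite (_ : 'D_(e2 R) _ = fun x : Q => u x.1 * derive1 w x.2).
    by apply: IH => //; exact: smoothW.
  by apply/funext => x; rewrite derive_e2 derive1E; case: (D2 x).
Qed.

Definition box (N : R) : set P := `[-N, N]%classic `*` `[-N, N]%classic.

Lemma closed_box (a b c d : R) : closed (`[a, b]%classic `*` `[c, d]%classic : set Q).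
Proof.
apply: compact_closed; first exact: norm_hausdorff.
by apply: compact_setX; exact: segment_compact.
Qed.

Lemma compact_support_sub (f : Q -> R) (a b c d : R) :
  (forall x : Q, f x != 0 -> a <= x.1 <= b /\ c <= x.2 <= d) ->
  compact (closure [set x | f x != 0]).
Proof.
move=> h; apply: (@subclosed_compact _ _ (`[a, b]%classic `*` `[c, d]%classic : set Q)).
- exact: closed_closure.
- by apply: compact_setX; exact: segment_compact.
- rewrite [X in _ `<=` X](closure_id _).1; last exact: closed_box.
  by apply: closureS => x /= /h[h1 h2]; split; rewrite /= in_itv.
Qed.

Lemma test_bump (a b c d : R) n m :
  test_function (fun x : Q => bump a b n x.1 * bump c d m x.2).
Proof.
split; first by move=> k; apply: Ck_prod; exact: smooth_bump.
apply: (@compact_support_sub _ a b c d) => x h.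
have [h1 h2] : a < x.1 < b /\ c < x.2 < d.
  split; apply: contraNT h => h; rewrite /=.
    by rewrite (bump_out n h) mul0r.
  by rewrite (bump_out m h) mulr0.
by case/andP: h1 => /ltW -> /ltW ->; case/andP: h2 => /ltW -> /ltW ->.
Qed.

Lemma test_cont (f : Q -> R) : test_function f -> continuous f.
Proof. by move=> [/(_ 0%N)[]]. Qed.

Lemma test_bound (f : Q -> R) : test_function f ->
  exists M N : R, 0 <= M /\ forall x : Q, `|f x| <= M * \1_(box N) x.
Proof.
move=> tf; have cf := test_cont tf; have [_ cK] := tf.
set K := closure _ in cK.
have B (g : Q -> R) : continuous g -> exists M : R, forall x, K x -> `|g x| <= M.
  move=> cg; have : compact (g @` K).
    by apply: continuous_compact => //; exact: continuous_subspaceT.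
  move=> /compact_bounded[M [_ hM]]; exists (M + 1) => x Kx.
  by apply: (hM (M + 1)); [rewrite ltrDl|exists x].
have [M hM] := B f cf.
have [N1 h1] := B fst (fun x => cvg_fst).
have [N2 h2] := B snd (fun x => cvg_snd).
have M0 : 0 <= Num.max M 0 by rewrite le_max lexx orbT.
exists (Num.max M 0), (Num.max N1 N2); split => // x.
have [->|fx] := eqVneq (f x) 0; first by rewrite normr0 mulr_ge0.
have Kx : K x by exact: subset_closure.
rewrite indicE mem_set ?mulr1; first by rewrite le_max hM.
by split; rewrite /= in_itv/= -ler_norml le_max ?(h1 _ Kx) ?(h2 _ Kx)// orbT.
Qed.

End plane_functions.

(** * Fundamental lemma of the calculus of variations *)

Section fundamental_lemma.
Context {R : realType}.
Local Notation P := (mplane R).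
Local Notation Q := (plane R).
Local Notation mu := (leb2 R).
Local Notation L := (measurableTypeR R).

Definition rect (a b c d : R) : set P := `]a, b[%classic `*` `]c, d[%classic.

Lemma measurable_rect a b c d : measurable (rect a b c d).
Proof. by apply: measurableX; exact: measurable_itv. Qed.

Lemma indic_rect a b c d (x : P) :
  \1_(rect a b c d) x = \1_`]a, b[%classic x.1 * \1_`]c, d[%classic x.2 :> R.
Proof. by rewrite !indicE -natrM mulnb /rect in_setX. Qed.

Lemma ig_indic (A : set P) : measurable A -> (mu A < +oo)%E -> ig mu (\1_A : P -> R).
Proof.
move=> mA fA; apply: ge0_ig; [exact: measurable_indic|by []|].
by rewrite integral_indic// setIT.
Qed.

Lemma leb2_rect a b c d : (mu (rect a b c d) < +oo)%E.
Proof.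
have m1 : measurable (`]a, b[%classic : set L) by exact: measurable_itv.
have m2 : measurable (`]c, d[%classic : set L) by exact: measurable_itv.
have -> : mu (rect a b c d) =
    (lebesgue_measure (`]a, b[%classic : set L) * lebesgue_measure (`]c, d[%classic : set L))%E.
  exact: product_measure1E.
rewrite !lebesgue_measure_itv/= !lte_fin.
by case: ifP => _; case: ifP => _; rewrite -?EFinB -?EFinM ?mul0e ?mule0 ltry.
Qed.

Lemma L2_indic (A : set P) : measurable A -> (mu A < +oo)%E -> L2 mu (\1_A : P -> R).
Proof.
move=> mA fA; split; first exact: measurable_indic.
have := ig_indic mA fA; congr ig; apply/funext => x.
by rewrite indicE; case: (_ \in _); rewrite /= ?expr1n ?expr0n.
Qed.

Let G : set (set P) := [set A | exists a b c d, A = rect a b c d].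

Let G_setI : setI_closed G.
Proof.
move=> A B [a [b [c [d ->]]]] [a' [b' [c' [d' ->]]]].
exists (Num.max a a'), (Num.min b b'), (Num.max c c'), (Num.min d d').
apply/seteqP; split => x; rewrite /rect /= !in_itv/= !gt_max !lt_min.
  by move=> [[/andP[-> ->] /andP[-> ->]] [/andP[-> ->] /andP[-> ->]]].
by move=> [/andP[/andP[-> ->] /andP[-> ->]] /andP[/andP[-> ->] /andP[-> ->]]].
Qed.

Let S := g_sigma_algebraType (G : set (set (R * R))).

Let S_rays (x : R) : measurable ([set z : R * R | x < z.1] : set S) /\
  measurable ([set z : R * R | x < z.2] : set S).
Proof.
split.
- have -> : [set z : R * R | x < z.1] = \bigcup_n (rect x n%:R (- n%:R) n%:R : set S).
    apply/seteqP; split => [z /= xz|z [n _ []/=]]; last by rewrite !in_itv/= => /andP[].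
    exists (Num.truncn (`|z.1| + `|z.2|)).+1 => //.
    have h := truncnS_gt (`|z.1| + `|z.2|).
    have h1 := ler_norm z.1; have h2 := normr_ge0 z.2; have h3 := normr_ge0 z.1.
    split; rewrite /= in_itv/= ?xz/=; first by lra.
    by rewrite -ltr_norml; lra.
  by apply: bigcupT_measurable => n; apply: sub_sigma_algebra; exists x, n%:R, (- n%:R), n%:R.
- have -> : [set z : R * R | x < z.2] = \bigcup_n (rect (- n%:R) n%:R x n%:R : set S).
    apply/seteqP; split => [z /= xz|z [n _ []/=]]; last by rewrite !in_itv/= => _ /andP[].
    exists (Num.truncn (`|z.1| + `|z.2|)).+1 => //.
    have h := truncnS_gt (`|z.1| + `|z.2|).
    have h1 := ler_norm z.2; have h2 := normr_ge0 z.2; have h3 := normr_ge0 z.1.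
    split; rewrite /= in_itv/= ?xz/=; last by lra.
    by rewrite -ltr_norml; lra.
  by apply: bigcupT_measurable => n; apply: sub_sigma_algebra; exists (- n%:R), n%:R, x, n%:R.
Qed.

Let measurable_G (A : set P) : measurable A -> <<s G >> A.
Proof.
move=> mA.
have m1 : measurable_fun [set: S] (fun z : S => (z : R * R).1).
  apply: (@measurability _ _ S R setT _ _ (RGenOInfty.measurableE R)).
  move=> _ [_ [a ->] <-]; rewrite setTI preimage_itvoy.
  by have [] := S_rays a.
have m2 : measurable_fun [set: S] (fun z : S => (z : R * R).2).
  apply: (@measurability _ _ S R setT _ _ (RGenOInfty.measurableE R)).
  move=> _ [_ [a ->] <-]; rewrite setTI preimage_itvoy.
  by have [] := S_rays a.
have mid : measurable_fun [set: S] (fun z : S => z : P).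
  by apply/measurable_fun_pairP.
by have := mid measurableT _ mA; rewrite setTI.
Qed.

(** The Borel sets on which h has zero integral form a lambda-system containing the pi-system of
    rectangles, hence are all of them; then test on {h > 0} and {h < 0}. The hypothesis on [II mu h]
    accounts for the whole plane, which is not a bounded rectangle. *)
Lemma rect_separation (h : P -> R) : ig mu h ->
  II mu h = 0 ->
  (forall a b c d, II mu (fun x => h x * \1_(rect a b c d) x) = 0) ->
  {ae mu, forall x, h x = 0}.
Proof.
move=> hi h0 hr; have mh := ig_mf hi.
have hA (A : set P) : measurable A -> ig mu (fun x => h x * \1_A x).
  move=> mA; apply: (ig_le _ _ (ig_norm hi)).
    by apply: measurable_funM => //; exact: measurable_indic.
  by move=> x; rewrite normrM ler_piMr// indicE; case: (_ \in _); rewrite ?normr1 ?normr0.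
pose H : set (set P) := [set A | measurable A /\ II mu (fun x => h x * \1_A x) = 0].
have lamH : lambda_system setT H.
  split => //.
  - split; first exact: measurableT.
    by rewrite -[RHS]h0; congr II; apply/funext => x; rewrite indicT mulr1.
  - move=> A B BA [mA A0] [mB B0]; split; first exact: measurableD.
    rewrite -[RHS]subr0 -{1}A0 -{1}B0 -IIB; [|exact: hA|exact: hA].
    congr II; apply/funext => x; rewrite -mulrBr; congr (_ * _).
    rewrite !indicE in_setD; have [xB|xB] := boolP (x \in B).
      by rewrite (mem_set (BA _ (set_mem xB))) subrr.
    by rewrite andbT subr0.
  - move=> F ndF HF; split; first by apply: bigcupT_measurable => n; case: (HF n).
    have mF n : measurable (F n) by case: (HF n).
    have mU : measurable (\bigcup_n F n) by exact: bigcupT_measurable.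
    have cv : {ae mu, forall x, (fun n => h x * \1_(F n) x) @ \oo --> h x * \1_(\bigcup_n F n) x}.
      apply: aeW => x; apply: cvgMr; have [[n _ Fn]|nU] := pselect ((\bigcup_n F n) x).
        apply/cvg_seqP => e e0; exists n => m nm.
        have Fm : F m x by have /subsetPset := ndF _ _ nm; apply.
        have Um : (\bigcup_n F n) x by exists n.
        by rewrite !indicE (mem_set Fm) (mem_set Um) subrr normr0 ltW.
      apply/cvg_seqP => e e0; exists 0%N => m _.
      have Fm : ~ F m x by apply: contra_not nU => Fm; exists m.
      by rewrite !indicE (memNset Fm) (memNset nU) subrr normr0 ltW.
    have bd n x : `|h x * \1_(F n) x| <= `|h x|.
      rewrite normrM ler_piMr// indicE.
      by case: (_ \in _); rewrite ?normr1 ?normr0.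
    have [_ C] := II_dct (fun n => measurable_funM mh (measurable_indic (mF n)))
      (measurable_funM mh (measurable_indic mU)) cv (ig_norm hi) bd.
    have Z : (fun n => II mu (fun x => h x * \1_(F n) x)) = (fun=> 0).
      by apply/funext => n; case: (HF n).
    rewrite Z in C; apply: (cvg_unique _ C) => //; exact: cvg_cst.
have GH : G `<=` H.
  by move=> _ [a [b [c [d ->]]]]; split; [exact: measurable_rect|exact: hr].
have K A : measurable A -> II mu (fun x => h x * \1_A x) = 0.
  move=> mA; have := lambda_system_subset G_setI lamH GH (fun _ _ _ _ => I).
  by move=> /(_ A (measurable_G mA)) [].
have mpos : measurable [set x : P | 0 < h x].
  have := mh measurableT _ (@measurable_itv R `]0, +oo[).
  by rewrite setTI preimage_itvoy.
have mneg : measurable [set x : P | h x < 0].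
  have := mh measurableT _ (@measurable_itv R `]-oo, 0[).
  by rewrite setTI preimage_itvNyo.
have P1 : {ae mu, forall x, h x * \1_[set x | 0 < h x] x = 0}.
  apply: II_eq0; [exact: hA| |exact: K].
  move=> x; rewrite indicE; have [hx|] := boolP (_ \in _); last by rewrite mulr0.
  by rewrite mulr1 ltW//; move/set_mem: hx.
have N1 : {ae mu, forall x, - (h x * \1_[set x | h x < 0] x) = 0}.
  apply: II_eq0; [exact/igN/hA| |by rewrite IIN ?K ?oppr0//; exact: hA].
  move=> x; rewrite indicE; have [hx|] := boolP (_ \in _); last by rewrite mulr0 oppr0.
  by rewrite mulr1 oppr_ge0 ltW//; move/set_mem: hx.
apply: filterS2 P1 N1 => x; rewrite !indicE.
have [hx|hx|//] := ltgtP (h x) 0.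
  by rewrite (@mem_set _ [set x | h x < 0])//= mulr1 => _ /eqP; rewrite oppr_eq0 => /eqP.
by rewrite (@mem_set _ [set x | 0 < h x])//= mulr1.
Qed.

Lemma fundamental_lemma (h : P -> R) : L2 mu h ->
  (forall phi : Q -> R, test_function phi -> II mu (fun x => h x * phi x) = 0) ->
  {ae mu, forall x, h x = 0}.
Proof.
move=> hL H0.
have R0 a b c d : II mu (fun x => h x * \1_(rect a b c d) x) = 0.
  have LR := L2_indic (measurable_rect a b c d) (leb2_rect a b c d).
  pose phi n (x : P) : R := bump a b n x.1 * bump c d n x.2.
  have mphi n : mf (phi n) by apply: continuous_mf; apply: test_cont; exact: test_bump.
  have cv x : (fun n => h x * phi n x) @ \oo --> h x * \1_(rect a b c d) x.
    by apply: cvgMr; rewrite indic_rect; apply: cvgM; exact: bump_cvg.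
  have bd n x : `|h x * phi n x| <= `|h x| * \1_(rect a b c d) x.
    rewrite normrM; apply: ler_wpM2l => //.
    have /andP[u0 u1] := bump_itv a b n x.1; have /andP[v0 v1] := bump_itv c d n x.2.
    have p0 : 0 <= phi n x := mulr_ge0 u0 v0.
    have p1 : phi n x <= 1 := mulr_ile1 u0 v0 u1 v1.
    rewrite (ger0_norm p0) indicE.
    have [xr|xr] := boolP (x \in rect a b c d); first exact: p1.
    rewrite le_eqVlt; apply/orP; left; rewrite mulf_eq0.
    apply: contraNT xr => /norP[x1 x2]; apply/mem_set; split; rewrite /= in_itv/=.
      by apply: contraNT x1 => h1; rewrite bump_out.
    by apply: contraNT x2 => h1; rewrite bump_out.
  have [_ C] := II_dct (fun n => measurable_funM hL.1 (mphi n))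
      (measurable_funM hL.1 LR.1) (aeW _ cv) (L2_mul (L2_norm hL) LR) bd.
  have Z : (fun n => II mu (fun x => h x * phi n x)) = (fun=> 0).
    by apply/funext => n; apply: H0; exact: test_bump.
  rewrite Z in C; apply: (cvg_unique _ C) => //; exact: cvg_cst.
(* Since h is only square integrable, the separation lemma is applied to its restrictions to
   squares, which are integrable. *)
have N0 (N : nat) : {ae mu, forall x, h x * \1_(rect (- N%:R) N%:R (- N%:R) N%:R) x = 0}.
  set K := rect _ _ _ _.
  apply: rect_separation.
  - by apply: L2_mul => //; exact: L2_indic (measurable_rect _ _ _ _) (leb2_rect _ _ _ _).
  - exact: R0.
  - move=> a b c d; have [a' [b' [c' [d' E]]]] : G (K `&` rect a b c d).
      by apply: G_setI; [exists (- N%:R), N%:R, (- N%:R), N%:R|exists a, b, c, d].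
    rewrite -[RHS](R0 a' b' c' d') -E; congr II; apply/funext => x.
    by rewrite -mulrA !indicE in_setI -natrM mulnb.
apply: filterS (ae_foralln N0) => x.
move=> /(_ (Num.truncn (`|x.1| + `|x.2|)).+1).
have t := truncnS_gt (`|x.1| + `|x.2|).
rewrite indicE mem_set ?mulr1//.
have x1 := normr_ge0 x.1; have x2 := normr_ge0 x.2.
by split; rewrite /= in_itv/= -ltr_norml; lra.
Qed.

End fundamental_lemma.

(** * Calculus of test functions and their translates *)

Section test_functions.
Context {R : realType}.
Local Notation P := (mplane R).
Local Notation Q := (plane R).
Local Notation mu := (leb2 R).
Implicit Types f g phi psi : Q -> R.

Lemma mvt_err (u : R -> R) (a d c e : R) : (forall x, derivable u x (1 : R)) ->
  (forall t, `|t| <= `|d| -> `|derive1 u (a + t) - c| <= e) ->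
  `|u (a + d) - u a - d * c| <= `|d| * e.
Proof.
move=> Du H; have cu := derivable1_continuous Du.
have dv (x : R) : is_derive x (1 : R) u (derive1 u x).
  by apply: DeriveDef => //; rewrite derive1E.
have W (p q : R) : p <= q -> exists2 x : R, p <= x <= q & u q - u p = derive1 u x * (q - p).
  move=> pq.
  have [x] := @MVT_segment R u (derive1 u) p q pq (fun x _ => dv x) (continuous_subspaceT cu).
  by rewrite in_itv; exists x.
have [d0|d0] := leP 0 d.
  have [x /andP[x1 x2] ->] := W a (a + d) ltac:(lra).
  rewrite (_ : derive1 u x * _ - _ = d * (derive1 u (a + (x - a)) - c)); last first.
    by rewrite [a + (x - a)]addrC subrK; ring.
  by rewrite normrM; apply: ler_wpM2l => //; apply: H; rewrite !ger0_norm; lra.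
have [x /andP[x1 x2] E] := W (a + d) a ltac:(lra).
rewrite (_ : u (a + d) - u a - d * c = d * (derive1 u (a + (x - a)) - c)); last first.
  by rewrite [a + (x - a)]addrC subrK -[u (a + d) - u a]opprB E; ring.
rewrite normrM; apply: ler_wpM2l => //; apply: H.
by rewrite (ltr0_norm d0) ler_norml; apply/andP; split; lra.
Qed.

Lemma Ck_lin k f g (c : R) : Ck k f -> Ck k g -> Ck k (fun x => f x + c * g x).
Proof.
have cl (a b : Q -> R) : continuous a -> continuous b -> continuous (fun x => a x + c * b x).
  by move=> ca cb x; apply: cvgD; [exact: ca|apply: cvgMr; exact: cb].
elim: k f g => [|k IH] f g; first by move=> [cf _] [cg _]; split => //; exact: cl.
move=> [cf [f1 f2 F1 F2]] [cg [g1 g2 G1 G2]].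
have D (v x : Q) : derivable f x v -> derivable g x v ->
    is_derive x v (fun x => f x + c * g x) ('D_v f x + c * 'D_v g x).
  move=> df dg.
  exact: (is_deriveD (derivableP df) (is_deriveZ c (derivableP dg))).
split; first exact: cl.
split.
- by move=> x; case: (D _ _ (f1 x) (g1 x)).
- by move=> x; case: (D _ _ (f2 x) (g2 x)).
- rewrite (_ : 'D_(e1 R) _ = fun x => 'D_(e1 R) f x + c * 'D_(e1 R) g x); first exact: IH.
  by apply/funext => x; case: (D _ _ (f1 x) (g1 x)).
- rewrite (_ : 'D_(e2 R) _ = fun x => 'D_(e2 R) f x + c * 'D_(e2 R) g x); first exact: IH.
  by apply/funext => x; case: (D _ _ (f2 x) (g2 x)).
Qed.

Lemma test_boundN f : test_function f -> exists M N : R, [/\ 0 < M, 0 < N,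
  forall x, `|f x| <= M & forall x, f x != 0 -> `|x.1| <= N /\ `|x.2| <= N].
Proof.
move=> /test_bound[M [N [M0 h]]]; exists (M + 1), (`|N| + 1); split.
- by rewrite ltr_wpDl.
- by rewrite ltr_wpDl.
- move=> x; rewrite (le_trans (h x))// indicE; case: (_ \in _); rewrite /= ?mulr1 ?mulr0; lra.
- move=> x fx; have : x \in box N.
    apply: contraNT fx => xN; rewrite -normr_le0 (le_trans (h x))//.
    by rewrite indicE (negbTE xN) mulr0.
  move/set_mem => -[] /=; rewrite !in_itv/= -!ler_norml => h1 h2.
  by have := ler_norm N; split; lra.
Qed.

Lemma test_supp f (N : R) : (forall k, Ck k f) ->
  (forall x, f x != 0 -> `|x.1| <= N /\ `|x.2| <= N) -> test_function f.
Proof.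
move=> Cf h; split => //; apply: (@compact_support_sub _ _ (- N) N (- N) N) => x /h.
by rewrite !ler_norml.
Qed.

Lemma test_lin f g (c : R) : test_function f -> test_function g ->
  test_function (fun x => f x + c * g x).
Proof.
move=> tf tg; have [_ [N1 [_ N10 _ h1]]] := test_boundN tf.
have [_ [N2 [_ N20 _ h2]]] := test_boundN tg.
apply: (@test_supp _ (N1 + N2)).
  by move=> k; apply: Ck_lin; [case: tf|case: tg].
move=> x h; have [fx|/h1[a b]] := eqVneq (f x) 0; last by split; lra.
have [gx|/h2[a b]] := eqVneq (g x) 0; last by split; lra.
by move: h; rewrite fx gx mulr0 addr0 eqxx.
Qed.

Lemma test0 : test_function (fun _ : Q => 0).
Proof.
apply: (@test_supp _ 0); last by move=> x; rewrite eqxx.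
have C0 : forall k, Ck k (fun _ : Q => (0 : R)); last exact: C0.
elim=> [|k IH]; first by split => // x; exact: cvg_cst.
have D v (x : Q) : 'D_v (fun _ : Q => (0 : R)) x = 0 by exact: (@derive_cst _ _ _ (0 : R)).
split; first by move=> x; exact: cvg_cst.
split; try by move=> x; exact: (derivable_cst (0 : R)).
- by rewrite (_ : 'D_(e1 R) _ = fun _ : Q => 0)//; apply/funext => x; exact: D.
- by rewrite (_ : 'D_(e2 R) _ = fun _ : Q => 0)//; apply/funext => x; exact: D.
Qed.

Lemma zero_derive1 (u : R -> R) (x : R) : (\forall y \near x, u y = 0) -> derive1 u x = 0.
Proof.
move=> h; rewrite derive1E.
rewrite -(@near_eq_derive _ _ _ (fun=> 0) u x (1 : R)); first exact: derive_cst.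
by apply: filterS h => y ->.
Qed.

Lemma derive_support f (N : R) :
  (forall x, f x != 0 -> `|x.1| <= N /\ `|x.2| <= N) ->
  (forall x, 'D_(e1 R) f x != 0 -> `|x.1| <= N /\ `|x.2| <= N) /\
  (forall x, 'D_(e2 R) f x != 0 -> `|x.1| <= N /\ `|x.2| <= N).
Proof.
move=> h.
have out (x : Q) : N < `|x.1| \/ N < `|x.2| -> f x = 0.
  move=> hx; apply: contrapT => /eqP /h[h1 h2].
  by case: hx; rewrite ltNge ?h1 ?h2.
have fr (a : R) : N < `|a| -> \forall y \near a, N < `|y|.
  move=> Na; have c : {for a, continuous (fun y : R => `|y|)} by exact: norm_continuous.
  exact: (c _ (lt_nbhsr Na)).
split => x; apply: contraNP => /not_andP H; apply/eqP.
- rewrite derive_e1; apply: zero_derive1; case: H => /negP; rewrite -ltNge => H.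
    by near=> y; apply: out; left; near: y; exact: (fr _ H).
  by near=> y; apply: out; right.
- rewrite derive_e2; apply: zero_derive1; case: H => /negP; rewrite -ltNge => H.
    by near=> y; apply: out; left.
  by near=> y; apply: out; right; near: y; exact: (fr _ H).
Unshelve. all: by end_near. Qed.

Lemma test_D f : test_function f ->
  test_function ('D_(e1 R) f) /\ test_function ('D_(e2 R) f).
Proof.
move=> tf; have [_ [N [_ _ _ h]]] := test_boundN tf; have [h1 h2] := derive_support h.
by split; [apply: (test_supp _ h1)|apply: (test_supp _ h2)] => k;
  case: tf => /(_ k.+1) [_ []].
Qed.

Definition sh (w : P) (f : P -> R) : P -> R := fun x => f (x.1 + w.1, x.2 + w.2).

Lemma minv_sh (w : P) : minv mu (fun x : P => (x.1 + w.1, x.2 + w.2) : P).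
Proof.
have := minv_shift false w; congr minv; apply/funext => x.
by rewrite expr0 !mul1r.
Qed.

Lemma derive1_shift (u : R -> R) (c x : R) :
  (forall y, derivable u y (1 : R)) ->
  is_derive (x : R) (1 : R) (fun y => u (y + c)) (derive1 u (x + c)).
Proof.
move=> du; have h : is_derive (x : R) (1 : R) (fun y : R => y + c) 1.
  have h := is_deriveD (is_derive_id x (1 : R)) (is_derive_cst c x (1 : R)).
  exact: (is_derive_eq h (addr0 _)).
have hu : is_derive (x + c : R) (1 : R) u (derive1 u (x + c)).
  by apply: DeriveDef => //; rewrite derive1E.
have := @is_derive1_comp _ u (fun y => y + c) x (derive1 u (x + c)) 1 hu h.
by move=> H; exact: (is_derive_eq H (mulr1 _)).
Qed.

Lemma Ck_sh k (w : P) f : Ck k f -> Ck k (sh w f : Q -> R).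
Proof.
have cs (a : Q -> R) : continuous a -> continuous (sh w a : Q -> R).
  move=> ca x; apply: (@continuous_comp _ _ _ (fun x : Q => (x.1 + w.1, x.2 + w.2) : Q) a); last exact: ca.
  have c1 : (fun y : Q => y.1 + w.1) @ x --> x.1 + w.1.
    by apply: cvgD; [exact: cvg_fst|exact: cvg_cst].
  have c2 : (fun y : Q => y.2 + w.2) @ x --> x.2 + w.2.
    by apply: cvgD; [exact: cvg_snd|exact: cvg_cst].
  exact: (cvg_pair c1 c2).
elim: k f => [|k IH] f; first by move=> [cf _]; split => //; exact: cs.
move=> [cf [f1 f2 F1 F2]].
have D1 (x : Q) : is_derive (x.1 : R) (1 : R) (fun s : R => (sh w f : Q -> R) (s, x.2))
    ('D_(e1 R) f (x.1 + w.1, x.2 + w.2)).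
  rewrite derive_e1; apply: (@derive1_shift (fun s => f (s, x.2 + w.2)) w.1 x.1) => y.
  by have := f1 (y, x.2 + w.2); rewrite derivable_e1.
have D2 (x : Q) : is_derive (x.2 : R) (1 : R) (fun s : R => (sh w f : Q -> R) (x.1, s))
    ('D_(e2 R) f (x.1 + w.1, x.2 + w.2)).
  rewrite derive_e2; apply: (@derive1_shift (fun s => f (x.1 + w.1, s)) w.2 x.2) => y.
  by have := f2 (x.1 + w.1, y); rewrite derivable_e2.
split; first exact: cs.
split.
- by move=> x; rewrite derivable_e1; case: (D1 x).
- by move=> x; rewrite derivable_e2; case: (D2 x).
- rewrite (_ : 'D_(e1 R) _ = (sh w ('D_(e1 R) f) : Q -> R)); first exact: IH.
  by apply/funext => x; rewrite derive_e1 derive1E; case: (D1 x).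
- rewrite (_ : 'D_(e2 R) _ = (sh w ('D_(e2 R) f) : Q -> R)); first exact: IH.
  by apply/funext => x; rewrite derive_e2 derive1E; case: (D2 x).
Qed.

Lemma derive_sh (w : P) f : (forall k, Ck k f) ->
  'D_(e1 R) (sh w f : Q -> R) = (sh w ('D_(e1 R) f) : Q -> R) /\
  'D_(e2 R) (sh w f : Q -> R) = (sh w ('D_(e2 R) f) : Q -> R).
Proof.
move=> /(_ 1%N) [_ [f1 f2 _ _]]; split; apply/funext => x.
- have H y : derivable (fun s : R => f (s, x.2 + w.2)) y (1 : R).
    by have := f1 (y, x.2 + w.2); rewrite derivable_e1.
  by rewrite derive_e1 derive1E /sh derive_e1; case: (derive1_shift w.1 x.1 H).
- have H y : derivable (fun s : R => f (x.1 + w.1, s)) y (1 : R).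
    by have := f2 (x.1 + w.1, y); rewrite derivable_e2.
  by rewrite derive_e2 derive1E /sh derive_e2; case: (derive1_shift w.2 x.2 H).
Qed.

Lemma test_sh (w : P) f : test_function f -> test_function (sh w f : Q -> R).
Proof.
move=> tf; have [_ [N [_ _ _ h]]] := test_boundN tf.
apply: (@test_supp _ (N + `|w.1| + `|w.2|)); first by move=> k; apply: Ck_sh; case: tf.
move=> x /h /= [h1 h2].
have a1 := ler_normB (x.1 + w.1) w.1; have a2 := ler_normB (x.2 + w.2) w.2.
have b1 := normr_ge0 w.1; have b2 := normr_ge0 w.2.
by rewrite !addrK in a1 a2; split; lra.
Qed.

Lemma test_L2 f : test_function f -> L2 mu f.
Proof.
move=> tf; have [M [N [M0 h]]] := test_bound tf.
have mf1 : measurable_fun [set: P] f by apply: continuous_mf; exact: test_cont.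
have LB : L2 mu (\1_(rect (- (`|N| + 1)) (`|N| + 1) (- (`|N| + 1)) (`|N| + 1)) : P -> R).
  exact: L2_indic (measurable_rect _ _ _ _) (leb2_rect _ _ _ _).
apply: (L2_le mf1 _ (L2Z M LB)) => x; apply: (le_trans (h x)).
rewrite ger0_norm ?mulr_ge0//; apply: ler_wpM2l => //.
rewrite !indicE; have [xb|//] := boolP (x \in box N).
rewrite (@mem_set _ (rect _ _ _ _))//; move/set_mem: xb => -[] /=.
rewrite !in_itv/= -!ler_norml => h1 h2.
have N1 := ler_norm N.
by split; rewrite /= in_itv/= -ltr_norml; lra.
Qed.

Lemma test_lip f : test_function f -> exists M : R, 0 < M /\
  forall x y : Q, `|f x - f y| <= M * (`|x.1 - y.1| + `|x.2 - y.2|).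
Proof.
move=> tf; have [t1 t2] := test_D tf.
have [M1 [_ [M10 _ h1 _]]] := test_boundN t1; have [M2 [_ [M20 _ h2 _]]] := test_boundN t2.
have [/(_ 1%N)[_ [f1 f2 _ _]] _] := tf.
exists (M1 + M2); split; first by rewrite addr_gt0.
move=> [a b] [c d] /=.
have A : `|f (a, b) - f (c, b)| <= `|a - c| * M1.
  have := @mvt_err (fun s => f (s, b)) c (a - c) 0 M1.
  rewrite mulr0 subr0 [c + _]addrC subrK; apply.
    by move=> s; have := f1 (s, b); rewrite derivable_e1.
  by move=> t _; rewrite subr0; have := h1 (c + t, b); rewrite derive_e1.
have B : `|f (c, b) - f (c, d)| <= `|b - d| * M2.
  have := @mvt_err (fun s => f (c, s)) d (b - d) 0 M2.
  rewrite mulr0 subr0 [d + _]addrC subrK; apply.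
    by move=> s; have := f2 (c, s); rewrite derivable_e2.
  by move=> t _; rewrite subr0; have := h2 (c, d + t); rewrite derive_e2.
have := ler_normD (f (a, b) - f (c, b)) (f (c, b) - f (c, d)).
rewrite addrA subrK => C; apply: (le_trans C).
have := normr_ge0 (a - c); have := normr_ge0 (b - d); move: A B.
move: `|a - c| `|b - d| => s t *; nra.
Qed.

(** The two coordinates are moved one after the other; each move is a mean value estimate, the
    partial derivatives being Lipschitz. *)
Lemma test_taylor f : test_function f -> exists M : R, 0 < M /\
  forall (x : Q) (w : P), `|sh w f x - f x - (w.1 * 'D_(e1 R) f x + w.2 * 'D_(e2 R) f x)|
     <= M * (`|w.1| + `|w.2|) ^+ 2.
Proof.
move=> tf; have [t1 t2] := test_D tf.
have [M1 [M10 h1]] := test_lip t1; have [M2 [M20 h2]] := test_lip t2.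
have [/(_ 1%N)[_ [f1 f2 _ _]] _] := tf.
exists (M1 + M2); split; first by rewrite addr_gt0.
move=> [a b] [c d] /=; rewrite /sh /=.
set s := `|c|; set t := `|d|; have s0 := normr_ge0 c; have r0 := normr_ge0 d; rewrite -?/s -?/t in s0 r0.
have A : `|f (a + c, b + d) - f (a, b + d) - c * 'D_(e1 R) f (a, b)| <= s * (M1 * (s + t)).
  apply: (@mvt_err (fun y => f (y, b + d)) a c ('D_(e1 R) f (a, b)) (M1 * (s + t))).
    by move=> y; have := f1 (y, b + d); rewrite derivable_e1.
  move=> y ys; have := h1 (a + y, b + d) (a, b); rewrite derive_e1 /= => h.
  apply: (le_trans h); apply: ler_wpM2l; first exact: ltW.
  by rewrite addrAC subrr add0r addrAC subrr add0r lerD2r.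
have B : `|f (a, b + d) - f (a, b) - d * 'D_(e2 R) f (a, b)| <= t * (M2 * (s + t)).
  apply: (@mvt_err (fun y => f (a, y)) b d ('D_(e2 R) f (a, b)) (M2 * (s + t))).
    by move=> y; have := f2 (a, y); rewrite derivable_e2.
  move=> y ys; have := h2 (a, b + y) (a, b); rewrite derive_e2 /= => h.
  apply: (le_trans h); apply: ler_wpM2l; first exact: ltW.
  by rewrite subrr normr0 add0r addrAC subrr add0r (le_trans ys)// lerDr.
have E : f (a + c, b + d) - f (a, b) - (c * 'D_(e1 R) f (a, b) + d * 'D_(e2 R) f (a, b)) =
  (f (a + c, b + d) - f (a, b + d) - c * 'D_(e1 R) f (a, b)) +
  (f (a, b + d) - f (a, b) - d * 'D_(e2 R) f (a, b)) by ring.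
rewrite E; apply: (le_trans (ler_normD _ _)); apply: (le_trans (lerD A B)).
have p1 : 0 <= s * t by rewrite mulr_ge0.
have p2 : 0 <= M1 * (t * (s + t)) by rewrite !mulr_ge0 ?addr_ge0// ltW.
have p3 : 0 <= M2 * (s * (s + t)) by rewrite !mulr_ge0 ?addr_ge0// ltW.
by rewrite expr2; clear -p1 p2 p3 s0 r0 M10 M20; lra.
Qed.

End test_functions.

Section ip_right.
Context d (T : measurableType d) (R : realType) (mu : {measure set T -> \bar R}).
Implicit Types f g h : T -> R.

Lemma ipDr f g h : L2 mu f -> L2 mu g -> L2 mu h ->
  ip mu h (fun x => f x + g x) = ip mu h f + ip mu h g.
Proof. by move=> fL gL hL; rewrite ipC ipDl// (ipC mu f) (ipC mu g). Qed.

Lemma ipZr k f h : L2 mu f -> L2 mu h -> ip mu h (fun x => k * f x) = k * ip mu h f.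
Proof. by move=> fL hL; rewrite ipC ipZl// (ipC mu f). Qed.

Lemma ipBr f g h : L2 mu f -> L2 mu g -> L2 mu h ->
  ip mu h (fun x => f x - g x) = ip mu h f - ip mu h g.
Proof. by move=> fL gL hL; rewrite ipC ipBl// (ipC mu f) (ipC mu g). Qed.

End ip_right.

(** * Riesz representation over test functions and weak gradients *)

Section riesz.
Context {R : realType}.
Local Notation P := (mplane R).
Local Notation Q := (plane R).
Local Notation mu := (leb2 R).
Local Notation nrm2 := (nrm2 mu).
Local Notation ip := (ip mu).
Local Notation L2 := (L2 mu).

Lemma nrm2_cvg (f_ : nat -> P -> R) f : (forall n, L2 (f_ n)) -> L2 f ->
  (fun n => nrm2 (fun x => f_ n x - f x)) @ \oo --> 0 ->
  (fun n => nrm2 (f_ n)) @ \oo --> nrm2 f.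
Proof.
move=> fL_ fL h; have := nrm2_cvg0_ip fL_ fL fL h; rewrite ipff => h2.
have -> : (fun n => nrm2 (f_ n)) =
    (fun n => nrm2 (fun x => f_ n x - f x) + 2 * ip (f_ n) f - nrm2 f).
  by apply/funext => n; rewrite nrm2B//; ring.
rewrite [X in _ --> X](_ : _ = 0 + 2 * nrm2 f - nrm2 f); last by ring.
by apply: cvgB; [apply: cvgD => //; apply: cvgMr|exact: cvg_cst].
Qed.

(* Minimizing |phi|^2 - 2 ell(phi) over test functions. *)
Lemma riesz_test (ell : (Q -> R) -> R) (K : R) : 0 <= K ->
  (forall phi psi c, test_function phi -> test_function psi ->
     ell (fun x => phi x + c * psi x) = ell phi + c * ell psi) ->
  (forall phi, test_function phi -> ell phi ^+ 2 <= K * nrm2 phi) ->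
  exists g (psi : nat -> Q -> R), [/\ L2 g, forall n, test_function (psi n),
    (fun n => nrm2 (fun x => psi n x - g x)) @ \oo --> 0,
    forall phi, test_function phi -> ell phi = ip g phi & nrm2 g <= K].
Proof.
move=> K0 lin bd.
pose J phi := nrm2 phi - 2 * ell phi.
have Jlow phi : test_function phi -> - K <= J phi.
  move=> tp; have h := bd _ tp; rewrite /J; have n0 := nrm2_ge0 mu phi.
  have [//|l0] := leP (ell phi) 0; first by move: h n0; move: (nrm2 phi) => N; lra.
  have h2 : ell phi ^+ 2 <= ((K + nrm2 phi) / 2) ^+ 2.
    by apply: (le_trans h); have := sqr_ge0 (K - nrm2 phi); move: (nrm2 phi) => N; nra.
  have : ell phi <= (K + nrm2 phi) / 2.
    by rewrite -ler_sqr ?nnegrE ?(ltW l0)// divr_ge0// addr_ge0.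
  by move: (nrm2 phi) => N; lra.
pose A : set R := [set J phi | phi in [set phi | test_function phi]].
have A0 : has_inf A.
  split; first by exists (J (fun=> 0)), (fun=> 0) => //; exact: test0.
  by exists (- K) => _ [phi tp <-]; exact: Jlow.
have mJ phi : test_function phi -> inf A <= J phi.
  by move=> tp; apply: ge_inf; [case: A0|exists phi].
have /choice[psi hpsi] : forall n : nat, exists phi, test_function phi /\
    J phi < inf A + harmonic n.
  move=> n; have [||_ [phi tp <-] h] := @inf_adherent _ A (harmonic n).
  - by rewrite /= invr_gt0.
  - exact: A0.
  - by exists phi.
have tpsi n : test_function (psi n) by case: (hpsi n).
have Lpsi n : L2 (psi n) by exact: test_L2.
(* Parallelogram identity: the midpoint of two almost minimizers is a competitor, so the minimizing
   sequence is Cauchy. *)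
have par n m : nrm2 (fun x => psi n x - psi m x) <= 2 * harmonic n + 2 * harmonic m.
  have tm : test_function (fun x => psi n x + 1 * psi m x) by exact: test_lin.
  have th : test_function (fun x => 0 + 2^-1 * (psi n x + 1 * psi m x)).
    by apply: test_lin => //; exact: test0.
  have h := mJ _ th; have [_ hn] := hpsi n; have [_ hm] := hpsi m.
  have e0 : ell (fun=> 0) = 0.
    have := lin (fun=> 0) (fun=> 0) 1 test0 test0.
    rewrite (_ : (fun x => 0 + 1 * 0) = (fun=> 0)); first by lra.
    by apply/funext => x; rewrite mulr0 addr0.
  have E1 : ell (fun x => 0 + 2^-1 * (psi n x + 1 * psi m x)) = 2^-1 * (ell (psi n) + ell (psi m)).
    by rewrite lin//; [rewrite e0 lin// mul1r add0r|exact: test0].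
  have E2 : nrm2 (fun x => 0 + 2^-1 * (psi n x + 1 * psi m x)) =
      4^-1 * (nrm2 (psi n) + 2 * ip (psi n) (psi m) + nrm2 (psi m)).
    rewrite -nrm2D// (_ : 4^-1 = 2^-1 ^+ 2); last by field.
    rewrite -nrm2Z; last exact: L2D.
    by congr nrm2; apply/funext => x; rewrite add0r mul1r.
  rewrite nrm2B//; move: h hn hm; rewrite /J E1 E2.
  move: (nrm2 _) (nrm2 _) (ip _ _) (ell _) (ell _) (inf A) => a b c d e f.
  by move: (harmonic n) (harmonic m) => u v; lra.
have [g [gL gcv]] : exists g, L2 g /\ (fun n => nrm2 (fun x => psi n x - g x)) @ \oo --> 0.
  apply: L2_complete => // e e0.
  have /cvg_seqP/(_ (e / 4)) := @cvg_harmonic R.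
  case; first by rewrite divr_gt0.
  move=> N hN; exists N => n m /hN hn /hN hm.
  apply: (le_trans (par n m)); move: hn hm; rewrite !subr0.
  have := ler_norm (@harmonic R n); have := ler_norm (@harmonic R m); lra.
have repr phi : test_function phi -> ell phi = ip g phi.
  move=> tp; have pL := test_L2 tp; apply/esym/eqP; rewrite -subr_eq0; apply/eqP.
  set d := _ - _; pose N := nrm2 phi; have N0 : 0 <= N by exact: nrm2_ge0.
  have H s : 0 <= 2 * s * d + s ^+ 2 * N.
    have c1 : (fun n => 2 * s * (ip (psi n) phi - ell phi) + s ^+ 2 * N + harmonic n) @ \oo
        --> 2 * s * d + s ^+ 2 * N + 0.
      apply: cvgD; last exact: cvg_harmonic.
      apply: cvgD; last exact: cvg_cst.
      apply: cvgMr; apply: cvgB; last exact: cvg_cst.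
      exact: nrm2_cvg0_ip.
    rewrite -[X in _ <= X]addr0; apply: (cvg_ge c1) => n.
    have t1 : test_function (fun x => psi n x + s * phi x) by exact: test_lin.
    have := mJ _ t1; rewrite /J lin// nrm2_lin//.
    have [_] := hpsi n; rewrite /J -/N.
    move: (nrm2 _) (ip _ _) (ell _) (ell _) (inf A) (harmonic n) => a b c e f u.
    by lra.
  (* The vertex of the parabola, with N + 1 in place of N to avoid dividing by zero. *)
  have := H (- d / (N + 1)).
  have -> : 2 * (- d / (N + 1)) * d + (- d / (N + 1)) ^+ 2 * N =
      - (d ^+ 2 * (N + 2) / (N + 1) ^+ 2).
    by field; rewrite gt_eqF// ltr_wpDl.
  rewrite oppr_ge0 pmulr_lle0 ?invr_gt0 ?exprn_gt0 ?ltr_wpDl//.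
  rewrite pmulr_lle0 ?ltr_wpDl// => dd.
  by apply/eqP; rewrite -sqrf_eq0 eq_le dd sqr_ge0.
exists g, psi; split => //.
have c1 := nrm2_cvg0_ip Lpsi gL gL gcv; rewrite ipff in c1.
have c2 := nrm2_cvg Lpsi gL gcv.
have c3 : (fun n => K * nrm2 (psi n) - ip (psi n) g ^+ 2) @ \oo --> K * nrm2 g - nrm2 g ^+ 2.
  by rewrite expr2; apply: cvgB; [apply: cvgMr|rewrite (_ : (fun n => _) = (fun n => ip (psi n) g * ip (psi n) g)); [apply: cvgM|apply/funext => n; rewrite expr2]].
have : 0 <= K * nrm2 g - nrm2 g ^+ 2.
  by apply: (cvg_ge c3) => n; rewrite subr_ge0 ipC -repr//; exact: bd.
have := nrm2_ge0 mu g; rewrite le_eqVlt => /predU1P[<-//|g0].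
by rewrite expr2 -mulrBl pmulr_lge0// subr_ge0.
Qed.

(** The Riesz representative of phi |-> (h, phi) has squared norm at most K, and it is h by the
    fundamental lemma. *)
Lemma test_dual_bound h (K : R) : L2 h -> 0 <= K ->
  (forall phi, test_function phi -> ip h phi ^+ 2 <= K * nrm2 phi) -> nrm2 h <= K.
Proof.
move=> hL K0 bd.
have lin phi psi c : test_function phi -> test_function psi ->
    ip h (fun x => phi x + c * psi x) = ip h phi + c * ip h psi.
  move=> tp tq; have pL := test_L2 tp; have qL := test_L2 tq.
  rewrite ipC ipDl ?ipZl//; last exact: L2Z.
  by rewrite (ipC mu phi) (ipC mu psi).
have [g [psi [gL _ _ hg gK]]] := riesz_test K0 lin bd.
have E : {ae mu, forall x, h x - g x = 0}.
  apply: fundamental_lemma; first exact: L2B.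
  move=> phi tp; rewrite -[LHS]/(ip _ _) ipBl//; first by rewrite hg// subrr.
  exact: test_L2.
rewrite (ae_nrm2 hL.1 gL.1)//.
by apply: filterS E => x /eqP; rewrite subr_eq0 => /eqP.
Qed.

Definition wgrad (f g1 g2 : P -> R) := [/\ L2 f, L2 g1, L2 g2 &
  forall phi, test_function phi -> ip f ('D_(e1 R) phi) = - ip g1 phi /\
    ip f ('D_(e2 R) phi) = - ip g2 phi].

Lemma L2_sh w f : L2 f -> L2 (sh w f).
Proof. by move=> fL; exact: (minv_L2 (minv_sh w) fL). Qed.

Lemma nrm2_sh w f : mf f -> nrm2 (sh w f) = nrm2 f.
Proof. exact: (minv_nrm2 (minv_sh w)). Qed.

Lemma ip_sh w f h : mf f -> mf h -> ip (sh w f) h = ip f (sh (- w.1, - w.2) h).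
Proof.
move=> mf1 mh.
have m2 : mf (sh (- w.1, - w.2) h).
  by apply: measurableT_comp => //; case: (minv_sh (- w.1, - w.2)).
have E := minv_II (minv_sh w) (measurable_funM mf1 m2).
rewrite -[LHS]/(II mu _) -[RHS]E; congr II; apply/funext => x; rewrite /sh /=.
by congr (_ * h _); case: x => a b /=; rewrite !addrK.
Qed.

Lemma wgrad_sh w f g1 g2 : wgrad f g1 g2 -> wgrad (sh w f) (sh w g1) (sh w g2).
Proof.
move=> [fL gL1 gL2 H]; split; try exact: L2_sh.
move=> phi tp; have [t1 t2] := test_D tp; have [C _] := tp.
have [d1 d2] := derive_sh (- w.1, - w.2) C.
have [h1 h2] := H _ (test_sh (- w.1, - w.2) tp).
have pm := (test_L2 tp).1; have m1 := (test_L2 t1).1; have m2 := (test_L2 t2).1.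
rewrite (ip_sh w fL.1 m1) (ip_sh w fL.1 m2) (ip_sh w gL1.1 pm) (ip_sh w gL2.1 pm).
by rewrite -h1 -h2 d1 d2.
Qed.

(** The increment is carried by phi, where Taylor's formula applies. The constant depends on phi
    only, so that the estimate can be used with the same C for all translates of f. *)
Lemma wgrad_increment phi : test_function phi -> exists C : R, 0 <= C /\
  forall f g1 g2 (w : P), wgrad f g1 g2 -> `|w.1| + `|w.2| <= 1 ->
  `|ip f (fun x => sh w phi x - phi x) + ip (fun x => w.1 * g1 x + w.2 * g2 x) phi|
    <= Num.sqrt (nrm2 f) * (C * (`|w.1| + `|w.2|) ^+ 2).
Proof.
move=> tp; have [M [M0 hM]] := test_taylor tp.
have [_ [N [_ N0 _ hN]]] := test_boundN tp; have [t1 t2] := test_D tp.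
have [s1 s2] := derive_support hN.
(* Since |w| <= 1, this box contains the supports of phi, of its derivatives and of its translate,
   hence that of the Taylor error. *)
pose B : P -> R := \1_(rect (- (N + 2)) (N + 2) (- (N + 2)) (N + 2)).
have BL : L2 B by exact: L2_indic (measurable_rect _ _ _ _) (leb2_rect _ _ _ _).
exists (M * Num.sqrt (nrm2 B)); split; first by rewrite mulr_ge0// ltW.
move=> f g1 g2 w [fL gL1 gL2 H] w1.
pose d1 : P -> R := 'D_(e1 R) phi; pose d2 : P -> R := 'D_(e2 R) phi.
pose err x := sh w phi x - phi x - (w.1 * d1 x + w.2 * d2 x).
have pL := test_L2 tp; have L1 : L2 d1 := test_L2 t1; have L2' : L2 d2 := test_L2 t2.
have wL := L2_sh w pL.
have dL : L2 (fun x => w.1 * d1 x + w.2 * d2 x).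
  exact: (L2D (L2Z w.1 L1) (L2Z w.2 L2')).
have eL : L2 err by exact: (L2B (L2B wL pL) dL).
have -> : ip f (fun x => sh w phi x - phi x) + ip (fun x => w.1 * g1 x + w.2 * g2 x) phi = ip f err.
  have [h1 h2] := H _ tp; rewrite -/d1 in h1; rewrite -/d2 in h2.
  rewrite (ipBr (L2B wL pL) dL fL) (ipDr (L2Z w.1 L1) (L2Z w.2 L2') fL).
  rewrite (ipZr w.1 L1 fL) (ipZr w.2 L2' fL) h1 h2.
  rewrite (ipDl (L2Z w.1 gL1) (L2Z w.2 gL2) pL) (ipZl w.1 gL1 pL) (ipZl w.2 gL2 pL).
  by ring.
have Y0 : 0 <= M * Num.sqrt (nrm2 B) * (`|w.1| + `|w.2|) ^+ 2.
  apply: mulr_ge0; last exact: sqr_ge0.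
  by apply: mulr_ge0; [exact: ltW|exact: sqrtr_ge0].
apply: (norm_ip_le fL eL (sqrtr_ge0 _) Y0); first by rewrite sqr_sqrtr ?nrm2_ge0.
have eB x : `|err x| <= `|M * (`|w.1| + `|w.2|) ^+ 2 * B x|.
  rewrite /B indicE; have [xB|xB] := boolP (x \in _).
    rewrite mulr1; apply: (le_trans (hM x w)); exact: ler_norm.
  rewrite mulr0 normr0 normr_le0 /err; apply/eqP.
  have out (y : Q) : `|y.1| <= N + 1 /\ `|y.2| <= N + 1 -> x \in rect (- (N + 2)) (N + 2) (- (N + 2)) (N + 2) \/ y <> x.
    move=> [y1 y2]; have [<-|] := pselect (y = x); last by right.
    left; apply/mem_set; split; rewrite /= in_itv/= -ltr_norml; lra.
  have z (g : Q -> R) : (forall y, g y != 0 -> `|y.1| <= N /\ `|y.2| <= N) -> g x = 0.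
    move=> hg; apply: contrapT => /eqP/hg[a b].
    have [] := out x (conj _ _); [lra|lra| |by []].
    by move=> xr; rewrite xr in xB.
  rewrite /d1 /d2 (z _ hN) (z _ s1) (z _ s2) !mulr0 addr0 !subr0.
  apply: contrapT => /eqP/hN /= [a b].
  have a1 := ler_normB (x.1 + w.1) w.1; have a2 := ler_normB (x.2 + w.2) w.2.
  rewrite !addrK in a1 a2.
  have n1 := normr_ge0 w.1; have n2 := normr_ge0 w.2.
  have [] := out x (conj _ _); [lra|lra| |by []].
  by move=> xr; rewrite xr in xB.
have := II_le eL.2 (L2Z (M * (`|w.1| + `|w.2|) ^+ 2) BL).2 _.
rewrite -/(nrm2 err) -/(nrm2 (fun x => _)) nrm2Z// => h.
rewrite (_ : (_ * _) ^+ 2 = (M * (`|w.1| + `|w.2|) ^+ 2) ^+ 2 * nrm2 B).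
  apply: h => x; rewrite -(real_normK (num_real (err x))) -(real_normK (num_real (_ * B x))).
  by rewrite lerXn2r ?nnegrE.
by rewrite -[in RHS](sqr_sqrtr (nrm2_ge0 mu B)); ring.
Qed.

(** By duality with a test function. The segment from 0 to z is cut into N + 1 pieces; on each the
    increment is linear up to O(1/N^2), and the errors add up to O(1/N). *)
Lemma wgrad_translation f g1 g2 (z : P) : wgrad f g1 g2 ->
  nrm2 (fun x => sh z f x - f x) <= nrm2 (fun x => z.1 * g1 x + z.2 * g2 x).
Proof.
move=> G; have [fL gL1 gL2 _] := G.
have zL : L2 (fun x => z.1 * g1 x + z.2 * g2 x) by apply: L2D; exact: L2Z.
apply: test_dual_bound; [by apply: L2B => //; exact: L2_sh|exact: nrm2_ge0|].
move=> phi tp; have pL := test_L2 tp.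
have [C [C0 hC]] := wgrad_increment tp.
set a := Num.sqrt (nrm2 (fun x => z.1 * g1 x + z.2 * g2 x)).
set b := Num.sqrt (nrm2 phi).
suff : `|ip (fun x => sh z f x - f x) phi| <= a * b.
  move=> h; rewrite -(real_normK (num_real (ip _ _))).
  rewrite -(sqr_sqrtr (nrm2_ge0 mu (fun x => z.1 * g1 x + z.2 * g2 x))).
  rewrite -(sqr_sqrtr (nrm2_ge0 mu phi)) -exprMn -/a -/b.
  have ab : 0 <= a * b by apply: mulr_ge0; exact: sqrtr_ge0.
  by apply: lerXn2r => //; rewrite nnegrE.
pose Z := `|z.1| + `|z.2|; pose D := Num.sqrt (nrm2 f) * (C * Z ^+ 2).
have Z0 : 0 <= Z by rewrite addr_ge0.
have D0 : 0 <= D by apply: mulr_ge0; [exact: sqrtr_ge0|apply: mulr_ge0 => //; exact: sqr_ge0].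
have step N : Z <= N.+1%:R -> `|ip (fun x => sh z f x - f x) phi| <= a * b + D * harmonic N.
  move=> ZN; pose n : R := N.+1%:R; have n0 : 0 < n by rewrite ltr0n.
  (* The translations along the segment; the elementary step [w] has a minus sign because it is
     moved to the test function. *)
  pose s k : P := (k%:R / n * z.1, k%:R / n * z.2).
  pose w : P := (- (z.1 / n), - (z.2 / n)).
  have w1 : `|w.1| + `|w.2| = Z / n.
    by rewrite /w /= !normrN !normrM (gtr0_norm (_ : 0 < n^-1)) ?invr_gt0// -mulrDl.
  have inc k : `|ip (sh (s k.+1) f) phi - ip (sh (s k) f) phi| <= (a * b + D * harmonic N) / n.
    have [kL kL1 kL2 _] := wgrad_sh (s k) G.
    have -> : ip (sh (s k.+1) f) phi = ip (sh (s k) f) (sh w phi).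
      rewrite (ip_sh _ fL.1 pL.1) (ip_sh _ fL.1 (L2_sh w pL).1).
      congr ip; apply/funext => x; rewrite /sh /s /w /=.
      by congr phi; congr (_, _); rewrite -natr1; field; rewrite gt_eqF.
    have wL := L2_sh w pL.
    rewrite -[X in `|X|](_ : ip (sh (s k) f) (fun x => sh w phi x - phi x) = _); last first.
      by rewrite ipC ipBl// (ipC mu (sh w phi)) (ipC mu phi).
    have h := hC _ _ _ w (wgrad_sh (s k) G).
    rewrite w1 ler_pdivrMr// mul1r in h; have {}h := h ZN.
    have e2 : `|ip (fun x => w.1 * sh (s k) g1 x + w.2 * sh (s k) g2 x) phi| <= a / n * b.
      apply: norm_ip_le => //; rewrite ?divr_ge0 ?sqrtr_ge0// ?(ltW n0)//.
      - by apply: L2D; exact: L2Z.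
      - rewrite [X in nrm2 X](_ : _ = fun x => (- n^-1) * sh (s k) (fun x => z.1 * g1 x + z.2 * g2 x) x).
          rewrite nrm2Z; last exact: L2_sh.
          rewrite nrm2_sh; last by case: zL.
          by rewrite sqrrN expr_div_n sqr_sqrtr ?nrm2_ge0// mulrC exprVn.
        by apply/funext => x; rewrite /sh /w /=; ring.
      - by rewrite sqr_sqrtr ?nrm2_ge0.
    rewrite nrm2_sh in h; last by case: fL.
    have -> : (a * b + D * harmonic N) / n = a / n * b + D / n ^+ 2.
      by rewrite /= -/n; field; rewrite gt_eqF.
    have e3 : Num.sqrt (nrm2 f) * (C * (Z / n) ^+ 2) = D / n ^+ 2.
      by rewrite /D; field; rewrite gt_eqF.
    rewrite e3 in h.
    have := ler_normB (ip (sh (s k) f) (fun x => sh w phi x - phi x) + ip (fun x => w.1 * sh (s k) g1 x + w.2 * sh (s k) g2 x) phi)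
      (ip (fun x => w.1 * sh (s k) g1 x + w.2 * sh (s k) g2 x) phi).
    rewrite addrK => T; apply: (le_trans T); rewrite addrC; exact: lerD.
  have tel m : `|ip (sh (s m) f) phi - ip f phi| <= m%:R * ((a * b + D * harmonic N) / n).
    elim: m => [|m IH].
      have -> : sh (s 0%N) f = f.
        by apply/funext => -[x y]; rewrite /sh /s /= !mul0r !addr0.
      by rewrite subrr normr0 mul0r.
    have := ler_normD (ip (sh (s m.+1) f) phi - ip (sh (s m) f) phi) (ip (sh (s m) f) phi - ip f phi).
    rewrite addrA subrK => T; apply: (le_trans T).
    by rewrite -natr1 mulrDl mul1r addrC; apply: lerD.
  have := tel N.+1; rewrite -/n mulrC divfK ?gt_eqF//.
  have -> : s N.+1 = z by rewrite /s -/n divff ?gt_eqF// !mul1r; case: (z).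
  by rewrite ipBl//; exact: L2_sh.
have c1 : (fun N => a * b + D * harmonic N) @ \oo --> a * b + D * 0.
  by apply: cvgD; [exact: cvg_cst|apply: cvgMr; exact: cvg_harmonic].
rewrite mulr0 addr0 in c1.
apply: (cvg_ge (cvg_sub_seq (s := fun n => (n + Num.truncn Z)%N) _ c1)) => [n|n].
  exact: leq_addr.
apply: step; rewrite (le_trans (ltW (truncnS_gt Z)))// ler_nat ltnS leq_addl//.
Qed.

End riesz.

(** * The Dirichlet form through the heat semigroup *)

Section fubini_real.
Context d1 d2 (T1 : measurableType d1) (T2 : measurableType d2) (R : realType).
Context (m1 : {sigma_finite_measure set T1 -> \bar R}) (m2 : {sigma_finite_measure set T2 -> \bar R}).
Local Notation pm := (m1 \x m2)%E.
Implicit Type F : T1 * T2 -> R.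

Lemma prod_tonelli F : mf F -> (forall z, 0 <= F z) ->
  (\int[pm]_z (F z)%:E = \int[m1]_x \int[m2]_y (F (x, y))%:E)%E /\
  (\int[m1]_x \int[m2]_y (F (x, y))%:E = \int[m2]_y \int[m1]_x (F (x, y))%:E)%E.
Proof.
move=> mF F0; have mE : measurable_fun setT (EFin \o F) by exact/measurable_EFinP.
have E0 z : (0 <= (EFin \o F) z)%E by rewrite lee_fin.
by split; [exact: (@fubini_tonelli1 _ _ _ _ _ m1 m2 _ mE E0)|exact: (@fubini_tonelli _ _ _ _ _ m1 m2 _ mE E0)].
Qed.

Lemma section_int1 F : mf F -> (forall z, 0 <= F z) ->
  measurable_fun setT (fun x => \int[m2]_y (F (x, y))%:E)%E.
Proof.
move=> mF F0; apply: (@measurable_fun_fubini_tonelli_F _ _ _ _ _ m2 (EFin \o F)).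
  exact/measurable_EFinP.
by move=> z; rewrite lee_fin.
Qed.

Lemma section_int2 F : mf F -> (forall z, 0 <= F z) ->
  measurable_fun setT (fun y => \int[m1]_x (F (x, y))%:E)%E.
Proof.
move=> mF F0; apply: (@measurable_fun_fubini_tonelli_G _ _ _ _ _ m1 (EFin \o F)).
  exact/measurable_EFinP.
by move=> z; rewrite lee_fin.
Qed.

Lemma prod_ig F : mf F ->
  (\int[m1]_x \int[m2]_y `|F (x, y)|%:E < +oo)%E -> ig pm F.
Proof.
move=> mF h; apply/integrableP; split; first exact/measurable_EFinP.
have mN : mf (fun z => `|F z|) by exact: measurableT_comp.
by have [/= -> _] := prod_tonelli mN (fun z => normr_ge0 _).
Qed.

(** Sections are integrable only almost everywhere; on the exceptional null set [II] takes some
    default value, which the outer integral does not see. *)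
Lemma prod_fubini1 F : ig pm F -> ig m1 (fun x => II m2 (fun y => F (x, y))) /\
  II pm F = II m1 (fun x => II m2 (fun y => F (x, y))).
Proof.
move=> iF; have A := ae_integrable1 iF.
have m : mf (fun x => II m2 (fun y => F (x, y))).
  by apply: (measurableT_comp (f := fine) _ (measurable_fubini_F iF)).
have B : {ae m1, forall x, setT x -> fubini_F m2 (EFin \o F) x = (II m2 (fun y => F (x, y)))%:E}.
  by apply: filterS A => x ix _; exact: (EFin_II ix).
split.
  have /integrableP[mI h] := integrable_fubini_F iF.
  apply/integrableP; split; first exact/measurable_EFinP.
  rewrite (_ : (\int[m1]_x _)%E = (\int[m1]_x `|fubini_F m2 (EFin \o F) x|)%E)//.
  apply: ae_eq_integral => //; [|exact: measurableT_comp|].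
  - by apply: (measurableT_comp (f := abse)) => //; exact/measurable_EFinP.
  - by apply: filterS B => x e xT; rewrite e.
rewrite {1}/II /Rintegral -(integral12_prod_meas1 iF).
congr fine; apply: ae_eq_integral => //; first exact: measurable_fubini_F iF.
exact/measurable_EFinP.
Qed.

Lemma prod_fubini2 F : ig pm F -> ig m2 (fun y => II m1 (fun x => F (x, y))) /\
  II pm F = II m2 (fun y => II m1 (fun x => F (x, y))).
Proof.
move=> iF; have A := ae_integrable2 iF.
have m : mf (fun y => II m1 (fun x => F (x, y))).
  by apply: (measurableT_comp (f := fine) _ (measurable_fubini_G iF)).
have B : {ae m2, forall y, setT y -> fubini_G m1 (EFin \o F) y = (II m1 (fun x => F (x, y)))%:E}.
  by apply: filterS A => y iy _; exact: (EFin_II iy).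
split.
  have mF := ig_mf iF; have mN : mf (fun z => `|F z|) by exact: measurableT_comp.
  have N0 (z : T1 * T2) : 0 <= `|F z| by [].
  have [t1 t2] := prod_tonelli mN N0.
  have fin : (\int[m2]_y \int[m1]_x `|F (x, y)|%:E < +oo)%E.
    by rewrite -t2 -t1; exact: (ig_lty (ig_norm iF)).
  apply/integrableP; split; first exact/measurable_EFinP.
  apply: le_lt_trans fin; apply: ge0_le_integral => //.
  - by apply: (measurableT_comp (f := abse)) => //; exact/measurable_EFinP.
  - exact: (section_int2 mN N0).
  - move=> y _ /=; rewrite (_ : `|II m1 _| = `|fine (\int[m1]_x (F (x, y))%:E)|)//.
    have mFy : mf (fun x => F (x, y)) by exact: (measurableT_comp mF (pair2_measurable y)).
    apply: (le_trans _ (le_abse_integral m1 measurableT ((measurable_EFinP _ _).2 mFy))).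
    have fa (a : \bar R) : (`|fine a|%:E <= `|a|)%E.
      by case: a => [r| |] //=; rewrite normr0 leey.
    exact: fa.
rewrite {1}/II /Rintegral -(integral21_prod_meas1 iF).
congr fine; apply: ae_eq_integral => //; first exact: measurable_fubini_G iF.
exact/measurable_EFinP.
Qed.

End fubini_real.

(** * Integration by parts on the line *)

Section compact_support.
Context {R : realType}.
Local Notation leb := (@lebesgue_measure R).
Local Notation L := (measurableTypeR R).

Lemma supported_ig (f : R -> R) (N : R) : continuous f ->
  (forall x, f x != 0 -> `|x| <= N) -> ig leb f /\
  II leb f = \int[leb]_(x in `[- N, N]) f x.
Proof.
move=> cf sf.
have E : f = f \_ `[- N, N].
  apply/funext => x; rewrite patchE; case: ifPn => // xN.
  apply/eqP; apply: contraNT xN => /sf xN; rewrite inE/= in_itv/= -ler_norml//.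
split; last by rewrite {1}/II {1}E -Rintegral_mkcond.
rewrite /ig E -restrict_EFin.
have h : leb.-integrable `[- N, N] (EFin \o f).
  apply: continuous_compact_integrable; first exact: segment_compact.
  by apply: continuous_subspaceT => x; exact: cf.
have mD : measurable (`[- N, N]%classic : set L) by exact: measurable_itv.
by have [H _] := @integrable_mkcond _ L R leb _ (EFin \o f) mD; exact: H h.
Qed.

Lemma ibp_line (u u' w w' : R -> R) (N : R) : 0 < N ->
  (forall x : R, is_derive x (1 : R) u (u' x)) -> (forall x : R, is_derive x (1 : R) w (w' x)) ->
  continuous u' -> continuous w' ->
  (forall x, w x != 0 -> `|x| <= N) -> (forall x, w' x != 0 -> `|x| <= N) ->
  II leb (fun x => u x * w' x) = - II leb (fun x => u' x * w x).
Proof.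
move=> N0 Du Dw cu' cw' sw sw'.
have cu : continuous u by apply: derivable1_continuous => x; exact: ex_derive.
have cw : continuous w by apply: derivable1_continuous => x; exact: ex_derive.
(* The interval is enlarged by 1 so that w vanishes at its end points. *)
have N1 : - (N + 1) < N + 1 by lra.
have sw2 (v : R -> R) (w1 : R -> R) : (forall x, w1 x != 0 -> `|x| <= N) ->
    forall x, v x * w1 x != 0 -> `|x| <= N + 1.
  move=> h x; rewrite mulf_eq0 negb_or => /andP[_ /h xN]; lra.
have w0 x : `|x| = N + 1 -> w x = 0.
  by move=> xN; apply/eqP/negPn/negP => /sw; rewrite xN; lra.
have [_ ->] := @supported_ig (fun x => u x * w' x) (N + 1)
   (fun x => cvgM (cu x) (cw' x)) (sw2 u w' sw').
have [_ ->] := @supported_ig (fun x => u' x * w x) (N + 1)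
   (fun x => cvgM (cu' x) (cw x)) (sw2 u' w sw).
have LR (v : R -> R) (v' : R -> R) : (forall x : R, is_derive x (1 : R) v (v' x)) ->
    derivable_oo_LRcontinuous v (- (N + 1)) (N + 1).
  move=> Dv; have cv : continuous v by apply: derivable1_continuous => x; exact: ex_derive.
  split; first by move=> x _; exact: ex_derive.
  - by apply: cvg_at_right_filter; exact: cv.
  - by apply: cvg_at_left_filter; exact: cv.
rewrite (@Rintegration_by_parts R u w u' w' _ _ N1) //.
- rewrite !w0; [by rewrite !mulr0 subr0 sub0r| |].
  + by rewrite normrN ger0_norm//; lra.
  + by rewrite ger0_norm//; lra.
- by apply: continuous_subspaceT => x; exact: cu'.
- exact: LR Du.
- by move=> x _; rewrite derive1E; exact: derive_val.
- by apply: continuous_subspaceT => x; exact: cw'.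
- exact: LR Dw.
- by move=> x _; rewrite derive1E; exact: derive_val.
Qed.

End compact_support.

(** * The heat form of a function with a weak gradient *)

Section heat_form.
Context {R : realType}.
Local Notation P := (mplane R).
Local Notation mu := (leb2 R).
Local Notation muf := (@leb2f R).
Local Notation pm := (muf \x muf)%E.
Local Notation nrm2 := (nrm2 mu).
Local Notation ip := (ip mu).
Local Notation L2 := (L2 mu).

Lemma mfst (f : P -> R) : mf f -> measurable_fun setT (fun z : P * P => f z.1).
Proof. by move=> h; exact: (measurableT_comp h measurable_fst). Qed.

Lemma msnd (f : P -> R) : mf f -> measurable_fun setT (fun z : P * P => f z.2).
Proof. by move=> h; exact: (measurableT_comp h measurable_snd). Qed.

Lemma sect1 (F : P * P -> R) x : measurable_fun setT F -> mf (fun y : P => F (x, y)).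
Proof. by move=> h; exact: (measurableT_comp h (@pair1_measurable _ _ P P x)). Qed.

Lemma pm_tonelli (F : P * P -> R) : measurable_fun setT F -> (forall z, 0 <= F z) ->
  (\int[pm]_z (F z)%:E = \int[mu]_x \int[mu]_y (F (x, y))%:E)%E.
Proof. by move=> mF F0; have [-> _] := @prod_tonelli _ _ P P R muf muf F mF F0. Qed.

Lemma msection_int (F : P * P -> R) : measurable_fun setT F -> (forall z, 0 <= F z) ->
  measurable_fun setT (fun x => \int[mu]_y (F (x, y))%:E)%E.
Proof. by move=> mF F0; exact: (@section_int1 _ _ P P R muf F mF F0). Qed.

Lemma tonelliR (F : P * P -> R) : measurable_fun setT F -> (forall z, 0 <= F z) ->
  (\int[mu]_x \int[mu]_y (F (x, y))%:E = \int[mu]_y \int[mu]_x (F (x, y))%:E)%E.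
Proof. by move=> mF F0; have [_ h] := @prod_tonelli _ _ P P R muf muf F mF F0. Qed.

Lemma pm_ig (F : P * P -> R) : measurable_fun setT F ->
  (\int[mu]_x \int[mu]_y `|F (x, y)|%:E < +oo)%E -> ig pm F.
Proof. by move=> mF h; exact: (@prod_ig _ _ P P R muf muf F mF h). Qed.

Lemma pm_fubini (F : P * P -> R) : ig pm F ->
  II pm F = II mu (fun x => II mu (fun y => F (x, y))) /\
  II pm F = II mu (fun y => II mu (fun x => F (x, y))).
Proof.
move=> iF; have [_ h1] := @prod_fubini1 _ _ P P R muf muf F iF.
have [_ h2] := @prod_fubini2 _ _ P P R muf muf F iF; exact: (conj h1 h2).
Qed.

(** The form D_t with extended values, so that Tonelli's theorem applies without integrability; its
    real version is [dn]. *)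
Definition Dn (t : R) (f : P -> R) : \bar R :=
  (\int[mu]_x \int[mu]_y (kk t x y * (f x - f y) ^+ 2)%:E)%E.

Lemma mDn t (f : P -> R) : mf f -> measurable_fun setT (fun z : P * P => kk t z.1 z.2 * (f z.1 - f z.2) ^+ 2).
Proof.
move=> mf1; apply: measurable_funM; first exact: mkk.
by apply: measurable_funX; apply: measurable_funB; [exact: mfst|exact: msnd].
Qed.

Lemma Dn_integrand_ge0 t (f : P -> R) (z : P * P) : 0 <= kk t z.1 z.2 * (f z.1 - f z.2) ^+ 2.
Proof. by apply: mulr_ge0; [exact: kk_ge0|exact: sqr_ge0]. Qed.

Let o : P := (0, 0).

Lemma kk_shift t (x z : P) : kk t x (z.1 + x.1, z.2 + x.2) = kk t o z.
Proof. by rewrite /kk /g1 /= !addrK !subr0. Qed.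

(** Substitute y = x + z and exchange the integrals: D_t averages the squared norms of the
    increments of f. *)
Lemma Dn_sh t (f : P -> R) : mf f ->
  (Dn t f = \int[mu]_z \int[mu]_x (kk t o z * (sh z f x - f x) ^+ 2)%:E)%E.
Proof.
move=> mf1; transitivity (\int[mu]_x \int[mu]_z (kk t o z * (sh z f x - f x) ^+ 2)%:E)%E.
  apply: eq_integral => x _.
  have [_ h] := minv_sh x.
  rewrite -(h (fun y => (kk t x y * (f x - f y) ^+ 2)%:E)); last 2 first.
  - by apply/measurable_EFinP; exact: (sect1 x (mDn t mf1)).
  - by move=> y; rewrite lee_fin; exact: (Dn_integrand_ge0 t f (x, y)).
  apply: eq_integral => z _; rewrite kk_shift /sh -[(f x - _) ^+ 2]sqrrN opprB.
  by rewrite [x.1 + _]addrC [x.2 + _]addrC.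
apply: (tonelliR (F := fun w => kk t o w.2 * (sh w.2 f w.1 - f w.1) ^+ 2)).
  apply: measurable_funM; first exact: (msnd (mkk1 t o)).
  apply: measurable_funX; apply: measurable_funB; last exact: mfst.
  apply: measurableT_comp => //.
  apply/measurable_fun_pairP; split => /=; apply: measurable_funD.
  - exact: (measurableT_comp measurable_fst measurable_fst).
  - exact: (measurableT_comp measurable_fst measurable_snd).
  - exact: (measurableT_comp measurable_snd measurable_fst).
  - exact: (measurableT_comp measurable_snd measurable_snd).
by move=> w; apply: mulr_ge0; [exact: kk_ge0|exact: sqr_ge0].
Qed.

(** Increments are bounded by [wgrad_translation], and the second moment of the kernel in the
    direction of the gradient produces the factor 2 t. *)
Lemma Dn_wgrad t f g1 g2 : 0 < t -> wgrad f g1 g2 ->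
  (Dn t f <= (2 * t * (nrm2 g1 + nrm2 g2))%:E)%E.
Proof.
move=> t0 G; have [fL gL1 gL2 _] := G; rewrite Dn_sh; last by case: fL.
have mG : measurable_fun setT
    (fun w : P * P => kk t o w.2 * (w.2.1 * g1 w.1 + w.2.2 * g2 w.1) ^+ 2).
  apply: measurable_funM; first exact: (msnd (mkk1 t o)).
  apply: measurable_funX; apply: measurable_funD; apply: measurable_funM.
  - exact: (measurableT_comp measurable_fst measurable_snd).
  - exact: (mfst gL1.1).
  - exact: (measurableT_comp measurable_snd measurable_snd).
  - exact: (mfst gL2.1).
have G0 (w : P * P) : 0 <= kk t o w.2 * (w.2.1 * g1 w.1 + w.2.2 * g2 w.1) ^+ 2.
  by apply: mulr_ge0; [exact: kk_ge0|exact: sqr_ge0].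
apply: (@le_trans _ _ (\int[mu]_z \int[mu]_x (kk t o z * (z.1 * g1 x + z.2 * g2 x) ^+ 2)%:E)%E).
  apply: ge0_le_integral => //.
  - move=> z _; apply: integral_ge0 => x _; rewrite lee_fin.
    by apply: mulr_ge0; [exact: kk_ge0|exact: sqr_ge0].
  - have := @measurable_fun_fubini_tonelli_G _ _ P P R muf (EFin \o (fun w : P * P => kk t o w.2 * (sh w.2 f w.1 - f w.1) ^+ 2)).
    apply.
    + apply/measurable_EFinP; apply: measurable_funM; first exact: (msnd (mkk1 t o)).
      apply: measurable_funX; apply: measurable_funB; last exact: (mfst fL.1).
      apply: measurableT_comp; first by case: fL.
      apply/measurable_fun_pairP; split => /=; apply: measurable_funD.
      * exact: (measurableT_comp measurable_fst measurable_fst).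
      * exact: (measurableT_comp measurable_fst measurable_snd).
      * exact: (measurableT_comp measurable_snd measurable_fst).
      * exact: (measurableT_comp measurable_snd measurable_snd).
    + by move=> w; rewrite lee_fin; apply: mulr_ge0; [exact: kk_ge0|exact: sqr_ge0].
  - have := @measurable_fun_fubini_tonelli_G _ _ P P R muf (EFin \o (fun w : P * P => kk t o w.2 * (w.2.1 * g1 w.1 + w.2.2 * g2 w.1) ^+ 2)).
    by apply; [exact/measurable_EFinP|move=> w; rewrite lee_fin].
  - move=> z _; have zL : L2 (fun x => z.1 * g1 x + z.2 * g2 x).
      exact: (L2D (L2Z z.1 gL1) (L2Z z.2 gL2)).
    have sL : L2 (fun x => sh z f x - f x) by exact: (L2B (L2_sh z fL) fL).
    rewrite int_Zl; [|by apply: measurable_funX; case: sL|by move=> x; exact: sqr_ge0|exact: kk_ge0].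
    rewrite int_Zl; [|by apply: measurable_funX; case: zL|by move=> x; exact: sqr_ge0|exact: kk_ge0].
    rewrite (EFin_II sL.2) (EFin_II zL.2) -!EFinM lee_fin ler_wpM2l ?kk_ge0//.
    exact: (wgrad_translation z G).
rewrite -(tonelliR mG G0) /=.
rewrite (_ : (\int[mu]_x _)%E = (\int[mu]_x (2 * t * (g1 x ^+ 2 + g2 x ^+ 2))%:E)%E).
  have i12 := igD gL1.2 gL2.2.
  by rewrite (EFin_II (igZ (2 * t) i12)) IIZ// IID//; [case: gL1|case: gL2].
apply: eq_integral => x _ /=.
have E := kk_moment_lin o (g1 x) (g2 x) t0; have iE := kk_lin_ig o (g1 x) (g2 x) t0.
rewrite -E -(EFin_II iE); apply: eq_integral => z _; congr (_ * _)%:E.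
by rewrite /o /=; ring.
Qed.

End heat_form.

(** * The heat semigroup on L^2 *)

Section heat_operator.
Context {R : realType}.
Local Notation P := (mplane R).
Local Notation mu := (leb2 R).
Local Notation muf := (@leb2f R).
Local Notation pm := (muf \x muf)%E.
Local Notation nrm2 := (nrm2 mu).
Local Notation ip := (ip mu).
Local Notation L2 := (L2 mu).

(** The heat flow of f at time t, at the point x. *)
Definition TT (t : R) (f : P -> R) (x : P) : R := ip (kk t x) f.

Lemma TT_lin t (f h : P -> R) (c : R) x : 0 < t -> L2 f -> L2 h ->
  TT t (fun y => f y + c * h y) x = TT t f x + c * TT t h x.
Proof.
move=> t0 fL hL; rewrite /TT ipDr//; [|exact: L2Z|exact: L2_kk].
by rewrite ipZr//; exact: L2_kk.
Qed.

Lemma TT_sqr_le t (f : P -> R) x : 0 < t -> L2 f ->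
  TT t f x ^+ 2 <= (8 * pi * t)^-1 * nrm2 f.
Proof. by move=> t0 fL; rewrite -(nrm2_kk x t0); apply: cauchy_schwarz => //; exact: L2_kk. Qed.

Lemma mTT_ge0 t (f : P -> R) : mf f -> (forall x, 0 <= f x) -> mf (TT t f : P -> R).
Proof.
move=> mf1 f0; have h : measurable_fun setT (fun z : P * P => kk t z.1 z.2 * f z.2).
  by apply: measurable_funM; [exact: mkk|exact: msnd].
have := msection_int h (fun z => mulr_ge0 (kk_ge0 t z.1 z.2) (f0 z.2)).
by move=> H; apply: (measurableT_comp (f := fine) _ H).
Qed.

(** Tonelli's theorem gives measurability for nonnegative functions; f is half the difference of |f|
    + f and |f| - f. *)
Lemma mTT t (f : P -> R) : 0 < t -> L2 f -> mf (TT t f : P -> R).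
Proof.
move=> t0 fL; pose g x := `|f x| + 1 * f x; pose h x := `|f x| + (-1) * f x.
have fN := L2_norm fL.
have gL : L2 g := L2D fN (L2Z 1 fL); have hL : L2 h := L2D fN (L2Z (-1) fL).
have g0 x : 0 <= g x by rewrite /g mul1r -lerBlDr sub0r -normrN ler_norm.
have h0 x : 0 <= h x by rewrite /h mulN1r subr_ge0 ler_norm.
rewrite (_ : TT t f = fun x => 2^-1 * (TT t g x - TT t h x)).
  apply: measurable_funM => //; apply: measurable_funB; apply: mTT_ge0 => //.
  - by case: gL.
  - by case: hL.
by apply/funext => x; rewrite !TT_lin//; field.
Qed.

Lemma ig_kkM t x (f : P -> R) : 0 < t -> ig mu f -> ig mu (fun y => kk t x y * f y).
Proof.
move=> t0 fi; apply: (@ig_le _ _ _ _ _ (fun y => (4 * pi * t)^-1 * `|f y|)).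
- by have mf0 := ig_mf fi; apply: measurable_funM => //; exact: mkk1.
- by move=> y; rewrite normrM ger0_norm ?kk_ge0//; apply: ler_wpM2r => //; exact: kk_le.
- by apply: igZ; exact: ig_norm.
Qed.

(** The kernel is a probability density, so the difference of the two sides is a variance. *)
Lemma TT_jensen t (f : P -> R) x (a : R) : 0 < t -> L2 f ->
  (a - TT t f x) ^+ 2 <= II mu (fun y => kk t x y * (a - f y) ^+ 2).
Proof.
move=> t0 fL; have i0 := ig_kk x t0; have i1 := L2_mul (L2_kk x t0) fL.
have i2 := ig_kkM x t0 fL.2.
have E (b : R) : II mu (fun y => kk t x y * (b - f y) ^+ 2) =
    b ^+ 2 - 2 * b * TT t f x + II mu (fun y => kk t x y * f y ^+ 2).
  rewrite (_ : (fun y => _) = fun y => b ^+ 2 * kk t x y - 2 * b * (kk t x y * f y) + kk t x y * f y ^+ 2); last first.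
    by apply/funext => y; ring.
  rewrite IID//; last by apply: igB; exact: igZ.
  by rewrite IIB; [|exact: igZ|exact: igZ]; rewrite !IIZ// II_kk// mulr1.
have : 0 <= II mu (fun y => kk t x y * (TT t f x - f y) ^+ 2).
  by apply: II_ge0 => y; apply: mulr_ge0; [exact: kk_ge0|exact: sqr_ge0].
rewrite !E; lra.
Qed.

Definition dn (t : R) (f : P -> R) : R :=
  II pm (fun z : P * P => kk t z.1 z.2 * (f z.1 - f z.2) ^+ 2).

Lemma pm_ig_sqr1 t (f : P -> R) : 0 < t -> L2 f ->
  ig pm (fun z : P * P => kk t z.1 z.2 * f z.1 ^+ 2).
Proof.
move=> t0 fL; apply: pm_ig.
  by apply: measurable_funM; [exact: mkk|exact: (mfst (ig_mf fL.2))].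
rewrite (_ : (\int[mu]_x _)%E = \int[mu]_x (f x ^+ 2)%:E)%E; last first.
  apply: eq_integral => x _; rewrite -[RHS]mule1 -(int_kk x t0) -int_Zl//; [|exact: mkk1|exact: kk_ge0|exact: sqr_ge0].
  apply: eq_integral => y _; rewrite /= ger0_norm 1?mulrC//.
  by apply: mulr_ge0; [exact: sqr_ge0|exact: kk_ge0].
by apply: (ig_lty fL.2) => x; exact: sqr_ge0.
Qed.

Lemma pm_ig_swap (F : P * P -> R) : ig pm F -> ig pm (fun z => F (z.2, z.1)).
Proof.
move=> iF; have mF := ig_mf iF.
have ms : measurable_fun setT (fun z : P * P => F (z.2, z.1)).
  apply: measurableT_comp => //; apply/measurable_fun_pairP; split => /=.
  - exact: measurable_snd.
  - exact: measurable_fst.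
apply: pm_ig => //=.
have mN : measurable_fun setT (fun z : P * P => `|F z|) by exact: measurableT_comp.
rewrite -(tonelliR (F := fun z => `|F z|) mN (fun z => normr_ge0 _)).
rewrite -(pm_tonelli mN (fun z => normr_ge0 _)).
by apply: (ig_lty (ig_norm iF)).
Qed.

Lemma pm_ig_mul t (f h : P -> R) : 0 < t -> L2 f -> L2 h ->
  ig pm (fun z : P * P => kk t z.1 z.2 * (f z.1 * h z.2)).
Proof.
move=> t0 fL hL.
have i2 : ig pm (fun z : P * P => kk t z.1 z.2 * h z.2 ^+ 2).
  have := pm_ig_swap (pm_ig_sqr1 t0 hL).
  by congr ig; apply/funext => z /=; rewrite kkC.
apply: (@ig_le _ _ _ _ _ (fun z : P * P => kk t z.1 z.2 * f z.1 ^+ 2 + kk t z.1 z.2 * h z.2 ^+ 2)).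
- apply: measurable_funM; first exact: mkk.
  by apply: measurable_funM; [exact: mfst fL.1|exact: msnd hL.1].
- move=> z; rewrite normrM ger0_norm ?kk_ge0// -mulrDr ler_wpM2l ?kk_ge0//.
  rewrite normrM -[f z.1 ^+ 2]real_normK ?num_real// -[h z.2 ^+ 2]real_normK ?num_real//.
  have := sqr_ge0 (`|f z.1| - `|h z.2|); have := normr_ge0 (f z.1); have := normr_ge0 (h z.2).
  nra.
- by apply: igD => //; exact: pm_ig_sqr1.
Qed.

Lemma pm_II_mul t (f h : P -> R) : 0 < t -> L2 f -> L2 h ->
  II pm (fun z : P * P => kk t z.1 z.2 * (f z.1 * h z.2)) = ip f (TT t h) /\
  II pm (fun z : P * P => kk t z.1 z.2 * (f z.1 * h z.2)) = ip h (TT t f).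
Proof.
move=> t0 fL hL; have i := pm_ig_mul t0 fL hL.
have [-> E] := pm_fubini i; split.
  congr (II mu); apply/funext => x; rewrite /TT /ip -IIZ; last exact: (L2_mul (L2_kk x t0) hL).
  by congr (II mu); apply/funext => y /=; ring.
rewrite E.
congr (II mu); apply/funext => y; rewrite /TT /ip -IIZ; last exact: (L2_mul (L2_kk y t0) fL).
by congr (II mu); apply/funext => x /=; rewrite kkC; ring.
Qed.

Lemma ip_TT_sym t (f h : P -> R) : 0 < t -> L2 f -> L2 h -> ip f (TT t h) = ip h (TT t f).
Proof. by move=> t0 fL hL; have [<- <-] := pm_II_mul t0 fL hL. Qed.

Lemma pm_II_sqr1 t (f : P -> R) : 0 < t -> L2 f ->
  II pm (fun z : P * P => kk t z.1 z.2 * f z.1 ^+ 2) = nrm2 f /\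
  II pm (fun z : P * P => kk t z.1 z.2 * f z.2 ^+ 2) = nrm2 f.
Proof.
move=> t0 fL; have i := pm_ig_sqr1 t0 fL.
have i2 : ig pm (fun z : P * P => kk t z.1 z.2 * f z.2 ^+ 2).
  have := pm_ig_swap i; by congr ig; apply/funext => z /=; rewrite kkC.
split.
  have [-> _] := pm_fubini i; congr (II mu); apply/funext => x /=.
  rewrite -[RHS]mulr1 -(II_kk x t0) -IIZ; last exact: ig_kk.
  by congr (II mu); apply/funext => y; rewrite mulrC.
have [_ ->] := pm_fubini i2; congr (II mu); apply/funext => x /=.
rewrite -[RHS]mulr1 -(II_kk x t0) -IIZ; last exact: ig_kk.
by congr (II mu); apply/funext => y; rewrite mulrC kkC.
Qed.

Lemma ig_dn t (f : P -> R) : 0 < t -> L2 f ->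
  ig pm (fun z : P * P => kk t z.1 z.2 * (f z.1 - f z.2) ^+ 2).
Proof.
move=> t0 fL; have i := pm_ig_sqr1 t0 fL.
have i2 : ig pm (fun z : P * P => kk t z.1 z.2 * f z.2 ^+ 2).
  have := pm_ig_swap i; by congr ig; apply/funext => z /=; rewrite kkC.
rewrite (_ : (fun z => _) = fun z : P * P => (kk t z.1 z.2 * f z.1 ^+ 2 + kk t z.1 z.2 * f z.2 ^+ 2)
   - 2 * (kk t z.1 z.2 * (f z.1 * f z.2))); last by apply/funext => z; ring.
by apply: igB; [exact: igD|apply: igZ; exact: pm_ig_mul].
Qed.

(** Expanding the square: D_t(f) is twice the defect of the semigroup, which makes it a quadratic
    form computable by scalar products. *)
Lemma dnE t (f : P -> R) : 0 < t -> L2 f -> dn t f = 2 * (nrm2 f - ip f (TT t f)).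
Proof.
move=> t0 fL; have i := pm_ig_sqr1 t0 fL.
have i2 : ig pm (fun z : P * P => kk t z.1 z.2 * f z.2 ^+ 2).
  have := pm_ig_swap i; by congr ig; apply/funext => z /=; rewrite kkC.
rewrite /dn (_ : (fun z => _) = fun z : P * P => (kk t z.1 z.2 * f z.1 ^+ 2 + kk t z.1 z.2 * f z.2 ^+ 2)
   - 2 * (kk t z.1 z.2 * (f z.1 * f z.2))); last by apply/funext => z; ring.
rewrite IIB; [|exact: igD|by apply: igZ; exact: pm_ig_mul].
rewrite IID// IIZ; last exact: pm_ig_mul.
by have [-> ->] := pm_II_sqr1 t0 fL; have [-> _] := pm_II_mul t0 fL fL; ring.
Qed.

Lemma Dn_dn t (f : P -> R) : 0 < t -> L2 f -> (Dn t f = (dn t f)%:E)%E.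
Proof.
move=> t0 fL; rewrite -(EFin_II (ig_dn t0 fL)) (pm_tonelli (mDn t fL.1))//.
by move=> z; exact: Dn_integrand_ge0.
Qed.

Lemma dn_ge0 t (f : P -> R) : 0 <= dn t f.
Proof. by apply: II_ge0 => z; exact: Dn_integrand_ge0. Qed.

(** Integrate [TT_jensen] with a = f x. This is also how [TT t f] is seen to be square
    integrable. *)
Lemma nrm2_sub_TT t (f : P -> R) : 0 < t -> L2 f ->
  L2 (fun x => f x - TT t f x) /\ nrm2 (fun x => f x - TT t f x) <= dn t f.
Proof.
move=> t0 fL.
have mh : mf (fun x => f x - TT t f x).
  by apply: measurable_funB; [case: fL|exact: mTT].
have B : (\int[mu]_x ((f x - TT t f x) ^+ 2)%:E <= (dn t f)%:E)%E.
  rewrite -Dn_dn//; apply: ge0_le_integral => //.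
  - by move=> x _; rewrite lee_fin; exact: sqr_ge0.
  - by apply/measurable_EFinP; exact: measurable_funX.
  - exact: (msection_int (mDn t fL.1) (Dn_integrand_ge0 t f)).
  - move=> x _; have i : ig mu (fun y => kk t x y * (f x - f y) ^+ 2).
      rewrite (_ : (fun y => _) = fun y => f x ^+ 2 * kk t x y - 2 * f x * (kk t x y * f y) + kk t x y * f y ^+ 2); last first.
        by apply/funext => y; ring.
      apply: igD; last exact: (ig_kkM x t0 fL.2).
      by apply: igB; apply: igZ; [exact: ig_kk|exact: (L2_mul (L2_kk x t0) fL)].
    by rewrite (EFin_II i) lee_fin; exact: TT_jensen.
have hL : L2 (fun x => f x - TT t f x) by apply: L2P => //; apply: le_lt_trans B _; rewrite ltry.
by split=> //; rewrite -lee_fin -(EFin_II hL.2).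
Qed.

Lemma L2_TT t (f : P -> R) : 0 < t -> L2 f -> L2 (TT t f : P -> R).
Proof.
move=> t0 fL; have [h _] := nrm2_sub_TT t0 fL; have := L2B fL h.
by congr L2; apply/funext => x; ring.
Qed.

Lemma ip_TT_lin t (f h : P -> R) (c : R) : 0 < t -> L2 f -> L2 h ->
  ip (fun x => f x + c * h x) (TT t (fun x => f x + c * h x)) =
  ip f (TT t f) + 2 * c * ip f (TT t h) + c ^+ 2 * ip h (TT t h).
Proof.
move=> t0 fL hL; have FL := L2_TT t0 fL; have HL := L2_TT t0 hL.
have -> : TT t (fun x => f x + c * h x) = fun x => TT t f x + c * TT t h x.
  by apply/funext => x; rewrite TT_lin.
have cH := L2Z c HL; have cfh := L2D fL (L2Z c hL).
rewrite ipDr// ipZr// !ipDl//; try exact: L2Z.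
rewrite !ipZl// (ip_TT_sym t0 hL fL).
move: (ip f _) (ip f _) (ip h _) => x y z; ring.
Qed.

Lemma dn_lin t (f h : P -> R) (c : R) : 0 < t -> L2 f -> L2 h ->
  dn t (fun x => f x + c * h x) =
  dn t f + 4 * c * (ip f h - ip f (TT t h)) + c ^+ 2 * dn t h.
Proof.
move=> t0 fL hL; have L := L2D fL (L2Z c hL).
rewrite !dnE// ip_TT_lin// nrm2_lin//.
move: (nrm2 f) (nrm2 h) (ip f h) (ip f _) (ip f _) (ip h _) => a b d e x y; ring.
Qed.

(** Parallelogram identity, dropping D_t(f - h). *)
Lemma dnD_le t (f h : P -> R) : 0 < t -> L2 f -> L2 h ->
  dn t (fun x => f x + h x) <= 2 * dn t f + 2 * dn t h.
Proof.
move=> t0 fL hL.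
have E := dn_lin 1 t0 fL hL; have E' := dn_lin (-1) t0 fL hL.
have := dn_ge0 t (fun x => f x + (-1) * h x).
have -> : (fun x => f x + h x) = (fun x => f x + 1 * h x) by apply/funext => x; rewrite mul1r.
rewrite E E'; lra.
Qed.

End heat_operator.

Section sequences.
Context {R : realType}.
Implicit Types (u v : nat -> R) (a b c : R).

Lemma sqC c : (fun _ : nat => c) @ \oo --> c. Proof. exact: cvg_cst. Qed.
Lemma sqD u v a b : u @ \oo --> a -> v @ \oo --> b -> (fun n => u n + v n) @ \oo --> a + b.
Proof. by move=> ua vb; exact: cvgD. Qed.
Lemma sqN u a : u @ \oo --> a -> (fun n => - u n) @ \oo --> - a.
Proof. by move=> ua; exact: cvgN. Qed.
Lemma sqB u v a b : u @ \oo --> a -> v @ \oo --> b -> (fun n => u n - v n) @ \oo --> a - b.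
Proof. by move=> ua vb; exact: cvgB. Qed.
Lemma sqM u v a b : u @ \oo --> a -> v @ \oo --> b -> (fun n => u n * v n) @ \oo --> a * b.
Proof. by move=> ua vb; exact: cvgM. Qed.
Lemma sqZ c u a : u @ \oo --> a -> (fun n => c * u n) @ \oo --> c * a.
Proof. by move=> ua; exact: (sqM (@sqC c) ua). Qed.
Lemma sq_le u v a b : u @ \oo --> a -> v @ \oo --> b -> (forall n, u n <= v n) -> a <= b.
Proof.
move=> ua vb uv; rewrite -subr_ge0; apply: cvg_ge (sqB vb ua) _ => n.
by rewrite subr_ge0.
Qed.
End sequences.
Arguments sqC {R} c.
Arguments sqZ {R} c {u a}.

Section sqrt_heat.
Context {R : realType}.
Local Notation P := (mplane R).
Local Notation pm := (@leb2f R \x @leb2f R)%E.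

(** Distributing the weight as two square roots gives the Cauchy-Schwarz inequality for the measure
    k_t(x - y) dx dy. *)
Lemma sqrt_kk_L2 t (h : P * P -> R) : measurable_fun setT h ->
  ig pm (fun z : P * P => kk t z.1 z.2 * h z ^+ 2) ->
  L2 pm (fun z : P * P => Num.sqrt (kk t z.1 z.2) * h z) /\
  nrm2 pm (fun z : P * P => Num.sqrt (kk t z.1 z.2) * h z) = II pm (fun z : P * P => kk t z.1 z.2 * h z ^+ 2).
Proof.
move=> mh i; have e : (fun z : P * P => (Num.sqrt (kk t z.1 z.2) * h z) ^+ 2) = (fun z : P * P => kk t z.1 z.2 * h z ^+ 2).
  by apply/funext => z; rewrite exprMn sqr_sqrtr// kk_ge0.
split; last by rewrite /nrm2 e.
split; last by rewrite e.
apply: measurable_funM => //; apply: (measurableT_comp (f := @Num.sqrt R)); last exact: mkk.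
by apply: continuous_measurable_fun; exact: sqrt_continuous.
Qed.

End sqrt_heat.

(** * Recovering the weak gradient from the heat form *)

Section energy_limit.
Context {R : realType}.
Local Notation leb := (@lebesgue_measure R).
Local Notation P := (mplane R).
Local Notation Q := (plane R).
Local Notation L := (measurableTypeR R).
Local Notation mu := (leb2 R).
Local Notation muf := (@leb2f R).
Local Notation pm := (muf \x muf)%E.
Local Notation nrm2 := (nrm2 mu).
Local Notation ip := (ip mu).
Local Notation L2 := (L2 mu).

Lemma line_fubini1 (F : P -> R) : ig mu F ->
  ig leb (fun x => II leb (fun y => F (x, y))) /\
  II mu F = II leb (fun x => II leb (fun y => F (x, y))).
Proof. by move=> iF; exact: (@prod_fubini1 _ _ L L R leb leb F iF). Qed.

Lemma line_fubini2 (F : P -> R) : ig mu F ->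
  ig leb (fun y => II leb (fun x => F (x, y))) /\
  II mu F = II leb (fun y => II leb (fun x => F (x, y))).
Proof. by move=> iF; exact: (@prod_fubini2 _ _ L L R leb leb F iF). Qed.

Lemma g1_derive t (m x : R) : 0 < t ->
  is_derive x (1 : R) (g1 t m) (g1 t m x * (m - x) / (2 * t)).
Proof.
move=> t0; have h : is_derive x (1 : R) (fun x : R => - (x - m) ^+ 2 / (4 * t)) ((m - x) / (2 * t)).
  have h1 : is_derive x (1 : R) (fun x : R => x - m) 1.
    by have := is_deriveB (is_derive_id x (1 : R)) (is_derive_cst m x (1 : R)); rewrite subr0.
  have h2 := is_deriveZ (- (4 * t)^-1) (is_deriveX 2 h1).
  have e : (fun x : R => - (x - m) ^+ 2 / (4 * t)) = (- (4 * t)^-1) \*: (fun x => x - m) ^+ 2.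
    by apply/funext => y /=; rewrite /GRing.scale/= mulNr mulrC mulNr.
  rewrite e; apply: (is_derive_eq h2); rewrite /GRing.scale/= /GRing.scale/= expr1 mulr1.
  by field; rewrite gt_eqF.
have h3 : is_derive x (1 : R) (fun x : R => expR (- (x - m) ^+ 2 / (4 * t)))
    (expR (- (x - m) ^+ 2 / (4 * t)) * ((m - x) / (2 * t))) by exact: is_derive1_comp.
have h4 := is_deriveZ (Num.sqrt (4 * pi * t))^-1 h3.
by apply: (is_derive_eq h4); rewrite /GRing.scale/= /g1 !mulrA.
Qed.

Lemma g1_derive_cont t (m : R) : 0 < t -> continuous (fun x : R => g1 t m x * (m - x) / (2 * t)).
Proof.
move=> t0 x; have c : {for x, continuous (g1 t m)}.
  by apply: derivable1_continuous => y; have := g1_derive m y t0 => h; exact: ex_derive.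
apply: cvgM; last exact: cvg_cst.
by apply: cvgM => //; apply: cvgB; [exact: cvg_cst|exact: cvg_id].
Qed.

Lemma g1_scale_derive t (m c x : R) : 0 < t ->
  is_derive x (1 : R) (fun s => g1 t m s * c) (g1 t m x * (m - x) / (2 * t) * c).
Proof.
move=> t0; have h := is_deriveZ c (g1_derive m x t0).
have e : (fun s => g1 t m s * c) = c \*: g1 t m by apply/funext => s /=; rewrite mulrC.
by rewrite e; apply: (is_derive_eq h); rewrite /GRing.scale/= mulrC.
Qed.

Lemma kk_lin_M t (x : P) (psi : Q -> R) : 0 < t -> test_function psi ->
  ig mu (fun y => kk t x y * (x.1 - y.1) / (2 * t) * psi y) /\
  ig mu (fun y => kk t x y * (x.2 - y.2) / (2 * t) * psi y).
Proof.
move=> t0 tp; have [M [N [M0 N0 bM bN]]] := test_boundN tp.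
have [ko1 [ko2 _]] := kk_odd x t0; have pL := test_L2 tp.
have mpsi : mf (psi : P -> R) by case: pL.
have aux (f : P -> R) : ig mu f -> ig mu (fun y => f y / (2 * t) * psi y).
  move=> fi; have mff := ig_mf fi.
  apply: (ig_le _ _ (igZ (M / (2 * t)) (ig_norm fi))).
    by apply: measurable_funM => //; apply: measurable_funM.
  move=> y; rewrite !normrM normfV (ger0_norm (_ : 0 <= 2 * t)); last by rewrite mulr_ge0// ltW.
  rewrite mulrC -[M / _ * _]mulrA [_^-1 * _]mulrC; apply: ler_wpM2r; last exact: bM.
  by rewrite divr_ge0// mulr_ge0// ltW.
by split; [exact: aux ko1|exact: aux ko2].
Qed.

(** Integration by parts on horizontal lines, the y-derivative of the kernel being the kernel times
    (x - y) / (2 t). *)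
Lemma ip_kk_derive1 t (x : P) (psi : Q -> R) : 0 < t -> test_function psi ->
  ip (kk t x) ('D_(e1 R) psi) = - II mu (fun y => kk t x y * (x.1 - y.1) / (2 * t) * psi y).
Proof.
move=> t0 tp; have [td1 _] := test_D tp.
have [M [N [M0 N0 bM bN]]] := test_boundN tp; have [bD1 _] := derive_support bN.
have [j1 _] := kk_lin_M x t0 tp.
have i1 := L2_mul (L2_kk x t0) (test_L2 td1).
have [_ [dpsi1 _ _ _]] := tp.1 1%N.
have [_ E1] := line_fubini2 i1; have [j2 E2] := line_fubini2 j1.
rewrite /ip E1 E2 -mulN1r -IIZ//; congr (II leb); apply/funext => b; rewrite mulN1r.
have h := @ibp_line R (fun s => g1 t x.1 s * g1 t x.2 b) _ (fun s => psi (s, b)) (fun s => 'D_(e1 R) psi (s, b)) N N0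
  (fun s => g1_scale_derive x.1 (g1 t x.2 b) s t0).
apply: etrans (h _ _ _ _ _) _ => {h}.
- by move=> s; have := dpsi1 (s, b); rewrite derivable_e1 derive_e1/= => d; apply: DeriveDef => //; rewrite derive1E.
- by move=> s; apply: cvgM; [exact: g1_derive_cont|exact: cvg_cst].
- apply: derivable1_continuous => s; have [_ [dd _ _ _]] := td1.1 1%N.
  by have := dd (s, b); rewrite derivable_e1.
- by move=> s /bN [].
- by move=> s /bD1 [].
by congr (- II leb _); apply/funext => s; rewrite /kk /=; ring.
Qed.

Lemma ip_kk_derive2 t (x : P) (psi : Q -> R) : 0 < t -> test_function psi ->
  ip (kk t x) ('D_(e2 R) psi) = - II mu (fun y => kk t x y * (x.2 - y.2) / (2 * t) * psi y).
Proof.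
move=> t0 tp; have [_ td2] := test_D tp.
have [M [N [M0 N0 bM bN]]] := test_boundN tp; have [_ bD2] := derive_support bN.
have [_ j1] := kk_lin_M x t0 tp.
have i1 := L2_mul (L2_kk x t0) (test_L2 td2).
have [_ [_ dpsi2 _ _]] := tp.1 1%N.
have [_ E1] := line_fubini1 i1; have [j2 E2] := line_fubini1 j1.
rewrite /ip E1 E2 -mulN1r -IIZ//; congr (II leb); apply/funext => b; rewrite mulN1r.
have h := @ibp_line R (fun s => g1 t x.2 s * g1 t x.1 b) _ (fun s => psi (b, s)) (fun s => 'D_(e2 R) psi (b, s)) N N0
  (fun s => g1_scale_derive x.2 (g1 t x.1 b) s t0).
have e : (fun s => kk t x (b, s) * 'D_(e2 R) psi (b, s)) =
    fun s => g1 t x.2 s * g1 t x.1 b * 'D_(e2 R) psi (b, s).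
  by apply/funext => s; rewrite /kk /=; congr (_ * _); rewrite mulrC.
rewrite e; apply: etrans (h _ _ _ _ _) _ => {h}.
- by move=> s; have := dpsi2 (b, s); rewrite derivable_e2 derive_e2/= => d; apply: DeriveDef => //; rewrite derive1E.
- by move=> s; apply: cvgM; [exact: g1_derive_cont|exact: cvg_cst].
- apply: derivable1_continuous => s; have [_ [_ dd _ _]] := td2.1 1%N.
  by have := dd (b, s); rewrite derivable_e2.
- by move=> s /bN [].
- by move=> s /bD2 [].
by congr (- II leb _); apply/funext => s; rewrite /kk /=; ring.
Qed.

(** After integration by parts, 2 t times the pairing is the double integral of k_t(x - y) (psi(x) .
    (x - y)) f(y). Odd moments vanish, so f(y) may be replaced by f(y) - f(x); Cauchy-Schwarz with
    weight k_t then separates D_t(f) from the second moments, which contribute 2 t |psi|^2. *)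
Lemma weak_test_bound t (f : P -> R) (psi1 psi2 : Q -> R) : 0 < t -> L2 f ->
  test_function psi1 -> test_function psi2 ->
  (ip f (TT t ('D_(e1 R) psi1)) + ip f (TT t ('D_(e2 R) psi2))) ^+ 2 <=
  dn t f / (2 * t) * (nrm2 psi1 + nrm2 psi2).
Proof.
move=> t0 fL p1 p2; have L1 := test_L2 p1; have L2' := test_L2 p2.
pose k (z : P * P) := kk t z.1 z.2.
pose l (z : P * P) := psi1 z.1 * (z.1.1 - z.2.1) + psi2 z.1 * (z.1.2 - z.2.2).
have mk : measurable_fun setT k := mkk t.
have ml : measurable_fun setT l.
  apply: measurable_funD; apply: measurable_funM.
  - exact: mfst L1.1.
  - by apply: measurable_funB; [exact: (measurableT_comp measurable_fst measurable_fst)|exact: (measurableT_comp measurable_fst measurable_snd)].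
  - exact: mfst L2'.1.
  - by apply: measurable_funB; [exact: (measurableT_comp measurable_snd measurable_fst)|exact: (measurableT_comp measurable_snd measurable_snd)].
have il : ig pm (fun z => k z * l z ^+ 2).
  apply: pm_ig; first by apply: measurable_funM => //; exact: measurable_funX.
  rewrite (_ : (\int[mu]_x _)%E = (\int[mu]_x (2 * t * (psi1 x ^+ 2 + psi2 x ^+ 2))%:E)%E).
    by apply: ig_lty; [apply: igZ; apply: igD; [exact: L1.2|exact: L2'.2]|move=> x; apply: mulr_ge0; [rewrite mulr_ge0// ltW|apply: addr_ge0; exact: sqr_ge0]].
  apply: eq_integral => x _; rewrite -(kk_moment_lin x _ _ t0) -(EFin_II (kk_lin_ig x _ _ t0)).
  by apply: eq_integral => y _; rewrite ger0_norm//; apply: mulr_ge0; [exact: kk_ge0|exact: sqr_ge0].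
have nl : II pm (fun z => k z * l z ^+ 2) = 2 * t * (nrm2 psi1 + nrm2 psi2).
  have [-> _] := pm_fubini il.
  rewrite -IID; [|exact: L1.2|exact: L2'.2]; rewrite -IIZ; last by apply: igD; [exact: L1.2|exact: L2'.2].
  by congr (II mu); apply/funext => x; rewrite -(kk_moment_lin x _ _ t0).
have mf1 := mfst fL.1; have mf2 := msnd fL.1.
have [AL An] := sqrt_kk_L2 ml il.
have [BL Bn] := sqrt_kk_L2 (measurable_funB mf1 mf2) (ig_dn t0 fL).
have if1 := pm_ig_sqr1 t0 fL.
have if2 : ig pm (fun z : P * P => kk t z.1 z.2 * f z.2 ^+ 2).
  have := pm_ig_swap if1; by congr ig; apply/funext => z /=; rewrite kkC.
have [F1L _] := sqrt_kk_L2 mf1 if1; have [F2L _] := sqrt_kk_L2 mf2 if2.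
have CS : (II pm (fun z => Num.sqrt (kk t z.1 z.2) * l z * (Num.sqrt (kk t z.1 z.2) * (f z.1 - f z.2)))) ^+ 2 <=
    2 * t * (nrm2 psi1 + nrm2 psi2) * dn t f.
  by have := cauchy_schwarz AL BL; rewrite An Bn nl.
have sq (a b : P * P -> R) : (fun z => Num.sqrt (kk t z.1 z.2) * a z * (Num.sqrt (kk t z.1 z.2) * b z)) = fun z => k z * a z * b z.
  by apply/funext => z; rewrite mulrACA -expr2 sqr_sqrtr ?kk_ge0// !mulrA.
have j1 := L2_mul AL F1L; have j2 := L2_mul AL F2L; rewrite !sq in j1 j2.
have z1 : II pm (fun z => k z * l z * f z.1) = 0.
  have [-> _] := pm_fubini j1; rewrite -(II0 mu); congr (II mu); apply/funext => x.
  have [q1 [q2 [a1 a2]]] := kk_odd x t0.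
  rewrite (_ : (fun y => _) = fun y => f x * psi1 x * (kk t x y * (x.1 - y.1)) + f x * psi2 x * (kk t x y * (x.2 - y.2))); last first.
    by apply/funext => y; rewrite /k /l /=; ring.
  by rewrite IID; [|exact: igZ|exact: igZ]; rewrite !IIZ// a1 a2 !mulr0 addr0.
pose S := ip f (TT t ('D_(e1 R) psi1)) + ip f (TT t ('D_(e2 R) psi2)).
have [td1 _] := test_D p1; have [_ td2] := test_D p2.
have T1L := L2_TT t0 (test_L2 td1); have T2L := L2_TT t0 (test_L2 td2).
have Se : S = ip f (fun y => TT t ('D_(e1 R) psi1) y + TT t ('D_(e2 R) psi2) y).
  by rewrite (ipDr T1L T2L fL).
have z2 : II pm (fun z => k z * l z * f z.2) = 2 * t * S.
  have [_ ->] := pm_fubini j2; rewrite Se -(IIZ (2 * t) (L2_mul fL (L2D T1L T2L))).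
  congr (II mu); apply/funext => y.
  rewrite /TT (ip_kk_derive1 y t0 p1) (ip_kk_derive2 y t0 p2).
  have [m1 _] := kk_lin_M y t0 p1; have [_ m2] := kk_lin_M y t0 p2.
  rewrite (_ : (fun x => _) = fun x => (- (2 * t * f y)) * (kk t y x * (y.1 - x.1) / (2 * t) * psi1 x) + (- (2 * t * f y)) * (kk t y x * (y.2 - x.2) / (2 * t) * psi2 x)); last first.
    by apply/funext => x; rewrite /k /l /= kkC; field; rewrite gt_eqF.
  rewrite IID; [|exact: igZ|exact: igZ]; rewrite !IIZ//.
  by move: (II mu _) (II mu _) => a b; ring.
have E : II pm (fun z => Num.sqrt (kk t z.1 z.2) * l z * (Num.sqrt (kk t z.1 z.2) * (f z.1 - f z.2))) = - (2 * t * S).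
  rewrite sq (_ : (fun z => _) = fun z => k z * l z * f z.1 - k z * l z * f z.2).
    by rewrite IIB// z1 z2 sub0r.
  by apply/funext => z; rewrite mulrBr.
rewrite E sqrrN in CS.
move: CS; rewrite -/S; move: (dn t f) (nrm2 psi1 + nrm2 psi2) => d n CS.
have t2 : 0 < 2 * t by rewrite mulr_gt0.
rewrite mulrAC ler_pdivlMr// -(ler_pM2l t2) (_ : 2 * t * (S ^+ 2 * (2 * t)) = (2 * t * S) ^+ 2); last by ring.
by rewrite (_ : 2 * t * (d * n) = 2 * t * n * d)//; ring.
Qed.

Definition H1 (f : P -> R) := exists g1 g2, wgrad f g1 g2.

Lemma TT_cvg (f : P -> R) (t_ c : nat -> R) (l : R) : L2 f -> (forall n, 0 < t_ n) -> t_ @ \oo --> 0 ->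
  (forall n, dn (t_ n) f <= 2 * t_ n * c n) -> c @ \oo --> l ->
  (fun n => nrm2 (fun x => TT (t_ n) f x - f x)) @ \oo --> 0.
Proof.
move=> fL t0 tc dc cl; have h : (fun n => 2 * t_ n * c n) @ \oo --> 0.
  by have := sqM (sqZ 2 tc) cl; rewrite mulr0 mul0r.
apply: squeeze0 h => n; have [_ b] := nrm2_sub_TT (t0 n) fL.
have -> : nrm2 (fun x => TT (t_ n) f x - f x) = nrm2 (fun x => f x - TT (t_ n) f x).
  by congr (II mu); apply/funext => x; rewrite -sqrrN opprB.
by rewrite ger0_norm ?nrm2_ge0//; exact: le_trans b (dc n).
Qed.

Lemma weak_limit_bound (f : P -> R) (t_ c : nat -> R) (M : R) (psi1 psi2 : Q -> R) : L2 f ->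
  (forall n, 0 < t_ n) -> t_ @ \oo --> 0 -> (forall n, dn (t_ n) f <= 2 * t_ n * c n) ->
  c @ \oo --> M -> test_function psi1 -> test_function psi2 ->
  (ip f ('D_(e1 R) psi1) + ip f ('D_(e2 R) psi2)) ^+ 2 <= M * (nrm2 psi1 + nrm2 psi2).
Proof.
move=> fL t0 tc dc cM p1 p2; have [td1 _] := test_D p1; have [_ td2] := test_D p2.
have D1L := test_L2 td1; have D2L := test_L2 td2.
have TL n := L2_TT (t0 n) fL; have Tc := TT_cvg fL t0 tc dc cM.
have h1 := nrm2_cvg0_ip TL fL D1L Tc; have h2 := nrm2_cvg0_ip TL fL D2L Tc.
have h := sqM (sqD h1 h2) (sqD h1 h2).
have hM := sqM cM (sqC (nrm2 psi1 + nrm2 psi2)).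
rewrite expr2; apply: sq_le h hM _ => n; rewrite -expr2 !(ipC mu (TT (t_ n) f)).
rewrite (ip_TT_sym (t0 n) D1L fL) (ip_TT_sym (t0 n) D2L fL).
apply: (le_trans (weak_test_bound (t0 n) fL p1 p2)).
apply: ler_wpM2r; first by rewrite addr_ge0// nrm2_ge0.
by rewrite ler_pdivrMr ?mulr_gt0// mulrC.
Qed.

Lemma ip_derive_lin (f : P -> R) (v : Q) : L2 f ->
  (forall phi : Q -> R, test_function phi -> (forall x, derivable phi x v) /\ L2 ('D_v phi)) ->
  forall (phi psi : Q -> R) (k : R), test_function phi -> test_function psi ->
  - ip f ('D_v (fun x => phi x + k * psi x)) = - ip f ('D_v phi) + k * - ip f ('D_v psi).
Proof.
move=> fL H phi psi k tp tq; have [dp pL] := H _ tp; have [dq qL] := H _ tq.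
have E : 'D_v (fun x => phi x + k * psi x) = fun x => 'D_v phi x + k * 'D_v psi x.
  apply/funext => x; have D : is_derive x v (fun x => phi x + k * psi x) ('D_v phi x + k * 'D_v psi x).
    exact: (is_deriveD (derivableP (dp x)) (is_deriveZ k (derivableP (dq x)))).
  exact: derive_val.
rewrite E (ipDr pL (L2Z k qL) fL) (ipZr k qL fL).
by move: (ip _ _) (ip _ _) => u w; ring.
Qed.

(** The bound passes to the limit in t and the Riesz lemma represents each partial derivative. *)
Lemma wgrad_of_dn (f : P -> R) (t_ c : nat -> R) (M : R) : L2 f ->
  (forall n, 0 < t_ n) -> t_ @ \oo --> 0 -> (forall n, dn (t_ n) f <= 2 * t_ n * c n) ->
  c @ \oo --> M -> exists g1 g2, wgrad f g1 g2 /\ nrm2 g1 + nrm2 g2 <= M.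
Proof.
move=> fL t0 tc dc cM.
have bd := weak_limit_bound fL t0 tc dc cM.
have c0 n : 0 <= c n.
  have h := le_trans (dn_ge0 (t_ n) f) (dc n).
  by rewrite pmulr_rge0 ?mulr_gt0// in h.
have M0 : 0 <= M := cvg_ge cM c0.
have D0 (v : Q) : 'D_v (fun _ : Q => 0 : R) = (fun=> 0) by apply/funext => x; exact: derive_cst.
have n0 : nrm2 (fun=> 0) = 0 by rewrite -ipff -[RHS](II0 mu); congr (II mu); apply/funext => x; rewrite mulr0.
have i0 : ip f (fun=> 0) = 0 by rewrite -[RHS](II0 mu); congr (II mu); apply/funext => x; rewrite mulr0.
have [t1 t2] : (forall phi : Q -> R, test_function phi -> (forall x, derivable phi x (e1 R)) /\ L2 ('D_(e1 R) phi)) /\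
    (forall phi : Q -> R, test_function phi -> (forall x, derivable phi x (e2 R)) /\ L2 ('D_(e2 R) phi)).
  split=> phi tp; have [a1 a2] := test_D tp; have [_ [d1 d2' _ _]] := tp.1 1%N.
  - by split=> //; exact: test_L2 a1.
  - by split=> //; exact: test_L2 a2.
have [g1 [p1 [g1L tp1 p1c r1 _]]] := riesz_test M0 (ip_derive_lin fL t1) (fun phi tp =>
  ltac:(by have := bd phi _ tp test0; rewrite D0 i0 n0 !addr0 -sqrrN)).
have [g2 [p2 [g2L tp2 p2c r2 _]]] := riesz_test M0 (ip_derive_lin fL t2) (fun phi tp =>
  ltac:(by have := bd _ phi test0 tp; rewrite D0 i0 n0 !add0r -sqrrN)).
exists g1, g2; split.
  split=> // phi tp; split.
  - by rewrite -(r1 _ tp) opprK.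
  - by rewrite -(r2 _ tp) opprK.
have q1 n := test_L2 (tp1 n); have q2 n := test_L2 (tp2 n).
have h1 := nrm2_cvg0_ip q1 g1L g1L p1c; have h2 := nrm2_cvg0_ip q2 g2L g2L p2c.
have m1 := nrm2_cvg q1 g1L p1c; have m2 := nrm2_cvg q2 g2L p2c.
rewrite !ipff in h1 h2.
have h := sqM (sqD h1 h2) (sqD h1 h2).
have m := sqZ M (sqD m1 m2).
(* Testing with both components at once, along test functions tending to g1 and g2, gives the
   constant M for the whole gradient instead of M for each component. *)
have : (nrm2 g1 + nrm2 g2) * (nrm2 g1 + nrm2 g2) <= M * (nrm2 g1 + nrm2 g2).
  apply: sq_le h m _ => n; rewrite -expr2.
  have a1 : ip (p1 n) g1 = - ip f ('D_(e1 R) (p1 n)) by rewrite (r1 _ (tp1 n)); exact: ipC.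
  have a2 : ip (p2 n) g2 = - ip f ('D_(e2 R) (p2 n)) by rewrite (r2 _ (tp2 n)); exact: ipC.
  rewrite a1 a2 -opprD sqrrN.
  exact: (bd (p1 n) (p2 n) (tp1 n) (tp2 n)).
have : 0 <= nrm2 g1 + nrm2 g2 by rewrite addr_ge0// nrm2_ge0.
rewrite le_eqVlt => /orP[/eqP <-//|N0]; by rewrite ler_pM2r.
Qed.

Lemma wgrad_unique (f g1 g2 h1 h2 : P -> R) : wgrad f g1 g2 -> wgrad f h1 h2 ->
  {ae mu, forall x, g1 x = h1 x} /\ {ae mu, forall x, g2 x = h2 x}.
Proof.
move=> [fL g1L g2L G] [_ h1L h2L H].
have aux (a b : P -> R) : L2 a -> L2 b -> (forall phi, test_function phi -> ip a phi = ip b phi) ->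
    {ae mu, forall x, a x = b x}.
  move=> aL bL e; have := @fundamental_lemma R (fun x => a x - b x) (L2B aL bL).
  have z phi : test_function phi -> II mu (fun x => (a x - b x) * phi x) = 0.
    by move=> tp; have := ipBl aL bL (test_L2 tp); rewrite e// subrr.
  by move=> /(_ z); apply: filterS => x /eqP; rewrite subr_eq0 => /eqP.
split; apply: aux => // phi tp.
- by have [a _] := G _ tp; have [b _] := H _ tp; apply: oppr_inj; rewrite -a -b.
- by have [_ a] := G _ tp; have [_ b] := H _ tp; apply: oppr_inj; rewrite -a -b.
Qed.

Lemma wgrad_dn t f g1 g2 : 0 < t -> wgrad f g1 g2 -> dn t f <= 2 * t * (nrm2 g1 + nrm2 g2).
Proof.
move=> t0 G; have [fL _ _ _] := G; have := Dn_wgrad t0 G.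
by rewrite Dn_dn// lee_fin.
Qed.

(** [Dn_wgrad] bounds the quotients by N. If they stayed below N - e along a subsequence,
    [wgrad_of_dn] would yield a weak gradient of squared norm at most N - e, against uniqueness. *)
Lemma wgrad_dn_cvg (f g1 g2 : P -> R) (t_ : nat -> R) : wgrad f g1 g2 -> (forall n, 0 < t_ n) ->
  t_ @ \oo --> 0 -> (fun n => dn (t_ n) f / (2 * t_ n)) @ \oo --> nrm2 g1 + nrm2 g2.
Proof.
move=> G t0 tc; have [fL g1L g2L _] := G; set N := nrm2 g1 + nrm2 g2.
have tp n : 0 < 2 * t_ n by rewrite mulr_gt0.
have up n : dn (t_ n) f / (2 * t_ n) <= N.
  by rewrite ler_pdivrMr// mulrC; exact: wgrad_dn.
apply/cvg_seqP => e e0; apply: contrapT => K.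
have sub m : exists n, (m <= n)%N /\ dn (t_ n) f / (2 * t_ n) <= N - e.
  apply: contrapT => K2; apply: K; exists m => n mn.
  have := up n; have [lt _|le] := leP (dn (t_ n) f / (2 * t_ n)) (N - e).
    by exfalso; apply: K2; exists n.
  by rewrite ler_norml => u; apply/andP; split; lra.
have [s sP] := choice sub.
have sc := cvg_sub_seq (fun n => (sP n).1) tc.
have dc n : dn ((t_ \o s) n) f <= 2 * (t_ \o s) n * (N - e).
  by have [_] := sP n; rewrite ler_pdivrMr//= [_ * (N - e)]mulrC.
have [h1 [h2 [H Hb]]] := wgrad_of_dn fL (fun n => t0 (s n)) sc dc (sqC (N - e)).
have [_ h1L h2L _] := H; have [u1 u2] := wgrad_unique G H.
have E : N = nrm2 h1 + nrm2 h2.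
  by rewrite /N (ae_nrm2 g1L.1 h1L.1 u1) (ae_nrm2 g2L.1 h2L.1 u2).
by move: Hb; rewrite -E; lra.
Qed.

(** The Riesz representative of phi |-> (h, phi) is h, and it is built as a limit of test
    functions. *)
Lemma test_dense (h : P -> R) : L2 h -> exists psi : nat -> Q -> R,
  (forall n, test_function (psi n)) /\ (fun n => nrm2 (fun x => psi n x - h x)) @ \oo --> 0.
Proof.
move=> hL; have lin (phi psi : Q -> R) k : test_function phi -> test_function psi ->
    ip h (fun x => phi x + k * psi x) = ip h phi + k * ip h psi.
  move=> tp tq; have pL := test_L2 tp; have qL := test_L2 tq.
  by rewrite (ipDr pL (L2Z k qL) hL) ipZr.
have bd (phi : Q -> R) : test_function phi -> ip h phi ^+ 2 <= nrm2 h * nrm2 phi.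
  by move=> tp; apply: cauchy_schwarz => //; exact: test_L2.
have [g [psi [gL tp c r _]]] := riesz_test (nrm2_ge0 mu h) lin bd.
exists psi; split=> //.
have e : {ae mu, forall x, g x - h x = 0}.
  apply: (@fundamental_lemma R (fun x => g x - h x) (L2B gL hL)) => phi tp'.
  by have := ipBl gL hL (test_L2 tp'); rewrite -r// subrr.
rewrite (_ : (fun n => _) = (fun n => nrm2 (fun x => psi n x - g x)))//.
apply/funext => n; apply: ae_nrm2.
- by case: (L2B (test_L2 (tp n)) hL).
- by case: (L2B (test_L2 (tp n)) gL).
by apply: filterS e => x /eqP; rewrite subr_eq0 => /eqP ->.
Qed.

End energy_limit.

(** * The Green function *)

Section line_integrals.
Context {R : realType}.
Local Notation leb := (@lebesgue_measure R).
Local Notation L := (measurableTypeR R).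

Lemma line_continuous_mf (f : R -> R) : continuous f -> measurable_fun [set: L] f.
Proof. by move=> cf; exact: continuous_measurable_fun. Qed.

Lemma line_ftc (f F : R -> R) (l0 l1 : R) : (forall x : R, is_derive x (1 : R) F (f x)) ->
  continuous f -> (forall x, 0 <= f x) ->
  (fun n : nat => F n.+1%:R) @ \oo --> l1 -> (fun n : nat => F (- n.+1%:R)) @ \oo --> l0 ->
  (\int[leb]_x (f x)%:E = (l1 - l0)%:E)%E.
Proof.
move=> dF cf f0 F1 F0; pose I n := `[- n.+1%:R, n.+1%:R : R]%classic.
pose g n (x : L) : \bar R := (f x * \1_(I n) x)%:E.
have mI n : measurable (I n : set L) by exact: measurable_itv.
have mf' := line_continuous_mf cf.
have g0 n x : setT x -> (0 <= g n x)%E by rewrite lee_fin mulr_ge0.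
have mg n : measurable_fun setT (g n).
  by apply/measurable_EFinP; apply: measurable_funM => //; exact: measurable_indic.
have gm x : setT x -> {homo g ^~ x : n m / (n <= m)%N >-> (n <= m)%E}.
  move=> _ n m nm; rewrite lee_fin ler_wpM2l//.
  have nm' : n.+1%:R <= m.+1%:R :> R by rewrite ler_nat.
  rewrite !indicE; have [h|] := boolP (x \in I n); last by rewrite ler0n.
  rewrite (_ : x \in I m)//; move: h; rewrite !inE /I/= !in_itv/= => /andP[h1 h2].
  by apply/andP; split; lra.
have gc x : limn (g ^~ x) = (f x)%:E.
  apply: cvg_lim => //; apply/cvg_ballP => e e0.
  have [k kx] : exists k : nat, `|x| <= k.+1%:R.
    exists (Num.bound `|x|); apply: le_trans (ltW (archi_boundP (normr_ge0 x))) _.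
    by rewrite ler_nat.
  near=> n; have kn : (k <= n)%N by near: n; exists k.
  rewrite /g indicE (_ : x \in I n) ?mulr1; first exact: ballxx.
  rewrite inE /I/= in_itv/= -ler_norml (le_trans kx)// ler_nat//.
have := @cvg_monotone_convergence _ _ R leb _ measurableT g mg g0 gm.
rewrite (_ : (\int[leb]_x limn (g ^~ x))%E = (\int[leb]_x (f x)%:E)%E); last first.
  by apply: eq_integral => x _; exact: gc.
move=> h.
have e n : (\int[leb]_x g n x = (F n.+1%:R - F (- n.+1%:R))%:E)%E.
  have -> : (g n) = (EFin \o f) \_ (I n).
    by apply/funext => x; rewrite /g patchE indicE; case: ifPn => _ /=; rewrite ?mulr1 ?mulr0.
  rewrite -integral_mkcond EFinB; apply: continuous_FTC2.
  - by rewrite ltrNl (lt_trans _ (ltr0Sn _ n))// oppr_lt0.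
  - by apply: continuous_subspaceT => x; exact: cf.
  - have cF : continuous F by apply: derivable1_continuous => y; have := dF y => h'; exact: ex_derive.
    split; first by move=> x _; have := dF x => h'; exact: ex_derive.
    + by apply: cvg_at_right_filter; exact: cF.
    + by apply: cvg_at_left_filter; exact: cF.
  - by move=> x _; rewrite derive1E; have := dF x => h'; exact: derive_val.
rewrite (_ : (fun n => _) = (fun n => (F n.+1%:R - F (- n.+1%:R))%:E)) in h; last exact/funext.
have h2 := EFin_cvg (sqB F1 F0).
exact: (cvg_unique _ h h2).
Unshelve. all: by end_near. Qed.

Lemma line_ftc_ig (f F : R -> R) (l0 l1 : R) : (forall x : R, is_derive x (1 : R) F (f x)) ->
  continuous f -> (forall x, 0 <= f x) ->
  (fun n : nat => F n.+1%:R) @ \oo --> l1 -> (fun n : nat => F (- n.+1%:R)) @ \oo --> l0 ->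
  ig leb f /\ II leb f = l1 - l0.
Proof.
move=> dF cf f0 F1 F0; have h := line_ftc dF cf f0 F1 F0.
split; last by rewrite /II /Rintegral h.
by apply: ge0_ig; [exact: line_continuous_mf|exact: f0|rewrite h ltry].
Qed.

Lemma expR_ge_nat (n : nat) : n.+1%:R <= expR n.+1%:R :> R.
Proof. by apply: le_trans (expR_ge1Dx _); rewrite lerDr. Qed.

Lemma expRN_le_inv (x : R) : 0 < x -> expR (- x) <= x^-1.
Proof.
move=> x0; rewrite expRN lef_pV2 ?posrE ?expR_gt0//.
by apply: le_trans (expR_ge1Dx _); rewrite lerDr.
Qed.

Lemma harmonic_squeeze (u : nat -> R) (l C : R) :
  (forall n, `|u n - l| <= C * n.+1%:R^-1) -> u @ \oo --> l.
Proof.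
move=> h; have c : (fun n : nat => C * n.+1%:R^-1) @ \oo --> (0 : R).
  by have := sqZ C (@cvg_harmonic R); rewrite mulr0.
have := sqD (squeeze0 h c) (sqC l); rewrite add0r.
by under eq_fun do rewrite subrK.
Qed.

Lemma expR_is_derive (k x : R) : is_derive x (1 : R) (fun y => expR (k * y)) (k * expR (k * x)).
Proof.
have h : is_derive x (1 : R) (fun y : R => k * y) k.
  by have := is_deriveZ k (is_derive_id x (1 : R)) => h; apply: (is_derive_eq h); rewrite /GRing.scale/= mulr1.
have := @is_derive1_comp _ expR (fun y : R => k * y) x _ _ (is_derive_expR _) h.
by move=> d; apply: (is_derive_eq d); rewrite mulrC.
Qed.

Lemma int_exp_scale (c : R) : 0 < c ->
  (\int[leb]_w (expR w * expR (- c * expR w))%:E = (c^-1)%:E)%E.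
Proof.
move=> c0; have e1 (x : R) : is_derive x (1 : R) (fun y => - c^-1 * expR (- c * expR y)) (expR x * expR (- c * expR x)).
  have h := @is_derive1_comp _ (fun y => expR (- c * y)) expR x _ _ (expR_is_derive (- c) (expR x)) (is_derive_expR x).
  have := is_deriveZ (- c^-1) h => d; apply: (is_derive_eq d).
  by rewrite /GRing.scale/= ; field; rewrite gt_eqF.
have cont : continuous (fun x : R => expR x * expR (- c * expR x)).
  move=> x; apply: cvgM; first exact: continuous_expR.
  apply: (@continuous_comp _ _ _ expR (fun y => expR (- c * y))); first exact: continuous_expR.
  have := expR_is_derive (- c) (expR x) => d.
  by apply/differentiable_continuous/derivable1_diffP; exact: ex_derive.
have c1 : 0 < c^-1 by rewrite invr_gt0.
rewrite (line_ftc (l1 := 0) (l0 := - c^-1) e1 cont).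
- by rewrite sub0r opprK.
- by move=> x; rewrite mulr_ge0// expR_ge0.
- apply: (@harmonic_squeeze _ _ (c^-1 * c^-1)) => n.
  rewrite subr0 normrM normrN !ger0_norm ?expR_ge0 ?(ltW c1)// -mulrA.
  apply: ler_wpM2l; first exact: ltW.
  rewrite mulNr; apply: le_trans (expRN_le_inv _) _; first by rewrite mulr_gt0// expR_gt0.
  rewrite invfM; apply: ler_wpM2l; first exact: ltW.
  by rewrite lef_pV2 ?posrE ?expR_gt0//; exact: expR_ge_nat.
- apply: (@harmonic_squeeze _ _ 1) => n.
  set y := expR (- n.+1%:R).
  have y0 : 0 < y by exact: expR_gt0.
  have yn : y <= n.+1%:R^-1 by apply: expRN_le_inv.
  have cy : 0 < c * y by rewrite mulr_gt0.
  have y1 : expR (- (c * y)) <= 1 by rewrite -expR0 ler_expR oppr_le0 ltW.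
  have y2 := expR_ge1Dx (- (c * y)).
  rewrite mulNr mulNr opprK mul1r addrC -{1}[c^-1]mulr1 -mulrBr normrM !ger0_norm ?subr_ge0 ?(ltW c1)//.
  apply: le_trans yn; rewrite mulrC ler_pdivrMr// [y * c]mulrC; lra.
Qed.

(** The derivative, up to a factor, of a logistic function; it serves as the reference dominating
    function on the line. *)
Lemma ig_sech (k : R) : 0 < k -> ig leb (fun z => expR (k * z) / (1 + expR (k * z)) ^+ 2).
Proof.
move=> k0; pose F (z : R) := - k^-1 * (1 + expR (k * z))^-1.
have p1 (z : R) : 0 < 1 + expR (k * z) by rewrite addr_gt0// expR_gt0.
have d (z : R) : is_derive z (1 : R) F (expR (k * z) / (1 + expR (k * z)) ^+ 2).
  have h1 : is_derive z (1 : R) (fun y => 1 + expR (k * y)) (k * expR (k * z)).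
    have := is_deriveD (is_derive_cst (1 : R) z (1 : R)) (expR_is_derive k z).
    by rewrite add0r.
  have h2 := inv_derive (lt0r_neq0 (p1 z)).
  have := is_deriveZ (- k^-1) (@is_derive1_comp _ (fun y : R => y^-1) _ z _ _ h2 h1).
  move=> h; apply: (is_derive_eq h); rewrite /GRing.scale/=; field.
  by rewrite !gt_eqF.
have c : continuous (fun z => expR (k * z) / (1 + expR (k * z)) ^+ 2).
  have ce (z : R) : {for z, continuous (fun z => expR (k * z))}.
    by have := expR_is_derive k z => h; apply/differentiable_continuous/derivable1_diffP; exact: ex_derive.
  move=> z; apply: cvgM; first exact: ce.
  apply: cvgV; first by rewrite expf_neq0// gt_eqF.
  by apply: cvgM; apply: cvgD; [exact: cvg_cst|exact: ce|exact: cvg_cst|exact: ce].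
have k1 : 0 < k^-1 by rewrite invr_gt0.
apply: (line_ftc_ig (l1 := 0) (l0 := - k^-1) d c _ _ _).1.
- by move=> x; rewrite divr_ge0 ?expR_ge0// sqr_ge0.
- apply: (@harmonic_squeeze _ _ (k^-1 * k^-1)) => n.
  rewrite subr0 /F mulNr normrN ger0_norm; last by rewrite mulr_ge0 ?(ltW k1)// invr_ge0 ltW.
  rewrite -mulrA; apply: ler_wpM2l; first exact: ltW.
  rewrite -invfM lef_pV2 ?posrE ?mulr_gt0//.
  by have := expR_ge1Dx (k * n.+1%:R); lra.
- apply: (@harmonic_squeeze _ _ (k^-1 * k^-1)) => n; rewrite /F.
  set y := expR _; have y0 : 0 < y by exact: expR_gt0.
  have yn : y <= (k * n.+1%:R)^-1 by rewrite /y mulrN; apply: expRN_le_inv; rewrite mulr_gt0.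
  have -> : - k^-1 * (1 + y)^-1 - - k^-1 = k^-1 * (y / (1 + y)) by field; rewrite !gt_eqF// addr_gt0.
  have y1 : 0 < 1 + y by rewrite addr_gt0.
  rewrite ger0_norm; last by apply: mulr_ge0; [exact: ltW|rewrite divr_ge0 ?ltW].
  rewrite -mulrA; apply: ler_wpM2l; first exact: ltW.
  rewrite -invfM; apply: le_trans yn; rewrite ler_pdivrMr//; nra.
Qed.

Lemma ln_add_le (a y : R) : 0 < a -> 0 < y -> 0 <= ln (a + y) - ln a <= y / a.
Proof.
move=> a0 y0; have ay : 0 < a + y by rewrite addr_gt0.
rewrite -ln_div ?posrE// mulrDl divff ?gt_eqF//.
have ya : 0 < y / a by rewrite divr_gt0.
apply/andP; split; first by rewrite ln_ge0// lerDl ltW.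
by rewrite -ler_expR lnK ?posrE ?addr_gt0//; exact: expR_ge1Dx.
Qed.

(** With y = e^z this is the integral of 1/((a + y)(b + y)) over y > 0, done by partial
    fractions. *)
Lemma int_resolvents (a b : R) : 0 < a -> 0 < b ->
  ig leb (fun z => expR z / ((a + expR z) * (b + expR z))) /\
  II leb (fun z => expR z / ((a + expR z) * (b + expR z))) =
    if a == b then a^-1 else (ln a - ln b) / (a - b).
Proof.
move=> a0 b0.
have p (c z : R) : 0 < c -> 0 < c + expR z by move=> c0; rewrite addr_gt0// expR_gt0.
have h1 (c z : R) : is_derive z (1 : R) (fun y => c + expR y) (expR z).
  by have := is_deriveD (is_derive_cst c z (1 : R)) (is_derive_expR z); rewrite add0r.
have cc : continuous (fun z => expR z / ((a + expR z) * (b + expR z))).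
  have ce (c z : R) : {for z, continuous (fun z => c + expR z)}.
    by have := h1 c z => h; apply/differentiable_continuous/derivable1_diffP; exact: ex_derive.
  move=> z; apply: cvgM; first exact: continuous_expR.
  apply: cvgV; first by rewrite mulf_neq0// gt_eqF// p.
  by apply: cvgM; exact: ce.
have f0 (z : R) : 0 <= expR z / ((a + expR z) * (b + expR z)).
  by rewrite divr_ge0 ?expR_ge0// mulr_ge0// ltW// p.
have en (n : nat) : 0 < n.+1%:R :> R by [].
case: eqVneq => [ab|ab].
  pose F (z : R) := - (a + expR z)^-1.
  have d (z : R) : is_derive z (1 : R) F (expR z / ((a + expR z) * (b + expR z))).
    have h2 := inv_derive (lt0r_neq0 (p a z a0)).
    have := is_deriveN (@is_derive1_comp _ (fun y : R => y^-1) _ z _ _ h2 (h1 a z)).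
    by move=> h; apply: (is_derive_eq h); rewrite -ab; field; rewrite gt_eqF// p.
  have := @line_ftc_ig _ F (- a^-1) 0 d cc f0; rewrite sub0r opprK; apply.
  - apply: (@harmonic_squeeze _ _ 1) => n.
    rewrite subr0 /F normrN normfV ger0_norm ?(ltW (p _ _ a0))// mul1r lef_pV2 ?posrE ?p//.
    by apply: le_trans (expR_ge_nat n) _; rewrite lerDr ltW.
  - apply: (@harmonic_squeeze _ _ (a^-1 * a^-1)) => n; rewrite /F.
    set y := expR _; have y0 : 0 < y by exact: expR_gt0.
    have yn : y <= n.+1%:R^-1 by apply: expRN_le_inv.
    have -> : - (a + y)^-1 - - a^-1 = a^-1 * (y / (a + y)) by field; rewrite !gt_eqF// addr_gt0.
    have y1 : 0 < a + y by rewrite addr_gt0.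
    rewrite ger0_norm; last by rewrite mulr_ge0 ?invr_ge0 ?(ltW a0)// divr_ge0 ?ltW.
    rewrite -mulrA; apply: ler_wpM2l; first by rewrite invr_ge0 ltW.
    apply: le_trans (_ : n.+1%:R^-1 * (a + y)^-1 <= _).
      by apply: ler_wpM2r => //; rewrite invr_ge0 ltW.
    rewrite mulrC; apply: ler_wpM2r; first by rewrite invr_ge0.
    by rewrite lef_pV2 ?posrE// lerDl ltW.
pose F (z : R) := (ln (b + expR z) - ln (a + expR z)) / (a - b).
have nab : a - b != 0 by rewrite subr_eq0.
have d (z : R) : is_derive z (1 : R) F (expR z / ((a + expR z) * (b + expR z))).
  have hl (c : R) : 0 < c -> is_derive z (1 : R) (fun y => ln (c + expR y)) ((c + expR z)^-1 * expR z).
    by move=> c0; apply: (@is_derive1_comp _ (@ln R) _ z _ _ (is_derive1_ln (p c z c0)) (h1 c z)).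
  have := is_deriveZ (a - b)^-1 (is_deriveB (hl b b0) (hl a a0)).
  have -> : F = (a - b)^-1 \*: ((fun y => ln (b + expR y)) - (fun y => ln (a + expR y))).
    by apply/funext => y; rewrite /F mulrC.
  move=> h; apply: (is_derive_eq h); rewrite /GRing.scale/=; field.
  by rewrite nab !gt_eqF// p.
have := @line_ftc_ig _ F ((ln b - ln a) / (a - b)) 0 d cc f0.
rewrite sub0r -mulNr opprB; apply.
- apply: (@harmonic_squeeze _ _ ((b + a) * `|a - b|^-1)) => n; rewrite subr0 /F normrM normfV mulrAC.
  apply: ler_wpM2r; first by rewrite invr_ge0.
  have [u1 u2] := andP (ln_add_le (expR_gt0 n.+1%:R) a0).
  have [v1 v2] := andP (ln_add_le (expR_gt0 n.+1%:R) b0).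
  rewrite ![_ + expR _]addrC.
  have w (c : R) : 0 < c -> c / expR n.+1%:R <= c / n.+1%:R.
    move=> c0; apply: ler_wpM2l; first exact: ltW.
    by rewrite lef_pV2 ?posrE ?expR_gt0//; exact: expR_ge_nat.
  have := w a a0; have := w b b0; rewrite mulrDl ler_norml => w1 w2.
  have a1 : 0 <= a / n.+1%:R by rewrite divr_ge0// ltW.
  have b1 : 0 <= b / n.+1%:R by rewrite divr_ge0// ltW.
  move: u1 u2 v1 v2 w1 w2 a1 b1; clear.
  move: (a / _) (b / _) (a / _) (b / _) (ln _) (ln _) (ln _) => q1 q2 q3 q4 q5 q6 q7 *.
  by apply/andP; split; lra.
- apply: (@harmonic_squeeze _ _ ((b^-1 + a^-1) * `|a - b|^-1)) => n; rewrite /F -mulrBl normrM normfV mulrAC.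
  apply: ler_wpM2r; first by rewrite invr_ge0.
  set y := expR _; have y0 : 0 < y by exact: expR_gt0.
  have yn : y <= n.+1%:R^-1 by apply: expRN_le_inv.
  have [u1 u2] := andP (ln_add_le a0 y0).
  have [v1 v2] := andP (ln_add_le b0 y0).
  have w (c : R) : 0 < c -> y / c <= c^-1 / n.+1%:R.
    by move=> c0; rewrite [leRHS]mulrC; apply: ler_wpM2r => //; rewrite invr_ge0 ltW.
  have := w a a0; have := w b b0; rewrite mulrDl ler_norml => w1 w2.
  have a1 : 0 <= a^-1 / n.+1%:R by rewrite divr_ge0// invr_ge0 ltW.
  have b1 : 0 <= b^-1 / n.+1%:R by rewrite divr_ge0// invr_ge0 ltW.
  move: u1 u2 v1 v2 w1 w2 a1 b1; clear.
  move: (_ / n.+1%:R) (_ / n.+1%:R) (y / _) (y / _) (ln _) (ln _) (ln _) (ln _) => q1 q2 q3 q4 q5 q6 q7 q8 *.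
  by apply/andP; split; lra.
Qed.

End line_integrals.

(** Integrability is not assumed: if f has infinite integral, [II] takes its default value 0 on both
    sides. *)
Lemma IIZ_ge0 d (T : measurableType d) (R : realType) (m : {measure set T -> \bar R})
    (c : R) (f : T -> R) : mf f -> (forall x, 0 <= f x) ->
  II m (fun x => c * f x) = c * II m f.
Proof.
move=> mf0 f0; have [i|ni] := pselect (ig m f); first exact: IIZ.
have inf : (\int[m]_x (f x)%:E = +oo)%E.
  by apply/eqP; rewrite -leye_eq leNgt; apply/negP => h; apply: ni; exact: ge0_ig.
have -> : II m f = 0 by rewrite /II /Rintegral inf.
rewrite mulr0 /II /Rintegral; have [c0|c0] := leP 0 c.
  by rewrite int_Zl// inf; have [->|nc] := eqVneq c 0; rewrite ?mul0e// muleC gt0_mulye// lte_fin lt_def nc.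
have -> : (\int[m]_x (c * f x)%:E = - \int[m]_x ((- c) * f x)%:E)%E.
  by rewrite -integral_ge0N => [|x _]; [apply: eq_integral => x _; rewrite mulNr EFinN oppeK|rewrite lee_fin mulr_ge0// oppr_ge0 ltW].
by rewrite int_Zl ?oppr_ge0 ?(ltW c0)// inf muleC gt0_mulye// lte_fin oppr_gt0.
Qed.

(** * The Green function as a time integral of heat kernels *)

Section green_kernel.
Context {R : realType}.
Local Notation leb := (@lebesgue_measure R).
Local Notation P := (mplane R).
Local Notation L := (measurableTypeR R).
Local Notation mu := (leb2 R).
Local Notation muf := (@leb2f R).
Local Notation lp := (leb \x muf)%E.
Let o : P := (0, 0).

(* The substitution s = e^w turns e^{-a s} ds, s > 0, into rho a w dw on the line. *)
Definition rho (a w : R) : R := expR w * expR (- a * expR w).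

(* Up to the factor e^{as}, the heat flow at time s of the Green function:
   the integral over times t = e^w of e^{-at} k_{t+s}. *)
Definition Ga (a s : R) (x : P) : R := II leb (fun w => rho a w * kk (expR w + s) o x).

(* The image of [Ga a s] under an isometry to L^2 of the line, z being the
   logarithm of the squared frequency. *)
Definition ms (a s z : R) : R :=
  (Num.sqrt (4 * pi))^-1 * expR (2^-1 * z) * expR (- s * expR z) / (a + expR z).

Lemma rho_ge0 a w : 0 <= rho a w.
Proof. by rewrite mulr_ge0 ?expR_ge0. Qed.

Lemma mrho a : measurable_fun [set: L] (rho a).
Proof.
apply: measurable_funM; first exact: measurable_expR.
apply: measurableT_comp; first exact: measurable_expR.
by apply: measurable_funM => //; exact: measurable_expR.
Qed.

(** In the time s = e^w this is s^(-1/2) e^(-a s) ds, where s^(-1/2) is the order of the L^2 norm of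
    the heat kernel at time s. *)
Lemma ig_rho_half a : 0 < a -> ig leb (fun w => rho a w * expR (- (2^-1 * w))).
Proof.
move=> a0; have h2 : 0 < 2^-1 :> R by [].
(* With y = e^(w/2), the constant makes (1 + y)^2 <= (2 + 2/a) (1 + a y^2) true. *)
apply: (ig_le _ _ (igZ (2 + 2 / a) (ig_sech h2))).
  apply: measurable_funM; first exact: mrho.
  apply: measurableT_comp; first exact: measurable_expR.
  by apply: measurableT_comp => //; exact: measurable_funM.
move=> w; rewrite ger0_norm; last by rewrite mulr_ge0 ?rho_ge0 ?expR_ge0.
rewrite /rho; set y := expR (2^-1 * w).
have y0 : 0 < y by exact: expR_gt0.
have ew : expR w = y ^+ 2.
  by rewrite expr2 -expRD; congr expR; field.
have -> : expR (- (2^-1 * w)) = y^-1 by rewrite expRN.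
rewrite ew.
have -> : y ^+ 2 * expR (- a * y ^+ 2) / y = y * expR (- a * y ^+ 2) by field; rewrite gt_eqF.
rewrite [leRHS]mulrCA; apply: ler_wpM2l; first exact: ltW.
have ay : 0 < 1 + a * y ^+ 2 by rewrite addr_gt0// mulr_gt0// exprn_gt0.
rewrite mulNr expRN; apply: (@le_trans _ _ (1 + a * y ^+ 2)^-1).
  by rewrite lef_pV2 ?posrE ?expR_gt0//; exact: expR_ge1Dx.
have y1 : 0 < (1 + y) ^+ 2 by rewrite exprn_gt0// addr_gt0.
rewrite ler_pdivlMr// mulrC ler_pdivrMr//.
have -> : (2 + 2 / a) * (1 + a * y ^+ 2) = 2 + 2 * y ^+ 2 + (2 * a * y ^+ 2 + 2 / a).
  by field; rewrite gt_eqF.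
have : 0 <= 2 * a * y ^+ 2 + 2 / a.
  by rewrite addr_ge0// ?divr_ge0 ?mulr_ge0// ?sqr_ge0// ltW.
by have := sqr_ge0 (1 - y); lra.
Qed.

Lemma time_gt0 (w s : R) : 0 <= s -> 0 < expR w + s.
Proof. by move=> s0; rewrite ltr_pwDl// expR_gt0. Qed.

Lemma mkk_time s : 0 <= s -> measurable_fun setT (fun z : L * P => kk (expR z.1 + s) o z.2).
Proof.
move=> s0; pose iv (w : R) := expR (- ln (expR w + s)).
have ivE w : iv w = (expR w + s)^-1 by rewrite /iv expRN lnK// posrE time_gt0.
have -> : (fun z : L * P => kk (expR z.1 + s) o z.2) =
    fun z => (4 * pi)^-1 * iv z.1 * expR (- (4^-1 * (z.2.1 ^+ 2 + z.2.2 ^+ 2)) * iv z.1).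
  apply/funext => z; rewrite kkE ?time_gt0// ivE /d2 /= !sub0r !sqrrN invfM; congr (_ * expR _).
  by rewrite invfM !mulrA; congr (_ / _); ring.
have miv : measurable_fun setT (fun z : L * P => iv z.1).
  apply: (measurableT_comp (f := iv)); last exact: measurable_fst.
  apply: measurableT_comp; first exact: measurable_expR.
  apply: measurableT_comp => //; apply: measurableT_comp; first exact: measurable_ln.
  by apply: measurable_funD => //; exact: measurable_expR.
have m1 : measurable_fun setT (fun z : L * P => z.2.1 : L) by exact: (measurableT_comp measurable_fst measurable_snd).
have m2 : measurable_fun setT (fun z : L * P => z.2.2 : L) by exact: (measurableT_comp measurable_snd measurable_snd).
apply: measurable_funM; first exact: measurable_funM.
apply: measurableT_comp; first exact: measurable_expR.
apply: measurable_funM => //; apply: measurableT_comp => //; apply: measurable_funM => //.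
by apply: measurable_funD; apply: measurable_funX.
Qed.

Lemma Ga_ge0 a s x : 0 <= Ga a s x.
Proof. by apply: II_ge0 => w; rewrite mulr_ge0 ?rho_ge0 ?kk_ge0. Qed.

Lemma mF_Ga a s : 0 <= s -> measurable_fun setT (fun z : L * P => rho a z.1 * kk (expR z.1 + s) o z.2).
Proof.
move=> s0; apply: measurable_funM; last exact: mkk_time.
exact: (measurableT_comp (mrho a) measurable_fst).
Qed.

Lemma mGa a s : 0 <= s -> mf (Ga a s : P -> R).
Proof.
move=> s0; have h := @section_int2 _ _ L P R leb _ (mF_Ga a s0) (fun z => mulr_ge0 (rho_ge0 a z.1) (kk_ge0 _ o z.2)).
exact: (measurableT_comp (f := fine) _ h).
Qed.

Lemma inv_time_le (w s : R) : 0 <= s -> (expR w + s)^-1 <= expR (- w).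
Proof. by move=> s0; rewrite expRN lef_pV2 ?posrE ?expR_gt0 ?time_gt0// lerDl. Qed.

Lemma ip_kk_time_le s (phi : P -> R) w : 0 <= s -> L2 mu phi ->
  `|ip mu (kk (expR w + s) o) phi| <= Num.sqrt (nrm2 mu phi) * expR (- (2^-1 * w)).
Proof.
move=> s0 pL; rewrite [leRHS]mulrC; apply: norm_ip_le (L2_kk o (time_gt0 w s0)) pL (expR_ge0 _) (sqrtr_ge0 _) _ _.
- rewrite nrm2_kk ?time_gt0//; have -> : expR (- (2^-1 * w)) ^+ 2 = expR (- w).
    by rewrite expr2 -expRD; congr expR; field.
  apply: le_trans (inv_time_le w s0); rewrite lef_pV2 ?posrE ?time_gt0//; last first.
    by rewrite !mulr_gt0 ?pi_gt0 ?time_gt0.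
  have := pi_ge2 R; have := time_gt0 w s0; move: (expR w + s) pi => t p; nra.
- by rewrite sqr_sqrtr ?nrm2_ge0.
Qed.

Lemma Ga_pair_ig a s (phi : P -> R) : 0 < a -> 0 <= s -> L2 mu phi ->
  ig lp (fun z : L * P => rho a z.1 * kk (expR z.1 + s) o z.2 * phi z.2).
Proof.
move=> a0 s0 pL.
apply: (@prod_ig _ _ L P R leb muf).
  apply: measurable_funM; first exact: mF_Ga.
  exact: (measurableT_comp pL.1 measurable_snd).
have pN := L2_norm pL.
apply: (@le_lt_trans _ _ (\int[leb]_w (Num.sqrt (nrm2 mu phi) * (rho a w * expR (- (2^-1 * w))))%:E)%E); last first.
  apply: (ig_lty (igZ _ (ig_rho_half a0))) => w.
  by apply: mulr_ge0; [exact: sqrtr_ge0|rewrite mulr_ge0 ?rho_ge0 ?expR_ge0].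
have mN : measurable_fun setT (fun z : L * P => `|rho a z.1 * kk (expR z.1 + s) o z.2 * phi z.2|).
  apply: measurableT_comp => //; apply: measurable_funM; first exact: mF_Ga.
  exact: (measurableT_comp pL.1 measurable_snd).
apply: ge0_le_integral => //.
- by move=> w _; apply: integral_ge0.
- exact: (@section_int1 _ _ L P R muf _ mN (fun z => normr_ge0 _)).
- by apply/measurable_EFinP; apply: measurable_funM => //; exact: ig_mf (ig_rho_half a0).
move=> w _ /=.
have E (x : P) : `|rho a w * kk (expR w + s) o x * phi x| = rho a w * (kk (expR w + s) o x * `|phi x|).
  by rewrite normrM (ger0_norm (mulr_ge0 (rho_ge0 a w) (kk_ge0 _ _ _))) mulrA.
rewrite (eq_integral (fun x => (rho a w * (kk (expR w + s) o x * `|phi x|))%:E)); last by move=> x _; rewrite E.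
have ikp := L2_mul (L2_kk o (time_gt0 w s0)) pN.
rewrite (EFin_II (igZ (rho a w) ikp)) lee_fin IIZ// mulrCA; apply: ler_wpM2l; first exact: rho_ge0.
apply: le_trans (ler_norm _) _; apply: le_trans (ip_kk_time_le w s0 pN) _.
suff -> : nrm2 mu (fun x => `|phi x|) = nrm2 mu phi by [].
by congr (II mu); apply/funext => x; rewrite real_normK ?num_real.
Qed.

Lemma Ga_mul a s x (c : R) : 0 <= s ->
  II leb (fun w => rho a w * kk (expR w + s) o x * c) = Ga a s x * c.
Proof.
move=> s0; rewrite mulrC -(IIZ_ge0 leb c).
- by congr (II leb); apply/funext => w; rewrite mulrC.
- exact: (measurableT_comp (mF_Ga a s0) (@pair2_measurable _ _ L P x)).
- by move=> w; rewrite mulr_ge0 ?rho_ge0 ?kk_ge0.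
Qed.

Lemma ip_Ga a s (phi : P -> R) : 0 < a -> 0 <= s -> L2 mu phi ->
  [/\ ig mu (fun x => Ga a s x * phi x),
      ig leb (fun w => rho a w * ip mu (kk (expR w + s) o) phi) &
      ip mu (Ga a s) phi = II leb (fun w => rho a w * ip mu (kk (expR w + s) o) phi)].
Proof.
move=> a0 s0 pL; have i := Ga_pair_ig a0 s0 pL.
have [i1 e1] := @prod_fubini1 _ _ L P R leb muf _ i.
have [i2 e2] := @prod_fubini2 _ _ L P R leb muf _ i.
have E1 : (fun w : L => II muf (fun y : P => rho a w * kk (expR w + s) o y * phi y)) =
    fun w => rho a w * ip mu (kk (expR w + s) o) phi.
  apply/funext => w; rewrite /ip -(IIZ (rho a w) (L2_mul (L2_kk o (time_gt0 w s0)) pL)).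
  by congr (II muf); apply/funext => x; rewrite mulrA.
have E2 : (fun x : P => II leb (fun w => rho a w * kk (expR w + s) o x * phi x)) = fun x => Ga a s x * phi x.
  by apply/funext => x; rewrite Ga_mul.
rewrite /= E1 in i1 e1; rewrite /= E2 in i2 e2; split=> //.
by rewrite /ip -e1 e2.
Qed.

(** By Tonelli and the semigroup law the squared norm is a double time integral of the kernel at
    time t + t' on the diagonal, of order 1/(t + t'); the bound by (t t')^(-1/2) separates the two
    times and leaves a square of [ig_rho_half]. *)
Lemma L2_Ga a s : 0 < a -> 0 <= s -> L2 mu (Ga a s : P -> R).
Proof.
move=> a0 s0; apply: L2P; first exact: mGa.
have mF := mF_Ga a s0; have mG := mGa a s0.
have mH : measurable_fun setT (fun z : L * P => rho a z.1 * kk (expR z.1 + s) o z.2 * Ga a s z.2).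
  by apply: measurable_funM => //; exact: (measurableT_comp mG measurable_snd).
have H0 (z : L * P) : 0 <= rho a z.1 * kk (expR z.1 + s) o z.2 * Ga a s z.2.
  by rewrite !mulr_ge0 ?expR_ge0 ?kk_ge0 ?Ga_ge0.
have [_ T] := @prod_tonelli _ _ L P R leb muf _ mH H0.
apply: (@le_lt_trans _ _ (\int[mu]_x \int[leb]_w (rho a w * kk (expR w + s) o x * Ga a s x)%:E)%E).
  apply: ge0_le_integral => //.
  - by move=> x _; rewrite lee_fin sqr_ge0.
  - by apply/measurable_EFinP; exact: measurable_funX.
  - exact: (@section_int2 _ _ L P R leb _ mH H0).
  move=> x _.
  have mFx : measurable_fun [set: L] (fun w : L => rho a w * kk (expR w + s) o x).
    exact: (measurableT_comp mF (@pair2_measurable _ _ L P x)).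
  have F0 w : 0 <= rho a w * kk (expR w + s) o x by rewrite mulr_ge0 ?rho_ge0 ?kk_ge0.
  under eq_integral do rewrite mulrC.
  rewrite (int_Zl leb mFx F0 (Ga_ge0 a s x)) expr2 EFinM; apply: lee_pmul.
  - by rewrite lee_fin Ga_ge0.
  - by rewrite lee_fin Ga_ge0.
  - by [].
  rewrite /Ga /II /Rintegral.
  have : (0 <= \int[leb]_w (rho a w * kk (expR w + s) o x)%:E)%E by apply: integral_ge0 => w _; rewrite lee_fin.
  by case: (\int[leb]_w _)%E => [r| |] //= _; rewrite leey.
rewrite -T.
have K w : (\int[mu]_x (rho a w * kk (expR w + s) o x * Ga a s x)%:E)%E =
    (rho a w * II leb (fun v => rho a v * kk (expR v + s + (expR w + s)) o o))%:E.
  have kL := L2_kk o (time_gt0 w s0).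
  have [i1 _ e] := ip_Ga a0 s0 kL.
  have i2 : ig mu (fun x => kk (expR w + s) o x * Ga a s x).
    by move: i1; congr (ig mu); apply/funext => x; rewrite mulrC.
  under eq_integral do rewrite -mulrA.
  rewrite (EFin_II (igZ (rho a w) i2)) IIZ//; congr (_ * _)%:E.
  rewrite -/(ip mu (kk (expR w + s) o) (Ga a s)) ipC e; congr (II leb); apply/funext => v.
  by rewrite ip_kk ?time_gt0.
under eq_integral do rewrite K.
have i := ig_rho_half a0; set I := II leb (fun w => rho a w * expR (- (2^-1 * w))).
apply: (@le_lt_trans _ _ (\int[leb]_w (I * (rho a w * expR (- (2^-1 * w))))%:E)%E); last first.
  apply: (ig_lty (igZ I i)) => w; rewrite !mulr_ge0 ?expR_ge0//.
  by apply: II_ge0 => v; rewrite !mulr_ge0 ?expR_ge0.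
have IE w : II leb (fun v => rho a v * kk (expR v + s + (expR w + s)) o o) <= expR (- (2^-1 * w)) * I.
  rewrite /I -IIZ//; apply: II_le; last 2 first.
  - exact: igZ.
  - move=> v; rewrite [leRHS]mulrCA; apply: ler_wpM2l; first exact: rho_ge0.
    have p1 : 0 < expR v + s + (expR w + s) by rewrite addr_gt0 ?time_gt0.
    rewrite kkxx// -expRD -opprD expRN lef_pV2 ?posrE ?expR_gt0 ?mulr_gt0 ?pi_gt0//.
    have -> : expR (2^-1 * w + 2^-1 * v) = expR (2^-1 * w) * expR (2^-1 * v) by rewrite expRD.
    have ev : expR v = expR (2^-1 * v) ^+ 2 by rewrite expr2 -expRD; congr expR; field.
    have ew : expR w = expR (2^-1 * w) ^+ 2 by rewrite expr2 -expRD; congr expR; field.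
    rewrite ev ew; have := pi_ge2 R; have := sqr_ge0 (expR (2^-1 * v) - expR (2^-1 * w)).
    have := expR_gt0 (2^-1 * v); have := expR_gt0 (2^-1 * w).
    move: (expR _) (expR _) pi => y x p x0 y0 h p2.
    have q : x * y * 1 <= (x ^+ 2 + s + (y ^+ 2 + s)) * (4 * p).
      apply: ler_pM; [exact: mulr_ge0 (ltW x0) (ltW y0)| by [] | nra | lra].
    by move: q; lra.
  have [_ i' _] := ip_Ga a0 s0 (L2_kk o (time_gt0 w s0)).
  by move: i'; congr (ig leb); apply/funext => v; rewrite ip_kk ?time_gt0.
have mI : measurable_fun [set: L] (fun w => \int[mu]_x (rho a w * kk (expR w + s) o x * Ga a s x)%:E)%E.
  exact: (@section_int1 _ _ L P R muf _ mH H0).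
apply: ge0_le_integral => //.
- move=> w _; rewrite lee_fin mulr_ge0 ?rho_ge0//.
  by apply: II_ge0 => v; rewrite mulr_ge0 ?rho_ge0 ?kk_ge0.
- by move: mI; congr (measurable_fun setT); apply/funext => w; rewrite K.
- by apply/measurable_EFinP; exact: (ig_mf (igZ I i)).
move=> w _; rewrite lee_fin mulrCA; apply: ler_wpM2l; first exact: rho_ge0.
by rewrite mulrC.
Qed.

(** The semigroup law: the heat flow only advances the time s. *)
Lemma TT_Ga a s t x : 0 < a -> 0 <= s -> 0 < t -> TT t (Ga a s) x = Ga a (s + t) x.
Proof.
move=> a0 s0 t0; have [_ _ e] := ip_Ga a0 s0 (L2_kk x t0).
rewrite /TT ipC e; congr (II leb); apply/funext => w.
by rewrite ip_kk ?time_gt0// addrA.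
Qed.

End green_kernel.

(** * A model of the Green functions on the line *)

Section spectral.
Context {R : realType}.
Local Notation leb := (@lebesgue_measure R).
Local Notation P := (mplane R).
Local Notation L := (measurableTypeR R).
Local Notation mu := (leb2 R).
Let o : P := (0, 0).

Lemma ig_exp_scale (c : R) : 0 < c ->
  ig leb (fun z => expR z * expR (- c * expR z)) /\ II leb (fun z => expR z * expR (- c * expR z)) = c^-1.
Proof.
move=> c0; have h := int_exp_scale c0; split; last by rewrite /II /Rintegral h.
by apply: ge0_ig; [exact: mrho|move=> x; exact: rho_ge0|rewrite h ltry].
Qed.

Lemma addexp_gt0 (b z : R) : 0 < b -> 0 < b + expR z.
Proof. by move=> b0; rewrite addr_gt0// expR_gt0. Qed.

Lemma exp_splitD (p q z : R) : expR (- (p + q) * expR z) = expR (- p * expR z) * expR (- q * expR z).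
Proof. by rewrite -expRD; congr expR; ring. Qed.

(** After exchanging the integrals, the time integral of e^(-(b + e^z) t) is the resolvent factor
    1/(b + e^z). *)
Lemma laplace_swap (b : R) (h : R -> R) : 0 < b -> measurable_fun [set: L] h -> (forall z, 0 <= h z) ->
  (forall v, ig leb (fun z => h z * expR (- expR v * expR z))) ->
  II leb (fun v => rho b v * II leb (fun z => h z * expR (- expR v * expR z))) =
  II leb (fun z => h z / (b + expR z)).
Proof.
move=> b0 mh h0 ih; pose F (w : L * L) := rho b w.1 * (h w.2 * expR (- expR w.1 * expR w.2)).
have me1 : measurable_fun setT (fun w : L * L => expR w.1) by exact: (measurableT_comp (@measurable_expR R) measurable_fst).
have me2 : measurable_fun setT (fun w : L * L => expR w.2) by exact: (measurableT_comp (@measurable_expR R) measurable_snd).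
have mF : mf F.
  apply: measurable_funM; first exact: (measurableT_comp (mrho b) measurable_fst).
  apply: measurable_funM; first exact: (measurableT_comp mh measurable_snd).
  apply: measurableT_comp; first exact: measurable_expR.
  by apply: measurable_funM => //; exact: measurableT_comp.
have F0 w : 0 <= F w by rewrite !mulr_ge0 ?rho_ge0 ?expR_ge0.
have [_ T] := @prod_tonelli _ _ L L R leb leb F mF F0.
rewrite /II /Rintegral; congr fine.
transitivity (\int[leb]_v \int[leb]_z (F (v, z))%:E)%E.
  by apply: eq_integral => v _; rewrite /F /= (EFin_II (igZ (rho b v) (ih v))) IIZ.
rewrite T; apply: eq_integral => z _.
have bz := addexp_gt0 z b0.
have E v : F (v, z) = h z * (expR v * expR (- (b + expR z) * expR v)).
  rewrite /F /= /rho exp_splitD; have -> : - expR v * expR z = - expR z * expR v by ring.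
  by ring.
under eq_integral do rewrite E.
exact: (etrans (int_Zl leb (mrho _) (rho_ge0 _) (h0 z)) (congr1 (fun e => (h z)%:E * e)%E (int_exp_scale bz))).
Qed.

(** The diagonal value 1/(4 pi t) of the kernel is itself the integral of e^z e^(-t e^z) / (4 pi) in
    z; this introduces the frequency variable. *)
Lemma ip_kk_Ga b t tau : 0 < b -> 0 <= t -> 0 < tau ->
  ip mu (kk tau o) (Ga b t) =
  II leb (fun z => (4 * pi)^-1 * (expR z * expR (- (t + tau) * expR z)) / (b + expR z)).
Proof.
move=> b0 t0 tau0; have [_ _ e] := ip_Ga b0 t0 (L2_kk o tau0).
have p0 : 0 < 4 * pi :> R by rewrite mulr_gt0 ?pi_gt0.
have tt : 0 < t + tau by rewrite ltr_wpDl.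
rewrite ipC e -laplace_swap//.
- congr (II leb); apply/funext => v; congr (_ * _).
  have c0 : 0 < expR v + t + tau by rewrite addr_gt0 ?time_gt0.
  rewrite ip_kk ?time_gt0// kkxx// invfM -(ig_exp_scale c0).2 -IIZ; last exact: (ig_exp_scale c0).1.
  congr (II leb); apply/funext => z.
  by rewrite -addrA [expR v + _]addrC exp_splitD; ring.
- by apply: measurable_funM => //; exact: (mrho (t + tau)).
- by move=> z; rewrite mulr_ge0 ?invr_ge0 ?(ltW p0)//; exact: (rho_ge0 (t + tau) z).
- move=> v; have c0 : 0 < t + tau + expR v by rewrite addr_gt0// expR_gt0.
  have := igZ (4 * pi)^-1 (ig_exp_scale c0).1; congr (ig leb); apply/funext => z.
  by rewrite exp_splitD; ring.
Qed.

Lemma mms a s : 0 < a -> measurable_fun [set: L] (@ms R a s).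
Proof.
move=> a0.
have mE : measurable_fun [set: L] (@expR R) by exact: measurable_expR.
have me k : measurable_fun [set: L] (fun z : R => expR (k * z)).
  by apply: measurableT_comp => //; exact: measurable_funM.
apply: measurable_funM.
  apply: measurable_funM; first by apply: measurable_funM.
  by apply: (measurableT_comp (f := @expR R)) => //; exact: measurable_funM.
have -> : (fun z : L => (a + expR z)^-1) = fun z => expR (- ln (a + expR z)).
  by apply/funext => z; have h := addexp_gt0 z a0; rewrite expRN lnK.
apply: measurableT_comp => //; apply: measurableT_comp => //.
by apply: (measurableT_comp (f := @ln R)); [exact: measurable_ln|exact: measurable_funD].
Qed.

Lemma ms_mul (a b s t z : R) : 0 < a -> 0 < b -> ms a s z * ms b t z =
  (4 * pi)^-1 * expR z * expR (- (s + t) * expR z) / ((a + expR z) * (b + expR z)).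
Proof.
move=> a0 b0; rewrite /ms.
have -> : expR z = expR (2^-1 * z) ^+ 2 :> R by rewrite expr2 -expRD; congr expR; field.
set y := expR (2^-1 * z); have y0 : 0 < y by exact: expR_gt0.
have -> : expR (- (s + t) * y ^+ 2) = expR (- s * y ^+ 2) * expR (- t * y ^+ 2) by rewrite -expRD; congr expR; ring.
have p0 : 0 < 4 * pi :> R by rewrite mulr_gt0 ?pi_gt0.
have -> : (4 * pi)^-1 = (Num.sqrt (4 * pi))^-1 * (Num.sqrt (4 * pi))^-1 :> R.
  by rewrite -invfM -expr2 sqr_sqrtr// ltW.
by rewrite invfM; ring.
Qed.

Lemma L2_ms a s : 0 < a -> 0 <= s -> L2 leb (@ms R a s).
Proof.
move=> a0 s0; split; first exact: mms.
have p0 : 0 < 4 * pi :> R by rewrite mulr_gt0 ?pi_gt0.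
apply: (ig_le _ _ (igZ (4 * pi)^-1 (int_resolvents a0 a0).1)).
  by apply: measurable_funX; exact: mms.
move=> z; rewrite expr2 ms_mul// ger0_norm; last first.
  by rewrite !mulr_ge0 ?invr_ge0 ?expR_ge0 ?(ltW p0)// mulr_ge0 ?addr_ge0 ?expR_ge0 ?ltW.
rewrite -!mulrA; apply: ler_wpM2l; first by rewrite invr_ge0 ltW.
apply: ler_wpM2l; first exact: expR_ge0.
rewrite -[leRHS]mul1r; apply: ler_wpM2r.
  by rewrite invr_ge0 mulr_ge0 ?addr_ge0 ?expR_ge0 ?ltW.
by rewrite -expR0 ler_expR mulNr oppr_le0 mulr_ge0 ?expR_ge0 ?addr_ge0.
Qed.

(** The first Green function is expanded in time and [ip_kk_Ga] is applied under the integral; the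
    remaining time integral is a second Laplace transform, so each Green function contributes one
    resolvent factor. *)
Lemma ip_GaGa a b s t : 0 < a -> 0 < b -> 0 <= s -> 0 <= t ->
  ip mu (Ga a s) (Ga b t) = ip leb (ms a s) (ms b t).
Proof.
move=> a0 b0 s0 t0; have [_ _ ->] := ip_Ga a0 s0 (L2_Ga b0 t0).
have p0 : 0 < 4 * pi :> R by rewrite mulr_gt0 ?pi_gt0.
pose h z := (4 * pi)^-1 * expR z * expR (- (s + t) * expR z) / (b + expR z).
have h0 z : 0 <= h z.
  by rewrite !mulr_ge0 ?invr_ge0 ?expR_ge0 ?(ltW p0)// addr_ge0 ?expR_ge0 ?ltW.
have mh : measurable_fun [set: L] h.
  have mE : measurable_fun [set: L] (@expR R) by exact: measurable_expR.
  have : measurable_fun [set: L] (fun z => ms b (s + t) z * (Num.sqrt (4 * pi))^-1 * expR (2^-1 * z)).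
    apply: measurable_funM; first by apply: measurable_funM => //; exact: mms.
    by apply: measurableT_comp => //; exact: measurable_funM.
  congr (measurable_fun setT); apply/funext => z; rewrite /ms /h.
  have -> : expR z = expR (2^-1 * z) ^+ 2 :> R by rewrite expr2 -expRD; congr expR; field.
  have -> : (4 * pi)^-1 = (Num.sqrt (4 * pi))^-1 * (Num.sqrt (4 * pi))^-1 :> R.
    by rewrite -invfM -expr2 sqr_sqrtr// ltW.
  by ring.
transitivity (II leb (fun w => rho a w * II leb (fun z => h z * expR (- expR w * expR z)))).
  congr (II leb); apply/funext => w; congr (_ * _).
  rewrite (ip_kk_Ga b0 t0 (time_gt0 w s0)); congr (II leb); apply/funext => z; rewrite /h.
  have -> : t + (expR w + s) = s + t + expR w by ring.
  by rewrite exp_splitD; ring.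
rewrite laplace_swap//.
  by congr (II leb); apply/funext => z; rewrite ms_mul// /h (invfM (a + _)); ring.
move=> v; have ev : 0 < expR v :> R by exact: expR_gt0.
apply: (ig_le _ _ (igZ ((4 * pi)^-1 / b) (ig_exp_scale ev).1)).
  apply: measurable_funM => //; have := mrho (expR v).
  have mE : measurable_fun [set: L] (@expR R) by exact: measurable_expR.
  by move=> _; apply: measurableT_comp => //; exact: measurable_funM.
move=> z; rewrite ger0_norm; last by rewrite mulr_ge0 ?expR_ge0.
rewrite mulrA; apply: ler_wpM2r; first exact: expR_ge0.
rewrite /h -!mulrA; apply: ler_wpM2l; first by rewrite invr_ge0 ltW.
rewrite [leRHS]mulrC; apply: ler_wpM2l; first exact: expR_ge0.
rewrite -[leRHS]mul1r; apply: ler_pM.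
- exact: expR_ge0.
- by rewrite invr_ge0 addr_ge0 ?expR_ge0 ?ltW.
- by rewrite -expR0 ler_expR mulNr oppr_le0 mulr_ge0 ?expR_ge0 ?addr_ge0.
- by rewrite lef_pV2 ?posrE ?addr_gt0 ?expR_gt0// lerDl expR_ge0.
Qed.

(** Equality of the pairings with the generating family only; [SP] then strengthens it to all pairs
    having this property. *)
Definition SP1 (X : P -> R) (m : R -> R) := [/\ L2 mu X, L2 leb m &
  forall a s, 0 < a -> 0 <= s -> ip mu X (Ga a s) = ip leb m (ms a s)].

(* X corresponds to m under the isometry; by induction on linear combinations
   of the functions [Ga a s]. *)
Definition SP X m := SP1 X m /\ forall Y n, SP1 Y n -> ip mu X Y = ip leb m n.

Lemma SP_Ga a s : 0 < a -> 0 <= s -> SP (Ga a s) (ms a s).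
Proof.
move=> a0 s0; split.
  split; [exact: L2_Ga|exact: L2_ms|by move=> b t b0 t0; exact: ip_GaGa].
by move=> Y n [YL nL h]; rewrite ipC h// ipC.
Qed.

Lemma SP_lin X Y m n (c : R) : SP X m -> SP Y n ->
  SP (fun x => X x + c * Y x) (fun z => m z + c * n z).
Proof.
move=> [[XL mL h] H] [[YL nL k] K]; split.
  split; [exact: L2D XL (L2Z c YL)|exact: L2D mL (L2Z c nL)|].
  move=> a s a0 s0; have GL := L2_Ga a0 s0; have gL := L2_ms a0 s0.
  by rewrite (ipDl XL (L2Z c YL) GL) (ipZl c YL GL) (ipDl mL (L2Z c nL) gL) (ipZl c nL gL) h// k.
move=> Z q ZS; have [ZL qL _] := ZS.
by rewrite (ipDl XL (L2Z c YL) ZL) (ipZl c YL ZL) (ipDl mL (L2Z c nL) qL) (ipZl c nL qL) (H _ _ ZS) (K _ _ ZS).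
Qed.

Lemma SP_ip X Y m n : SP X m -> SP Y n -> ip mu X Y = ip leb m n.
Proof. by move=> [_ H] [K _]; exact: H. Qed.

(** The logarithms are those that [theta] compensates when the Green parameter is changed, see
    [ip_G_theta]. *)
Lemma ip_Ga0 a b : 0 < a -> 0 < b -> ip mu (Ga a 0) (Ga b 0) =
  (4 * pi)^-1 * (if a == b then a^-1 else (ln a - ln b) / (a - b)).
Proof.
move=> a0 b0; rewrite ip_GaGa// -(int_resolvents a0 b0).2 -IIZ; last exact: (int_resolvents a0 b0).1.
congr (II leb); apply/funext => z; rewrite ms_mul// addr0 oppr0 mul0r expR0 mulr1 -mulrA.
by [].
Qed.

End spectral.

Lemma sq_ext (R : realType) (u v : nat -> R) (l : R) : (forall n, u n = v n) ->
  u @ \oo --> l -> v @ \oo --> l.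
Proof. by move=> e; rewrite (_ : v = u)//; apply/funext => n; rewrite e. Qed.

(** * Gradient norms as limits, and the Green function *)

Section finite_energy.
Context {R : realType}.
Local Notation leb := (@lebesgue_measure R).
Local Notation P := (mplane R).
Local Notation Q := (plane R).
Local Notation L := (measurableTypeR R).
Local Notation mu := (leb2 R).
Let o : P := (0, 0).

(* f belongs to H^1 and its gradient has squared norm N. *)
Definition HN (f : P -> R) (N : R) := exists g1 g2, wgrad f g1 g2 /\ nrm2 mu g1 + nrm2 mu g2 = N.

Lemma HN_L2 f N : HN f N -> L2 mu f.
Proof. by move=> [g1 [g2 [[]]]]. Qed.

Lemma HN_cvg f N (t_ : nat -> R) : HN f N -> (forall n, 0 < t_ n) -> t_ @ \oo --> 0 ->
  (fun n => dn (t_ n) f / (2 * t_ n)) @ \oo --> N.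
Proof. by move=> [g1 [g2 [G <-]]]; exact: wgrad_dn_cvg. Qed.

Lemma HN_le f N t : HN f N -> 0 < t -> dn t f <= 2 * t * N.
Proof. by move=> [g1 [g2 [G <-]]] t0; exact: wgrad_dn. Qed.

Lemma harm_gt0 (n : nat) : 0 < n.+1%:R^-1 :> R. Proof. by rewrite invr_gt0. Qed.

Lemma HN_unique f N M : HN f N -> HN f M -> N = M.
Proof.
move=> h k; have a := HN_cvg h harm_gt0 (@cvg_harmonic R).
have b := HN_cvg k harm_gt0 (@cvg_harmonic R).
exact: (cvg_unique _ a b).
Qed.

Lemma HN_ge0 f N : HN f N -> 0 <= N.
Proof. by move=> [g1 [g2 [_ <-]]]; rewrite addr_ge0// nrm2_ge0. Qed.

Lemma HN_bounded f (t_ c : nat -> R) M : L2 mu f -> (forall n, 0 < t_ n) -> t_ @ \oo --> 0 ->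
  (forall n, dn (t_ n) f <= 2 * t_ n * c n) -> c @ \oo --> M -> exists2 N, HN f N & N <= M.
Proof.
move=> fL t0 tc dc cM; have [g1 [g2 [G h]]] := wgrad_of_dn fL t0 tc dc cM.
by exists (nrm2 mu g1 + nrm2 mu g2) => //; exists g1, g2.
Qed.

Lemma HN_limit f (t_ : nat -> R) N : L2 mu f -> (forall n, 0 < t_ n) -> t_ @ \oo --> 0 ->
  (fun n => dn (t_ n) f / (2 * t_ n)) @ \oo --> N -> HN f N.
Proof.
move=> fL t0 tc dN.
have dc n : dn (t_ n) f <= 2 * t_ n * (dn (t_ n) f / (2 * t_ n)).
  by rewrite mulrC divfK// gt_eqF// mulr_gt0.
have [M h _] := HN_bounded fL t0 tc dc dN.
by rewrite (cvg_unique _ dN (HN_cvg h t0 tc)).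
Qed.

Lemma HN_lin f g N M (c : R) : HN f N -> HN g M -> exists K, HN (fun x => f x + c * g x) K.
Proof.
move=> [f1 [f2 [[fL f1L f2L F] _]]] [g1 [g2 [[gL g1L g2L G] _]]].
eexists; exists (fun x => f1 x + c * g1 x), (fun x => f2 x + c * g2 x); split; last by [].
split; [exact: L2D fL (L2Z c gL)|exact: L2D f1L (L2Z c g1L)|exact: L2D f2L (L2Z c g2L)|].
move=> phi tp; have [td1 td2] := test_D tp; have pL := test_L2 tp.
have [a1 a2] := F _ tp; have [b1 b2] := G _ tp.
rewrite (ipDl fL (L2Z c gL) (test_L2 td1)) (ipDl fL (L2Z c gL) (test_L2 td2)).
rewrite (ipZl c gL (test_L2 td1)) (ipZl c gL (test_L2 td2)).
rewrite (ipDl f1L (L2Z c g1L) pL) (ipDl f2L (L2Z c g2L) pL) (ipZl c g1L pL) (ipZl c g2L pL).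
rewrite a1 a2 b1 b2; move: (ip _ _ _) (ip _ _ _) (ip _ _ _) (ip _ _ _) => u v u' v'.
by split; ring.
Qed.

Lemma HN_ae f g N : mf g -> {ae mu, forall x, f x = g x} -> HN f N -> HN g N.
Proof.
move=> mg e [f1 [f2 [[fL f1L f2L F] <-]]]; exists f1, f2; split=> //; split=> //.
  exact: ae_L2 fL.1 mg e fL.
move=> phi tp; have [td1 td2] := test_D tp; have [a1 a2] := F _ tp.
have r (psi : Q -> R) : test_function psi -> ip mu f psi = ip mu g psi.
  move=> tq; have qL := test_L2 tq; apply: ae_ip => //; [exact: fL.1|exact: qL.1|exact: qL.1|].
  by apply: filterE.
by rewrite -(r _ td1) -(r _ td2).
Qed.

Lemma HN0 : HN (fun=> 0) 0.
Proof.
have z : nrm2 mu (fun _ : P => 0 : R) = 0.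
  by rewrite -ipff -[RHS](II0 mu); congr (II mu); apply/funext => x; rewrite mulr0.
exists (fun=> 0), (fun=> 0); rewrite z addr0; split=> //; split; try exact: L2_0.
have i (phi : Q -> R) : ip mu (fun=> 0) phi = 0.
  by rewrite -[RHS](II0 mu); congr (II mu); apply/funext => x; rewrite mul0r.
by move=> phi tp; rewrite !i oppr0.
Qed.

Lemma HNZ f N (c : R) : HN f N -> HN (fun x => c * f x) (c ^+ 2 * N).
Proof.
move=> h; have [K k] := HN_lin c HN0 h; have fL := HN_L2 h.
have e : (fun x => 0 + c * f x) = (fun x => c * f x) by apply/funext => x; rewrite add0r.
rewrite e in k; suff -> : c ^+ 2 * N = K by [].
have a := HN_cvg k harm_gt0 (@cvg_harmonic R).
have b := sqZ (c ^+ 2) (HN_cvg h harm_gt0 (@cvg_harmonic R)).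
have a2 : (fun n : nat => c ^+ 2 * (dn n.+1%:R^-1 f / (2 * n.+1%:R^-1))) @ \oo --> K.
  apply: (sq_ext _ a) => n; rewrite -e dn_lin//; last exact: L2_0.
  have z t : dn t (fun _ : P => 0 : R) = 0.
    by rewrite /dn -[RHS](II0 (leb2f \x leb2f)%E); congr (II _); apply/funext => x; rewrite subrr expr0n mulr0.
  have i (phi : P -> R) : ip mu (fun=> 0) phi = 0.
    by rewrite -[RHS](II0 mu); congr (II mu); apply/funext => x; rewrite mul0r.
  by rewrite z !i subrr mulr0 !add0r mulrA.
exact: (cvg_unique _ b a2).
Qed.

Local Notation G a := (@Ga R a 0).

Lemma exp_sub_bounds (y : R) : 0 <= y ->
  0 <= 1 - expR (- y) <= y /\ y - (1 - expR (- y)) <= y ^+ 2.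
Proof.
move=> y0; have h1 := expR_ge1Dx (- y).
have h2 : expR (- y) <= 1 by rewrite -expR0 ler_expR oppr_le0.
have y1 : 0 < 1 + y by rewrite ltr_pwDl.
have h3 : expR (- y) <= (1 + y)^-1.
  by rewrite expRN lef_pV2 ?posrE ?expR_gt0//; exact: expR_ge1Dx.
split; first by apply/andP; split; lra.
have h4 : (1 + y)^-1 <= 1 - y + y ^+ 2.
  rewrite -div1r ler_pdivrMr//; have := exprn_ge0 3 y0; rewrite !exprS expr0; nra.
by lra.
Qed.

(** The difference G_a - G_b and its image [hG] under minus the Laplacian: each -Laplacian G_a is a
    Dirac mass minus a G_a, and the Dirac masses cancel. *)
Definition wG (a b : R) (x : P) := G a x + (-1) * G b x.
Definition hG (a b : R) (x : P) := b * G b x + (- a) * G a x.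

Let kap (z : R) : R := (Num.sqrt (4 * pi))^-1 * expR (2^-1 * z).

Let msE (a s z : R) : ms a s z = kap z * expR (- s * expR z) / (a + expR z).
Proof. by []. Qed.

Let kap2 (z : R) : kap z ^+ 2 = (4 * pi)^-1 * expR z.
Proof.
have p0 : 0 < 4 * pi :> R by rewrite mulr_gt0 ?pi_gt0.
rewrite exprMn exprVn sqr_sqrtr ?(ltW p0)//; congr (_ * _).
by rewrite expr2 -expRD; congr expR; field.
Qed.

Lemma L2_wG a b : 0 < a -> 0 < b -> L2 mu (wG a b).
Proof. by move=> a0 b0; exact: (L2D (L2_Ga a0 (lexx 0)) (L2Z (-1) (L2_Ga b0 (lexx 0)))). Qed.

Lemma L2_hG a b : 0 < a -> 0 < b -> L2 mu (hG a b).
Proof. by move=> a0 b0; exact: (L2D (L2Z b (L2_Ga b0 (lexx 0))) (L2Z (- a) (L2_Ga a0 (lexx 0)))). Qed.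

(** In the model the semigroup is multiplication by e^(-t e^z), and the claim follows by dominated
    convergence. *)
Lemma wG_generator a b (t_ : nat -> R) : 0 < a -> 0 < b -> (forall n, 0 < t_ n) -> t_ @ \oo --> 0 ->
  (fun n => nrm2 mu (fun x => (t_ n)^-1 * (wG a b x - TT (t_ n) (wG a b) x) - hG a b x)) @ \oo --> 0.
Proof.
move=> a0 b0 t0 tc.
have l0 : (0 : R) <= 0 by [].
pose c z := kap z * (b - a) / ((a + expR z) * (b + expR z)).
pose m n z := c z * ((t_ n)^-1 * (1 - expR (- (t_ n * expR z))) - expR z).
have S n : SP (fun x => (t_ n)^-1 * (wG a b x - TT (t_ n) (wG a b) x) - hG a b x) (m n).
  have tn := t0 n.
  have S0 := SP_lin (-1) (SP_Ga a0 l0) (SP_Ga b0 l0).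
  have S1 := SP_lin (-1) (SP_Ga a0 (ltW tn)) (SP_Ga b0 (ltW tn)).
  (* Correspondences combine two at a time as X + c Y; [S0] minus itself is the zero element from
     which a G_a - b G_b is started. *)
  have W := SP_lin (t_ n)^-1 (SP_lin (- b) (SP_lin a (SP_lin (-1) S0 S0) (SP_Ga a0 l0)) (SP_Ga b0 l0)) (SP_lin (-1) S0 S1).
  have E1 : (fun x => (t_ n)^-1 * (wG a b x - TT (t_ n) (wG a b) x) - hG a b x) =
     (fun x => (G a x + -1 * G b x + -1 * (G a x + -1 * G b x) + a * G a x + - b * G b x) +
       (t_ n)^-1 * (G a x + -1 * G b x + -1 * (Ga a (t_ n) x + -1 * Ga b (t_ n) x))).
    apply/funext => x; rewrite /wG /hG TT_lin ?(TT_Ga _ _ _ tn)//; [|exact: L2_Ga|exact: L2_Ga].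
    rewrite !add0r; move: (Ga a 0 x) (Ga b 0 x) (Ga a _ x) (Ga b _ x) (t_ n)^-1 => g1' g2' g3 g4 ti; ring.
  have E2 : m n = (fun z => (ms a 0 z + -1 * ms b 0 z + -1 * (ms a 0 z + -1 * ms b 0 z) + a * ms a 0 z + - b * ms b 0 z) +
       (t_ n)^-1 * (ms a 0 z + -1 * ms b 0 z + -1 * (ms a (t_ n) z + -1 * ms b (t_ n) z))).
    apply/funext => z; rewrite /m /c !msE oppr0 mul0r expR0 !mulNr.
    have az := addexp_gt0 z a0; have bz := addexp_gt0 z b0.
    by move: (expR (- _)) (kap z) az bz => u k az bz; field; rewrite !gt_eqF.
  by rewrite E1 E2; exact: W.
rewrite (_ : (fun n => _) = fun n => II leb (fun z => m n z ^+ 2)); last first.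
  by apply/funext => n; rewrite -ipff (SP_ip (S n) (S n)) ipff.
have mL n : L2 leb (m n) by have [[]] := S n.
pose g z := (b - a) ^+ 2 * (4 * pi)^-1 * (expR z / ((a + expR z) * (a + expR z))).
have ig_g : ig leb g by apply: igZ; exact: (int_resolvents a0 a0).1.
have bnd n z : 0 <= expR z - (t_ n)^-1 * (1 - expR (- (t_ n * expR z))) <= expR z /\
    expR z - (t_ n)^-1 * (1 - expR (- (t_ n * expR z))) <= t_ n * expR z ^+ 2.
  have tn := t0 n; have ez : 0 < expR z := expR_gt0 z.
  have [/andP[u1 u2] u3] := exp_sub_bounds (mulr_ge0 (ltW tn) (ltW ez)).
  have ti : 0 < (t_ n)^-1 by rewrite invr_gt0.
  move: u1 u2 u3; move: (1 - expR _) => v u1 u2 u3.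
  have e1 : (t_ n)^-1 * v <= expR z by rewrite mulrC ler_pdivrMr// mulrC.
  have e2 : 0 <= (t_ n)^-1 * v by rewrite mulr_ge0// ltW.
  split; first by apply/andP; split; lra.
  have -> : expR z - (t_ n)^-1 * v = (t_ n)^-1 * (t_ n * expR z - v) by field; rewrite gt_eqF.
  by rewrite mulrC ler_pdivrMr//; apply: le_trans u3 _; rewrite le_eqVlt; apply/orP; left; apply/eqP; ring.
have h : (fun n => II leb (fun z => m n z ^+ 2)) @ \oo --> II leb (fun=> 0); last by rewrite II0 in h.
apply: (@II_dct _ L R leb (fun n z => m n z ^+ 2) (fun=> 0) g _ _ _ _ _).2.
- by move=> n; apply: measurable_funX; case: (mL n).
- exact: measurable_cst.
- apply: filterE => z.
  have h : (fun n => m n z) @ \oo --> (0 : R).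
    apply: (@squeeze0 _ _ (fun n => `|c z| * (t_ n * expR z ^+ 2))).
      move=> n; rewrite /m normrM; apply: ler_wpM2l => //.
      have [/andP[u1 _] u2] := bnd n z; rewrite ler0_norm; lra.
    have := sqZ `|c z| (sqM tc (sqC (expR z ^+ 2))).
    by rewrite mul0r mulr0.
  by have := sqM h h; rewrite mulr0.
- exact: ig_g.
- move=> n z; rewrite ger0_norm ?sqr_ge0// /m exprMn.
  have az := addexp_gt0 z a0; have bz := addexp_gt0 z b0; have ez : 0 < expR z := expR_gt0 z.
  have -> : c z ^+ 2 = (b - a) ^+ 2 * (4 * pi)^-1 * (expR z / ((a + expR z) * (a + expR z))) * ((b + expR z) ^+ 2)^-1.
    have -> : c z ^+ 2 = kap z ^+ 2 * ((b - a) ^+ 2 / ((a + expR z) * (b + expR z)) ^+ 2).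
      by rewrite /c; move: (kap z) => k; field; rewrite !gt_eqF.
    rewrite kap2; have pp := pi_gt0 R; move: (expR z) pi az bz pp => E p az bz pp; field.
    by do ?(apply/andP; split); rewrite gt_eqF.
  rewrite -/(g z) -[leRHS]mulr1 -mulrA; apply: ler_wpM2l.
    rewrite /g; apply: mulr_ge0; first by rewrite mulr_ge0 ?sqr_ge0// invr_ge0 mulr_ge0 ?pi_ge0.
    by rewrite divr_ge0 ?(ltW ez)// mulr_ge0 ?ltW.
  rewrite mulrC ler_pdivrMr ?exprn_gt0// mul1r.
  have [/andP[u1 u2] _] := bnd n z; rewrite -sqrrN opprB ler_sqr ?nnegrE ?(ltW bz)//; lra.
Qed.

Lemma ip_wG_generator a b (t_ : nat -> R) phi : 0 < a -> 0 < b -> (forall n, 0 < t_ n) -> t_ @ \oo --> 0 ->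
  L2 mu phi ->
  (fun n => (t_ n)^-1 * (ip mu phi (wG a b) - ip mu phi (TT (t_ n) (wG a b)))) @ \oo --> ip mu phi (hG a b).
Proof.
move=> a0 b0 t0 tc pL; have wL := L2_wG a0 b0.
have TL n := L2_TT (t0 n) wL; have dL n := L2B wL (TL n).
have := nrm2_cvg0_ip (fun n => L2Z (t_ n)^-1 (dL n)) (L2_hG a0 b0) pL (wG_generator a0 b0 t0 tc).
rewrite (ipC mu (hG a b)); apply: sq_ext => n.
by rewrite (ipZl _ (dL n) pL) (ipBl wL (TL n) pL) !(ipC mu _ phi).
Qed.

(** In the expansion of D_t / (2 t) the cross term and the last square converge to pairings with
    [hG], so the pairing of the gradients is known without computing the gradient of [wG]. *)
Lemma HN_wG a b phi N (c : R) : 0 < a -> 0 < b -> HN phi N ->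
  HN (fun x => phi x + c * wG a b x)
     (N + 2 * c * ip mu phi (hG a b) + c ^+ 2 * ip mu (wG a b) (hG a b)).
Proof.
move=> a0 b0 h; have pL := HN_L2 h; have wL := L2_wG a0 b0.
apply: (HN_limit (L2D pL (L2Z c wL)) harm_gt0 (@cvg_harmonic R)).
have l1 := HN_cvg h harm_gt0 (@cvg_harmonic R).
have l2 := ip_wG_generator a0 b0 harm_gt0 (@cvg_harmonic R) pL.
have l3 := ip_wG_generator a0 b0 harm_gt0 (@cvg_harmonic R) wL.
have := sqD (sqD l1 (sqZ (2 * c) l2)) (sqZ (c ^+ 2) l3).
apply: sq_ext => n.
have tn := harm_gt0 n; rewrite dn_lin// (dnE tn wL) ipff.
move: (dn _ phi) (ip mu phi _) (ip mu phi _) (nrm2 mu _) (ip mu (wG a b) _) => x1 x2 x3 x4 x5.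
by move: (n.+1%:R^-1) tn => tau tn; field; rewrite gt_eqF.
Qed.

Lemma dn_Ga a t : 0 < a -> 0 < t ->
  dn t (G a) = II leb (fun z => 2 * (ms a 0 z ^+ 2 * (1 - expR (- (t * expR z))))).
Proof.
move=> a0 t0; have l0 : (0 : R) <= 0 by [].
have GL := L2_Ga a0 l0; have m0 := L2_ms a0 l0; have mt := L2_ms a0 (ltW t0).
have e : TT t (G a) = Ga a t by apply/funext => x; rewrite (TT_Ga x a0 l0 t0) add0r.
rewrite (dnE t0 GL) -ipff e.
rewrite (SP_ip (SP_Ga a0 l0) (SP_Ga a0 l0)) (SP_ip (SP_Ga a0 l0) (SP_Ga a0 (ltW t0))).
rewrite -(ipBr m0 mt m0) -IIZ; last exact: (L2_mul m0 (L2B m0 mt)).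
congr (II leb); apply/funext => z; rewrite !msE oppr0 mul0r expR0 mulNr.
by move: (expR _) (kap z) (a + _)^-1 => u k d; ring.
Qed.

(* Log-divergence of the gradient energy: the Fourier transform of G_a decays
   like |xi|^-2 only. *)
Lemma G_notin_H1 a N : 0 < a -> ~ HN (G a) N.
Proof.
move=> a0 h; have N0 := HN_ge0 h; have l0 : (0 : R) <= 0 by [].
pose f z := ms a 0 z ^+ 2 * expR z.
pose f_ (n : nat) z := ms a 0 z ^+ 2 * (n.+1%:R * (1 - expR (- (n.+1%:R^-1 * expR z)))).
have mE : measurable_fun [set: L] (@expR R) by exact: measurable_expR.
have mm : measurable_fun [set: L] (fun z => ms a 0 z ^+ 2) by apply: measurable_funX; exact: mms.
have me n : measurable_fun [set: L] (fun z => 1 - expR (- (n.+1%:R^-1 * expR z)) : R).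
  apply: measurable_funB => //; apply: measurableT_comp => //; apply: measurableT_comp => //.
  exact: measurable_funM.
have pos n (z : R) : 0 <= n.+1%:R^-1 * expR z by rewrite mulr_ge0 ?expR_ge0.
have F : (\int[leb]_z (f z)%:E <= N%:E)%E.
  apply: (@fatou_ae _ _ _ leb f_ f (fun=> N) N).
  - by move=> n; apply: measurable_funM => //; exact: measurable_funM.
  - exact: measurable_funM.
  - move=> n z; have [/andP[u _] _] := exp_sub_bounds (pos n z).
    by rewrite mulr_ge0 ?sqr_ge0// mulr_ge0.
  - by move=> z; rewrite mulr_ge0 ?sqr_ge0 ?expR_ge0.
  - apply: filterE => z; apply: sqM; first exact: sqC.
    apply: (@harmonic_squeeze _ _ _ (expR z ^+ 2)) => n.
    have [/andP[u1 u2] u3] := exp_sub_bounds (pos n z).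
    have e : n.+1%:R * (n.+1%:R^-1 * expR z) = expR z by rewrite mulrA divff ?mul1r.
    have n0 : 0 < n.+1%:R :> R by [].
    move: (1 - expR _) u1 u2 u3 => v u1 u2 u3.
    have -> : n.+1%:R * v - expR z = n.+1%:R * (v - n.+1%:R^-1 * expR z) by rewrite mulrBr e.
    rewrite normrM ger0_norm// mulrC ler0_norm ?subr_le0//.
    rewrite opprB; apply: le_trans (_ : (n.+1%:R^-1 * expR z) ^+ 2 * n.+1%:R <= _).
      exact: (ler_wpM2r (ltW n0) u3).
    by rewrite le_eqVlt; apply/orP; left; apply/eqP; field.
  - move=> n; have tn := harm_gt0 n.
    have i : ig leb (f_ n).
      apply: (ig_le _ _ (igZ n.+1%:R (L2_ms a0 l0).2)).
        by apply: measurable_funM => //; exact: measurable_funM.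
      move=> z; have [/andP[u1 u2] _] := exp_sub_bounds (pos n z).
      rewrite ger0_norm; last by rewrite mulr_ge0 ?sqr_ge0// mulr_ge0.
      rewrite /f_ [leRHS]mulrC; apply: ler_wpM2l; first exact: sqr_ge0.
      by rewrite -[leRHS]mulr1; apply: ler_wpM2l => //; rewrite lerBlDr lerDl expR_ge0.
    rewrite (EFin_II i) lee_fin; have := HN_le h tn; rewrite dn_Ga//.
    rewrite (_ : II leb (f_ n) = n.+1%:R * 2^-1 * II leb (fun z => 2 * (ms a 0 z ^+ 2 * (1 - expR (- (n.+1%:R^-1 * expR z)))))).
      rewrite -[2 * n.+1%:R^-1]invrK => k; rewrite mulrC; move: k.
      by rewrite -ler_pdivrMl ?invr_gt0 ?mulr_gt0// => k; apply: le_trans k; rewrite le_eqVlt; apply/orP; left; apply/eqP; field.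
    have i2 : ig leb (fun z => 2 * (ms a 0 z ^+ 2 * (1 - expR (- (n.+1%:R^-1 * expR z))))).
      by have := igZ (2 * n.+1%:R^-1) i; congr (ig leb); apply/funext => z; rewrite /f_; field.
    by rewrite -IIZ//; congr (II leb); apply/funext => z; rewrite /f_; field.
  - exact: sqC.
(* For z >= 0 the spectral density [f] of the gradient energy is at least c, so its integral over
   [0, n] is at least c n. *)
pose c := (4 * pi)^-1 / (a + 1) ^+ 2 : R.
have c0 : 0 < c by rewrite divr_gt0 ?exprn_gt0 ?addr_gt0// invr_gt0 mulr_gt0 ?pi_gt0.
have [n nN] : exists n : nat, N < c * n%:R.
  exists (Num.bound (N / c)); rewrite mulrC -ltr_pdivrMr//.
  by apply: archi_boundP; rewrite divr_ge0// ltW.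
have mI : measurable (`[0 : R, n%:R]%classic : set L) by exact: measurable_itv.
have : ((c * n%:R)%:E <= \int[leb]_z (f z)%:E)%E.
  apply: (@le_trans _ _ (\int[leb]_z (c * \1_(`[0, n%:R]%classic) z)%:E)%E).
    have lm : leb (`[0 : R, n%:R]%classic : set L) = n%:R%:E.
      rewrite lebesgue_measure_itv/= lte_fin; case: ltP => [_|n0]; first by rewrite sube0.
      by have -> : n%:R = 0 :> R by apply/eqP; rewrite eq_le n0/=.
    rewrite (int_Zl leb (measurable_indic mI) _ (ltW c0)); last by move=> z; rewrite indicE.
    have ei : (\int[leb]_x (\1_(`[0, n%:R]%classic : set L) x)%:E = n%:R%:E)%E.
      by rewrite integral_indic// setIT; exact: lm.
    by rewrite ei EFinM.
  apply: ge0_le_integral => //.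
  - by move=> z _; rewrite lee_fin mulr_ge0// ltW.
  - by apply/measurable_EFinP; apply: measurable_funM => //; exact: measurable_indic.
  - by apply/measurable_EFinP; exact: measurable_funM.
  move=> z _; rewrite lee_fin indicE; case: (boolP (z \in _)) => [|_]; last first.
    by rewrite mulr0 mulr_ge0 ?sqr_ge0 ?expR_ge0.
  rewrite inE/= in_itv/= => /andP[z0 _].
  have e1 : 1 <= expR z by rewrite -expR0 ler_expR.
  rewrite mulr1 /f expr2 ms_mul// addr0 oppr0 mul0r expR0 mulr1 /c.
  have e0 := expR_gt0 z; have az := addexp_gt0 z a0.
  rewrite -!mulrA; apply: ler_wpM2l; first by rewrite invr_ge0 mulr_ge0 ?pi_ge0.
  move: (expR z) e0 e1 az => E e0 e1 az.
  have -> : E * (((a + E) * (a + E))^-1 * E) = (E / (a + E)) ^+ 2 by field; rewrite gt_eqF.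
  have a1 : 0 < a + 1 by rewrite addr_gt0.
  rewrite -exprVn ler_sqr ?nnegrE ?invr_ge0 ?divr_ge0 ?(ltW e0) ?(ltW az) ?(ltW a1)//.
  by rewrite ler_pdivlMr// mulrC ler_pdivrMr//; nra.
by move=> h2; have := le_trans h2 F; rewrite lee_fin => h3; lra.
Qed.

(** Interpolation: 1 - e^(-y) <= y^delta for 0 < delta < 1, and the remaining spectral integral
    converges because delta < 1. *)
Lemma dn_Ga_powR a (del : R) : 0 < a -> 0 < del < 1 -> exists C, 0 <= C /\
  forall t, 0 < t -> dn t (G a) <= C * t `^ del.
Proof.
move=> a0 /andP[d0 d1]; have l0 : (0 : R) <= 0 by [].
have k0 : 0 < 1 - del by lra.
pose S z := expR ((1 - del) * z) / (1 + expR ((1 - del) * z)) ^+ 2.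
(* The factor a^-1 + 2 is a constant for e^(delta z) (1 + e^((1 - delta) z)) <= (a^-1 + 2) (a +
   e^z). *)
pose K := 2 * ((4 * pi)^-1 * (a^-1 + 2) ^+ 2).
have K0 : 0 <= K.
  rewrite /K; apply: mulr_ge0 => //; apply: mulr_ge0; last exact: sqr_ge0.
  by rewrite invr_ge0 mulr_ge0 ?pi_ge0.
have iS : ig leb S by exact: ig_sech.
have S0 z : 0 <= S z by rewrite divr_ge0 ?sqr_ge0 ?expR_ge0.
exists (K * II leb S); split; first by rewrite mulr_ge0// II_ge0.
move=> t t0; rewrite dn_Ga// mulrAC -IIZ//.
have pos (z : R) : 0 <= t * expR z by rewrite mulr_ge0 ?expR_ge0 ?ltW.
have p0 : 0 < 4 * pi :> R by rewrite mulr_gt0 ?pi_gt0.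
have B z : 2 * (ms a 0 z ^+ 2 * (1 - expR (- (t * expR z)))) <= K * t `^ del * S z.
  have [/andP[u1 u2] _] := exp_sub_bounds (pos z).
  have u3 : 1 - expR (- (t * expR z)) <= 1 by rewrite lerBlDr lerDl expR_ge0.
  have y0 : 0 < t * expR z by rewrite mulr_gt0 ?expR_gt0.
  have u4 : 1 - expR (- (t * expR z)) <= t `^ del * expR (del * z).
    have -> : t `^ del * expR (del * z) = (t * expR z) `^ del.
      by rewrite powRM ?(ltW t0) ?expR_ge0// /powR (gt_eqF (expR_gt0 z)) expRK.
    have [y1|y1] := leP (t * expR z) 1.
      apply: le_trans u2 _; rewrite -[leLHS]powRr1; last exact: ltW.
      by apply: ger_powR; rewrite ?y0 ?y1// ltW.
    have e1 : (1 : R) `^ del = 1 by rewrite powR1.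
    apply: le_trans u3 _; rewrite -[leLHS]e1.
    by apply: ge0_ler_powR; rewrite ?nnegrE ?ler01 ?(ltW d0) ?(ltW y0) ?(ltW y1).
  have -> : K * t `^ del * S z = 2 * ((4 * pi)^-1 * ((a^-1 + 2) ^+ 2 * (t `^ del * S z))).
    by rewrite /K; move: (_ `^ _) (S z) (_^-1) (a^-1 + 2) => u v u' v'; ring.
  have ems : ms a 0 z ^+ 2 = (4 * pi)^-1 * (expR z / ((a + expR z) * (a + expR z))).
    by rewrite expr2 ms_mul// addr0 oppr0 mul0r expR0 mulr1 -mulrA.
  apply: ler_wpM2l => //; rewrite ems -mulrA.
  apply: ler_wpM2l; first by rewrite invr_ge0 ltW.
  have az := addexp_gt0 z a0; have ez := expR_gt0 z.
  set E := expR z in az ez *; set H := expR (del * z) in u4.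
  set W := expR ((1 - del) * z).
  have H0 : 0 < H := expR_gt0 _; have W0 : 0 < W := expR_gt0 _.
  have HW : H * W = E by rewrite -expRD; congr expR; ring.
  apply: (@le_trans _ _ (E / ((a + E) * (a + E)) * (t `^ del * H))).
    by apply: ler_wpM2l => //; rewrite divr_ge0 ?(ltW ez)// mulr_ge0 ?ltW.
  rewrite [leRHS]mulrCA [leLHS]mulrCA; apply: ler_wpM2l; first exact: powR_ge0.
  rewrite /S -/W; have -> : E / ((a + E) * (a + E)) * H = W * (H / (a + E)) ^+ 2.
    by rewrite -HW; field; rewrite HW gt_eqF.
  rewrite [leRHS]mulrCA; apply: ler_wpM2l; first exact: ltW.
  rewrite -exprVn -exprMn ler_sqr ?nnegrE ?divr_ge0 ?addr_ge0 ?invr_ge0 ?(ltW H0) ?(ltW a0) ?(ltW ez) ?(ltW W0)//.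
  have W1 : 0 < 1 + W by rewrite addr_gt0.
  rewrite ler_pdivrMr// mulrAC ler_pdivlMr// mulrDr mulr1 HW.
  have HE : H <= 1 + E.
    have [z0|z0] := leP 0 z.
      have : H <= E by rewrite ler_expR; nra.
      lra.
    have : H <= 1 by rewrite -expR0 ler_expR; nra.
    lra.
  have -> : (a^-1 + 2) * (a + E) = 1 + E / a + 2 * a + 2 * E by field; rewrite gt_eqF.
  have : 0 <= E / a by rewrite divr_ge0 ?ltW.
  lra.
have i := igZ (K * t `^ del) iS.
apply: II_le => //; apply: (ig_le _ _ i).
  apply: measurable_funM => //; apply: measurable_funM; first by apply: measurable_funX; exact: mms.
  apply: measurable_funB => //; apply: measurableT_comp; first exact: measurable_expR.
  by apply: measurableT_comp => //; apply: measurable_funM => //; exact: measurable_expR.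
move=> z; rewrite ger0_norm; first exact: B.
have [/andP[u1 _] _] := exp_sub_bounds (pos z).
by apply: mulr_ge0 => //; apply: mulr_ge0 => //; exact: sqr_ge0.
Qed.

End finite_energy.

(** * Compactness and power integrals *)

Section tail.
Context {R : realType}.
Local Notation P := (mplane R).
Local Notation mu := (leb2 R).

Lemma powR_sub2 (x p : R) : 0 <= x -> 2 < p -> x `^ p = x `^ (p - 2) * x ^+ 2.
Proof.
move=> x0 p2; have [->|nx] := eqVneq x 0.
  by rewrite powR0 ?expr0n ?mulr0// gt_eqF//; lra.
rewrite -powR_mulrn// -powRD; last by rewrite nx implybT.
by congr (_ `^ _); lra.
Qed.

Lemma powR_mono (x y e : R) : 0 <= e -> 0 <= x -> x <= y -> x `^ e <= y `^ e.
Proof. by move=> e0 x0 xy; apply: ge0_ler_powR; rewrite ?nnegrE// (le_trans x0). Qed.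

Lemma mpowR (v : P -> R) (p : R) : mf v -> mf (fun x => `|v x| `^ p).
Proof.
move=> mv; apply: (measurableT_comp (f := fun y => y `^ p)); first exact: measurable_powR.
exact: measurableT_comp.
Qed.

Lemma mlevel (v : P -> R) (c : R) : mf v -> measurable [set x : P | `|v x| <= c].
Proof.
move=> mv; have mN : mf (fun x => `|v x|) by exact: measurableT_comp.
have := mN measurableT `]-oo, c]%classic (measurable_itv _); rewrite setTI.
by congr (measurable _); apply/seteqP; split => x /=; rewrite in_itv/=.
Qed.

(** Dyadic levels l_n = 2^n l0. At the time where eta / t = (l_n / 2)^2 the heat flow is at most l_n
    / 2, so that |v| <= 2 |v - TT t v| where l_n < |v| <= 2 l_n; the L^2 norm of v - TT t v is
    controlled by D_t(v) <= N t^delta. The contributions of the levels are geometric of ratio 2^(p -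
    2 - 2 delta) < 1. The parameter eta is a mass bound in [pB_coercive] and a small quantity in
    [pB_vanishing]. *)
Lemma tail_bound (p del : R) : 2 < p -> 0 < del -> p - 2 < 2 * del -> exists C, 0 <= C /\
  forall (v : P -> R) (eta N l0 : R), L2 mu v -> 0 < eta -> 0 <= N -> 0 < l0 -> 4 * eta <= l0 ^+ 2 ->
  (forall t x, 0 < t <= 1 -> TT t v x ^+ 2 <= eta / t) ->
  (forall t, 0 < t <= 1 -> dn t v <= N * t `^ del) ->
  (\int[mu]_x (`|v x| `^ p)%:E <=
    (l0 `^ (p - 2) * nrm2 mu v + C * (l0 `^ (p - 2 - 2 * del) * (eta `^ del * N)))%:E)%E.
Proof.
move=> p2 d0 pd; set e := p - 2 - 2 * del; have e0 : e < 0 by rewrite /e; lra.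
pose r : R := 2 `^ e; have r0 : 0 < r by exact: powR_gt0.
have l2 : 0 < ln 2 :> R by apply: ln_gt0; lra.
have r1 : r < 1.
  rewrite /r /powR gt_eqF// -[ltRHS]expR0 ltr_expR; move: (ln 2) e0 l2; clear => q e0 l2; nra.
pose K : R := 4 * (2 `^ (p - 2) * 4 `^ del).
have K0 : 0 <= K by rewrite !mulr_ge0 ?powR_ge0.
exists (K / (1 - r)); split; first by rewrite divr_ge0// subr_ge0 ltW.
move=> v eta N l0 vL eta0 N0 l00 le Hx Hd; have mv := vL.1.
pose l n : R := l0 * 2 ^+ n.
have l_gt n : 0 < l n by rewrite mulr_gt0 ?exprn_gt0.
have l_ge n : l0 <= l n by rewrite ler_peMr ?(ltW l00)// exprn_ege1// ler1n.
pose f n x := `|v x| `^ p * \1_[set x : P | `|v x| <= l n] x.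
have fE n x : f n x = if `|v x| <= l n then `|v x| `^ p else 0.
  rewrite /f indicE; case: ifPn => h; first by rewrite mem_set// mulr1.
  by rewrite memNset ?mulr0//; apply/negP.
have f0 n x : 0 <= f n x by rewrite mulr_ge0 ?powR_ge0.
have mfn n : mf (f n) by apply: measurable_funM; [exact: mpowR|apply: measurable_indic; exact: mlevel].
have fb n x : f n x <= l n `^ (p - 2) * v x ^+ 2.
  rewrite fE; case: ifP => h; last by rewrite mulr_ge0 ?powR_ge0 ?sqr_ge0.
  rewrite powR_sub2// real_normK ?num_real//; apply: ler_wpM2r; first exact: sqr_ge0.
  by apply: powR_mono => //; lra.
have fi n : ig mu (f n).
  by apply: (ig_le _ _ (igZ (l n `^ (p - 2)) vL.2)) => // x; rewrite ger0_norm.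
pose D : R := l0 `^ e * (eta `^ del * N).
have D0 : 0 <= D by rewrite !mulr_ge0 ?powR_ge0.
have ind n : II mu (f n) <= l0 `^ (p - 2) * nrm2 mu v + K * D * ((1 - r ^+ n) / (1 - r)).
  elim: n => [|n IH].
    rewrite expr0 subrr mul0r mulr0 addr0 /nrm2 -IIZ; last exact: vL.2.
    by apply: II_le => //; [apply: igZ; exact: vL.2|move=> x; have := fb 0%N x; rewrite /l expr0 mulr1].
  (* The time at which eta / t = (l n / 2)^2; the hypothesis on l0 makes it at most 1. *)
  pose t := 4 * eta / l n ^+ 2.
  have t0 : 0 < t by rewrite divr_gt0 ?mulr_gt0 ?exprn_gt0.
  have t1 : t <= 1.
    rewrite ler_pdivrMr ?exprn_gt0// mul1r; apply: (le_trans le).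
    by rewrite ler_sqr ?nnegrE ?(ltW l00) ?(ltW (l_gt n)).
  have tt : 0 < t <= 1 by rewrite t0.
  have [hL hd] := nrm2_sub_TT t0 vL.
  have pt x : f n.+1 x <= f n x + (2 * l n) `^ (p - 2) * 4 * (v x - TT t v x) ^+ 2.
    have z := mulr_ge0 (mulr_ge0 (powR_ge0 (2 * l n) (p - 2)) (ler0n R 4)) (sqr_ge0 (v x - TT t v x)).
    rewrite !fE; case: ifPn => h1; case: ifPn => h2; try lra.
    - have h3 : `|v x| <= 2 * l n by rewrite (le_trans h1)// /l exprS; lra.
      rewrite add0r powR_sub2// -mulrA; apply: ler_pM; rewrite ?powR_ge0 ?sqr_ge0//.
        by apply: powR_mono => //; lra.
      have h5 : TT t v x ^+ 2 <= (l n / 2) ^+ 2.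
        have -> : (l n / 2) ^+ 2 = eta / t; last exact: Hx.
        by rewrite /t; have := l_gt n; move: (l n) => q q0; field; rewrite !gt_eqF.
      have := l_gt n; rewrite -ltNge in h2; move: (TT t v x) (l n) (v x) h5 h2 {z h1 h3}; clear.
      move=> T q w h5 h2 q0; have h6 : `|T| <= q / 2.
        rewrite -ler_sqr ?nnegrE ?divr_ge0 ?(ltW q0)//.
        by rewrite real_normK ?num_real.
      have h7 : `|w| <= 2 * `|w - T|.
        have := ler_normD (w - T) T; rewrite subrK; lra.
      have : `|w| ^+ 2 <= (2 * `|w - T|) ^+ 2 by rewrite ler_sqr ?nnegrE ?mulr_ge0.
      rewrite -[(w - T) ^+ 2]real_normK ?num_real//; move: `|w| `|w - T| => x y; lra.
    - by have := powR_ge0 `|v x| p; lra.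
  have i2 := igZ ((2 * l n) `^ (p - 2) * 4) hL.2.
  apply: (le_trans (II_le (fi n.+1) (igD (fi n) i2) pt)).
  rewrite IID// IIZ; last exact: hL.2.
  have E : (2 * l n) `^ (p - 2) * 4 * (N * t `^ del) = K * D * r ^+ n.
    have -> : t `^ del = 4 `^ del * eta `^ del * l n `^ (- 2 * del).
      have -> : t = 4 * eta * (l n `^ (-2)) by rewrite /t powRN -powR_mulrn// ltW.
      by rewrite powRM ?powR_ge0 ?mulr_ge0 ?(ltW eta0)// powRM ?(ltW eta0)// -powRrM.
    rewrite powRM ?(ltW (l_gt n))//.
    have -> : r ^+ n = (2 ^+ n) `^ e by rewrite -powR_mulrn ?powR_ge0// /r -powRrM mulrC powRrM powR_mulrn.
    have le' : l n `^ (p - 2) * l n `^ (- 2 * del) = l0 `^ e * (2 ^+ n) `^ e.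
      rewrite -powRM ?exprn_ge0 ?(ltW l00)// -powRD; last by rewrite (gt_eqF (l_gt n)) implybT.
      by congr (_ `^ _); rewrite /e; clear; lra.
    rewrite /K /D; transitivity (4 * (2 `^ (p - 2) * 4 `^ del) * (eta `^ del * N) * (l n `^ (p - 2) * l n `^ (- 2 * del))).
      by move: (2 `^ (p - 2)) (4 `^ del) (eta `^ del) (l n `^ (p - 2)) (l n `^ (- 2 * del)) => x1 x2 x3 x4 x5; ring.
    by rewrite le'; move: (2 `^ (p - 2)) (4 `^ del) (eta `^ del) (l0 `^ e) ((2 ^+ n) `^ e) => x1 x2 x3 x4 x5; ring.
  have h1 : (2 * l n) `^ (p - 2) * 4 * II mu (fun x => (v x - TT t v x) ^+ 2) <= K * D * r ^+ n.
    rewrite -E; apply: ler_wpM2l; first by rewrite mulr_ge0 ?powR_ge0.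
    by apply: (le_trans hd); exact: Hd.
  have h2 : (1 - r ^+ n.+1) / (1 - r) = (1 - r ^+ n) / (1 - r) + r ^+ n.
    by rewrite exprS; field; rewrite subr_eq0 gt_eqF.
  by rewrite h2 mulrDr; lra.
have bd n : (\int[mu]_x (f n x)%:E <= (l0 `^ (p - 2) * nrm2 mu v + K / (1 - r) * D)%:E)%E.
  rewrite (EFin_II (fi n)) lee_fin; apply: (le_trans (ind n)); rewrite lerD2l.
  rewrite [leRHS]mulrAC; have r1' : 0 < 1 - r by lra.
  rewrite [leLHS]mulrA ler_pM2r ?invr_gt0//; apply: ler_piMr; first exact: mulr_ge0 K0 D0.
  by rewrite lerBlDr lerDl exprn_ge0// ltW.
apply: (@fatou_ae _ _ R mu f (fun x => `|v x| `^ p) _ _ _ _ _ _ _ bd (sqC _)) => //.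
- exact: mpowR.
- apply: filterE => x.
  have [k kx] : exists k : nat, `|v x| <= l k.
    exists (Num.bound (`|v x| / l0)); rewrite /l mulrC -ler_pdivrMr//.
    have /archi_boundP/ltW h : 0 <= `|v x| / l0 by rewrite divr_ge0// ltW.
    apply: (le_trans h); rewrite -natrX ler_nat; exact: ltnW (ltn_expl _ _).
  apply/cvg_seqP => eps eps0; exists k => n kn; rewrite fE (_ : (`|v x| <= l n)) ?subrr ?normr0 ?(ltW eps0)//.
  by apply: (le_trans kx); rewrite ler_pM2l// ler_weXn2l// ler1n.
Qed.

End tail.

(** * Local compactness of bounded sequences *)

Section rellich.
Context {R : realType}.
Local Notation P := (mplane R).
Local Notation mu := (leb2 R).
Let o : P := (0, 0).

Lemma four_sq (a a' b c d : R) :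
  (a - a') ^+ 2 <= 4 * ((a - b) ^+ 2 + (a' - c) ^+ 2 + ((b - d) ^+ 2 + (c - d) ^+ 2)).
Proof.
have -> : a - a' = (a - b) + (b - d) - (c - d) - (a' - c) by ring.
move: (a - b) (b - d) (c - d) (a' - c) => x1 x2 x3 x4.
have := sqr_ge0 (x1 - x2); have := sqr_ge0 (x1 + x3); have := sqr_ge0 (x1 + x4).
have := sqr_ge0 (x2 + x3); have := sqr_ge0 (x2 + x4); have := sqr_ge0 (x3 - x4).
rewrite !expr2; lra.
Qed.

Lemma real_cauchy (u : nat -> R) :
  (forall e, 0 < e -> exists N, forall n, (N <= n)%N -> `|u n - u N| <= e) -> cvgn u.
Proof.
move=> h; apply/cauchy_cvgP; apply: cauchy_exP => e e0.
have [N hN] := h _ (divr_gt0 e0 (ltr0Sn R 1)); exists (u N); exists N => //= n /hN {}hN.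
by rewrite /ball/= distrC (le_lt_trans hN)//; lra.
Qed.

(** By Tychonoff's theorem the sequence of all coordinates has a cluster point; neighbourhoods
    controlling the first k coordinates up to 1/(k + 1) then select the indices. *)
Lemma diagonal_subsequence (g : nat -> nat -> R) (C : nat -> R) : (forall j n, `|g j n| <= C j) ->
  exists s : nat -> nat, (forall n, (n <= s n)%N) /\ forall j, cvgn (fun n => g j (s n)).
Proof.
move=> gC; pose A j : set R := `[- C j, C j]%classic.
have cA j : compact (A j) by exact: segment_compact.
have K := @tychonoff nat (fun=> R) A cA.
pose F := (fun n => (fun j => g j n) : prod_topology (fun=> R)) @ \oo.
have FA : F [set f : prod_topology (fun=> R) | forall i, A i (f i)].
  by exists 0%N => // n _ i /=; rewrite /A /= in_itv/= -ler_norml.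
have [y [_ cy]] := K F _ FA.
have nb k e : 0 < e -> nbhs (y : prod_topology (fun=> R)) [set z : prod_topology (fun=> R) | forall j, (j < k)%N -> `|y j - z j| < e].
  move=> e0; elim: k => [|k IH]; first by apply: filterE.
  have H : nbhs (y : prod_topology (fun=> R)) [set z : prod_topology (fun=> R) | `|y k - z k| < e].
    have := @proj_continuous nat (fun=> R) k y [set r | `|y k - r| < e].
    by apply; apply/nbhs_ballP; exists e.
  apply: filterS (filterI IH H) => z [h1 h2] j; rewrite ltnS leq_eqVlt => /orP[/eqP ->//|]; exact: h1.
have ex k : exists n, (k <= n)%N /\ forall j, (j < k)%N -> `|y j - g j n| < k.+1%:R^-1.
  have FT : F [set z | exists2 n, (k <= n)%N & z = (fun j => g j n)].
    by exists k => // n /= kn; exists n.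
  have [z [[n kn ->] h]] := cy _ _ FT (nb k k.+1%:R^-1 ltac:(by rewrite invr_gt0)).
  by exists n.
have [s sP] := choice ex; exists s; split; first by move=> n; have [] := sP n.
move=> j; apply/cvg_ex; exists (y j); apply/cvg_seqP => e e0.
have [N [_ hN]] : exists N : nat, (0 <= N)%N /\ N.+1%:R^-1 <= e.
  exists (Num.bound e^-1); split=> //; rewrite -[leRHS]invrK lef_pV2 ?posrE ?invr_gt0//.
  have := archi_boundP (ltW (_ : 0 < e^-1)); rewrite invr_gt0 => /(_ e0) /ltW h.
  by apply: (le_trans h); rewrite ler_nat.
exists (maxn N j.+1) => n; rewrite geq_max => /andP[Nn jn].
have [_ /(_ j jn) h] := sP n; rewrite distrC (le_trans (ltW h))//; apply: le_trans hN.
by rewrite lef_pV2 ?posrE// ler_nat.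
Qed.

(** The L^2 distance between two translates of the kernel is explicit by the semigroup law, and 1 -
    e^(-u) <= u. *)
Lemma TT_lipschitz t (f : P -> R) x y : 0 < t -> L2 mu f ->
  (TT t f x - TT t f y) ^+ 2 <= nrm2 mu f * (d2 x y / (32 * pi * t ^+ 2)).
Proof.
move=> t0 fL; have kx := L2_kk x t0; have ky := L2_kk y t0.
rewrite /TT -(ipBl kx ky fL); apply: le_trans (cauchy_schwarz (L2B kx ky) fL) _.
rewrite mulrC; apply: ler_wpM2l; first exact: nrm2_ge0.
rewrite (nrm2B kx ky) !nrm2_kk// ip_kk// kkE ?addr_gt0//.
have p0 := pi_gt0 R; have := d2_ge0 x y; move: (d2 x y) => d d0.
have := expR_ge1Dx (- d / (4 * (t + t))); move: (expR _) => E hE.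
have -> : (8 * pi * t)^-1 - 2 * ((4 * pi * (t + t))^-1 * E) + (8 * pi * t)^-1 = (4 * pi * t)^-1 * (1 - E).
  by move: pi p0 => p p0; field; rewrite !gt_eqF ?addr_gt0.
have -> : d / (32 * pi * t ^+ 2) = (4 * pi * t)^-1 * (d / (4 * (t + t))).
  by move: pi p0 => p p0; field; rewrite !gt_eqF ?addr_gt0.
apply: ler_wpM2l; first by rewrite invr_ge0 !mulr_ge0 ?pi_ge0 ?ltW.
by rewrite lerBlDr addrC -lerBlDr; rewrite mulNr in hE; lra.
Qed.

Lemma rational_near (x : P) (e : R) : 0 < e -> exists q : rat * rat, d2 x (ratr q.1, ratr q.2) <= e.
Proof.
move=> e0; pose d := Num.min 1 (e / 2).
have d0 : 0 < d by rewrite lt_min ltr01 divr_gt0.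
have [d1 d2'] : d <= 1 /\ d <= e / 2 by split; rewrite ge_min lexx ?orbT.
have [q1] : exists q, ratr q \in `](x.1 : R), (x.1 + d)[ by apply: rat_in_itvoo; rewrite ltrDl.
have [q2] : exists q, ratr q \in `](x.2 : R), (x.2 + d)[ by apply: rat_in_itvoo; rewrite ltrDl.
rewrite !in_itv/= => /andP[a1 a2] /andP[b1 b2]; exists (q1, q2); rewrite /d2 /=.
nra.
Qed.

(** At each time 1/(i + 1) the heat flows are equi-Lipschitz, so a diagonal subsequence converging
    at rational points converges everywhere. The f_n stay within O(t) of their flows in squared
    norm, hence are Cauchy for the weight k_1, which makes bounded functions integrable. *)
Lemma rellich (f_ : nat -> P -> R) (M : R) : (forall n, L2 mu (f_ n)) ->
  (forall n, nrm2 mu (f_ n) <= M) -> (forall n t, 0 < t -> dn t (f_ n) <= 2 * t * M) ->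
  exists (s : nat -> nat) (f : P -> R), [/\ forall n, (n <= s n)%N, L2 mu f,
    {ae mu, forall x, (fun n => f_ (s n) x) @ \oo --> f x} &
    (fun n => II mu (fun x => kk 1 o x * (f_ (s n) x - f x) ^+ 2)) @ \oo --> 0].
Proof.
move=> fL fM fD; have M0 : 0 <= M := le_trans (nrm2_ge0 _ _) (fM 0%N).
pose tm (i : nat) : R := i.+1%:R^-1; have tm0 i : 0 < tm i by rewrite invr_gt0.
pose dec j : nat * (rat * rat) := if unpickle j is Some z then z else (0%N, (0, 0)).
pose pt (q : rat * rat) : P := (ratr q.1, ratr q.2).
pose g j n := TT (tm (dec j).1) (f_ n) (pt (dec j).2).
have gC j n : `|g j n| <= Num.sqrt ((8 * pi * tm (dec j).1)^-1 * M).
  rewrite -(ler_sqr (x := `|_|)) ?nnegrE ?sqrtr_ge0// real_normK ?num_real// sqr_sqrtr; last first.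
    by rewrite mulr_ge0// invr_ge0 !mulr_ge0 ?pi_ge0 ?(ltW (tm0 _)).
  apply: le_trans (TT_sqr_le _ (tm0 _) (fL n)) _; apply: ler_wpM2l => //.
  by rewrite invr_ge0 !mulr_ge0 ?pi_ge0 ?(ltW (tm0 _)).
have [s1 [s1n s1c]] := diagonal_subsequence gC.
pose h n := f_ (s1 n).
have hL n : L2 mu (h n) by exact: fL.
have cvT i x : cvgn (fun n => TT (tm i) (h n) x).
  apply: real_cauchy => e e0; have e3 : 0 < e / 3 by lra.
  pose K := (M + 1) / (32 * pi * tm i ^+ 2).
  have K0 : 0 < K by rewrite divr_gt0 ?mulr_gt0 ?pi_gt0 ?exprn_gt0//; lra.
  have eK : 0 < (e / 3) ^+ 2 / K by rewrite divr_gt0 ?exprn_gt0.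
  have [q hq] := rational_near x eK.
  have close n : `|TT (tm i) (h n) x - TT (tm i) (h n) (pt q)| <= e / 3.
    rewrite -ler_sqr ?nnegrE ?(ltW e3)// real_normK ?num_real//.
    apply: le_trans (TT_lipschitz x (pt q) (tm0 i) (hL n)) _.
    rewrite -[leRHS](divfK (lt0r_neq0 K0)); apply: (@le_trans _ _ (d2 x (pt q) * K)).
      rewrite mulrCA; apply: ler_wpM2l; first exact: d2_ge0.
      apply: ler_wpM2r; first by rewrite invr_ge0 !mulr_ge0 ?pi_ge0 ?exprn_ge0 ?(ltW (tm0 i)).
      by have := fM (s1 n); rewrite -/(h n); lra.
    by apply: ler_wpM2r => //; exact: ltW.
  have := s1c (pickle (i, q)); rewrite /g /dec pickleK /= => /cvg_ex[l /cvg_seqP hl].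
  have [N hN] := hl (e / 6) ltac:(lra); exists N => n Nn.
  have := hN _ Nn; have := hN _ (leqnn N); have := close n; have := close N.
  rewrite -!/(h _) !ler_norml; clear; move: (TT _ _ _) (TT _ _ _) (TT _ _ _) (TT _ _ _) => a b c d.
  by move=> /andP[? ?] /andP[? ?] /andP[? ?] /andP[? ?]; apply/andP; split; lra.
have W0 x : 0 < kk 1 o x by exact: kk_gt0.
have mW : mf (kk 1 o) by exact: mkk1.
have W1 x : kk 1 o x <= 1.
  apply: le_trans (kk_le _ _ ltr01) _; rewrite mulr1 -invr1 lef_pV2 ?posrE ?mulr_gt0 ?pi_gt0//.
  by have := pi_ge2 R; lra.
have igW (u : P -> R) : L2 mu u -> ig mu (fun x => kk 1 o x * u x ^+ 2).
  by move=> uL; apply: ig_kkM => //; exact: uL.2.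
have WL (u : P -> R) : L2 mu u -> II mu (fun x => kk 1 o x * u x ^+ 2) <= nrm2 mu u.
  move=> uL; apply: II_le; [exact: igW|exact: uL.2|move=> x].
  by rewrite ler_piMl ?sqr_ge0.
have cau e : 0 < e -> exists N, forall n m, (N <= n)%N -> (N <= m)%N ->
    II mu (fun x => kk 1 o x * (h n x - h m x) ^+ 2) <= e.
  (* The time is chosen so small that f_n and its flow differ by at most e/16; of the four terms of
     [four_sq], two are of this kind and two converge at fixed i. *)
  move=> e0; pose i := Num.bound (32 * M / e).
  have ti : 2 * tm i * M <= e / 16.
    have hb : 32 * M / e <= i.+1%:R.
      have : 0 <= 32 * M / e by rewrite divr_ge0 ?mulr_ge0// ltW.
      by move=> /archi_boundP/ltW b; apply: (le_trans b); rewrite ler_nat.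
    rewrite /tm mulrAC ler_pdivrMr//; rewrite ler_pdivrMr// in hb; lra.
  have TL n := L2_TT (tm0 i) (hL n).
  pose u x := limn (fun n => TT (tm i) (h n) x).
  have uc x : (fun n => TT (tm i) (h n) x) @ \oo --> u x by exact: cvT.
  have mU : mf u by apply: (measurable_fun_cvg (h := fun n x => TT (tm i) (h n) x)) => [n|x _]; [case: (TL n)|exact: uc].
  pose B := (8 * pi * tm i)^-1 * M.
  have TB n x : TT (tm i) (h n) x ^+ 2 <= B.
    apply: le_trans (TT_sqr_le x (tm0 i) (hL n)) _; apply: ler_wpM2l; last exact: fM.
    by rewrite invr_ge0 !mulr_ge0 ?pi_ge0 ?(ltW (tm0 i)).
  have uB x : u x ^+ 2 <= B by rewrite expr2; apply: (cvg_le (sqM (uc x) (uc x))) => n; rewrite -expr2.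
  have gB n x : `|kk 1 o x * (TT (tm i) (h n) x - u x) ^+ 2| <= 4 * B * kk 1 o x.
    rewrite (ger0_norm (mulr_ge0 (ltW (W0 x)) (sqr_ge0 _))) mulrC; apply: ler_wpM2r; first exact: ltW.
    have := TB n x; have := uB x; have := sqr_ge0 (TT (tm i) (h n) x + u x).
    by move: (TT _ _ _) (u x) => a b; lra.
  have igB := igZ (4 * B) (ig_kk o ltr01).
  have mD n : mf (fun x => kk 1 o x * (TT (tm i) (h n) x - u x) ^+ 2).
    by apply: measurable_funM => //; apply: measurable_funX; apply: measurable_funB => //; case: (TL n).
  have igD' n : ig mu (fun x => kk 1 o x * (TT (tm i) (h n) x - u x) ^+ 2) by exact: (ig_le (mD n) (gB n) igB).
  have aec : {ae mu, forall x, (fun n => kk 1 o x * (TT (tm i) (h n) x - u x) ^+ 2) @ \oo --> (0 : R)}.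
    apply: filterE => x; have d := sqB (uc x) (sqC (u x)); rewrite subrr in d.
    by have := sqZ (kk 1 o x) (sqM d d); rewrite !mulr0.
  have [_ /cvg_seqP Tc] := II_dct mD (measurable_cst _) aec igB gB.
  have [N hN] := Tc (e / 32) ltac:(lra); exists N => n m Nn Nm.
  have tn := nrm2_sub_TT (tm0 i) (hL n); have tm' := nrm2_sub_TT (tm0 i) (hL m).
  have b1 : II mu (fun x => kk 1 o x * (h n x - TT (tm i) (h n) x) ^+ 2) <= e / 16.
    by apply: le_trans (WL _ tn.1) _; apply: le_trans tn.2 _; apply: le_trans ti; exact: fD.
  have b2 : II mu (fun x => kk 1 o x * (h m x - TT (tm i) (h m) x) ^+ 2) <= e / 16.
    by apply: le_trans (WL _ tm'.1) _; apply: le_trans tm'.2 _; apply: le_trans ti; exact: fD.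
  have b3 := hN _ Nn; have b4 := hN _ Nm; have z0 : II mu (fun=> 0 : R) = 0 := II0 mu; rewrite z0 !subr0 in b3 b4.
  have {}b3 := le_trans (ler_norm _) b3; have {}b4 := le_trans (ler_norm _) b4.
  have i1 := igD (igD (igW _ tn.1) (igW _ tm'.1)) (igD (igD' n) (igD' m)).
  have pt4 x : kk 1 o x * (h n x - h m x) ^+ 2 <= 4 * ((kk 1 o x * (h n x - TT (tm i) (h n) x) ^+ 2 +
      kk 1 o x * (h m x - TT (tm i) (h m) x) ^+ 2) + (kk 1 o x * (TT (tm i) (h n) x - u x) ^+ 2 +
      kk 1 o x * (TT (tm i) (h m) x - u x) ^+ 2)).
    rewrite -!mulrDr (mulrCA 4); apply: ler_wpM2l; first exact: ltW.
    exact: four_sq.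
  apply: le_trans (II_le (igW _ (L2B (hL n) (hL m))) (igZ 4 i1) pt4) _.
  rewrite (IIZ 4 i1) (IID (igD (igW _ tn.1) (igW _ tm'.1)) (igD (igD' n) (igD' m))).
  rewrite (IID (igW _ tn.1) (igW _ tm'.1)) (IID (igD' n) (igD' m)).
  by move: e0 b1 b2 b3 b4; clear; move: (II _ _) (II _ _) (II _ _) (II _ _) => *; lra.
(* A second extraction, with increments 8^-k, turns the weighted Cauchy property into almost
   everywhere convergence. *)
have [Nf hNf] := choice (fun k => cau (8^-1 ^+ k) ltac:(by rewrite exprn_gt0)).
pose s2 k := (\sum_(j < k.+1) Nf j + k)%N.
have s2N k : (Nf k <= s2 k)%N by rewrite /s2 big_ord_recr /=; lia.
have s2S k : (s2 k <= s2 k.+1)%N by rewrite /s2 [X in (_ <= X + _)%N]big_ord_recr /=; lia.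
have igh n m : ig mu (fun x => kk 1 o x * (h n x - h m x) ^+ 2) by exact: (igW _ (L2B (hL n) (hL m))).
have fcH k : (\int[mu]_x (kk 1 o x * (h (s2 k.+1) x - h (s2 k) x) ^+ 2)%:E <= (8^-1 ^+ k)%:E)%E.
  rewrite (EFin_II (igh (s2 k.+1) (s2 k))) lee_fin.
  by apply: hNf; [exact: leq_trans (s2N k) (s2S k)|exact: s2N].
have [f [mf0 fc]] := fast_cauchy mW W0 (fun k => (hL (s2 k)).1) fcH.
have fL2 : L2 mu f.
  apply: L2P => //; apply: le_lt_trans (ltry M).
  apply: (@fatou_ae _ _ _ mu (fun k x => h (s2 k) x ^+ 2) (fun x => f x ^+ 2) (fun=> M) M).
  - by move=> k; apply: measurable_funX; case: (hL (s2 k)).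
  - exact: measurable_funX.
  - by move=> k x; exact: sqr_ge0.
  - by move=> x; exact: sqr_ge0.
  - by apply: filterS fc => x c; exact: (sqM c c).
  - by move=> k; rewrite (EFin_II (hL (s2 k)).2) lee_fin; exact: fM.
  - exact: sqC.
exists (s1 \o s2), f; split=> //.
  by move=> n; apply: leq_trans (s1n (s2 n)); rewrite /s2; lia.
apply/cvg_seqP => e e0; have [N hN] := cau e e0; exists N => n Nn.
have s2n k : (k <= s2 k)%N by rewrite /s2; lia.
have i : ig mu (fun x => kk 1 o x * (h (s2 n) x - f x) ^+ 2) by exact: (igW _ (L2B (hL (s2 n)) fL2)).
have ge0 : 0 <= II mu (fun x => kk 1 o x * (h (s2 n) x - f x) ^+ 2).
  by apply: II_ge0 => x; rewrite mulr_ge0 ?sqr_ge0 ?(ltW (W0 x)).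
rewrite subr0 ger0_norm// -lee_fin -(EFin_II i).
apply: (@fatou_ae _ _ _ mu (fun k x => kk 1 o x * (h (s2 n) x - h (s2 (k + N)%N) x) ^+ 2) _ (fun=> e) e).
- by move=> k; exact: ig_mf (igh (s2 n) (s2 (k + N)%N)).
- exact: ig_mf i.
- by move=> k x; rewrite mulr_ge0 ?sqr_ge0 ?(ltW (W0 x)).
- by move=> x; rewrite mulr_ge0 ?sqr_ge0 ?(ltW (W0 x)).
- apply: filterS fc => x c; have c' := @cvg_sub_seq _ _ _ (fun k => (k + N)%N) (fun k => leq_addr N k) c.
  by have d := sqB (sqC (h (s2 n) x)) c'; exact: (sqZ _ (sqM d d)).
- move=> k; rewrite (EFin_II (igh (s2 n) (s2 (k + N)%N))) lee_fin.
  by apply: hN; apply: leq_trans (s2n _); rewrite ?leq_addl.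
- exact: sqC.
Qed.

End rellich.

(** * The quadratic form on real functions *)

Section quadratic_form.
Context {R : realType}.
Variable alpha : R.
Local Notation P := (mplane R).
Local Notation mu := (leb2 R).
Local Notation G a := (@Ga R a 0).
Let o : P := (0, 0).

(* v is a real function of charge c on which the quadratic form takes the
   value q, computed with the parameter lam. *)
Definition QF (lam : R) (v : P -> R) (c q : R) := exists N : R,
  HN (fun x => v x - c * G lam x) N /\
  q = N + lam * (nrm2 mu (fun x => v x - c * G lam x) - nrm2 mu v) + (alpha + theta lam) * c ^+ 2.

Lemma theta_sub (a b : R) : 0 < a -> 0 < b -> theta a - theta b = (ln a - ln b) / (4 * pi).
Proof.
have h (x : R) : 0 < x -> ln (Num.sqrt x / 2) = ln x / 2 - ln 2.
  move=> x0; have s0 : 0 < Num.sqrt x by rewrite sqrtr_gt0.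
  rewrite ln_div ?posrE//; congr (_ - _).
  have -> : ln x = ln (Num.sqrt x) *+ 2 by rewrite -lnXn// sqr_sqrtr ?ltW.
  by rewrite mulr2n; field.
move=> a0 b0; rewrite /theta !h//; have := pi_gt0 R; move: pi => p p0.
by field; rewrite gt_eqF.
Qed.

Lemma L2_G a : 0 < a -> L2 mu (G a).
Proof. by move=> a0; exact: L2_Ga. Qed.

Lemma QF_L2 lam v c q : 0 < lam -> QF lam v c q -> L2 mu v.
Proof.
move=> l0 [N [/HN_L2 h _]]; have := L2D h (L2Z c (L2_G l0)).
by congr (L2 mu); apply/funext => x; rewrite subrK.
Qed.

(** Independence of the parameter, reduced to bilinear algebra: A and B stand for the two Green
    functions, and the only fact about them is the value of their scalar product. *)
Lemma charge_shift (f A B : P -> R) (a b c k N ta tb : R) : L2 mu f -> L2 mu A -> L2 mu B ->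
  (a - b) * ip mu A B = ta - tb ->
  N + a * (nrm2 mu f - nrm2 mu (fun x => f x + c * A x)) + (k + ta) * c ^+ 2 =
  N + 2 * c * ip mu f (fun x => b * B x + (- a) * A x)
    + c ^+ 2 * ip mu (fun x => A x + (-1) * B x) (fun x => b * B x + (- a) * A x)
    + b * (nrm2 mu (fun x => f x + c * (A x + (-1) * B x)) - nrm2 mu (fun x => f x + c * A x))
    + (k + tb) * c ^+ 2.
Proof.
move=> fL AL BL th; have wL := L2D AL (L2Z (-1) BL).
rewrite (nrm2_lin c fL wL) (nrm2_lin c fL AL) (nrm2_lin (-1) AL BL).
rewrite (ipDr AL (L2Z (-1) BL) fL) (ipZr (-1) BL fL).
rewrite (ipDr (L2Z b BL) (L2Z (- a) AL) fL) (ipZr b BL fL) (ipZr (- a) AL fL).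
rewrite (ipDr (L2Z b BL) (L2Z (- a) AL) wL) (ipZr b BL wL) (ipZr (- a) AL wL).
rewrite (ipDl AL (L2Z (-1) BL) BL) (ipDl AL (L2Z (-1) BL) AL) (ipZl (-1) BL BL) (ipZl (-1) BL AL).
rewrite !ipff (ipC mu B A); move: th.
move: (ip mu A B) (nrm2 mu A) (nrm2 mu B) (ip mu f A) (ip mu f B) (nrm2 mu f).
clear=> gab ga gb fa fb nf th; have -> : tb = ta - (a - b) * gab by rewrite th; ring.
by ring.
Qed.

Lemma ip_G_theta a b : 0 < a -> 0 < b -> (a - b) * ip mu (G a) (G b) = theta a - theta b.
Proof.
move=> a0 b0; rewrite theta_sub// ip_Ga0//; case: eqVneq => [->|nab]; first by rewrite !subrr !mul0r.
rewrite invfM; have : a - b != 0 by rewrite subr_eq0.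
by move: (pi^-1) (4^-1) => p' p4 d; field.
Qed.

Lemma QF_decomposition a b (f : P -> R) c N : 0 < a -> 0 < b -> HN f N ->
  QF b (fun x => f x + c * G a x) c
    (N + a * (nrm2 mu f - nrm2 mu (fun x => f x + c * G a x)) + (alpha + theta a) * c ^+ 2).
Proof.
move=> a0 b0 hN; have fL := HN_L2 hN; have GaL := L2_G a0; have GbL := L2_G b0.
have E : (fun x => f x + c * G a x - c * G b x) = fun x => f x + c * wG a b x.
  by apply/funext => x; rewrite /wG; move: (f x) (Ga a 0 x) (Ga b 0 x) => u1 u2 u3; ring.
exists (N + 2 * c * ip mu f (hG a b) + c ^+ 2 * ip mu (wG a b) (hG a b)); rewrite E.
by split; [exact: HN_wG|exact: charge_shift (ip_G_theta a0 b0)].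
Qed.

Lemma QF_change a b v c q : 0 < a -> 0 < b -> QF a v c q -> QF b v c q.
Proof.
move=> a0 b0 [N [hN ->]]; have := QF_decomposition c a0 b0 hN.
by rewrite (_ : (fun x => v x - c * G a x + c * G a x) = v)//; apply/funext => x; rewrite subrK.
Qed.

(** Two charges would make a multiple of G a difference of H^1 functions. *)
Lemma HN_uniq_charge lam v c d N M : 0 < lam -> HN (fun x => v x - c * G lam x) N ->
  HN (fun x => v x - d * G lam x) M -> c = d.
Proof.
move=> l0 h k; apply/eqP; rewrite -subr_eq0; apply/negPn/negP => cd.
have [K hk] := HN_lin (-1) k h.
have := HNZ (c - d)^-1 hk.
have -> : (fun x => (c - d)^-1 * (v x - d * G lam x + -1 * (v x - c * G lam x))) = G lam.
  by apply/funext => x; move: (v x) (Ga lam 0 x) => a b; field.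
exact: G_notin_H1.
Qed.

Lemma QF_unique a b v c d q r : 0 < a -> 0 < b -> QF a v c q -> QF b v d r -> c = d /\ q = r.
Proof.
move=> a0 b0 h k; have [N [hN ->]] := h; have [M [hM ->]] := QF_change b0 a0 k.
have cd := HN_uniq_charge a0 hN hM; split=> //; rewrite -cd in hM *.
by rewrite (HN_unique hN hM).
Qed.

Lemma QF_scale lam v c q (s : R) : 0 < lam -> QF lam v c q -> QF lam (fun x => s * v x) (s * c) (s ^+ 2 * q).
Proof.
move=> l0 h; have vL := QF_L2 l0 h; have [N [hN ->]] := h.
have e : (fun x => s * v x - s * c * G lam x) = fun x => s * (v x - c * G lam x).
  by apply/funext => x; ring.
exists (s ^+ 2 * N); rewrite e (nrm2Z s vL) (nrm2Z s (HN_L2 hN)); split; first exact: HNZ.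
by move: (nrm2 mu _) (nrm2 mu _) => a b; ring.
Qed.

Lemma QF_H1 lam f N : HN f N -> QF lam f 0 N.
Proof.
have e : (fun x => f x - 0 * G lam x) = f by apply/funext => x; rewrite mul0r subr0.
by exists N; rewrite e subrr mulr0 addr0 expr0n mulr0 addr0.
Qed.

Lemma QF_ae lam v w c q : 0 < lam -> mf w -> {ae mu, forall x, v x = w x} -> QF lam v c q -> QF lam w c q.
Proof.
move=> l0 mw e h; have vL := QF_L2 l0 h; have [N [hN ->]] := h; exists N.
have e2 : {ae mu, forall x, v x - c * G lam x = w x - c * G lam x}.
  by apply: filterS e => x ->.
have m2 : mf (fun x => w x - c * G lam x).
  by apply: measurable_funB => //; apply: measurable_funM => //; case: (L2_G l0).
split; first exact: HN_ae e2 hN.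
by rewrite (ae_nrm2 (HN_L2 hN).1 m2 e2) (ae_nrm2 vL.1 mw e).
Qed.

(** [theta] grows like log(lam) / (4 pi), so a large parameter makes the charge term coercive
    whatever the sign of alpha. *)
Lemma theta_large (K : R) : exists2 lam : R, 0 < lam & K <= alpha + theta lam.
Proof.
pose lam := expR (4 * pi * `|K - alpha - theta 1|); exists lam; first exact: expR_gt0.
have := theta_sub (expR_gt0 (4 * pi * `|K - alpha - theta 1|)) ltr01; rewrite -/lam ln1 subr0 expRK.
have -> : 4 * pi * `|K - alpha - theta 1| / (4 * pi) = `|K - alpha - theta 1|.
  by rewrite mulrC mulKf// mulf_neq0// gt_eqF// pi_gt0.
have := ler_norm (K - alpha - theta 1); lra.
Qed.

End quadratic_form.

(** * Subcritical power estimates *)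

Section power_integral.
Context {R : realType}.
Local Notation P := (mplane R).
Local Notation mu := (leb2 R).
Local Notation G a := (@Ga R a 0).
Implicit Type p : R.

Definition pB p (v : P -> R) : R := II mu (fun x => `|v x| `^ p).

Lemma pB_ge0 p v : 0 <= pB p v. Proof. by apply: II_ge0 => x; exact: powR_ge0. Qed.

(** The exponent p/4 is below 1, as [dn_Ga_powR] requires, and above (p - 2)/2, as [tail_bound]
    requires. *)
Lemma dn_V p lam : 2 < p -> p < 4 -> 0 < lam -> exists C, 0 <= C /\ forall f N c t, HN f N -> 0 < t <= 1 ->
  dn t (fun x => f x + c * G lam x) <= C * (N + c ^+ 2) * t `^ (p / 4).
Proof.
move=> p2 p4 l0; have p01 : 0 < p / 4 < 1 by apply/andP; split; lra.
have [C [C0 hC]] := dn_Ga_powR l0 p01; move: p01 => /andP[p0 p1].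
exists (4 + 2 * C); split; first by lra.
move=> f N c t h /andP[t0 t1]; have fL := HN_L2 h; have N0 := HN_ge0 h.
have GL := L2_G l0.
apply: (le_trans (dnD_le t0 fL (L2Z c GL))).
have a1 := HN_le h t0; have a2 := hC t t0.
have a3 : dn t (fun x => c * G lam x) = c ^+ 2 * dn t (G lam).
  have := dn_lin c t0 (@L2_0 _ _ _ mu) GL.
  have -> : (fun x : P => 0 + c * G lam x) = (fun x => c * G lam x) by apply/funext => x; rewrite add0r.
  have z : dn t (fun _ : P => 0 : R) = 0.
    by rewrite /dn -[RHS](II0 (leb2f \x leb2f)%E); congr (II _); apply/funext => x; rewrite subrr expr0n mulr0.
  have i (phi : P -> R) : ip mu (fun=> 0) phi = 0.
    by rewrite -[RHS](II0 mu); congr (II mu); apply/funext => x; rewrite mul0r.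
  by rewrite z !i subrr mulr0 !add0r.
have a4 : t <= t `^ (p / 4).
  rewrite -[leLHS]powRr1 ?(ltW t0)//; apply: ger_powR; [by rewrite t0|exact: ltW].
rewrite a3; move: a1 a2 a4 C0 N0 (sqr_ge0 c) (ltW t0); clear.
move: (t `^ _) (dn t (G lam)) (dn t f) (c ^+ 2) => q d1 d2 k a1 a2 a4 C0 N0 k0 t0.
have b1 : k * d1 <= k * (C * q) by exact: ler_wpM2l.
have b2 : t * N <= q * N by exact: ler_wpM2r.
have b3 : 0 <= C * (N * q) by rewrite !mulr_ge0// (le_trans t0).
have b4 : 0 <= k * q by rewrite mulr_ge0// (le_trans t0).
lra.
Qed.

Lemma TT_bound_mass (m t : R) (v : P -> R) x : 0 < t -> L2 mu v -> nrm2 mu v <= m ->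
  TT t v x ^+ 2 <= (m + 1) / t.
Proof.
move=> t0 vL vm; apply: le_trans (TT_sqr_le x t0 vL) _.
rewrite invfM mulrAC; apply: ler_wpM2r; first by rewrite invr_ge0 ltW.
have n0 := nrm2_ge0 mu v; apply: (@le_trans _ _ (1 * nrm2 mu v)); last by rewrite mul1r; lra.
apply: ler_wpM2r => //; rewrite invf_le1 ?mulr_gt0 ?pi_gt0//; have := pi_ge2 R; lra.
Qed.

(* Subcriticality p < 4: the power is absorbed by any fraction of the energy. *)
Lemma pB_coercive p lam m eps : 2 < p -> p < 4 -> 0 < lam -> 0 <= m -> 0 < eps ->
  exists K, forall f N c, HN f N -> nrm2 mu (fun x => f x + c * G lam x) <= m ->
  ig mu (fun x => `|f x + c * G lam x| `^ p) /\
  pB p (fun x => f x + c * G lam x) <= eps * (N + c ^+ 2) + K.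
Proof.
move=> p2 p4 l0 m0 e0; have [C [C0 hC]] := dn_V p2 p4 l0.
have d0 : 0 < p / 4 by lra.
have d2 : p - 2 < 2 * (p / 4) by lra.
have [T [T0 hT]] := tail_bound p2 d0 d2.
set e := p - 2 - 2 * (p / 4) in hT; have en : e < 0 by rewrite /e; lra.
pose X := T * ((m + 1) `^ (p / 4) * C); have X0 : 0 <= X by rewrite !mulr_ge0 ?powR_ge0.
have ee : 0 < eps * - e by rewrite mulr_gt0// oppr_gt0.
(* The level l = e^B serves two purposes: the first term of B makes X l^e at most eps, through
   e^(-x) <= 1/x, and the second gives the condition 4 (m + 1) <= l^2 of [tail_bound]. *)
pose B := X / (eps * - e) + 2 * (m + 1); have B0 : 0 < B.
  by rewrite ltr_wpDl ?divr_ge0 ?(ltW ee)// mulr_gt0// ltr_wpDl.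
pose l := expR B; have lpos : 0 < l := expR_gt0 B.
have lX : X * l `^ e <= eps.
  have -> : l `^ e = expR (- (- e * B)) by rewrite /l /powR gt_eqF ?expR_gt0// expRK mulNr opprK.
  have eB : 0 < - e * B by rewrite mulr_gt0// oppr_gt0.
  apply: (@le_trans _ _ (X * (- e * B)^-1)); first by apply: ler_wpM2l => //; exact: expRN_le_inv.
  rewrite ler_pdivrMr// /B mulrDr [- e * (X / _)]mulrC mulrDr invfM.
  have -> : eps * (X * (eps^-1 * (- e)^-1) * - e) = X.
    by have n1 := lt0r_neq0 e0; have n2 : e != 0 by [rewrite lt_eqF]; clear - n1 n2; field; rewrite ?oppr_eq0 n1 n2.
  by rewrite lerDl !mulr_ge0 ?(ltW e0) ?oppr_ge0 ?(ltW en)// addr_ge0.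
have l4 : 4 * (m + 1) <= l ^+ 2.
  have h : 2 * (m + 1) <= B by rewrite lerDr divr_ge0 ?(ltW ee).
  have := expR_ge1Dx B; rewrite -/l => h2.
  have q1 : 0 <= l - B by lra.
  have q2 : 0 <= l + B by lra.
  have := mulr_ge0 q1 q2.
  rewrite -subr_sqr subr_ge0 => h3; apply: le_trans h3; rewrite expr2; nra.
exists (l `^ (p - 2) * m) => f N c h vm.
have fL := HN_L2 h; have GL := L2_G l0; have vL := L2D fL (L2Z c GL); have N0 := HN_ge0 h.
have Nc : 0 <= N + c ^+ 2 by rewrite addr_ge0 ?sqr_ge0.
have m1 : 0 < m + 1 by rewrite ltr_wpDl.
have H1 t x : 0 < t <= 1 -> TT t (fun x => f x + c * G lam x) x ^+ 2 <= (m + 1) / t.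
  by move=> /andP[t0 _]; exact: (TT_bound_mass x t0 vL vm).
have := hT _ (m + 1) (C * (N + c ^+ 2)) l vL m1 (mulr_ge0 C0 Nc) lpos l4 H1 (fun t => hC f N c t h).
move=> bd; have i : ig mu (fun x => `|f x + c * G lam x| `^ p).
  apply: ge0_ig; [exact: mpowR vL.1|by move=> x; exact: powR_ge0|].
  by apply: le_lt_trans bd _; rewrite ltry.
split=> //; rewrite /pB -lee_fin -(EFin_II i); apply: (le_trans bd); rewrite lee_fin addrC.
apply: lerD; last by apply: ler_wpM2l => //; exact: powR_ge0.
have -> : T * (l `^ e * ((m + 1) `^ (p / 4) * (C * (N + c ^+ 2)))) = X * l `^ e * (N + c ^+ 2).
  by rewrite /X; move: (_ `^ _) (_ `^ _) => u w; ring.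
exact: ler_wpM2r.
Qed.

(** Jensen's inequality and k_t <= k_1 / t for t <= 1: the local masses at scale 1 control the heat
    flow at all smaller times. *)
Lemma TT_sqr_vanish (f : P -> R) eta t x : L2 mu f -> (forall y, TT 1 (fun z => f z ^+ 2) y <= eta) ->
  0 < t <= 1 -> TT t f x ^+ 2 <= eta / t.
Proof.
move=> fL h /andP[t0 t1]; have := TT_jensen x 0 t0 fL; rewrite sub0r sqrrN => j.
apply: le_trans j _; apply: (@le_trans _ _ (t^-1 * TT 1 (fun z => f z ^+ 2) x)); last first.
  by rewrite mulrC; apply: ler_wpM2r; rewrite ?invr_ge0 ?(ltW t0).
have i := ig_kkM x t0 fL.2; have i1 := ig_kkM x ltr01 fL.2.
rewrite /TT /ip -IIZ//; apply: II_le.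
- by move: i; congr (ig mu); apply/funext => y; rewrite sub0r sqrrN.
- exact: igZ.
move=> y; rewrite sub0r sqrrN mulrA; apply: ler_wpM2r; first exact: sqr_ge0.
rewrite !kkE// mulr1 invfM [_ * t^-1]mulrC -mulrA; apply: ler_wpM2l; first by rewrite invr_ge0 ltW.
apply: ler_wpM2l; first by rewrite invr_ge0 mulr_ge0 ?pi_ge0.
rewrite ler_expR mulr1 !mulNr lerN2; apply: ler_wpM2l; first exact: d2_ge0.
by rewrite lef_pV2 ?posrE ?mulr_gt0// ger_pMr.
Qed.

(** Exclusion of vanishing, in the manner of Lions. With eta = l^2 / 4 in [tail_bound], both terms
    are of order l^(p - 2), and l is fixed by l^(p - 2) = eps / A. *)
Lemma pB_vanishing p m M eps : 2 < p -> p < 4 -> 0 <= m -> 0 <= M -> 0 < eps ->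
  exists2 eta, 0 < eta & forall f N, HN f N -> N <= M -> nrm2 mu f <= m ->
  (forall y, TT 1 (fun z => f z ^+ 2) y <= eta) -> pB p f <= eps.
Proof.
move=> p2 p4 m0 M0 e0; have [C [C0 hC]] := dn_V p2 p4 (@ltr01 R).
have d0 : 0 < p / 4 by lra.
have d2 : p - 2 < 2 * (p / 4) by lra.
have [T [T0 hT]] := tail_bound p2 d0 d2.
pose A := m + T * (C * M) + 1; have A0 : 0 < A by rewrite ltr_wpDl// addr_ge0// !mulr_ge0.
pose l := (eps / A) `^ (p - 2)^-1.
have l0 : 0 < l by rewrite /l powR_gt0// divr_gt0.
have pn : p - 2 != 0 by rewrite gt_eqF//; lra.
have lp : l `^ (p - 2) = eps / A by rewrite /l -powRrM mulVf// powRr1// divr_ge0// ltW.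
exists (l ^+ 2 / 4); first by rewrite divr_gt0 ?exprn_gt0.
move=> f N h NM fm V; have fL := HN_L2 h; have N0 := HN_ge0 h.
have e4 : 4 * (l ^+ 2 / 4) <= l ^+ 2 by rewrite mulrC divfK.
have eta0 : 0 < l ^+ 2 / 4 by rewrite divr_gt0 ?exprn_gt0.
have Hd t : 0 < t <= 1 -> dn t f <= C * N * t `^ (p / 4).
  move=> tt; have := hC f N 0 t h tt; rewrite expr0n addr0.
  by rewrite (_ : (fun x => f x + 0 * G 1 x) = f)//; apply/funext => x; rewrite mul0r addr0.
have bd := hT f (l ^+ 2 / 4) (C * N) l fL eta0 (mulr_ge0 C0 N0) l0 e4 (fun t x => TT_sqr_vanish x fL V) Hd.
have i : ig mu (fun x => `|f x| `^ p).
  apply: ge0_ig; [exact: mpowR fL.1|by move=> x; exact: powR_ge0|].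
  by apply: le_lt_trans bd _; rewrite ltry.
rewrite /pB -lee_fin -(EFin_II i); apply: (le_trans bd); rewrite lee_fin.
have h1 : l `^ (p - 2 - 2 * (p / 4)) * (l ^+ 2 / 4) `^ (p / 4) <= eps / A.
  rewrite -lp powRM ?exprn_ge0 ?(ltW l0)// -powR_mulrn ?(ltW l0)// -powRrM mulrA -powRD; last by rewrite (gt_eqF l0) implybT.
  rewrite (_ : p - 2 - 2 * (p / 4) + 2 * (p / 4) = p - 2); last by rewrite subrK.
  rewrite -[leRHS]mulr1; apply: ler_wpM2l; first exact: powR_ge0.
  have q4 : (4^-1 : R) <= 1 by rewrite invf_le1// ler1n.
  by have := powR_mono (ltW d0) (ltac:(by rewrite invr_ge0) : (0 : R) <= 4^-1) q4; rewrite powR1.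
have eA : 0 <= eps / A by rewrite divr_ge0 ?ltW.
apply: (@le_trans _ _ (eps / A * (m + T * (C * M)))); last first.
  by rewrite mulrAC ler_pdivrMr//; apply: ler_wpM2l; [exact: ltW|rewrite /A lerDl].
rewrite mulrDr lp; apply: lerD; first exact: ler_wpM2l.
rewrite [l `^ _ * (_ * _)]mulrA mulrCA; apply: ler_pM.
- exact: mulr_ge0 (powR_ge0 _ _) (powR_ge0 _ _).
- exact: mulr_ge0 T0 (mulr_ge0 C0 N0).
- exact: h1.
- by apply: ler_wpM2l => //; exact: ler_wpM2l.
Qed.

End power_integral.

(** * Scalar convexity inequalities *)

Section scalar.
Context {R : realType}.
Implicit Types p r s t : R.

(** With t = e^x, use t^r = e^x e^((r - 1) x) >= e^x (1 + (r - 1) x) and e^x (1 - x) < 1. *)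
Lemma bernoulli_powR r t : 1 < r -> 0 <= t -> t != 1 -> 1 + r * (t - 1) < t `^ r.
Proof.
move=> r1; rewrite le_eqVlt => /predU1P[<- _|t0 t1].
  by rewrite powR0 ?gt_eqF ?(lt_trans ltr01)// sub0r mulrN1; lra.
pose x := ln t; have te : t = expR x by rewrite lnK.
have x0 : - x != 0 by rewrite oppr_eq0 /x ln_eq0.
have h1 : expR x * (1 - x) < 1.
  have := expR_gt1Dx x0; rewrite expRN => h.
  by rewrite -[ltRHS](divff (lt0r_neq0 (expR_gt0 x))); rewrite ltr_pM2l ?expR_gt0.
have h2 : expR x * (1 + (r - 1) * x) <= t `^ r.
  rewrite /powR gt_eqF// -/x (_ : r * x = x + (r - 1) * x); last by ring.
  by rewrite expRD ler_wpM2l ?expR_ge0 ?expR_ge1Dx.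
apply: lt_le_trans h2; rewrite te; move: (expR x) h1 => y h1.
have r0 : 0 < r - 1 by lra.
have := h1; rewrite -(ltr_pM2l r0); lra.
Qed.

Lemma bernoulli_powR_le r t : 1 < r -> 0 <= t -> 1 + r * (t - 1) <= t `^ r.
Proof.
move=> r1 t0; have [->|t1] := eqVneq t 1; first by rewrite powR1 subrr mulr0 addr0.
by rewrite ltW// bernoulli_powR.
Qed.

Lemma powR_tangent p (x z : R) : 1 < p -> 0 <= z -> 0 < x -> z != x ->
  x `^ p + p * x `^ (p - 1) * (z - x) < z `^ p.
Proof.
move=> p1 z0 x0 zx; have zx0 : 0 <= z / x by rewrite divr_ge0 ?(ltW x0).
have h : z / x != 1 by apply: contra zx => /eqP h; rewrite -(divfK (lt0r_neq0 x0) z) h mul1r.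
have := bernoulli_powR p1 zx0 h; have xp : 0 < x `^ p by rewrite powR_gt0.
rewrite -(ltr_pM2l xp) -powRM ?(ltW x0)// [x * _]mulrC divfK ?gt_eqF//.
congr (_ < _); rewrite mulrDr mulr1; congr (_ + _).
rewrite -(mulr_powRB1 (ltW x0) (lt_trans ltr01 p1)); field; exact: lt0r_neq0.
Qed.

(** Strict convexity: a + g and b + h lie strictly between a + h and b + g and have the same sum, so
    they are convex combinations of the extremes with complementary weights. *)
Lemma powR_rearrange p (a b g h : R) : 1 < p -> 0 <= a -> a < b -> 0 <= h -> h < g ->
  (a + g) `^ p + (b + h) `^ p < (b + g) `^ p + (a + h) `^ p.
Proof.
move=> p1 a0 ab h0 hg.
have k (y lo hi l : R) : 0 <= lo -> lo < y -> y < hi -> 0 < l -> l < 1 -> y = (1 - l) * lo + l * hi ->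
    y `^ p < (1 - l) * lo `^ p + l * hi `^ p.
  move=> lo0 ly yh l0 l1 e; have y0 : 0 < y by exact: le_lt_trans ly.
  have := powR_tangent p1 lo0 y0 (negbT (lt_eqF ly)).
  have := powR_tangent p1 (ltW (lt_trans y0 yh)) y0 (negbT (gt_eqF yh)).
  move: (y `^ p) (p * _) (lo `^ p) (hi `^ p) => A D B C.
  rewrite -(ltr_pM2l l0) => h1; have l' : 0 < 1 - l by lra.
  rewrite -(ltr_pM2l l') => h2.
  have : (1 - l) * (A + D * (lo - y)) + l * (A + D * (hi - y)) = A + D * ((1 - l) * lo + l * hi - y) by ring.
  by rewrite -e subrr mulr0 addr0; lra.
pose l := (g - h) / (b - a + (g - h)).
have d0 : 0 < b - a + (g - h) by lra.
have l0 : 0 < l by rewrite divr_gt0// subr_gt0.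
have l1 : l < 1 by rewrite /l ltr_pdivrMr// mul1r; lra.
have lE : l * (b - a + (g - h)) = g - h by rewrite /l divfK// gt_eqF.
have k1 : (b + h) `^ p < (1 - (1 - l)) * (a + h) `^ p + (1 - l) * (b + g) `^ p.
  by apply: k; [lra|lra|lra|lra|lra|]; move: lE; clear; nra.
have k2 : (a + g) `^ p < (1 - l) * (a + h) `^ p + l * (b + g) `^ p.
  by apply: k; [lra|lra|lra|lra|lra|]; move: lE; clear; nra.
by move: k1 k2; move: (_ `^ _) (_ `^ _) (_ `^ _) (_ `^ _) => A B C D; lra.
Qed.

(** Bernoulli's inequality at s^2 with exponent p/2; it locates the unique maximum of s^2/2 -
    s^p/p. *)
Lemma scaling_max p s : 2 < p -> 0 < s ->
  s ^+ 2 / 2 - s `^ p / p <= 2^-1 - p^-1 /\ (s ^+ 2 / 2 - s `^ p / p = 2^-1 - p^-1 -> s = 1).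
Proof.
move=> p2 s0; have p0 : 0 < p by lra.
have q1 : 1 < p / 2 by rewrite ltr_pdivlMr//; lra.
have sp : s `^ p = (s ^+ 2) `^ (p / 2).
  by rewrite -powR_mulrn ?(ltW s0)// -powRrM mulrC divfK.
have ip : 0 < p^-1 by rewrite invr_gt0.
have f1 (x : R) : (p^-1) * (1 + p / 2 * (x - 1)) = p^-1 + (x - 1) / 2 by field; exact: lt0r_neq0.
have s2 : 0 <= s ^+ 2 by exact: sqr_ge0.
split.
  have := bernoulli_powR_le q1 s2; rewrite -sp -(ler_pM2l ip) f1; rewrite [p^-1 * _]mulrC; move: (s ^+ 2) (_ / p) => a b; lra.
move=> e; apply/eqP; rewrite -(@eqrXn2 _ 2 s 1) ?ltW//; apply/negPn/negP; rewrite expr1n => n1.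
have := bernoulli_powR q1 s2 n1; rewrite -sp -(ltr_pM2l ip) f1.
by move: e; rewrite [s `^ p / p]mulrC; move: (s ^+ 2) (p^-1 * _) => a b; lra.
Qed.

Lemma powR_split p (e : R) : 2 < p -> p < 4 -> 0 < e -> exists2 C, 0 <= C &
  forall a b : R, `|a + b| `^ p <= (1 + e) * `|a| `^ p + C * `|b| `^ p.
Proof.
(* The number 15 is the sum of the nonconstant coefficients of (1 + d)^4, which dominates (1 +
   d)^p. *)
move=> p2 p4 e0; pose d := Num.min 1 (e / 15).
have d0 : 0 < d by rewrite lt_min ltr01 divr_gt0.
have d1 : d <= 1 by rewrite ge_min lexx.
have de : 15 * d <= e by rewrite mulrC -ler_pdivlMr// /d ge_min lexx orbT.
have p0 : 0 <= p by lra.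
exists ((1 + d^-1) `^ p); first exact: powR_ge0.
move=> a b; have ab := ler_normD a b; have [h|h] := leP `|b| (d * `|a|).
  apply: (@le_trans _ _ ((1 + e) * `|a| `^ p)); last by rewrite lerDl mulr_ge0 ?powR_ge0.
  apply: (@le_trans _ _ (((1 + d) * `|a|) `^ p)).
    by apply: powR_mono => //; apply: le_trans ab _; rewrite mulrDl mul1r; lra.
  rewrite powRM ?addr_ge0 ?(ltW d0)//; apply: ler_wpM2r; first exact: powR_ge0.
  apply: (@le_trans _ _ ((1 + d) `^ 4)); first by apply: ler_powR; lra.
  rewrite (powR_mulrn 4); last by rewrite addr_ge0 ?(ltW d0).
  have q2 : d ^+ 2 <= d by rewrite expr2 ger_pMl.
  have q3 : d ^+ 3 <= d by rewrite exprS; apply: le_trans (ler_wpM2l (ltW d0) q2) _; rewrite ger_pMl.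
  have q4 : d ^+ 4 <= d by rewrite exprS; apply: le_trans (ler_wpM2l (ltW d0) q3) _; rewrite ger_pMl.
  have -> : (1 + d) ^+ 4 = 1 + 4 * d + 6 * d ^+ 2 + 4 * d ^+ 3 + d ^+ 4 by ring.
  lra.
apply: (@le_trans _ _ ((1 + d^-1) `^ p * `|b| `^ p)); last first.
  by rewrite lerDr mulr_ge0 ?powR_ge0// addr_ge0// ltW.
rewrite -powRM ?addr_ge0 ?invr_ge0 ?(ltW d0)//; apply: powR_mono => //; apply: le_trans ab _.
have : `|a| <= d^-1 * `|b| by rewrite mulrC ler_pdivlMr// mulrC ltW.
by rewrite mulrDl mul1r; lra.
Qed.

End scalar.

(** * Coercivity and negativity of the energy *)

Section real_energy.
Context {R : realType}.
Local Notation P := (mplane R).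
Local Notation mu := (leb2 R).
Local Notation G a := (@Ga R a 0).
Let o : P := (0, 0).
Implicit Type p : R.

Lemma pBZ p (s : R) (v : P -> R) : mf v -> 0 <= s -> pB p (fun x => s * v x) = s `^ p * pB p v.
Proof.
move=> mv s0; rewrite /pB -IIZ_ge0; [|exact: mpowR|by move=> x; exact: powR_ge0].
by congr (II mu); apply/funext => x; rewrite normrM (ger0_norm s0) powRM.
Qed.

Lemma pB_sh p w (f : P -> R) : mf f -> pB p (sh w f) = pB p f.
Proof. by move=> fm; rewrite /pB -(minv_II (minv_sh w) (mpowR p fm)). Qed.

Lemma HN_sh w (f : P -> R) N : HN f N -> HN (sh w f) N.
Proof.
move=> [g1 [g2 [h <-]]]; exists (sh w g1), (sh w g2); split; first exact: wgrad_sh.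
by case: h => _ [m1 _] [m2 _] _; rewrite !nrm2_sh.
Qed.

Lemma pB_ae p (v w : P -> R) : mf v -> mf w -> {ae mu, forall x, v x = w x} -> pB p v = pB p w.
Proof.
move=> mv mw e; apply: ae_II; [exact: mpowR|exact: mpowR|].
by apply: filterS e => x ->.
Qed.

(** [theta_large] makes the coefficient of c^2 at least 1. The power is absorbed with eps = p/4,
    which costs a quarter of N + c^2 out of the available half. *)
Lemma energy_coercive (al : R) p m : 2 < p -> p < 4 -> 0 <= m -> exists lam K, 0 < lam /\
  forall f N c, HN f N -> nrm2 mu (fun x => f x + c * G lam x) <= m ->
  N + c ^+ 2 <= 4 * ((N + lam * (nrm2 mu f - nrm2 mu (fun x => f x + c * G lam x))
     + (al + theta lam) * c ^+ 2) / 2 - pB p (fun x => f x + c * G lam x) / p) + K.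
Proof.
move=> p2 p4 m0; have [lam l0 hl] := theta_large al 1.
have p0 : 0 < p by lra.
have e0 : 0 < p / 4 by rewrite divr_gt0.
have [K hK] := pB_coercive p2 p4 l0 m0 e0.
exists lam, (2 * lam * m + 4 * (K / p)); split=> // f N c h vm.
have [_ b] := hK f N c h vm; have k := ler_wpM2r (sqr_ge0 c) hl.
have f0 : 0 <= nrm2 mu f by exact: nrm2_ge0.
have fl := mulr_ge0 (ltW l0) f0; have vl := ler_wpM2l (ltW l0) vm.
have ip : 0 <= p^-1 by rewrite invr_ge0 ltW.
have b2 := ler_wpM2r ip b.
have e : (p / 4 * (N + c ^+ 2) + K) / p = (N + c ^+ 2) / 4 + K / p.
  by field; exact: lt0r_neq0.
move: b2 fl vl k; rewrite e mul1r; clear.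
move: (pB _ _ / p) (K / p) (nrm2 _ _) (nrm2 _ _) (c ^+ 2) (theta lam) => B k n1 n2 cc th.
rewrite [lam * (_ - _)]mulrBr -[2 * lam * m]mulrA; move: (lam * n1) (lam * n2) (lam * m) ((al + th) * cc) => a1 a2 a3 a4; lra.
Qed.

Lemma HN_kk t : 0 < t -> exists2 N, HN (kk t o) N & N <= (16 * pi * t ^+ 2)^-1.
Proof.
move=> t0; pose t_ n : R := n.+1%:R^-1; have tn n : 0 < t_ n by exact: harm_gt0.
have pi0 := pi_gt0 R.
apply: (@HN_bounded _ _ t_ (fun=> (16 * pi * t ^+ 2)^-1)) => //; [exact: L2_kk|exact: cvg_harmonic| |exact: sqC].
move=> n; rewrite (dnE (tn n) (L2_kk o t0)).
have -> : TT (t_ n) (kk t o) = kk (t_ n + t) o.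
  by apply/funext => x; rewrite /TT ip_kk// kkC.
rewrite ip_kk ?addr_gt0// kkxx ?addr_gt0// ?addr_gt0// nrm2_kk//.
move: (t_ n) (tn n) => s s0.
have -> : 2 * ((8 * pi * t)^-1 - (4 * pi * (t + (s + t)))^-1) = s / (4 * pi * (t * (2 * t + s))).
  have n1 : 2 * t + s != 0 by rewrite gt_eqF//; lra.
  rewrite (_ : t + (s + t) = 2 * t + s); last by ring.
  by move: (lt0r_neq0 pi0) (lt0r_neq0 t0) n1; clear; move: pi => q q0 t1 n1; field; rewrite q0 t1 n1.
have -> : 2 * s * (16 * pi * t ^+ 2)^-1 = s / (4 * pi * (t * (2 * t))).
  by move: (lt0r_neq0 pi0) (lt0r_neq0 t0); clear; move: pi => q q0 t1; field; rewrite q0 t1.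
apply: ler_wpM2l; first exact: ltW.
have q1 : 0 < t * (2 * t) by rewrite !mulr_gt0.
have q2 : t * (2 * t) <= t * (2 * t + s) by rewrite ler_pM2l// lerDl ltW.
have q3 : 0 < 4 * pi :> R by rewrite mulr_gt0.
rewrite lef_pV2 ?posrE; first by rewrite ler_pM2l.
- by apply: mulr_gt0 => //; exact: lt_le_trans q2.
- exact: mulr_gt0.
Qed.

Lemma pB_kk p t : 0 < p -> 0 < t -> pB p (kk t o) = (4 * pi * t) `^ (1 - p) / p.
Proof.
move=> p0 t0; have pi0 := pi_gt0 R; have T0 : 0 < 4 * pi * t by rewrite !mulr_gt0.
have tp : 0 < t / p by rewrite divr_gt0.
transitivity ((4 * pi * t) `^ (1 - p) / p * II mu (kk (t / p) o)); last by rewrite II_kk// mulr1.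
rewrite /pB -IIZ_ge0; [|exact: mkk1|by move=> x; exact: kk_ge0].
congr (II mu); apply/funext => x; rewrite (ger0_norm (kk_ge0 _ _ _)) !kkE//.
rewrite [LHS]powRM ?invr_ge0 ?expR_ge0 ?(ltW T0)//.
have -> : expR (- d2 o x / (4 * t)) `^ p = expR (- d2 o x / (4 * (t / p))).
  rewrite /powR gt_eqF ?expR_gt0// expRK; congr expR; field; rewrite !gt_eqF//.
rewrite [RHS]mulrA; congr (_ * _).
have -> : (4 * pi * t)^-1 `^ p = (4 * pi * t) `^ (- p) by rewrite -powR_inv1 ?(ltW T0)// -powRrM mulN1r.
rewrite powRD ?(gt_eqF T0) ?implybT// powRr1 ?(ltW T0)//.
move: (lt0r_neq0 pi0) (lt0r_neq0 t0) (lt0r_neq0 p0); move: ((4 * pi * t) `^ - p) => X; clear; move: pi => q q0 t1 p1.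
by field; rewrite q0 t1 p1.
Qed.

(** Spread-out Gaussians of mass m: the gradient term is at most m / (4 t), while the power term is
    C t^(1 - p/2), which decays more slowly because p < 4. The time is chosen so that the power term
    equals m / t. *)
Lemma negative_energy p m : 2 < p -> p < 4 -> 0 < m -> exists f N,
  [/\ HN f N, nrm2 mu f = m & N / 2 - pB p f / p < 0].
Proof.
move=> p2 p4 m0; have pi0 := pi_gt0 R; have p0 : 0 < p by lra.
pose C := (8 * pi * m) `^ (p / 2) * (4 * pi) `^ (1 - p) / p ^+ 2.
have C0 : 0 < C by rewrite divr_gt0 ?exprn_gt0// mulr_gt0 ?powR_gt0 ?mulr_gt0.
pose t := (m / C) `^ ((2 - p / 2)^-1); have t0 : 0 < t by rewrite /t powR_gt0// divr_gt0.
have p2n : 2 - p / 2 != 0 by rewrite gt_eqF//; lra.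
have tE : t `^ (2 - p / 2) = m / C by rewrite /t -powRrM mulVf// powRr1// divr_ge0// ltW.
pose s := Num.sqrt (8 * pi * t * m); have z0 : 0 < 8 * pi * t * m by rewrite !mulr_gt0.
have s2 : s ^+ 2 = 8 * pi * t * m by rewrite sqr_sqrtr// ltW.
have [N hN Nle] := HN_kk t0.
exists (fun x => s * kk t o x), (s ^+ 2 * N); split; first exact: HNZ.
  by rewrite (nrm2Z s (L2_kk o t0)) nrm2_kk// s2; move: (lt0r_neq0 pi0) (lt0r_neq0 t0); clear; move: pi => q q0 t1; field; rewrite q0 t1.
rewrite pBZ ?sqrtr_ge0 ?(mkk1 _ _)//; last exact: mkk1.
rewrite pB_kk// subr_lt0.
have h1 : s ^+ 2 * N / 2 <= m / (4 * t).
  apply: (@le_trans _ _ (s ^+ 2 * (16 * pi * t ^+ 2)^-1 / 2)).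
    by rewrite ler_pM2r// ler_wpM2l ?sqr_ge0.
  by rewrite s2 le_eqVlt; apply/orP; left; apply/eqP; move: (lt0r_neq0 pi0) (lt0r_neq0 t0); clear; move: pi => q q0 t1; field; rewrite q0 t1.
apply: le_lt_trans h1 _.
have -> : s `^ p * ((4 * pi * t) `^ (1 - p) / p) / p = C * t `^ (1 - p / 2).
  have -> : s `^ p = (8 * pi * m) `^ (p / 2) * t `^ (p / 2).
    rewrite /s -powR12_sqrt ?(ltW z0)// -powRrM [2^-1 * p]mulrC mulrAC.
    by rewrite [LHS]powRM ?mulr_ge0 ?(ltW pi0) ?(ltW m0) ?(ltW t0).
  rewrite [(4 * pi * t) `^ _]powRM ?mulr_ge0 ?(ltW pi0) ?(ltW t0)//.
  have -> : 1 - p / 2 = p / 2 + (1 - p) by field.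
  rewrite (@powRD _ t (p / 2) (1 - p)) ?(gt_eqF t0) ?implybT// /C.
  move: (lt0r_neq0 p0) (_ `^ (p / 2)) (_ `^ (p / 2)) (_ `^ (1 - p)) (_ `^ (1 - p)); clear=> p1 a b c d.
  by field; rewrite p1.
have -> : t `^ (1 - p / 2) = m / C / t.
  rewrite -tE -{3}[t]powRr1 ?(ltW t0)// -powRB ?(gt_eqF t0) ?implybT//; congr (_ `^ _); ring.
have -> : C * (m / C / t) = m / t by field; rewrite !gt_eqF.
by rewrite ltr_pM2l// ltf_pV2 ?posrE ?mulr_gt0//; lra.
Qed.

End real_energy.

(** * Existence of real minimizers *)

Section splitting.
Context {R : realType}.
Local Notation P := (mplane R).
Local Notation Q := (plane R).
Local Notation mu := (leb2 R).
Local Notation G a := (@Ga R a 0).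
Implicit Type p : R.

(** Boundedness extends weak convergence from test functions, which are dense, to all of L^2. *)
Lemma weak_cvg_dense (g_ : nat -> P -> R) g h (M : R) : (forall n, L2 mu (g_ n)) -> L2 mu g -> L2 mu h ->
  (forall n, nrm2 mu (g_ n) <= M) ->
  (forall psi : Q -> R, test_function psi -> (fun n => ip mu (g_ n) psi) @ \oo --> ip mu g psi) ->
  (fun n => ip mu (g_ n) h) @ \oo --> ip mu g h.
Proof.
move=> gL gl hL gM H; have [psi [pt pc]] := test_dense hL.
have g0 := nrm2_ge0 mu g; have M0 : 0 <= M := le_trans (nrm2_ge0 mu (g_ 0%N)) (gM 0%N).
pose K := 1 + M + nrm2 mu g; have K1 : 1 <= K by rewrite /K; lra.
have KK : K <= K ^+ 2 by rewrite expr2 ler_peMl//; lra.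
have K0 : 0 < K by lra.
apply/cvg_seqP => e e0; have d0 : 0 < e / (4 * K) by rewrite divr_gt0 ?mulr_gt0.
have [k hk] := (cvg_seqP _ _).1 pc _ (exprn_gt0 2 d0).
have {hk} := hk k (leqnn _); rewrite subr0 (ger0_norm (nrm2_ge0 _ _)) => hk.
have [n0 hn] := (cvg_seqP _ _).1 (H _ (pt k)) _ (divr_gt0 e0 (ltac:(by []) : (0 : R) < 4)).
exists n0 => n /hn; have pL := test_L2 (pt k).
have dL : L2 mu (fun x => psi k x - h x) by exact: L2B.
have b1 := norm_ip_le (gL n) dL (ltW K0) (ltW d0) (le_trans (gM n) (ltac:(rewrite /K in KK *; lra) : M <= K ^+ 2)) hk.
have b2 := norm_ip_le gl dL (ltW K0) (ltW d0) (ltac:(rewrite /K in KK *; lra) : nrm2 mu g <= K ^+ 2) hk.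
move: b1 b2; rewrite (ipBr pL hL (gL n)) (ipBr pL hL gl).
have -> : K * (e / (4 * K)) = e / 4 by field; rewrite gt_eqF.
move: (ip mu (g_ n) (psi k)) (ip mu g (psi k)) (ip mu (g_ n) h) (ip mu g h); clear - e0.
by move=> a b c d; rewrite !ler_norml => /andP[? ?] /andP[? ?] /andP[? ?]; apply/andP; split; lra.
Qed.

Lemma wgrad_lin (f g1 g2 h k1 k2 : P -> R) (c : R) : wgrad f g1 g2 -> wgrad h k1 k2 ->
  wgrad (fun x => f x + c * h x) (fun x => g1 x + c * k1 x) (fun x => g2 x + c * k2 x).
Proof.
move=> [fL g1L g2L fg] [hL k1L k2L hk]; split; [exact: L2D fL (L2Z _ _)|exact: L2D g1L (L2Z _ _)|exact: L2D g2L (L2Z _ _)|].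
move=> phi tphi; have [t1 t2] := test_D tphi; have pL := test_L2 tphi.
have [a1 a2] := fg _ tphi; have [b1 b2] := hk _ tphi.
rewrite (ipDl fL (L2Z c hL) (test_L2 t1)) (ipDl fL (L2Z c hL) (test_L2 t2)).
rewrite (ipDl g1L (L2Z c k1L) pL) (ipDl g2L (L2Z c k2L) pL).
rewrite (ipZl c hL (test_L2 t1)) (ipZl c hL (test_L2 t2)) (ipZl c k1L pL) (ipZl c k2L pL).
by rewrite a1 a2 b1 b2 !mulrN !opprD.
Qed.

Lemma nrm2_split (f_ : nat -> P -> R) f (M : R) : (forall n, L2 mu (f_ n)) -> L2 mu f ->
  (forall n, nrm2 mu (f_ n) <= M) -> {ae mu, forall x, f_ ^~ x @ \oo --> f x} ->
  (fun n => nrm2 mu (f_ n) - nrm2 mu (fun x => f_ n x + (-1) * f x)) @ \oo --> nrm2 mu f.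
Proof.
move=> fL fl fM ae; have := ae_bounded_weak_cvg fL fl fl fM ae; rewrite ipff => h.
have -> : nrm2 mu f = 2 * nrm2 mu f - nrm2 mu f by ring.
apply: sq_ext (sqB (sqZ 2 h) (sqC (nrm2 mu f))) => n.
by rewrite (nrm2_lin (-1) (fL n) fl); ring.
Qed.

(** The gradients pair with test functions as f_n does with derivatives, so they converge weakly to
    the gradient g of f; then |g_n|^2 - |g_n - g|^2 = 2 (g_n, g) - |g|^2 tends to |g|^2. *)
Lemma HN_split (f_ : nat -> P -> R) (N_ : nat -> R) f (M : R) : (forall n, HN (f_ n) (N_ n)) ->
  (forall n, N_ n <= M) -> (forall n, nrm2 mu (f_ n) <= M) -> L2 mu f ->
  {ae mu, forall x, f_ ^~ x @ \oo --> f x} ->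
  exists N Nh, [/\ HN f N, forall n, HN (fun x => f_ n x + (-1) * f x) (Nh n),
    forall n, Nh n <= 2 * N_ n + 2 * N & (fun n => N_ n - Nh n) @ \oo --> N].
Proof.
move=> hN NM fM fl ae; have fL n : L2 mu (f_ n) := HN_L2 (hN n).
have /boolp.choice[g hg] : forall n, exists g : (P -> R) * (P -> R),
    wgrad (f_ n) g.1 g.2 /\ nrm2 mu g.1 + nrm2 mu g.2 = N_ n.
  by move=> n; have [g1 [g2 h]] := hN n; exists (g1, g2).
have M0 : 0 <= M := le_trans (nrm2_ge0 mu (f_ 0%N)) (fM 0%N).
have gL1 n : L2 mu (g n).1 by case: (hg n) => -[].
have gL2 n : L2 mu (g n).2 by case: (hg n) => -[].
have gM1 n : nrm2 mu (g n).1 <= M.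
  by apply: le_trans (NM n); rewrite -(hg n).2 lerDl; exact: nrm2_ge0.
have gM2 n : nrm2 mu (g n).2 <= M.
  by apply: le_trans (NM n); rewrite -(hg n).2 lerDr; exact: nrm2_ge0.
have key (phi : Q -> R) : test_function phi ->
    (fun n => ip mu (g n).1 phi) @ \oo --> - ip mu f ('D_(e1 R) phi) /\
    (fun n => ip mu (g n).2 phi) @ \oo --> - ip mu f ('D_(e2 R) phi).
  move=> tp; have [t1 t2] := test_D tp.
  split.
    apply: sq_ext (sqN (ae_bounded_weak_cvg fL fl (test_L2 t1) fM ae)) => n.
    by have [[_ _ _ h] _] := hg n; rewrite (h _ tp).1 opprK.
  apply: sq_ext (sqN (ae_bounded_weak_cvg fL fl (test_L2 t2) fM ae)) => n.
  by have [[_ _ _ h] _] := hg n; rewrite (h _ tp).2 opprK.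
have bd (phi : Q -> R) : test_function phi ->
    (- ip mu f ('D_(e1 R) phi)) ^+ 2 <= M * nrm2 mu phi /\
    (- ip mu f ('D_(e2 R) phi)) ^+ 2 <= M * nrm2 mu phi.
  move=> tp; have [k1 k2] := key _ tp; have pL := test_L2 tp; have p0 := nrm2_ge0 mu phi.
  split.
    apply: sq_le (sqM k1 k1) (sqC _) _ => n; rewrite -expr2.
    by apply: le_trans (cauchy_schwarz (gL1 n) pL) _; exact: ler_wpM2r.
  apply: sq_le (sqM k2 k2) (sqC _) _ => n; rewrite -expr2.
  by apply: le_trans (cauchy_schwarz (gL2 n) pL) _; exact: ler_wpM2r.
have D1 : forall phi : Q -> R, test_function phi -> (forall x, derivable phi x (e1 R)) /\ L2 mu ('D_(e1 R) phi).
  move=> phi tp; have [t1 _] := test_D tp; split; last exact: test_L2.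
  by case: tp => c _; case: (c 1%N) => _ [].
have D2 : forall phi : Q -> R, test_function phi -> (forall x, derivable phi x (e2 R)) /\ L2 mu ('D_(e2 R) phi).
  move=> phi tp; have [_ t2] := test_D tp; split; last exact: test_L2.
  by case: tp => c _; case: (c 1%N) => _ [].
have [g1 [_ [k1L _ _ E1 _]]] := riesz_test M0
  (fun phi psi k tp ts => ip_derive_lin fl D1 k tp ts) (fun phi tp => (bd phi tp).1).
have [g2 [_ [k2L _ _ E2 _]]] := riesz_test M0
  (fun phi psi k tp ts => ip_derive_lin fl D2 k tp ts) (fun phi tp => (bd phi tp).2).
have wf : wgrad f g1 g2.
  split; [exact: fl|exact: k1L|exact: k2L|] => phi tp.
  by split; [rewrite -(E1 _ tp) opprK|rewrite -(E2 _ tp) opprK].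
have c1 : (fun n => ip mu (g n).1 g1) @ \oo --> nrm2 mu g1.
  rewrite -ipff; apply: (weak_cvg_dense gL1 k1L k1L gM1) => psi tp.
  by rewrite -(E1 _ tp); exact: (key _ tp).1.
have c2 : (fun n => ip mu (g n).2 g2) @ \oo --> nrm2 mu g2.
  rewrite -ipff; apply: (weak_cvg_dense gL2 k2L k2L gM2) => psi tp.
  by rewrite -(E2 _ tp); exact: (key _ tp).2.
exists (nrm2 mu g1 + nrm2 mu g2), (fun n => nrm2 mu (fun x => (g n).1 x + (-1) * g1 x) +
  nrm2 mu (fun x => (g n).2 x + (-1) * g2 x)); split.
- by exists g1, g2.
- move=> n; have w := wgrad_lin (-1) (hg n).1 wf.
  by exists (fun x => (g n).1 x + (-1) * g1 x), (fun x => (g n).2 x + (-1) * g2 x).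
- move=> n; rewrite -(hg n).2.
  have := nrm2D_le (gL1 n) (L2Z (-1) k1L); have := nrm2D_le (gL2 n) (L2Z (-1) k2L).
  rewrite (nrm2Z (-1) k1L) (nrm2Z (-1) k2L) sqrrN expr1n !mul1r.
  move: (nrm2 _ _) (nrm2 _ _) (nrm2 _ _) (nrm2 _ _) (nrm2 _ _) (nrm2 _ _) => a b c d e h; lra.
have -> : nrm2 mu g1 + nrm2 mu g2 = (2 * nrm2 mu g1 - nrm2 mu g1) + (2 * nrm2 mu g2 - nrm2 mu g2) by ring.
apply: sq_ext (sqD (sqB (sqZ 2 c1) (sqC _)) (sqB (sqZ 2 c2) (sqC _))) => n.
rewrite -(hg n).2 (nrm2_lin (-1) (gL1 n) k1L) (nrm2_lin (-1) (gL2 n) k2L).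
move: (nrm2 _ _) (nrm2 _ _) (nrm2 _ _) (nrm2 _ _) (ip _ _ _) (ip _ _ _) => a b c d e h; ring.
Qed.

Lemma half_ratio (x g : R) : 0 <= x -> 0 <= g -> g / (2 * (1 + x)) * x <= g / 2.
Proof.
move=> x0 g0; have y0 : 0 < 1 + x by lra.
have -> : g / (2 * (1 + x)) * x = g / 2 * (x / (1 + x)) by field; rewrite gt_eqF.
by rewrite ler_piMr ?divr_ge0// ler_pdivrMr// mul1r lerDr.
Qed.

Lemma powR_cvg0_seq p (y : nat -> R) : 2 < p -> y @ \oo --> 0 -> (fun n => `|y n| `^ p) @ \oo --> 0.
Proof.
move=> p2 /cvg_seqP h; apply/cvg_seqP => e e0.
have m0 : 0 < Num.min 1 e by rewrite lt_min ltr01.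
have [n0 hn] := h _ m0; exists n0 => n /hn; rewrite !subr0 le_min => /andP[y1 ye].
rewrite (ger0_norm (powR_ge0 _ _)); apply: le_trans ye.
have [->|yn] := eqVneq `|y n| 0; first by rewrite powR0// gt_eqF//; lra.
by apply: ge1r_powR; [rewrite lt_def yn normr_ge0|lra].
Qed.

(** The positive part [F] of the defect is dominated by C |v|^p and tends to 0. One side suffices
    because the power enters the energy with a minus sign and only lower bounds of the energy are
    needed. *)
Lemma one_sided_brezis_lieb p (v_ : nat -> P -> R) (v : P -> R) (e : R) : 2 < p -> p < 4 -> 0 < e ->
  (forall n, mf (v_ n)) -> mf v -> ig mu (fun x => `|v x| `^ p) ->
  (forall n, ig mu (fun x => `|v_ n x| `^ p)) -> (forall n, ig mu (fun x => `|v_ n x + (-1) * v x| `^ p)) ->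
  {ae mu, forall x, v_ ^~ x @ \oo --> v x} ->
  exists2 r : nat -> R, r @ \oo --> 0 & forall n, pB p (v_ n) <= (1 + e) * pB p (fun x => v_ n x + (-1) * v x) + pB p v + r n.
Proof.
move=> p2 p4 e0 mv_ mv iv iv_ iw ae; have [C C0 hC] := powR_split p2 p4 e0.
pose F n x := Num.max 0 (`|v_ n x| `^ p - ((1 + e) * `|v_ n x + (-1) * v x| `^ p + `|v x| `^ p)).
have mw n : mf (fun x => v_ n x + (-1) * v x).
  by apply: measurable_funD => //; apply: measurable_funM.
have mF n : mf (F n : P -> R).
  apply: measurable_maxr; first exact: measurable_cst.
  apply: measurable_funB; first exact: mpowR.
  by apply: measurable_funD; [apply: measurable_funM => //; exact: mpowR|exact: mpowR].
have F0 n x : 0 <= F n x by rewrite le_max lexx.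
have Fle n x : F n x <= C * `|v x| `^ p.
  rewrite /F ge_max mulr_ge0 ?powR_ge0//= lerBlDr.
  have := hC (v_ n x + (-1) * v x) (v x); rewrite mulN1r subrK => h.
  by apply: le_trans h _; have := powR_ge0 `|v x| p; lra.
have Fcv : {ae mu, forall x, F ^~ x @ \oo --> 0}.
  apply: filterS ae => x hx; apply/cvg_seqP => eta eta0.
  have y0 : (fun n => v_ n x + (-1) * v x) @ \oo --> 0.
    by have := sqD hx (sqC (-1 * v x)); rewrite mulN1r subrr.
  have Vp := powR_ge0 `|v x| p.
  have d0 : 0 < eta / (2 * (1 + `|v x| `^ p)) by rewrite divr_gt0// mulr_gt0// ltr_pwDl.
  have [D D0 hD] := powR_split p2 p4 d0.
  have q0 : 0 < eta / (2 * (1 + D)) by rewrite divr_gt0// mulr_gt0// ltr_pwDl.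
  have [n0 hn] := (cvg_seqP _ _).1 (powR_cvg0_seq p2 y0) _ q0.
  exists n0 => n /hn; rewrite !subr0 (ger0_norm (powR_ge0 _ _)) (ger0_norm (F0 _ _)) => Y.
  rewrite /F ge_max (ltW eta0)/= lerBlDr.
  have := hD (v x) (v_ n x + (-1) * v x); rewrite addrC mulN1r subrK => h; apply: le_trans h _.
  have Y0 := powR_ge0 `|v_ n x - v x| p.
  have a1 := half_ratio Vp (ltW eta0).
  have a2 : D * `|v_ n x - v x| `^ p <= eta / 2.
    rewrite mulN1r in Y; apply: (@le_trans _ _ (D * (eta / (2 * (1 + D))))); first exact: ler_wpM2l.
    by rewrite mulrC; exact: half_ratio (ltW eta0).
  have a3 : 0 <= (1 + e) * `|v_ n x - v x| `^ p by rewrite mulr_ge0// addr_ge0// ltW.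
  rewrite mulrDl mul1r; lra.
have iC := igZ C iv.
have [iF0 cF] := II_dct mF (@measurable_cst _ _ P R setT 0) Fcv iC (fun n x => ltac:(rewrite (ger0_norm (F0 n x)); exact: Fle)).
exists (fun n => II mu (F n)); first by rewrite II0 in cF.
move=> n; have iF : ig mu (F n).
  by apply: ig_le (mF n) _ iC => x; rewrite (ger0_norm (F0 n x)).
rewrite /pB -IIZ// -IID//; last exact: igZ.
rewrite -IID//; last by apply: igD => //; exact: igZ.
apply: II_le => //; first by apply: igD => //; apply: igD => //; exact: igZ.
by move=> x; rewrite -lerBlDl /F le_max lexx orbT.
Qed.

Definition VV (lam : R) (f : P -> R) (c : R) : P -> R := fun x => f x + c * G lam x.

(** The energy in terms of the regular part and the charge; [N] stands for the squared gradient norm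
    of f, to which [HN f N] ties it. *)
Definition EE (al p lam : R) (f : P -> R) (N c : R) : R :=
  (N + lam * (nrm2 mu f - nrm2 mu (VV lam f c)) + (al + theta lam) * c ^+ 2) / 2 - pB p (VV lam f c) / p.

(** The energy of v_n is, up to o(1) and a small fraction of the power, the sum of those of the
    limit and of the remainder. The hypothesis with right-hand side [EE], linear in the mass, bounds
    the remainder below by its share of e, which leaves the limit with at most its own share. *)
Lemma splitting al p lam m e (f_ : nat -> P -> R) (N_ c_ : nat -> R) f c M : 2 < p -> p < 4 ->
  0 < lam -> 0 < m ->
  (forall f N c, HN f N -> nrm2 mu (VV lam f c) <= m -> nrm2 mu (VV lam f c) / m * e <= EE al p lam f N c) ->
  (forall n, HN (f_ n) (N_ n)) -> (forall n, N_ n <= M) -> (forall n, nrm2 mu (f_ n) <= M) ->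
  (forall n, c_ n ^+ 2 <= M) -> c_ @ \oo --> c -> L2 mu f -> {ae mu, forall x, f_ ^~ x @ \oo --> f x} ->
  (fun n => nrm2 mu (VV lam (f_ n) (c_ n))) @ \oo --> m ->
  (forall d, 0 < d -> exists n0, forall n, (n0 <= n)%N -> EE al p lam (f_ n) (N_ n) (c_ n) <= e + d) ->
  0 < nrm2 mu (VV lam f c) -> exists N, [/\ HN f N, nrm2 mu (VV lam f c) <= m &
    EE al p lam f N c <= nrm2 mu (VV lam f c) / m * e].
Proof.
move=> p2 p4 l0 m0 low hN NM fM cM cc fl ae vm Ee v0.
have GL := L2_Ga l0 (lexx 0); have fL n := HN_L2 (hN n).
have [N [Nh [hf hh NhM Nc]]] := HN_split hN NM fM fl ae.
have VL g k : L2 mu g -> L2 mu (VV lam g k) by move=> gL; exact: L2D gL (L2Z k GL).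
pose h_ n : P -> R := fun x => f_ n x + (-1) * f x; pose k_ n := c_ n - c.
have M0 : 0 <= M := le_trans (sqr_ge0 _) (cM 0%N).
have G0 := nrm2_ge0 mu (G lam); have nf0 := nrm2_ge0 mu f.
have Vhk n : VV lam (h_ n) (k_ n) = fun x => VV lam (f_ n) (c_ n) x + (-1) * VV lam f c x.
  by apply/funext => x; rewrite /VV /h_ /k_; move: (f_ n x) (f x) (Ga lam 0 x) => a b g; ring.
have Vb g k : L2 mu g -> nrm2 mu g <= M -> k ^+ 2 <= M -> nrm2 mu (VV lam g k) <= 2 * M + 2 * (M * nrm2 mu (G lam)).
  move=> gL gM kM; apply: le_trans (nrm2D_le gL (L2Z k GL)) _; rewrite (nrm2Z k GL).
  have := ler_wpM2r G0 kM; lra.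
have VM n := Vb _ _ (fL n) (fM n) (cM n).
have aeV : {ae mu, forall x, (fun n => VV lam (f_ n) (c_ n) x) @ \oo --> VV lam f c x}.
  by apply: filterS ae => x hx; apply: sqD hx (sqM cc (sqC _)).
have s1 := nrm2_split fL fl fM ae.
have s2 := nrm2_split (fun n => VL _ (c_ n) (fL n)) (VL _ c fl) VM aeV.
have hm : (fun n => nrm2 mu (VV lam (h_ n) (k_ n))) @ \oo --> m - nrm2 mu (VV lam f c).
  apply: sq_ext (sqB vm s2) => n; rewrite Vhk; move: (nrm2 _ _) (nrm2 _ _) => a b; ring.
have nvm : nrm2 mu (VV lam f c) <= m.
  by rewrite -subr_ge0; apply: cvg_ge hm _ => n; exact: nrm2_ge0.
exists N; split=> //.
have sq := (fun n => c_ n ^+ 2 - k_ n ^+ 2) @ \oo --> c ^+ 2.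
have sqc : (fun n => c_ n ^+ 2 - k_ n ^+ 2) @ \oo --> c ^+ 2.
  have -> : c ^+ 2 = 2 * c * c - c ^+ 2 by ring.
  by apply: sq_ext (sqB (sqZ (2 * c) cc) (sqC (c ^+ 2))) => n; rewrite /k_; ring.
pose Mh := 2 * (2 * M + 2 * (M * nrm2 mu (G lam))) + 2 * nrm2 mu (VV lam f c).
have hM n : nrm2 mu (VV lam (h_ n) (k_ n)) <= Mh.
  rewrite Vhk; apply: le_trans (nrm2D_le (VL _ _ (fL n)) (L2Z (-1) (VL _ c fl))) _.
  rewrite (nrm2Z (-1) (VL _ c fl)) sqrrN expr1n mul1r /Mh; have := VM n; lra.
have Mh0 : 0 <= Mh := le_trans (nrm2_ge0 _ _) (hM 0%N).
have [K hK] := pB_coercive p2 p4 l0 Mh0 (@ltr01 R).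
have MhV : nrm2 mu (VV lam f c) <= Mh.
  by rewrite /Mh; have := nrm2_ge0 mu (VV lam f c); have := mulr_ge0 M0 G0; lra.
have MhV_ n : nrm2 mu (VV lam (f_ n) (c_ n)) <= Mh.
  by have := VM n; rewrite /Mh; have := nrm2_ge0 mu (VV lam f c); have := mulr_ge0 M0 G0; lra.
have iV := (hK _ _ c hf MhV).1; have iV_ n := (hK _ _ (c_ n) (hN n) (MhV_ n)).1.
have ih n := hK _ _ (k_ n) (hh n) (hM n).
pose K2 := 2 * M + 2 * N + (4 * M + 2 * c ^+ 2 + `|K|).
have Bh n : pB p (VV lam (h_ n) (k_ n)) <= K2.
  apply: le_trans (ih n).2 _; rewrite mul1r; have := NhM n; have := NM n; have := cM n; have := ler_norm K.
  have : k_ n ^+ 2 <= 2 * c_ n ^+ 2 + 2 * c ^+ 2 by have := sqr_ge0 (c_ n + c); rewrite /k_; nra.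
  rewrite /K2; move: (Nh n) (N_ n) (c_ n ^+ 2) (k_ n ^+ 2) => a1 a2 a3 a4; lra.
have K20 : 0 <= K2 := le_trans (pB_ge0 _ _) (Bh 0%N).
have [n0 hn0] : exists n0, forall n, (n0 <= n)%N -> nrm2 mu (VV lam (h_ n) (k_ n)) <= m.
  have [n0 h] := (cvg_seqP _ _).1 hm _ v0; exists n0 => n /h; rewrite ler_norml => /andP[_]; lra.
pose QV := N + lam * (nrm2 mu f - nrm2 mu (VV lam f c)) + (al + theta lam) * c ^+ 2.
have p0 : 0 < p by lra.
have ip0 : 0 < p^-1 by rewrite invr_gt0.
have dQ : (fun n => N_ n - Nh n + lam * ((nrm2 mu (f_ n) - nrm2 mu (h_ n))
    - (nrm2 mu (VV lam (f_ n) (c_ n)) - nrm2 mu (VV lam (h_ n) (k_ n))))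
    + (al + theta lam) * (c_ n ^+ 2 - k_ n ^+ 2)) @ \oo --> QV.
  apply: sqD (sqD Nc (sqZ lam (sqB s1 _))) (sqZ (al + theta lam) sqc).
  by apply: sq_ext s2 => n; rewrite Vhk.
suff main d : 0 < d -> EE al p lam f N c + (m - nrm2 mu (VV lam f c)) / m * e <= e + d * (K2 * p^-1 + 1).
  have e1 : (m - nrm2 mu (VV lam f c)) / m * e = e - nrm2 mu (VV lam f c) / m * e.
    by rewrite mulrBl divff ?gt_eqF// mulrBl mul1r.
  rewrite leNgt; apply/negP => lt.
  pose gap := EE al p lam f N c - nrm2 mu (VV lam f c) / m * e.
  have gap0 : 0 < gap by rewrite subr_gt0.
  have X0 : 0 <= K2 * p^-1 + 1 by rewrite addr_ge0// mulr_ge0// ltW.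
  have d0 : 0 < gap / (2 * (1 + (K2 * p^-1 + 1))) by rewrite divr_gt0// mulr_gt0// ltr_pwDl.
  have := main _ d0; rewrite e1.
  have := half_ratio X0 (ltW gap0).
  move: gap0; rewrite /gap; move: (EE _ _ _ _ _ _) (nrm2 _ _ / m * e) => x y; clear.
  by move: (_ * _) => z; lra.
move=> d0.
have ihn n : ig mu (fun x => `|VV lam (f_ n) (c_ n) x + (-1) * VV lam f c x| `^ p).
  have := (ih n).1; congr (ig mu _); apply/funext => x; congr (`|_| `^ p).
  by rewrite /VV /h_ /k_; move: (f_ n x) (f x) (Ga lam 0 x) => a b g; ring.
have [r r0 hr] := one_sided_brezis_lieb p2 p4 d0 (fun n => (VL _ (c_ n) (fL n)).1) (VL _ c fl).1 iV iV_ ihn aeV.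
have [n1 hn1] := Ee _ d0.
pose s n := (n + n1 + n0)%N; have sn n : (n <= s n)%N by rewrite /s -addnA leq_addr.
have L1 := sqB (sqB (sqD (sqZ 2^-1 dQ) (sqM (sqM hm (sqC m^-1)) (sqC e))) (sqC (p^-1 * (d * K2 + pB p (VV lam f c))))) (sqZ p^-1 r0).
have := cvg_le (cvg_sub_seq sn L1).
rewrite mulr0 subr0 => h.
have step n : 2^-1 * (N_ (s n) - Nh (s n) + lam * (nrm2 mu (f_ (s n)) - nrm2 mu (h_ (s n)) -
     (nrm2 mu (VV lam (f_ (s n)) (c_ (s n))) - nrm2 mu (VV lam (h_ (s n)) (k_ (s n))))) +
     (al + theta lam) * (c_ (s n) ^+ 2 - k_ (s n) ^+ 2)) +
   nrm2 mu (VV lam (h_ (s n)) (k_ (s n))) * m^-1 * e - p^-1 * (d * K2 + pB p (VV lam f c)) - p^-1 * r (s n)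
   <= e + d.
  apply: le_trans (hn1 (s n) (leq_trans (leq_addl n n1) (leq_addr _ _))).
  have := low _ _ (k_ (s n)) (hh (s n)) (hn0 _ (leq_addl _ _)).
  have := hr (s n); rewrite -Vhk => b.
  have {b}b : pB p (VV lam (f_ (s n)) (c_ (s n))) <= pB p (VV lam (h_ (s n)) (k_ (s n))) + d * K2 + pB p (VV lam f c) + r (s n).
    apply: le_trans b _; rewrite mulrDl mul1r !lerD2r lerD2l.
    by apply: ler_wpM2l; [exact: ltW|exact: Bh].
  have := ler_wpM2l (ltW ip0) b; rewrite /EE -/(h_ (s n)); clear.
  move: (nrm2 mu (VV lam (h_ (s n)) (k_ (s n)))) (nrm2 mu (VV lam (f_ (s n)) (c_ (s n)))) (nrm2 mu (f_ (s n)))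
    (nrm2 mu (h_ (s n))) => a1 a2 a3 a4.
  move: (pB _ _) (pB _ _) (pB _ _) (c_ (s n) ^+ 2) (k_ (s n) ^+ 2) (al + theta lam) (p^-1) (r (s n)) (N_ (s n)) (Nh (s n)).
  move=> b1 b2 b3 c1 c2 th ip r1 x1 x2; move: (a1 / m * e) => a5; lra.
have {}h := h (e + d) step.
have -> : e + d * (K2 * p^-1 + 1) = e + d + d * (K2 * p^-1) by ring.
rewrite -lerBlDr; apply: le_trans h; rewrite /EE -/QV; clear.
by rewrite le_eqVlt; apply/orP; left; apply/eqP; move: QV K2 (pB _ _) (nrm2 _ _) => A K2 B V; ring.
Qed.

End splitting.

(** * Minimizing sequences *)

Section existence.
Context {R : realType}.
Local Notation P := (mplane R).
Local Notation mu := (leb2 R).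
Local Notation G a := (@Ga R a 0).
Let o : P := (0, 0).
Implicit Type p : R.

Lemma VV_L2 lam f c : 0 < lam -> L2 mu f -> L2 mu (VV lam f c).
Proof. by move=> l0 fL; exact: L2D fL (L2Z c (L2_Ga l0 (lexx 0))). Qed.

Lemma VV0 lam (f : P -> R) : VV lam f 0 = f.
Proof. by apply/funext => x; rewrite /VV mul0r addr0. Qed.

Lemma EE0 al p lam (f : P -> R) N : EE al p lam f N 0 = N / 2 - pB p f / p.
Proof. by rewrite /EE VV0 subrr expr0n !mulr0 !addr0. Qed.

Lemma EE_scale al p lam f N c (s : R) : 0 < lam -> L2 mu f -> 0 <= s ->
  nrm2 mu (VV lam (fun x => s * f x) (s * c)) = s ^+ 2 * nrm2 mu (VV lam f c) /\
  EE al p lam (fun x => s * f x) (s ^+ 2 * N) (s * c) =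
  s ^+ 2 * ((N + lam * (nrm2 mu f - nrm2 mu (VV lam f c)) + (al + theta lam) * c ^+ 2) / 2)
    - s `^ p * (pB p (VV lam f c) / p).
Proof.
move=> l0 fL s0; have VL := VV_L2 c l0 fL.
have e : VV lam (fun x => s * f x) (s * c) = fun x => s * VV lam f c x.
  by apply/funext => x; rewrite /VV mulrDr mulrA.
rewrite /EE e (nrm2Z s VL) (nrm2Z s fL) (pBZ p VL.1 s0); split=> //.
by move: (nrm2 _ _) (nrm2 _ _) (pB _ _) (s `^ p) (theta lam) => a b B q th; clear; ring.
Qed.

Lemma EE_scale_le al p lam f N c (s : R) : 2 < p -> 0 < lam -> L2 mu f -> 1 <= s ->
  EE al p lam (fun x => s * f x) (s ^+ 2 * N) (s * c) <= s ^+ 2 * EE al p lam f N c.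
Proof.
move=> p2 l0 fL s1; rewrite (EE_scale al p N c l0 fL (le_trans ler01 s1)).2 /EE [leRHS]mulrBr lerD2l lerN2.
apply: ler_wpM2r; first by apply: divr_ge0 (pB_ge0 _ _) _; lra.
by rewrite -(powR_mulrn 2 (le_trans ler01 s1)); apply: ler_powR => //; exact: ltW.
Qed.

(** A nonzero charge would make G equal almost everywhere to an H^1 function. *)
Lemma zero_state al p lam f N c : 2 < p -> 0 < lam -> HN f N -> nrm2 mu (VV lam f c) = 0 ->
  [/\ c = 0, nrm2 mu f = 0 & EE al p lam f N c = 0].
Proof.
move=> p2 l0 h v0; have fL := HN_L2 h; have ae := nrm2_eq0 (VV_L2 c l0 fL) v0.
have c0 : c = 0.
  apply/eqP/negPn/negP => cn; apply: (@G_notin_H1 _ lam ((- c^-1) ^+ 2 * N) l0).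
  apply: HN_ae (L2_Ga l0 (lexx 0)).1 _ (HNZ (- c^-1) h).
  apply: filterS ae => x; rewrite /VV => /eqP; rewrite addr_eq0 => /eqP ->.
  by rewrite mulNr mulrN opprK mulKf.
move: v0 ae; rewrite c0 VV0 => v0 ae; rewrite EE0; split=> //.
have m0 : mf (fun _ : P => 0 : R) by exact: measurable_cst.
have N0 : N = 0 := HN_unique (HN_ae m0 ae h) HN0.
rewrite (pB_ae p fL.1 m0 ae) N0 /pB.
have -> : (fun _ : P => `|(0 : R)| `^ p) = (fun=> 0).
  by apply/funext => x; rewrite normr0 powR0// gt_eqF//; lra.
by rewrite II0 !mul0r subrr.
Qed.

(** Scale up to mass m. The zero state cannot be scaled and is handled by [zero_state]. *)
Lemma EE_lower al p lam m e : 2 < p -> 0 < lam -> 0 < m ->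
  (forall f N c, HN f N -> nrm2 mu (VV lam f c) = m -> e <= EE al p lam f N c) ->
  forall f N c, HN f N -> nrm2 mu (VV lam f c) <= m -> nrm2 mu (VV lam f c) / m * e <= EE al p lam f N c.
Proof.
move=> p2 l0 m0 low f N c h vm; have fL := HN_L2 h.
have [v0|v0] := eqVneq (nrm2 mu (VV lam f c)) 0.
  by have [_ _ ->] := zero_state al p2 l0 h v0; rewrite v0 !mul0r.
have vp : 0 < nrm2 mu (VV lam f c) by rewrite lt_def v0 nrm2_ge0.
pose s := Num.sqrt (m / nrm2 mu (VV lam f c)).
have s2 : s ^+ 2 = m / nrm2 mu (VV lam f c) by rewrite sqr_sqrtr// divr_ge0// ltW.
have r1 : 1 <= m / nrm2 mu (VV lam f c) by rewrite ler_pdivlMr// mul1r.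
have s1 : 1 <= s by rewrite -sqrtr1 /s ler_wsqrtr.
have [nE _] := EE_scale al p N c l0 fL (le_trans ler01 s1).
have := low _ _ (s * c) (HNZ s h).
rewrite {1}nE {1}s2 divfK// => /(_ erefl) le; have {le} := le_trans le (EE_scale_le al N c p2 l0 fL s1).
rewrite s2 => le; rewrite mulrC -ler_pdivlMr ?divr_gt0//.
by rewrite invf_div mulrC.
Qed.

Lemma minimizer_of_ratio al p lam m e f N c : 2 < p -> 0 < lam -> 0 < m -> HN f N ->
  0 < nrm2 mu (VV lam f c) <= m -> EE al p lam f N c <= nrm2 mu (VV lam f c) / m * e ->
  exists g M d, [/\ HN g M, nrm2 mu (VV lam g d) = m & EE al p lam g M d <= e].
Proof.
move=> p2 l0 m0 h /andP[vp vm] le; have fL := HN_L2 h; have v0 := lt0r_neq0 vp.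
pose s := Num.sqrt (m / nrm2 mu (VV lam f c)).
have s2 : s ^+ 2 = m / nrm2 mu (VV lam f c) by rewrite sqr_sqrtr// divr_ge0// ltW.
have r1 : 1 <= m / nrm2 mu (VV lam f c) by rewrite ler_pdivlMr// mul1r.
have s1 : 1 <= s by rewrite -sqrtr1 /s ler_wsqrtr.
have [nE _] := EE_scale al p N c l0 fL (le_trans ler01 s1).
exists (fun x => s * f x), (s ^+ 2 * N), (s * c); split; first exact: HNZ.
  by rewrite nE s2 divfK.
apply: le_trans (EE_scale_le al N c p2 l0 fL s1) _; rewrite s2 mulrC -ler_pdivlMr ?divr_gt0//.
by rewrite invf_div mulrC.
Qed.

Lemma TT_sqr_sh (f : P -> R) y : mf f ->
  TT 1 (fun z => f z ^+ 2) y = II mu (fun z => kk 1 o z * (sh y f z) ^+ 2).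
Proof.
move=> fm; rewrite /TT /ip -(minv_II (minv_sh y)).
  by congr (II mu); apply/funext => z; rewrite /= kk_shift.
by apply: measurable_funM; [exact: mkk1|exact: measurable_funX].
Qed.

Lemma bounded_subsequence (c_ : nat -> R) (M : R) : (forall n, `|c_ n| <= M) ->
  exists (s : nat -> nat) (c : R), (forall n, (n <= s n)%N) /\ (fun n => c_ (s n)) @ \oo --> c.
Proof.
move=> h; have [s [sn cs]] := @diagonal_subsequence R (fun _ n => c_ n) (fun=> M) (fun _ n => h n).
by exists s, (limn (fun n => c_ (s n))); split=> //; exact: (cs 0%N).
Qed.

(* Without a charge the limit may vanish only by escaping to infinity, which
   translations undo. *)
Lemma chargeless_minimizer al p lam m e (f_ : nat -> P -> R) (N_ : nat -> R) M : 2 < p -> p < 4 ->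
  0 < lam -> 0 < m -> e < 0 ->
  (forall f N c, HN f N -> nrm2 mu (VV lam f c) = m -> e <= EE al p lam f N c) ->
  (forall n, HN (f_ n) (N_ n)) -> (forall n, N_ n <= M) -> (forall n, nrm2 mu (f_ n) <= M) ->
  (fun n => nrm2 mu (f_ n)) @ \oo --> m ->
  (forall d, 0 < d -> exists n0, forall n, (n0 <= n)%N -> EE al p lam (f_ n) (N_ n) 0 <= e + d) ->
  exists g K d, [/\ HN g K, nrm2 mu (VV lam g d) = m & EE al p lam g K d <= e].
Proof.
move=> p2 p4 l0 m0 e0 low hN NM fM fm Ee; have fL n := HN_L2 (hN n); have p0 : 0 < p by lra.
have M0 : 0 <= M := le_trans (nrm2_ge0 mu _) (fM 0%N).
(* Energies below e/2 force p-th powers of at least p |e| / 2, whereas vanishing would bring them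
   below p |e| / 4. *)
have x0 : 0 < p * - (e / 4) by rewrite mulr_gt0//; lra.
have [eta eta0 van] := pB_vanishing p2 p4 M0 M0 x0.
have [n0 hn0] := Ee (- (e / 2)) (ltac:(lra)).
have /boolp.choice[y hy] n : exists y, eta < TT 1 (fun z => f_ (n + n0)%N z ^+ 2) y.
  apply: contrapT => ny; have /(van _ _ (hN _) (NM _) (fM _)) : forall y, TT 1 (fun z => f_ (n + n0)%N z ^+ 2) y <= eta.
    by move=> y; rewrite leNgt; apply/negP => lt; apply: ny; exists y.
  have := hn0 _ (leq_addl n n0); rewrite EE0; have := HN_ge0 (hN (n + n0)%N).
  move: (N_ _) (pB _ _) => a B a0; rewrite lerBlDr -lerBlDl ler_pdivlMr// => b1 b2.
  have : p * (a / 2 - (e + - (e / 2))) <= p * - (e / 4) by rewrite mulrC (le_trans b1).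
  by rewrite ler_pM2l//; lra.
pose h_ n := sh (y n) (f_ (n + n0)%N); pose K_ n := N_ (n + n0)%N.
have hh n : HN (h_ n) (K_ n) by exact: HN_sh.
have hn n : nrm2 mu (h_ n) = nrm2 mu (f_ (n + n0)%N) by exact: nrm2_sh (fL _).1.
have hM n : nrm2 mu (h_ n) <= M by rewrite hn.
have dM n t : 0 < t -> dn t (h_ n) <= 2 * t * M.
  move=> t0; apply: le_trans (HN_le (hh n) t0) _; apply: ler_wpM2l; first by rewrite mulr_ge0 ?(ltW t0).
  exact: NM.
have [s [f [sn fl ae wc]]] := rellich (fun n => HN_L2 (hh n)) hM dM.
pose s2 n := (s n + n0)%N; have s2n n : (n <= s2 n)%N by rewrite (leq_trans (sn n)) ?leq_addr.
have fp : 0 < nrm2 mu f.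
  rewrite lt_def nrm2_ge0 andbT; apply/negP => /eqP f0; have ae0 := nrm2_eq0 fl f0.
  have : eta <= 0; last by rewrite leNgt eta0.
  apply: cvg_ge wc _ => n; apply: (le_trans (ltW (hy (s n)))).
  rewrite (TT_sqr_sh _ (fL _).1) le_eqVlt; apply/orP; left; apply/eqP.
  have mh := (HN_L2 (hh (s n))).1.
  apply: ae_II; [by apply: measurable_funM; [exact: mkk1|exact: measurable_funX]| |].
    by apply: measurable_funM; [exact: mkk1|apply: measurable_funX; apply: measurable_funB => //; exact: fl.1].
  by apply: filterS ae0 => x ->; rewrite subr0.
have lw := EE_lower p2 l0 m0 low.
have := @splitting R al p lam m e (h_ \o s) (K_ \o s) (fun=> 0) f 0 M p2 p4 l0 m0 lw (fun n => hh _)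
  (fun n => NM _) (fun n => hM _) _ (sqC 0) fl ae.
have c1 : forall n : nat, (0 : R) ^+ 2 <= M by move=> _; rewrite expr0n.
have c2 : (fun n => nrm2 mu (VV lam ((h_ \o s) n) 0)) @ \oo --> m.
  by apply: sq_ext (cvg_sub_seq s2n fm) => n; rewrite VV0 /= hn.
have c3 d : 0 < d -> exists n0, forall n, (n0 <= n)%N -> EE al p lam ((h_ \o s) n) ((K_ \o s) n) 0 <= e + d.
  move=> /Ee[n1 h]; exists n1 => n /leq_trans - /(_ _ (s2n n)) /h.
  by rewrite !EE0 /= pB_sh//; exact: (fL _).1.
have c4 : 0 < nrm2 mu (VV lam f 0) by rewrite VV0.
by move=> /(_ c1 c2 c3 c4)[N [hf vm le]]; apply: minimizer_of_ratio p2 l0 m0 hf _ le; rewrite c4.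
Qed.

Theorem real_minimizer al p m : 2 < p -> p < 4 -> 0 < m -> exists lam f N c,
  [/\ 0 < lam, HN f N, nrm2 mu (VV lam f c) = m, EE al p lam f N c < 0 &
  forall g K d, HN g K -> nrm2 mu (VV lam g d) = m -> EE al p lam f N c <= EE al p lam g K d].
Proof.
move=> p2 p4 m0; have [lam [K [l0 hK]]] := energy_coercive al p2 p4 (ltW m0).
have p0 : 0 < p by lra.
pose S := [set r | exists f N c, [/\ HN f N, nrm2 mu (VV lam f c) = m & EE al p lam f N c = r]].
have [g [L [gL gm gneg]]] := negative_energy p2 p4 m0.
have Sg : S (L / 2 - pB p g / p) by exists g, L, 0; rewrite EE0 VV0.
have Slb : lbound S (- (K / 4)).
  move=> r [f [N [c [h vm <-]]]]; have b : N + c ^+ 2 <= 4 * EE al p lam f N c + K.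
    by apply: hK h _; rewrite -/(VV lam f c) vm.
  have := HN_ge0 h; have := sqr_ge0 c; lra.
have hS : has_inf S by split; [exists (L / 2 - pB p g / p)|exists (- (K / 4))].
pose e := inf S; have e0 : e < 0 by apply: le_lt_trans gneg; exact: (ge_inf hS.2 Sg).
have low f N c : HN f N -> nrm2 mu (VV lam f c) = m -> e <= EE al p lam f N c.
  by move=> h v; apply: (ge_inf hS.2); exists f, N, c.
suff [f [N [c [h v le]]]] : exists f N c, [/\ HN f N, nrm2 mu (VV lam f c) = m & EE al p lam f N c <= e].
  exists lam, f, N, c; split; [exact: l0|exact: h|exact: v|exact: le_lt_trans le e0|].
  by move=> g' K' d hg vg; apply: le_trans le _; exact: low.
have /boolp.choice[X hX] (n : nat) : exists X : (P -> R) * R * R, [/\ HN X.1.1 X.1.2,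
    nrm2 mu (VV lam X.1.1 X.2) = m & EE al p lam X.1.1 X.1.2 X.2 < e + n.+1%:R^-1].
  have [r [f [N [c [h v <-]]]] lt] := inf_adherent (harm_gt0 n) hS.
  by exists (f, N, c).
pose f_ n := (X n).1.1; pose N_ n := (X n).1.2; pose c_ n := (X n).2.
have hN n : HN (f_ n) (N_ n) by case: (hX n).
have vm n : nrm2 mu (VV lam (f_ n) (c_ n)) = m by case: (hX n).
have En n : EE al p lam (f_ n) (N_ n) (c_ n) < e + n.+1%:R^-1 by case: (hX n).
have fL n := HN_L2 (hN n); have GL := L2_Ga l0 (lexx 0).
pose M0 := 4 + `|K|.
have Nc n : N_ n + c_ n ^+ 2 <= M0.
  have b : N_ n + c_ n ^+ 2 <= 4 * EE al p lam (f_ n) (N_ n) (c_ n) + K.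
    by apply: hK (hN n) _; rewrite -/(VV lam (f_ n) (c_ n)) vm.
  have h1 : (n.+1%:R^-1 : R) <= 1 by rewrite invf_le1// ler1n.
  have := En n; have := ler_norm K; rewrite /M0; move: (n.+1%:R^-1) h1 => z; move: (EE _ _ _ _ _ _) b => y; lra.
have N0 n := HN_ge0 (hN n).
have cM0 n : c_ n ^+ 2 <= M0 by have := Nc n; have := N0 n; lra.
have NM0 n : N_ n <= M0 by have := Nc n; have := sqr_ge0 (c_ n); lra.
have M00 : 0 <= M0 := le_trans (sqr_ge0 _) (cM0 0%N).
have G0 := nrm2_ge0 mu (G lam).
pose M := M0 + (2 * m + 2 * (M0 * nrm2 mu (G lam))).
have MM : M0 <= M by rewrite /M; have := mulr_ge0 M00 G0; lra.
have fM n : nrm2 mu (f_ n) <= M.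
  have -> : f_ n = fun x => VV lam (f_ n) (c_ n) x + (- c_ n) * G lam x.
    by apply/funext => x; rewrite /VV mulNr addrK.
  apply: le_trans (nrm2D_le (VV_L2 _ l0 (fL n)) (L2Z _ GL)) _.
  rewrite vm (nrm2Z _ GL) sqrrN /M; have := ler_wpM2r G0 (cM0 n); lra.
have M1 := le_trans M00 MM.
have dM n t : 0 < t -> dn t (f_ n) <= 2 * t * M.
  move=> t0; apply: le_trans (HN_le (hN n) t0) _; apply: ler_wpM2l; first by rewrite mulr_ge0 ?(ltW t0).
  exact: le_trans MM.
have [s1 [f [s1n fl ae1 _]]] := rellich fL fM dM.
have cb n : `|c_ (s1 n)| <= 1 + M0.
  rewrite -[leRHS]ger0_norm ?addr_ge0// -ler_sqr ?nnegrE// !real_normK ?num_real//.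
  by apply: (le_trans (cM0 _)); nra.
have [s2 [c [s2n cc]]] := bounded_subsequence cb.
pose s n := s1 (s2 n); have sn n : (n <= s n)%N by exact: leq_trans (s2n n) (s1n _).
have ae : {ae mu, forall x, (fun n => f_ (s n) x) @ \oo --> f x}.
  by apply: filterS ae1 => x hx; exact: (cvg_sub_seq s2n hx).
have Ee d : 0 < d -> exists n0, forall n, (n0 <= n)%N -> EE al p lam (f_ (s n)) (N_ (s n)) (c_ (s n)) <= e + d.
  move=> d0; have [n0 h] := (cvg_seqP _ _).1 (@cvg_harmonic R) _ d0; exists n0 => n nn.
  have := h _ (leq_trans nn (sn n)); rewrite subr0 ger0_norm ?invr_ge0//= => h1.
  by apply: (le_trans (ltW (En _))); rewrite lerD2l.
have lw := EE_lower p2 l0 m0 low.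
have vms : (fun n => nrm2 mu (VV lam (f_ (s n)) (c_ (s n)))) @ \oo --> m.
  by apply: sq_ext (sqC m) => n; rewrite vm.
have [v0|v0] := eqVneq (nrm2 mu (VV lam f c)) 0; last first.
  have vp : 0 < nrm2 mu (VV lam f c) by rewrite lt_def v0 nrm2_ge0.
  have [N [hf vle le]] := splitting p2 p4 l0 m0 lw (fun n => hN (s n)) (fun n => le_trans (NM0 (s n)) MM)
    (fun n => fM (s n)) (fun n => le_trans (cM0 (s n)) MM) cc fl ae vms Ee vp.
  by apply: minimizer_of_ratio p2 l0 m0 hf _ le; rewrite vp.
(* The limit is 0: its charge is 0, the masses are carried by the f_n, and dropping the charges c_n,
   which tend to 0, changes mass and energy by o(1). *)
have [N [_ [hf _ _ _]]] := HN_split (fun n => hN (s n)) (fun n => le_trans (NM0 (s n)) MM) (fun n => fM (s n)) fl ae.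
have [c0 _ _] := zero_state al p2 l0 hf v0; rewrite {}c0 in cc.
have ipb n : `|ip mu (f_ (s n)) (G lam)| <= (1 + M) * (1 + nrm2 mu (G lam)).
  have sq1 (x : R) : 0 <= x -> x <= (1 + x) ^+ 2 by move=> x0; rewrite expr2; nra.
  apply: (norm_ip_le (fL _) GL (addr_ge0 ler01 M1) (addr_ge0 ler01 G0) _ (sq1 _ G0)).
  exact: le_trans (fM _) (sq1 _ M1).
pose Kb := (1 + M) * (1 + nrm2 mu (G lam)).
have dif : (fun n => nrm2 mu (VV lam (f_ (s n)) (c_ (s n))) - nrm2 mu (f_ (s n))) @ \oo --> 0.
  have z1 : (fun n => `|c_ (s n)| * (2 * Kb) + c_ (s n) ^+ 2 * nrm2 mu (G lam)) @ \oo --> 0.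
    have a1 : (fun n => `|c_ (s n)|) @ \oo --> 0.
      apply/cvg_seqP => d d0; have [n0 h] := (cvg_seqP _ _).1 cc _ d0.
      by exists n0 => n /h; rewrite !subr0 normr_id.
    have := sqD (sqM a1 (sqC (2 * Kb))) (sqM (sqM cc cc) (sqC (nrm2 mu (G lam)))).
    by rewrite !mul0r addr0.
  apply: squeeze0 z1 => n; rewrite /VV (nrm2_lin _ (fL _) GL).
  have -> : forall a b c : R, a + b + c - a = b + c by move=> a b c1; ring.
  have cG0 : 0 <= c_ (s n) ^+ 2 * nrm2 mu (G lam) := mulr_ge0 (sqr_ge0 _) G0.
  apply: (le_trans (ler_normD _ _)); rewrite (ger0_norm cG0) lerD2r.
  rewrite normrM [`|2 * _|]normrM (ger0_norm (ler0n _ _)) -mulrA mulrCA; apply: ler_wpM2l => //.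
  by rewrite ler_pM2l.
have nf : (fun n => nrm2 mu (f_ (s n))) @ \oo --> m.
  have := sqB vms dif; rewrite subr0; apply: sq_ext => n; move: (nrm2 _ _) (nrm2 _ _) => a b; ring.
apply: (chargeless_minimizer p2 p4 l0 m0 e0 low (fun n => hN (s n)) (fun n => le_trans (NM0 (s n)) MM) (fun n => fM (s n)) nf).
move=> d d0; have [KG hKG] := pB_coercive p2 p4 l0 M1 (@ltr01 R).
have iB n : pB p (f_ (s n)) <= M0 + `|KG| /\ ig mu (fun x => `|f_ (s n) x| `^ p).
  have := hKG _ _ 0 (hN (s n)); rewrite -/(VV lam (f_ (s n)) 0) VV0 => /(_ (fM _)) [i b]; split; last first.
    by move: i; congr (ig mu _); apply/funext => x; rewrite mul0r addr0.
  apply: (le_trans b); rewrite mul1r expr0n addr0; apply: lerD (NM0 _) (ler_norm _).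
have GG : HN (fun=> 0) 0 := @HN0 R.
have [KG2 hKG2] := pB_coercive p2 p4 l0 G0 (@ltr01 R).
have iG : ig mu (fun x => `|G lam x| `^ p).
  have hG : nrm2 mu (fun x => 0 + 1 * G lam x) <= nrm2 mu (G lam).
    have -> : (fun x => 0 + 1 * G lam x) = G lam by apply/funext => x; rewrite add0r mul1r.
    exact: lexx.
  by have := (hKG2 _ _ 1 GG hG).1; congr (ig mu _); apply/funext => x; rewrite add0r mul1r.
have MK0 : 0 <= M0 + `|KG| := le_trans (pB_ge0 _ _) (iB 0%N).1.
(* This makes the loss in [powR_split] at most d p / 3, that is d/3 in the energy. *)
pose dd := (d * p / 3) / (1 + (M0 + `|KG|)).
have dd0 : 0 < dd by rewrite divr_gt0 ?divr_gt0 ?mulr_gt0// ltr_pwDl.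
have [C C0 hC] := powR_split p2 p4 dd0.
have bV n : pB p (VV lam (f_ (s n)) (c_ (s n))) <= pB p (f_ (s n)) + d * p / 3 + C * (`|c_ (s n)| `^ p * pB p (G lam)).
  have iV := (hKG _ _ (c_ (s n)) (hN (s n)) _).1.
  have {}iV : ig mu (fun x => `|VV lam (f_ (s n)) (c_ (s n)) x| `^ p).
    by apply: iV; rewrite -/(VV lam (f_ (s n)) (c_ (s n))) vm /M; have := mulr_ge0 M00 G0; lra.
  have h1 : pB p (VV lam (f_ (s n)) (c_ (s n))) <= (1 + dd) * pB p (f_ (s n)) + C * (`|c_ (s n)| `^ p * pB p (G lam)).
    rewrite /pB -(IIZ (`|c_ (s n)| `^ p) iG) -(IIZ (1 + dd) (iB n).2).
    rewrite -(IIZ C (igZ _ iG)) -IID; [|exact: igZ (iB n).2|exact: igZ (igZ _ iG)].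
    apply: II_le => //; first by apply: igD (igZ _ (iB n).2) (igZ _ (igZ _ iG)).
    by move=> x; rewrite -powRM// -normrM; exact: hC.
  apply: (le_trans h1); rewrite lerD2r mulrDl mul1r lerD2l.
  apply: (@le_trans _ _ (dd * (M0 + `|KG|))); first by apply: ler_wpM2l; [exact: ltW|exact: (iB n).1].
  rewrite /dd mulrAC ler_pdivrMr ?ltr_pwDl//; apply: ler_wpM2l; last by rewrite lerDr.
  by rewrite !mulr_ge0 ?(ltW d0) ?(ltW p0).
have z : (fun n => C * (`|c_ (s n)| `^ p * pB p (G lam)) / p + (lam * (nrm2 mu (VV lam (f_ (s n)) (c_ (s n))) - nrm2 mu (f_ (s n))) - (al + theta lam) * (c_ (s n) * c_ (s n))) / 2) @ \oo --> 0.
  have := sqD (sqM (sqZ C (sqM (powR_cvg0_seq p2 cc) (sqC (pB p (G lam))))) (sqC p^-1))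
    (sqM (sqB (sqZ lam dif) (sqZ (al + theta lam) (sqM cc cc))) (sqC 2^-1)).
  by rewrite !mul0r !mulr0 subr0 !mul0r addr0.
have d3 : 0 < d / 3 by rewrite divr_gt0.
have [n0 h0] := (cvg_seqP _ _).1 z _ d3; have [n1 h1] := Ee _ d3.
exists (n0 + n1)%N => n nn; have := h0 n (leq_trans (leq_addr _ _) nn); have := h1 n (leq_trans (leq_addl _ _) nn).
rewrite subr0 ler_norml EE0 /EE => q1 /andP[_ q2].
have ip0 : 0 <= p^-1 by rewrite invr_ge0 ltW.
have := ler_wpM2r ip0 (bV n).
have -> : forall a b : R, (a + d * p / 3 + b) / p = a / p + d / 3 + b / p.
  by move=> a b; field; rewrite gt_eqF.
move: q1 q2; rewrite expr2; clear.
move: (pB p (VV _ _ _)) (pB p (f_ (s n))) (C * _) (nrm2 mu (VV _ _ _)) (nrm2 mu (f_ _)) ((al + _) * _) (N_ (s n)) => a1 a2 a3 a4 a5 a6 a7.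
rewrite !mulrBr; move: (lam * a4) (lam * a5) (a1 / p) (a2 / p) (a3 / p) => b1 b2 b3 b4 b5; lra.
Qed.

End existence.

(** * Complex functions and frequency comparison *)

Section green_function.
Context {R : realType}.
Local Notation P := (mplane R).
Local Notation L := (measurableTypeR R).
Local Notation leb := (@lebesgue_measure R).
Local Notation mu := (leb2 R).
Let o : P := (0, 0).

Let F (r t : R) : R := expR (- r * ((expR t + expR (- t)) / 2)).

Let cosh_gt0 (t : R) : 0 < (expR t + expR (- t)) / 2.
Proof. by rewrite divr_gt0// addr_gt0 ?expR_gt0. Qed.

Let mF r : measurable_fun [set: L] (F r).
Proof.
apply: line_continuous_mf => x; apply: (@continuous_comp _ _ _ (fun t : R => - r * ((expR t + expR (- t)) / 2)) (@expR R)); last exact: continuous_expR.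
apply: cvgM; first exact: cvg_cst.
apply: cvgM; last exact: cvg_cst.
apply: cvgD; first exact: continuous_expR.
apply: (@continuous_comp _ _ _ (fun t : R => - t) (@expR R)); first exact: oppr_continuous.
exact: continuous_expR.
Qed.

Let igF r : 0 < r -> ig leb (F r).
Proof.
move=> r0; apply: ig_le (mF r) _ (igZ (4 / r) (@ig_sech R 1 ltr01)) => t.
rewrite (ger0_norm (expR_ge0 _)) mul1r /F mulNr.
apply: le_trans (expRN_le_inv (mulr_gt0 r0 (cosh_gt0 t))) _.
have e0 := expR_gt0 t; rewrite expRN; move: (expR t) e0 => x x0.
have x1 : 0 < 1 + x by lra.
have s0 : 0 < x ^+ 2 + 1 by have := sqr_ge0 x; lra.
have -> : (r * ((x + x^-1) / 2))^-1 = r^-1 * (2 * x / (x ^+ 2 + 1)).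
  by move: (lt0r_neq0 x0) (lt0r_neq0 s0) (lt0r_neq0 r0) => a b c; field; rewrite a b c.
have -> : 4 / r * (x / (1 + x) ^+ 2) = r^-1 * (4 * x / (1 + x) ^+ 2) by ring.
rewrite ler_pM2l ?invr_gt0// ler_pdivrMr// mulrAC ler_pdivlMr ?exprn_gt0//.
have -> : 4 * x * (x ^+ 2 + 1) = 2 * x * (2 * x ^+ 2 + 2) by ring.
rewrite ler_pM2l ?mulr_gt0// -subr_ge0.
have -> : 2 * x ^+ 2 + 2 - (1 + x) ^+ 2 = (1 - x) ^+ 2 by ring.
exact: sqr_ge0.
Qed.

(** Twice the Bessel function K_0(r): the integral of e^(-r cosh t) over the whole line. *)
Let kap (r : R) : R := II leb (F r).

Lemma II_leb_gt0 (f : R -> R) : ig leb f -> (forall x, 0 < f x) -> 0 < II leb f.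
Proof.
move=> i f0; rewrite lt_def II_ge0 ?andbT; last by move=> x; exact: ltW.
apply/negP => /eqP h; have [A [mA A0 sub]] := II_eq0 i (fun x => ltW (f0 x)) h.
have AT : A = setT by apply/seteqP; split => // x _; apply: sub => /= fx; have := f0 x; rewrite fx ltxx.
have : (leb `[0%R, 1%R]%classic <= leb A)%E by apply: le_measure; rewrite ?inE// AT.
rewrite A0 lebesgue_measure_itv/= lte_fin ltr01 -EFinB subr0 lee_fin ler10.
by [].
Qed.

Let kap_gt0 r : 0 < r -> 0 < kap r.
Proof. by move=> r0; apply: II_leb_gt0 (igF r0) _ => x; exact: expR_gt0. Qed.

Let kap_decr r s : 0 < r -> r < s -> kap s < kap r.
Proof.
move=> r0 rs; have s0 := lt_trans r0 rs.
rewrite -subr_gt0 /kap -(IIB (igF r0) (igF s0)); apply: II_leb_gt0; first exact: igB (igF r0) (igF s0).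
by move=> x; rewrite subr_gt0 ltr_expR !mulNr ltrN2 ltr_pM2r.
Qed.

Let F_even r t : F r (- t) = F r t.
Proof. by rewrite /F opprK addrC. Qed.

Let besselK0E r : 0 < r -> besselK0 r = kap r / 2.
Proof.
move=> r0; pose A : set L := `[0%R, +oo[%classic.
have mA : measurable A by exact: measurable_itv.
pose g (t : L) : R := F r t * \1_A t.
have mg : measurable_fun [set: L] g by apply: measurable_funM; [exact: mF|exact: measurable_indic].
have gF x : `|g x| <= F r x.
  rewrite /g normrM (ger0_norm (expR_ge0 _)) indicE; case: (x \in A); first by rewrite normr1 mulr1.
  by rewrite normr0 mulr0 expR_ge0.
have ig1 : ig leb g := ig_le mg gF (igF r0).
have E : besselK0 r = II leb g.
  rewrite /besselK0 Rintegral_mkcond; congr (II leb); apply/funext => t.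
  by rewrite patchE /g indicE; case: (t \in A); rewrite ?mulr1 ?mulr0.
pose s (x : L) : L := (-1) ^+ true * x + 0.
have sm : minv leb s by exact: leb_affine.
have gs : II leb (g \o s) = II leb g by exact: minv_II.
have igs : ig leb (g \o s) by exact: minv_ig.
rewrite E; suff -> : kap r = II leb g + II leb (g \o s) by rewrite gs; field.
rewrite -(IID ig1 igs); apply: ae_II; [exact: mF| |].
  by apply: measurable_funD => //; exact: ig_mf igs.
(* The two closed half-lines overlap only at 0. *)
exists [set 0]; split; [exact: measurable_set1|exact: lebesgue_measure_set1|].
move=> x /= nx; apply: contrapT => x0; apply: nx.
rewrite /g /s expr1 mulN1r addr0 F_even -mulrDr -[LHS]mulr1; congr (_ * _).
have e (t : L) : \1_A t = (0 <= (t : R))%R%:R :> R.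
  rewrite indicE; congr ((_ : bool)%:R); apply/idP/idP => [/set_mem|h]; first by rewrite /A /= in_itv/= andbT.
  by apply/mem_set; rewrite /A /= in_itv/= andbT.
rewrite !e oppr_ge0; move: x0; clear; move: x => x; case: (ltgtP (x : R) 0) => // h _; by rewrite ?addr0 ?add0r.
Qed.

(** Translating w by log(|x| / (2 sqrt a)) symmetrizes the exponent: a e^w + |x|^2 / (4 e^w) = sqrt
    a |x| cosh(w - c). This identifies the time integral of heat kernels with K_0. *)
Let affine_F a x : 0 < a -> x != (0, 0) :> P -> exists2 c : R, 0 < enorm x &
  forall w : R, rho a w * kk (expR w) o x = (4 * pi)^-1 * F (Num.sqrt a * enorm x) (w - c).
Proof.
move=> a0 xn; pose q := x.1 ^+ 2 + x.2 ^+ 2.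
have q0 : 0 < q.
  rewrite lt_def addr_ge0 ?sqr_ge0// andbT; apply: contra xn => /eqP h.
  have := sqr_ge0 x.1; have := sqr_ge0 x.2; rewrite /q in h => h2 h1.
  have /eqP : x.1 ^+ 2 = 0 by lra.
  have /eqP : x.2 ^+ 2 = 0 by lra.
  by rewrite !sqrf_eq0; case: (x) => x1 x2 /= /eqP -> /eqP ->.
have n0 : 0 < enorm x by rewrite sqrtr_gt0.
have s0 : 0 < Num.sqrt a by rewrite sqrtr_gt0.
have y0 : 0 < enorm x / (2 * Num.sqrt a) by rewrite divr_gt0 ?mulr_gt0.
exists (ln (enorm x / (2 * Num.sqrt a))) => // w.
rewrite kkE ?expR_gt0// /rho /F [- (w - _)]opprB.
rewrite !expRB lnK ?posrE//.
have w0 := expR_gt0 w; have pi0 := pi_gt0 R.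
have -> : d2 o x = enorm x ^+ 2 by rewrite /enorm sqr_sqrtr ?(ltW q0)// /d2 /= !sub0r !sqrrN.
have aE : a = Num.sqrt a ^+ 2 by rewrite sqr_sqrtr// ltW.
rewrite mulrACA; have -> : expR w * (4 * pi * expR w)^-1 = (4 * pi)^-1.
  by move: (lt0r_neq0 w0) (lt0r_neq0 pi0); move: (expR w) pi => u v u0 v0; field; rewrite u0 v0.
congr (_ * _); rewrite -expRD; congr expR; rewrite {1}aE.
move: (lt0r_neq0 w0) (lt0r_neq0 n0) (lt0r_neq0 s0); move: (expR w) (enorm x) (Num.sqrt a) => u v s u0 v0 s1.
by field; rewrite u0 v0 s1.
Qed.

Let Ga_kap a x : 0 < a -> x != (0, 0) :> P -> Ga a 0 x = kap (Num.sqrt a * enorm x) / (4 * pi).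
Proof.
move=> a0 xn; have [c n0 h] := affine_F a0 xn.
have r0 : 0 < Num.sqrt a * enorm x by rewrite mulr_gt0// sqrtr_gt0.
pose s (w : L) : L := (-1) ^+ false * w + (- c).
have sm : minv leb s by exact: leb_affine.
rewrite /Ga; have -> : (fun w => rho a w * kk (expR w + 0) o x) = fun w => (4 * pi)^-1 * (F (Num.sqrt a * enorm x) \o s) w.
  by apply/funext => w; rewrite addr0 h /s /= expr0 mul1r.
rewrite IIZ; last exact: minv_ig sm (igF r0).
by rewrite minv_II// mulrC.
Qed.

Let enorm_gt0 (x : P) : x != (0, 0) :> P -> 0 < enorm x.
Proof. by move=> xn; have [c n0 _] := affine_F (@ltr01 R) xn. Qed.

Lemma greenE a (x : P) : 0 < a -> x != (0, 0) :> P -> green a x = Ga a 0 x.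
Proof.
move=> a0 xn; have s0 : 0 < Num.sqrt a by rewrite sqrtr_gt0.
have r0 := mulr_gt0 s0 (enorm_gt0 xn).
rewrite Ga_kap// /green besselK0E//; move: (kap _) => k; have := pi_gt0 R; move: pi => v /lt0r_neq0 v0.
by field; rewrite v0.
Qed.

Lemma Ga_gt0 a (x : P) : 0 < a -> x != (0, 0) :> P -> 0 < Ga a 0 x.
Proof.
move=> a0 xn; have s0 : 0 < Num.sqrt a by rewrite sqrtr_gt0.
rewrite Ga_kap// divr_gt0 ?mulr_gt0 ?pi_gt0// kap_gt0//.
exact: mulr_gt0 s0 (enorm_gt0 xn).
Qed.

Lemma Ga_decr a (x y : P) : 0 < a -> x != (0, 0) :> P -> enorm x < enorm y -> Ga a 0 y < Ga a 0 x.
Proof.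
move=> a0 xn xy; have s0 : 0 < Num.sqrt a by rewrite sqrtr_gt0.
have yn : y != (0, 0) :> P.
  apply/eqP => y0; have := le_lt_trans (sqrtr_ge0 _) xy.
  by rewrite y0 /enorm /= expr0n addr0 sqrtr0 ltxx.
rewrite !Ga_kap// ltr_pM2r ?invr_gt0 ?mulr_gt0 ?pi_gt0//.
by apply: kap_decr; [exact: mulr_gt0 s0 (enorm_gt0 xn)|rewrite ltr_pM2l].
Qed.

Lemma Ga_radial a (x y : P) : 0 < a -> x != (0, 0) :> P -> y != (0, 0) :> P -> enorm x = enorm y ->
  Ga a 0 x = Ga a 0 y.
Proof. by move=> a0 xn yn e; rewrite (Ga_kap a0 xn) (Ga_kap a0 yn) e. Qed.

Lemma Ga_mass_decr a b (x : P) : 0 < a -> a < b -> x != (0, 0) :> P -> Ga b 0 x < Ga a 0 x.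
Proof.
move=> a0 ab xn; have b0 := lt_trans a0 ab.
rewrite !Ga_kap// ltr_pM2r ?invr_gt0 ?mulr_gt0 ?pi_gt0//.
have s0 : 0 < Num.sqrt a by rewrite sqrtr_gt0.
by apply: kap_decr; [exact: mulr_gt0 s0 (enorm_gt0 xn)|rewrite (ltr_pM2r (enorm_gt0 xn)) ltr_sqrt].
Qed.

Let origin_set : [set o] = [set (0 : L)] `*` [set (0 : L)].
Proof. by apply/seteqP; split => -[x y] /=; [case=> -> ->|case=> -> ->]. Qed.

Lemma origin_null : measurable [set o] /\ mu [set o] = 0%E.
Proof.
split; first by rewrite origin_set; apply: measurableX; exact: measurable_set1.
have h := @product_measure1E _ _ L L R leb leb [set 0] [set 0] (measurable_set1 _) (measurable_set1 _).
rewrite origin_set; exact: (etrans h (etrans (congr1 (fun z => (_ * z)%E) (lebesgue_measure_set1 _)) (mule0 _))).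
Qed.

Lemma ae_nonzero : {ae mu, forall x : P, x != (0, 0)}.
Proof.
have [m z] := origin_null; exists [set o]; split=> // x /= /negP; rewrite negbK => /eqP ->.
by [].
Qed.

Lemma green_ae a : 0 < a -> {ae mu, forall x : P, green a x = Ga a 0 x}.
Proof. by move=> a0; apply: filterS ae_nonzero => x; exact: greenE. Qed.

Lemma mgreen a : 0 < a -> mf (green a : P -> R).
Proof.
move=> a0; have [m _] := origin_null.
have -> : (green a : P -> R) = fun x => Ga a 0 x * (1 - \1_[set o] x) + green a o * \1_[set o] x.
  apply/funext => x; rewrite indicE; have [->|xo] := eqVneq x o.
    by rewrite mem_set//= subrr mulr0 add0r mulr1.
  by rewrite memNset/=; [rewrite subr0 mulr1 mulr0 addr0 greenE|apply/eqP].
have mi : mf (\1_[set o] : P -> R) by exact: measurable_indic.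
apply: measurable_funD; last by apply: measurable_funM => //; exact: measurable_cst.
by apply: measurable_funM; [exact: mGa|apply: measurable_funB => //; exact: measurable_cst].
Qed.

(* For d2 o x <= e^-k the times e^w, -k <= w <= 0, each contribute at least a
   constant. *)
Lemma Ga_unbounded a (K : R) : 0 < a -> exists2 d : R, 0 < d &
  forall x : P, x != (0, 0) :> P -> d2 o x <= d -> K <= Ga a 0 x.
Proof.
move=> a0; pose c := (4 * pi)^-1 * (expR (- a) * expR (- 4^-1)); have pi0 := pi_gt0 R.
have c0 : 0 < c by rewrite !mulr_gt0 ?expR_gt0 ?invr_gt0 ?mulr_gt0.
pose k := `|K| / c + 1; have k0 : 0 < k by rewrite ltr_wpDl ?divr_ge0 ?(ltW c0).
exists (expR (- k)) => [|x xn xd]; first exact: expR_gt0.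
pose A : set L := `[- k, 0]%classic; have mA : measurable A by exact: measurable_itv.
have lA : leb A = k%:E by rewrite lebesgue_measure_itv/= lte_fin oppr_lt0 k0 -EFinB sub0r opprK.
have IE : (\int[leb]_t (\1_A t)%:E = k%:E :> \bar R)%E by rewrite integral_indic// setIT.
have e (t : R) : \1_A t = ((- k <= t) && (t <= 0))%:R :> R.
  rewrite indicE; congr ((_ : bool)%:R); apply/idP/idP => [/set_mem|h]; first by rewrite /A /= in_itv.
  by apply/mem_set; rewrite /A /= in_itv.
have iA : ig leb (\1_A : L -> R).
  apply: ge0_ig; [exact: measurable_indic|by move=> t; rewrite indicE; case: (_ \in _)|].
  by rewrite IE ltry.
have IA : II leb (\1_A : L -> R) = k.
  by have := EFin_II iA; rewrite IE => -[<-].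
have [c' n0 h] := affine_F a0 xn.
have r0 : 0 < Num.sqrt a * enorm x by rewrite mulr_gt0// sqrtr_gt0.
have i : ig leb (fun w => rho a w * kk (expR w + 0) o x).
  pose s (w : L) : L := (-1) ^+ false * w + (- c').
  have sm : minv leb s by exact: leb_affine.
  have -> : (fun w => rho a w * kk (expR w + 0) o x) = fun w => (4 * pi)^-1 * (F (Num.sqrt a * enorm x) \o s) w.
    by apply/funext => w; rewrite addr0 h /s /= expr0 mul1r.
  by apply: igZ; exact: minv_ig sm (igF r0).
apply: (@le_trans _ _ (c * k)).
  rewrite /k mulrDr mulr1 mulrCA divff ?gt_eqF// mulr1; have := ler_norm K; lra.
rewrite -IA /Ga -(IIZ c iA); apply: II_le (igZ c iA) i _ => w.
rewrite addr0 e; case: andP => [[w1 w2]|_]; last first.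
  by rewrite mulr0; apply: mulr_ge0; [exact: rho_ge0|exact: kk_ge0].
rewrite mulr1 kkE ?expR_gt0// /rho mulrACA.
have w0 := expR_gt0 w; have -> : expR w * (4 * pi * expR w)^-1 = (4 * pi)^-1.
  by move: (lt0r_neq0 w0) (lt0r_neq0 pi0); move: (expR w) pi => u v u0 v0; field; rewrite u0 v0.
apply: ler_wpM2l; first by rewrite invr_ge0 mulr_ge0 ?(ltW pi0).
apply: ler_pM; rewrite ?expR_ge0// ler_expR.
  by rewrite mulNr lerN2 ger_pMr// -expR0 ler_expR.
rewrite mulNr lerN2 ler_pdivrMr ?mulr_gt0// mulrA mulVf// mul1r.
by apply: le_trans xd _; rewrite ler_expR.
Qed.

End green_function.

(** * Complex functions through real and imaginary parts *)

Section complex_functions.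
Context {R : realType}.
Local Notation P := (mplane R).
Local Notation mu := (leb2 R).
Local Notation G a := (@Ga R a 0).
Implicit Types (v f g : plane R -> R[i]) (p : R).

Definition re v : P -> R := fun x => complex.Re (v x).
Definition im v : P -> R := fun x => complex.Im (v x).
Definition modulus v : P -> R := fun x => Normc.normc (v x).

Lemma modulusE v x : modulus v x = Num.sqrt (re v x ^+ 2 + im v x ^+ 2).
Proof. by rewrite /modulus /re /im; case: (v x). Qed.

Lemma modulus_ge0 v x : 0 <= modulus v x.
Proof. by rewrite modulusE sqrtr_ge0. Qed.

Lemma modulus_sqr v x : modulus v x ^+ 2 = re v x ^+ 2 + im v x ^+ 2.
Proof. by rewrite modulusE sqr_sqrtr// addr_ge0 ?sqr_ge0. Qed.

Lemma mmodulus v : cmeasurable v -> mf (modulus v).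
Proof.
case=> mr mi; have -> : modulus v = fun x => Num.sqrt (re v x ^+ 2 + im v x ^+ 2).
  by apply/funext => x; rewrite modulusE.
apply: measurableT_comp; first exact: continuous_measurable_fun (@sqrt_continuous R).
by apply: measurable_funD; exact: measurable_funX.
Qed.

Lemma eLp_normE p f : 0 < p -> eLp_norm p f = poweR (\int[mu]_x (`|modulus f x| `^ p)%:E)%E p^-1.
Proof. by move=> p0; rewrite /eLp_norm unlock. Qed.

Lemma Lp_norm_powR p f : 0 < p -> Lp_norm p f `^ p = pB p (modulus f).
Proof.
move=> p0; rewrite /Lp_norm eLp_normE// fine_poweR -powRrM mulVf ?gt_eqF// powRr1//.
by apply: fine_ge0; apply: integral_ge0 => x _; rewrite lee_fin powR_ge0.
Qed.

Lemma in_L2P f : in_L2 f <-> L2 mu (re f) /\ L2 mu (im f).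
Proof.
have e x : `|modulus f x| `^ 2 = re f x ^+ 2 + im f x ^+ 2.
  by rewrite (powR_mulrn 2)// real_normK ?num_real// modulus_sqr.
split=> [[[mr mi] h]|[[mr ir] [mi ii]]].
  have {}h : (\int[mu]_x (re f x ^+ 2 + im f x ^+ 2)%:E < +oo)%E.
    move: h; rewrite eLp_normE//; under eq_integral do rewrite e.
    by apply: lty_poweRy; rewrite invr_eq0.
  have i : ig mu (fun x => re f x ^+ 2 + im f x ^+ 2).
    apply: ge0_ig => // [|x]; last by rewrite addr_ge0 ?sqr_ge0.
    by apply: measurable_funD; exact: measurable_funX.
  split; split=> //.
    apply: ig_le i; first exact: measurable_funX.
    by move=> x; rewrite ger0_norm ?sqr_ge0// lerDl sqr_ge0.
  apply: ig_le i; first exact: measurable_funX.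
  by move=> x; rewrite ger0_norm ?sqr_ge0// lerDr sqr_ge0.
split=> //; rewrite eLp_normE//; under eq_integral do rewrite e.
apply: poweR_lty; apply: ig_lty (igD ir ii) _ => x; by rewrite addr_ge0 ?sqr_ge0.
Qed.

Lemma Lp_norm2 f : in_L2 f -> Lp_norm 2 f ^+ 2 = nrm2 mu (re f) + nrm2 mu (im f).
Proof.
move=> /in_L2P[[mr ir] [mi ii]].
have h0 : 0 <= Lp_norm 2 f by rewrite /Lp_norm; apply: fine_ge0; exact: Lnorm_ge0.
rewrite -(powR_mulrn 2 h0) Lp_norm_powR// /pB -(IID ir ii); congr (II mu); apply/funext => x.
by rewrite (powR_mulrn 2)// real_normK ?num_real// modulus_sqr.
Qed.

Definition cpx (a b : P -> R) : plane R -> R[i] := fun x => (a x +i* b x)%C.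

Lemma wgrad_components f g1 g2 : in_L2 f -> in_L2 g1 -> in_L2 g2 ->
  weak_derivative (e1 R) f g1 -> weak_derivative (e2 R) f g2 ->
  wgrad (re f) (re g1) (re g2) /\ wgrad (im f) (im g1) (im g2).
Proof.
move=> /in_L2P[fr fi] /in_L2P[r1 i1] /in_L2P[r2 i2] d1 d2.
split; split; [exact: fr|exact: r1|exact: r2| |exact: fi|exact: i1|exact: i2|] => phi tp.
  by split; [exact: (d1 phi tp).1|exact: (d2 phi tp).1].
by split; [exact: (d1 phi tp).2|exact: (d2 phi tp).2].
Qed.

Lemma weak_partials_norm f g1 g2 (a b : R) : HN (re f) a -> HN (im f) b -> in_L2 f -> in_L2 g1 -> in_L2 g2 ->
  weak_derivative (e1 R) f g1 -> weak_derivative (e2 R) f g2 ->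
  Lp_norm 2 g1 ^+ 2 + Lp_norm 2 g2 ^+ 2 = a + b.
Proof.
move=> hr hi fL L1 L2' d1 d2; have [wr wi] := wgrad_components fL L1 L2' d1 d2.
have er : nrm2 mu (re g1) + nrm2 mu (re g2) = a by apply: HN_unique hr; exists (re g1), (re g2).
have ei : nrm2 mu (im g1) + nrm2 mu (im g2) = b by apply: HN_unique hi; exists (im g1), (im g2).
by rewrite (Lp_norm2 L1) (Lp_norm2 L2') -er -ei; ring.
Qed.

(** [weak_partial] is chosen among representatives; its norm is nevertheless determined, since
    gradient norms are unique. *)
Lemma in_H1_HN f a b : HN (re f) a -> HN (im f) b -> in_H1 f /\ grad_norm2 f = a + b.
Proof.
move=> hr hi; have fL : in_L2 f by apply/in_L2P; split; [exact: HN_L2 hr|exact: HN_L2 hi].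
have [r1 [r2 [[_ r1L r2L rd] _]]] := hr; have [i1 [i2 [[_ i1L i2L id] _]]] := hi.
have x1 : exists g, in_L2 g /\ weak_derivative (e1 R) f g.
  exists (cpx r1 i1); split; first by apply/in_L2P.
  by move=> phi tp; split; [exact: (rd phi tp).1|exact: (id phi tp).1].
have x2 : exists g, in_L2 g /\ weak_derivative (e2 R) f g.
  exists (cpx r2 i2); split; first by apply/in_L2P.
  by move=> phi tp; split; [exact: (rd phi tp).2|exact: (id phi tp).2].
split; first by split.
have [p1L p1d] : in_L2 (weak_partial (e1 R) f) /\ weak_derivative (e1 R) f (weak_partial (e1 R) f) := xgetPex (fun=> 0) x1.
have [p2L p2d] : in_L2 (weak_partial (e2 R) f) /\ weak_derivative (e2 R) f (weak_partial (e2 R) f) := xgetPex (fun=> 0) x2.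
exact: weak_partials_norm hr hi fL p1L p2L p1d p2d.
Qed.

Lemma HN_in_H1 f : in_H1 f -> exists a b, HN (re f) a /\ HN (im f) b.
Proof.
move=> [fL [g1 [g1L d1]] [g2 [g2L d2]]].
have [wr wi] := wgrad_components fL g1L g2L d1 d2.
exists (nrm2 mu (re g1) + nrm2 mu (re g2)), (nrm2 mu (im g1) + nrm2 mu (im g2)).
by split; [exists (re g1), (re g2)|exists (im g1), (im g2)].
Qed.

Lemma re_minus_green lam (c1 c2 : R) v x :
  re (minus_green lam (c1 +i* c2)%C v) x = re v x - c1 * green lam x /\
  im (minus_green lam (c1 +i* c2)%C v) x = im v x - c2 * green lam x.
Proof. by rewrite /re /im /minus_green; case: (v x) => a b /=; rewrite !mulr0 subr0 add0r. Qed.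

Lemma minus_green_ae lam (c1 c2 : R) v : 0 < lam -> cmeasurable v ->
  [/\ mf (re (minus_green lam (c1 +i* c2)%C v)), mf (im (minus_green lam (c1 +i* c2)%C v)),
   {ae mu, forall x : P, re v x - c1 * G lam x = re (minus_green lam (c1 +i* c2)%C v) x} &
   {ae mu, forall x : P, im v x - c2 * G lam x = im (minus_green lam (c1 +i* c2)%C v) x}].
Proof.
move=> l0 [mr mi].
have -> : re (minus_green lam (c1 +i* c2)%C v) = fun x => re v x - c1 * green lam x.
  by apply/funext => x; exact: (re_minus_green _ _ _ _ _).1.
have -> : im (minus_green lam (c1 +i* c2)%C v) = fun x => im v x - c2 * green lam x.
  by apply/funext => x; exact: (re_minus_green _ _ _ _ _).2.
split.
- by apply: measurable_funB => //; apply: measurable_funM => //; exact: mgreen.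
- by apply: measurable_funB => //; apply: measurable_funM => //; exact: mgreen.
- by apply: filterS (green_ae l0) => x ->.
- by apply: filterS (green_ae l0) => x ->.
Qed.

Lemma minus_green_HN lam (c1 c2 a b : R) v : 0 < lam -> cmeasurable v ->
  HN (fun x => re v x - c1 * G lam x) a -> HN (fun x => im v x - c2 * G lam x) b ->
  [/\ in_H1 (minus_green lam (c1 +i* c2)%C v),
   grad_norm2 (minus_green lam (c1 +i* c2)%C v) = a + b &
   Lp_norm 2 (minus_green lam (c1 +i* c2)%C v) ^+ 2 =
     nrm2 mu (fun x => re v x - c1 * G lam x) + nrm2 mu (fun x => im v x - c2 * G lam x)].
Proof.
move=> l0 mv ha hb; have [m1 m2 a1 a2] := minus_green_ae c1 c2 l0 mv.
have [h1 h2] := in_H1_HN (HN_ae m1 a1 ha) (HN_ae m2 a2 hb); split=> //.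
case: (h1) => fL _ _; rewrite (Lp_norm2 fL).
by rewrite (ae_nrm2 (HN_L2 ha).1 m1 a1) (ae_nrm2 (HN_L2 hb).1 m2 a2).
Qed.

Lemma HN_minus_green lam (c1 c2 : R) v : 0 < lam -> cmeasurable v ->
  in_H1 (minus_green lam (c1 +i* c2)%C v) -> exists a b,
  HN (fun x => re v x - c1 * G lam x) a /\ HN (fun x => im v x - c2 * G lam x) b.
Proof.
move=> l0 mv h; have [m1 m2 a1 a2] := minus_green_ae c1 c2 l0 mv.
have mG : mf (G lam) := (L2_Ga l0 (lexx 0)).1.
have [a [b [ha hb]]] := HN_in_H1 h; exists a, b; split.
  apply: HN_ae ha; last by apply: filterS a1 => x ->.
  by apply: measurable_funB; [exact: mv.1|apply: measurable_funM].
apply: HN_ae hb; last by apply: filterS a2 => x ->.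
by apply: measurable_funB; [exact: mv.2|apply: measurable_funM].
Qed.

Lemma normc_sqr (a b : R) : Normc.normc (a +i* b)%C ^+ 2 = a ^+ 2 + b ^+ 2.
Proof. by rewrite /= sqr_sqrtr// addr_ge0 ?sqr_ge0. Qed.

(** The data of v by real and imaginary parts: charge c1 + i c2 and quadratic form q1 + q2. The
    parameter 1 is that of [quad_form]. *)
Definition states (al : R) v (c1 q1 c2 q2 : R) := [/\ cmeasurable v, QF al 1 (re v) c1 q1 & QF al 1 (im v) c2 q2].

(** Any admissible charge, at any parameter, yields a [QF] for each part, so uniqueness identifies
    the chosen one. *)
Lemma states_form al v c1 q1 c2 q2 : states al v c1 q1 c2 q2 ->
  [/\ energy_space v, delta_charge v = (c1 +i* c2)%C & quad_form al v = q1 + q2].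
Proof.
move=> [mv h1 h2]; have [a [ha e1]] := h1; have [b [hb e2]] := h2.
have vL : in_L2 v by apply/in_L2P; split; [exact: QF_L2 ltr01 h1|exact: QF_L2 ltr01 h2].
have [hH hg hn] := minus_green_HN ltr01 mv ha hb.
have dE : delta_charge v = (c1 +i* c2)%C.
  apply: xget_unique; first by exists 1.
  move=> [d1 d2] [lam [l0 /(HN_minus_green l0 mv)[a' [b' [ha' hb']]]]].
  have [r1 k1] : exists r, QF al lam (re v) d1 r by eexists; exists a'; split; [exact: ha'|].
  have [r2 k2] : exists r, QF al lam (im v) d2 r by eexists; exists b'; split; [exact: hb'|].
  by have [-> _] := QF_unique ltr01 l0 h1 k1; have [-> _] := QF_unique ltr01 l0 h2 k2.
split=> //; first by split=> //; exists (c1 +i* c2)%C, 1; rewrite ltr01.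
rewrite /quad_form /quad_form_at /regular_part dE hg hn (Lp_norm2 vL) normc_sqr e1 e2.
by move: (nrm2 _ _) (nrm2 _ _) (nrm2 _ _) (nrm2 _ _) (theta 1) => x y z w t; ring.
Qed.

Lemma form_states al v : energy_space v -> exists c1 q1 c2 q2, states al v c1 q1 c2 q2.
Proof.
move=> [[mv _] [[c1 c2] [lam [l0 /(HN_minus_green l0 mv)[a [b [ha hb]]]]]]].
exists c1; eexists; exists c2; eexists; split=> //.
  by apply: (QF_change l0 ltr01); exists a; split; [exact: ha|].
by apply: (QF_change l0 ltr01); exists b; split; [exact: hb|].
Qed.

Lemma states_mass al v c1 q1 c2 q2 : states al v c1 q1 c2 q2 ->
  Lp_norm 2 v ^+ 2 = nrm2 mu (re v) + nrm2 mu (im v).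
Proof.
move=> [mv h1 h2]; apply: Lp_norm2; apply/in_L2P.
by split; [exact: QF_L2 ltr01 h1|exact: QF_L2 ltr01 h2].
Qed.

Lemma real_states al (v : P -> R) lam c q : 0 < lam -> QF al lam v c q -> states al (cpx v (fun=> 0)) c q 0 0.
Proof.
move=> l0 h; split; last exact: QF_H1 (@HN0 R).
  by split; [exact: (QF_L2 l0 h).1|exact: measurable_cst].
exact: QF_change l0 ltr01 h.
Qed.

Lemma pB_abs p (v w : P -> R) : (forall x, `|v x| = `|w x|) -> pB p v = pB p w.
Proof. by move=> e; congr (II mu); apply/funext => x; rewrite e. Qed.

End complex_functions.

(** * Comparison at a fixed frequency and passage to the modulus *)

Section reduction.
Context {R : realType}.
Local Notation P := (mplane R).
Local Notation mu := (leb2 R).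
Local Notation G a := (@Ga R a 0).
Implicit Type p : R.

(** At mass m the energy is half the action minus om m / 2 minus the power term. Under scaling by s
    it is at most A0 (s^2/2 - s^p/p) - om m / 2, largest at s = 1 by [scaling_max]; equality forces
    s = 1 and equality in both hypotheses. *)
Lemma scaled_energy al p m om A0 lam v c q : 2 < p -> 0 < m -> 0 < A0 -> 0 < lam -> QF al lam v c q ->
  0 < nrm2 mu v -> q + om * nrm2 mu v <= A0 -> A0 <= pB p v ->
  exists s, [/\ 0 < s, s ^+ 2 * nrm2 mu v = m,
    s ^+ 2 * q / 2 - pB p (fun x => s * v x) / p <= (A0 - om * m) / 2 - A0 / p &
    (A0 - om * m) / 2 - A0 / p <= s ^+ 2 * q / 2 - pB p (fun x => s * v x) / p ->
    [/\ nrm2 mu v = m, q + om * nrm2 mu v = A0 & pB p v = A0]].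
Proof.
move=> p2 m0 A00 l0 hv v0 qA AB; have p0 : 0 < p by lra.
pose s := Num.sqrt (m / nrm2 mu v); exists s.
have s2 : s ^+ 2 = m / nrm2 mu v by rewrite sqr_sqrtr// divr_ge0// ltW.
have s0 : 0 < s by rewrite sqrtr_gt0 divr_gt0.
have sm : s ^+ 2 * nrm2 mu v = m by rewrite s2 divfK// gt_eqF.
have [mx me] := scaling_max p2 s0.
rewrite (pBZ p (QF_L2 l0 hv).1 (ltW s0)).
have sq0 : 0 < s ^+ 2 by exact: exprn_gt0.
have sp0 : 0 < s `^ p by exact: powR_gt0.
have h1 := ler_wpM2l (ltW sq0) qA; have h2 := ler_wpM2l (ltW sp0) AB.
have h3 := ler_wpM2l (ltW A00) mx; have ip : 0 < p^-1 by rewrite invr_gt0.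
have h4 := ler_wpM2r (ltW ip) h2.
have e : s ^+ 2 * (q + om * nrm2 mu v) = s ^+ 2 * q + om * m by rewrite -sm; ring.
rewrite e in h1; move: h1 h3 h4; rewrite !mulrBr; clear h2.
split=> //.
  by move: (s ^+ 2 * q) (om * m) (s `^ p * pB p v / p) h1 h3 h4 => a b d h1 h3 h4; lra.
move=> le; have h5 : s ^+ 2 * q + om * m = s ^+ 2 * A0.
  by move: (s ^+ 2 * q) (om * m) (s `^ p * pB p v / p) h1 h3 h4 le => a b d h1 h3 h4 le; lra.
have h6 : s `^ p * pB p v / p = s `^ p * A0 / p.
  by move: (s ^+ 2 * q) (om * m) (s `^ p * pB p v / p) h1 h3 h4 le => a b d h1 h3 h4 le; lra.
have h7 : s = 1.
  apply: me; apply: (mulfI (lt0r_neq0 A00)); rewrite !mulrBr.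
  by move: (s ^+ 2 * q) (om * m) (s `^ p * pB p v / p) h1 h3 h4 le => a b d h1 h3 h4 le; lra.
move: h6 h5 e sm; rewrite h7 expr1n powR1 !mul1r => h6 h5 e sm; split=> //.
  by rewrite e.
by apply: (mulIf (lt0r_neq0 ip)).
Qed.

Definition md (a b : P -> R) : P -> R := fun x => Num.sqrt (a x ^+ 2 + b x ^+ 2).

Lemma md_sqr a b x : md a b x ^+ 2 = a x ^+ 2 + b x ^+ 2.
Proof. by rewrite /md sqr_sqrtr// addr_ge0 ?sqr_ge0. Qed.

Lemma md_ge0 a b x : 0 <= md a b x.
Proof. exact: sqrtr_ge0. Qed.

Lemma md_L2 a b : L2 mu a -> L2 mu b -> L2 mu (md a b) /\ nrm2 mu (md a b) = nrm2 mu a + nrm2 mu b.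
Proof.
move=> [ma ia] [mb ib]; have e : (fun x => md a b x ^+ 2) = fun x => a x ^+ 2 + b x ^+ 2.
  by apply/funext => x; exact: md_sqr.
split; last by rewrite /nrm2 e IID.
split; last by rewrite e; exact: igD.
apply: measurableT_comp; first exact: continuous_measurable_fun (@sqrt_continuous R).
by apply: measurable_funD; exact: measurable_funX.
Qed.

Lemma md_dist (a b a' b' : R) :
  (Num.sqrt (a ^+ 2 + b ^+ 2) - Num.sqrt (a' ^+ 2 + b' ^+ 2)) ^+ 2 <= (a - a') ^+ 2 + (b - b') ^+ 2.
Proof.
have h0 : 0 <= a ^+ 2 + b ^+ 2 by rewrite addr_ge0 ?sqr_ge0.
have h1 : 0 <= a' ^+ 2 + b' ^+ 2 by rewrite addr_ge0 ?sqr_ge0.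
have := sqr_sqrtr h0; have := sqr_sqrtr h1; have := sqrtr_ge0 (a ^+ 2 + b ^+ 2); have := sqrtr_ge0 (a' ^+ 2 + b' ^+ 2).
move: (Num.sqrt _) (Num.sqrt _) => x y y0 x0 ey ex.
have xy : a * a' + b * b' <= x * y.
  apply: le_trans (ler_norm _) _; rewrite -ler_sqr ?nnegrE ?mulr_ge0// real_normK ?num_real//.
  rewrite exprMn ex ey -subr_ge0.
  have -> : (a ^+ 2 + b ^+ 2) * (a' ^+ 2 + b' ^+ 2) - (a * a' + b * b') ^+ 2 = (a * b' - b * a') ^+ 2 by ring.
  exact: sqr_ge0.
rewrite -subr_ge0; have -> : (a - a') ^+ 2 + (b - b') ^+ 2 - (x - y) ^+ 2 =
  (a ^+ 2 + b ^+ 2) - x ^+ 2 + ((a' ^+ 2 + b' ^+ 2) - y ^+ 2) + 2 * (x * y - (a * a' + b * b')) by ring.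
by rewrite ex ey !subrr !add0r mulr_ge0// subr_ge0.
Qed.

Lemma HN_contraction f g h N M : L2 mu h -> HN f N -> HN g M ->
  (forall x y, (h x - h y) ^+ 2 <= (f x - f y) ^+ 2 + (g x - g y) ^+ 2) ->
  exists2 K, HN h K & K <= N + M.
Proof.
move=> hL hf hg le; have fL := HN_L2 hf; have gL := HN_L2 hg.
pose t_ n : R := n.+1%:R^-1; have t0 n : 0 < t_ n by exact: harm_gt0.
apply: (@HN_bounded _ _ t_ (fun=> N + M)) => //; [exact: cvg_harmonic| |exact: sqC].
move=> n; apply: (@le_trans _ _ (dn (t_ n) f + dn (t_ n) g)); last first.
  by rewrite mulrDr; apply: lerD; exact: HN_le.
have i1 := ig_dn (t0 n) fL; have i2 := ig_dn (t0 n) gL.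
rewrite /dn -(IID i1 i2); apply: II_le; [exact: ig_dn|exact: igD|] => z.
by rewrite -mulrDr; apply: ler_wpM2l; [exact: kk_ge0|exact: le].
Qed.

Lemma QF_at al lam v c q : 0 < lam -> QF al 1 v c q -> exists N,
  HN (fun x => v x - c * G lam x) N /\
  q = N + lam * (nrm2 mu (fun x => v x - c * G lam x) - nrm2 mu v) + (al + theta lam) * c ^+ 2.
Proof. by move=> l0 h; exact: (QF_change ltr01 l0 h). Qed.

Lemma ig_powR_state al p v c q : 2 < p -> p < 4 -> QF al 1 v c q -> ig mu (fun x => `|v x| `^ p).
Proof.
move=> p2 p4 h; have [N [hN _]] := h; have n0 := nrm2_ge0 mu v.
have [K hK] := pB_coercive p2 p4 ltr01 n0 (@ltr01 R).
have e : (fun x => v x - c * G 1 x + c * G 1 x) = v by apply/funext => x; rewrite subrK.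
have le : nrm2 mu (fun x => v x - c * G 1 x + c * G 1 x) <= nrm2 mu v by rewrite e.
have [i _] := hK _ _ c hN le.
by move: i; congr (ig mu _); apply/funext => x; rewrite subrK.
Qed.

Lemma ig_powR_le p (v w : P -> R) : 2 < p -> mf v -> (forall x, `|v x| <= `|w x|) ->
  ig mu (fun x => `|w x| `^ p) -> ig mu (fun x => `|v x| `^ p).
Proof.
move=> p2 mv le; apply: ig_le; first exact: mpowR.
by move=> x; rewrite (ger0_norm (powR_ge0 _ _)); apply: powR_mono => //; lra.
Qed.

Lemma pB_le p (v w : P -> R) : 2 < p -> mf v -> (forall x, `|v x| <= `|w x|) ->
  ig mu (fun x => `|w x| `^ p) -> pB p v <= pB p w /\ (pB p w <= pB p v -> {ae mu, forall x : P, `|v x| = `|w x|}).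
Proof.
move=> p2 mv le iw; have iv := ig_powR_le p2 mv le iw; have p0 : 0 < p by lra.
have pt x : `|v x| `^ p <= `|w x| `^ p by apply: powR_mono => //; exact: ltW.
split; first exact: II_le.
move=> ge; have z : II mu (fun x => `|w x| `^ p - `|v x| `^ p) = 0.
  rewrite (IIB iw iv); apply/eqP; rewrite subr_eq0 eq_le; apply/andP; split; first exact: ge.
  exact: II_le.
have := II_eq0 (igB iw iv) (fun x => ltac:(by rewrite subr_ge0)) z.
apply: filterS => x /eqP; rewrite subr_eq0 => /eqP e.
by apply: (powR_injective p0); rewrite ?nnegrE.
Qed.

Lemma pB_gt0 p (v : P -> R) : 2 < p -> L2 mu v -> 0 < nrm2 mu v -> ig mu (fun x => `|v x| `^ p) -> 0 < pB p v.
Proof.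
move=> p2 vL v0 i; rewrite lt_def pB_ge0 andbT; apply/negP => /eqP z.
have ae := II_eq0 i (fun x => powR_ge0 _ _) z.
have : {ae mu, forall x : P, v x = 0}.
  by apply: filterS ae => x /powR_eq0_eq0/eqP; rewrite normr_eq0 => /eqP.
move=> /(ae_nrm2 vL.1 (@measurable_cst _ _ P R setT 0)).
have -> : nrm2 mu (fun _ : P => 0 : R) = 0 by rewrite /nrm2 -[RHS](II0 mu); congr (II mu); apply/funext => x; rewrite expr0n.
by move=> e; rewrite e ltxx in v0.
Qed.

(* Replacing phi by |phi| and q by |q| at the frequency om. *)
Lemma modulus_state al p om v c1 q1 c2 q2 N1 N2 : 2 < p -> p < 4 -> 0 < om -> states al v c1 q1 c2 q2 ->
  let f1 := fun x => re v x - c1 * G om x in let f2 := fun x => im v x - c2 * G om x in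
  HN f1 N1 -> HN f2 N2 ->
  let c := Num.sqrt (c1 ^+ 2 + c2 ^+ 2) in let w := fun x => md f1 f2 x + c * G om x in
  exists N q, [/\ HN (md f1 f2) N, QF al om w c q, ig mu (fun x => `|w x| `^ p),
    q = N + om * (nrm2 mu (md f1 f2) - nrm2 mu w) + (al + theta om) * c ^+ 2 &
    q + om * nrm2 mu w <= q1 + q2 + om * (nrm2 mu (re v) + nrm2 mu (im v))].
Proof.
move=> p2 p4 om0 [mv h1 h2] f1 f2 hf1 hf2 c w.
have [_ e1] := QF_unique om0 ltr01 (ex_intro _ N1 (conj hf1 erefl) : QF al om _ c1 _) h1.
have [_ e2] := QF_unique om0 ltr01 (ex_intro _ N2 (conj hf2 erefl) : QF al om _ c2 _) h2.
have [mL mn] := md_L2 (HN_L2 hf1) (HN_L2 hf2).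
have [N hN Nle] := HN_contraction mL hf1 hf2 (fun x y => md_dist _ _ _ _).
have we : (fun x => w x - c * G om x) = md f1 f2 by apply/funext => x; rewrite /w addrK.
exists N, (N + om * (nrm2 mu (md f1 f2) - nrm2 mu w) + (al + theta om) * c ^+ 2); split=> //.
- by exists N; rewrite we.
- have n0 := nrm2_ge0 mu w; have [K hK] := pB_coercive p2 p4 om0 n0 (@ltr01 R).
  by have [] := hK _ _ c hN (lexx _).
rewrite mn /c sqr_sqrtr ?addr_ge0 ?sqr_ge0// -e1 -e2.
move: (nrm2 mu w) (nrm2 mu (re v)) (nrm2 mu (im v)) (nrm2 mu f1) (nrm2 mu f2) => nw nr ni n1 n2.
rewrite -/f1 -/f2; move: (nrm2 mu f1) (nrm2 mu f2); clear - Nle => n3 n4; nra.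
Qed.

Lemma modulus_le om v c1 c2 (x : P) : 0 < om ->
  modulus v x <= md (fun x => re v x - c1 * G om x) (fun x => im v x - c2 * G om x) x + Num.sqrt (c1 ^+ 2 + c2 ^+ 2) * G om x.
Proof.
move=> om0; rewrite modulusE /md; have g0 : 0 <= Ga om 0 x by exact: Ga_ge0.
move: (re v x) (im v x) (Ga om 0 x) g0 => a b g g0.
have h := md_dist a b (a - c1 * g) (b - c2 * g).
have c0 : 0 <= c1 ^+ 2 + c2 ^+ 2 by rewrite addr_ge0 ?sqr_ge0.
have r0 : 0 <= Num.sqrt (c1 ^+ 2 + c2 ^+ 2) * g by rewrite mulr_ge0 ?sqrtr_ge0.
rewrite -lerBlDl; apply: le_trans (ler_norm _) _.
rewrite -ler_sqr ?nnegrE// real_normK ?num_real//; apply: le_trans h _.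
by rewrite exprMn sqr_sqrtr// le_eqVlt; apply/orP; left; apply/eqP; ring.
Qed.

End reduction.

(** * Polarization and radial symmetry *)

Section polarization.
Context {R : realType}.
Local Notation P := (mplane R).
Local Notation mu := (leb2 R).
Local Notation G a := (@Ga R a 0).
Let o : P := (0, 0).
Implicit Type p : R.
Variables (n1 n2 k : R).
Hypothesis unit_n : n1 ^+ 2 + n2 ^+ 2 = 1.

(** Signed distance to the line n . x = k; for k > 0 the half-plane [side < 0] contains the origin,
    and it is there that [pol] puts the larger value of each pair. *)
Definition side (x : P) : R := n1 * x.1 + n2 * x.2 - k.
Definition refl (x : P) : P := (x.1 - 2 * side x * n1, x.2 - 2 * side x * n2).

Lemma side_refl x : side (refl x) = - side x.
Proof.
rewrite /side /refl /=; set s := n1 * x.1 + n2 * x.2 - k.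
have -> : n1 * (x.1 - 2 * s * n1) + n2 * (x.2 - 2 * s * n2) - k = s - 2 * s * (n1 ^+ 2 + n2 ^+ 2) by rewrite /s; ring.
by rewrite unit_n; ring.
Qed.

Lemma reflK x : refl (refl x) = x.
Proof.
rewrite {1}/refl side_refl /refl /=; case: x => a b /=; congr pair; ring.
Qed.

Lemma minv_refl : minv mu refl.
Proof.
(* The linear part of the reflection is I - 2 n n^T, of the form treated in [minv_lin] with these
   two entries. *)
have u : (1 - 2 * n1 ^+ 2) ^+ 2 + (- 2 * n1 * n2) ^+ 2 = 1.
  have -> : (1 - 2 * n1 ^+ 2) ^+ 2 + (- 2 * n1 * n2) ^+ 2 = 1 + 4 * n1 ^+ 2 * (n1 ^+ 2 + n2 ^+ 2 - 1) by ring.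
  by rewrite unit_n subrr mulr0 addr0.
have := minv_comp (@minv_shift R false (2 * k * n1, 2 * k * n2)) (minv_lin u).
congr (minv mu _); apply/funext => -[a b]; rewrite /refl /side /= expr0 !mul1r; congr pair.
  by ring.
have -> : b - 2 * (n1 * a + n2 * b - k) * n2 =
  -2 * n1 * n2 * a - (1 - 2 * n1 ^+ 2) * b + 2 * k * n2 + 2 * b * (1 - (n1 ^+ 2 + n2 ^+ 2)) by ring.
by rewrite unit_n subrr mulr0 addr0.
Qed.

Lemma d2_refl x y : d2 (refl x) (refl y) = d2 x y /\ d2 x (refl y) = d2 x y + 4 * side x * side y /\
  d2 (refl x) y = d2 x y + 4 * side x * side y.
Proof.
have key s t (a b c d : R) : s = n1 * a + n2 * b - k -> t = n1 * c + n2 * d - k ->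
    (a - 2 * s * n1 - (c - 2 * t * n1)) ^+ 2 + (b - 2 * s * n2 - (d - 2 * t * n2)) ^+ 2 = (a - c) ^+ 2 + (b - d) ^+ 2 /\
    (a - (c - 2 * t * n1)) ^+ 2 + (b - (d - 2 * t * n2)) ^+ 2 = (a - c) ^+ 2 + (b - d) ^+ 2 + 4 * s * t.
  move=> es et; split.
    have -> : (a - 2 * s * n1 - (c - 2 * t * n1)) ^+ 2 + (b - 2 * s * n2 - (d - 2 * t * n2)) ^+ 2 =
      (a - c) ^+ 2 + (b - d) ^+ 2 + 4 * (s - t) * ((s - t) * (n1 ^+ 2 + n2 ^+ 2) - (n1 * a + n2 * b - k - (n1 * c + n2 * d - k))) by ring.
    by rewrite unit_n -es -et mulr1 subrr mulr0 addr0.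
  have -> : (a - (c - 2 * t * n1)) ^+ 2 + (b - (d - 2 * t * n2)) ^+ 2 =
    (a - c) ^+ 2 + (b - d) ^+ 2 + 4 * t * (n1 * a + n2 * b - k - (n1 * c + n2 * d - k)) + 4 * t ^+ 2 * (n1 ^+ 2 + n2 ^+ 2) by ring.
  by rewrite unit_n -es -et; ring.
have [h1 h2] := key (side x) (side y) x.1 x.2 y.1 y.2 erefl erefl.
have [_ h3] := key (side y) (side x) y.1 y.2 x.1 x.2 erefl erefl.
rewrite /d2 /refl /=; split; first exact: h1.
split; first exact: h2.
move: h3; move: (side x) (side y) => s t h3.
have -> : (x.1 - 2 * s * n1 - y.1) ^+ 2 + (x.2 - 2 * s * n2 - y.2) ^+ 2 =
  (y.1 - (x.1 - 2 * s * n1)) ^+ 2 + (y.2 - (x.2 - 2 * s * n2)) ^+ 2 by ring.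
by rewrite h3; ring.
Qed.

(** Reflecting y adds 4 side x side y to the squared distance: the kernel is larger between points
    on the same side. *)
Lemma kk_refl t x y : 0 < t -> [/\ kk t (refl x) (refl y) = kk t x y, kk t (refl x) y = kk t x (refl y) &
  0 <= (kk t x y - kk t x (refl y)) * (side x * side y)].
Proof.
move=> t0; have [h1 [h2 h3]] := d2_refl x y; rewrite !kkE// h1 h2 h3; split=> //.
have c0 : 0 <= (4 * pi * t)^-1 by rewrite invr_ge0 !mulr_ge0 ?pi_ge0 ?(ltW t0).
rewrite -mulrBr -[leRHS]mulrA; apply: mulr_ge0 => //.
have t4 : 0 < 4 * t by rewrite mulr_gt0.
have [s0|s0] := leP 0 (side x * side y).
  apply: mulr_ge0 => //; rewrite subr_ge0 ler_expR !mulNr lerN2 ler_pM2r ?invr_gt0// lerDl -mulrA.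
  exact: mulr_ge0.
apply: mulr_le0; last exact: ltW.
rewrite subr_le0 ler_expR !mulNr lerN2 ler_pM2r ?invr_gt0// gerDl -mulrA.
by rewrite pmulr_rle0// ltW.
Qed.

Definition pol (f : P -> R) (x : P) : R :=
  if side x < 0 then Num.max (f x) (f (refl x)) else Num.min (f x) (f (refl x)).

Lemma refl_fixed x : side x = 0 -> refl x = x.
Proof. by move=> s; rewrite /refl s; case: (x) => a b /=; congr pair; ring. Qed.

(** The third identity encodes the order of the two values in a single formula, valid on both sides
    and on the line itself. *)
Lemma pol_pair f x : pol f x + pol f (refl x) = f x + f (refl x) /\
  pol f x ^+ 2 + pol f (refl x) ^+ 2 = f x ^+ 2 + f (refl x) ^+ 2 /\
  side x * (pol f x - pol f (refl x)) = - (`|side x| * `|f x - f (refl x)|).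
Proof.
rewrite /pol side_refl reflK oppr_lt0; case: ltgtP => s.
- rewrite (ltr0_norm s); case: (leP (f x) (f (refl x))) => h; rewrite ?(minC (f (refl x))).
    by rewrite (ler0_norm (x := _ - _)) ?subr_le0//; split; [|split]; ring.
  by rewrite (ger0_norm (x := _ - _)) ?subr_ge0 ?(ltW h)//; split; [|split]; ring.
- rewrite (gtr0_norm s); case: (leP (f x) (f (refl x))) => h; rewrite ?(maxC (f (refl x))).
    by rewrite (ler0_norm (x := _ - _)) ?subr_le0//; split; [|split]; ring.
  by rewrite (ger0_norm (x := _ - _)) ?subr_ge0 ?(ltW h)//; split; [|split]; ring.
rewrite refl_fixed//; by rewrite minxx s !mul0r normr0 mul0r oppr0.
Qed.

Lemma mside : mf side.
Proof.
apply: measurable_funB; last exact: measurable_cst.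
by apply: measurable_funD; apply: measurable_funM; [exact: measurable_cst|exact: measurable_fst|exact: measurable_cst|exact: measurable_snd].
Qed.

Lemma mpol f : mf f -> mf (pol f).
Proof.
move=> fm; have rm : mf (f \o refl) by apply: measurableT_comp => //; exact: minv_refl.1.
apply: measurable_fun_ifT; first exact: measurable_fun_ltr mside (measurable_cst _).
  exact: measurable_maxr.
exact: measurable_minr.
Qed.

(** Sums and sums of squares over each pair are preserved, so only (K - L) times the change of the
    product of differences remains. K - L has the sign of side x side y, and polarization makes the
    product of differences as large as possible with that sign. *)
Lemma pol_dist t f x y : 0 < t ->
  kk t x y * (pol f x - pol f y) ^+ 2 + kk t (refl x) y * (pol f (refl x) - pol f y) ^+ 2
  + (kk t x (refl y) * (pol f x - pol f (refl y)) ^+ 2 + kk t (refl x) (refl y) * (pol f (refl x) - pol f (refl y)) ^+ 2)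
  <= kk t x y * (f x - f y) ^+ 2 + kk t (refl x) y * (f (refl x) - f y) ^+ 2
  + (kk t x (refl y) * (f x - f (refl y)) ^+ 2 + kk t (refl x) (refl y) * (f (refl x) - f (refl y)) ^+ 2).
Proof.
move=> t0; have [-> -> ] := kk_refl x y t0.
have zx : side x = 0 -> (pol f x = pol f (refl x)) * (f x = f (refl x)) by move=> /refl_fixed ->.
have zy : side y = 0 -> (pol f y = pol f (refl y)) * (f y = f (refl y)) by move=> /refl_fixed ->.
have [a1 [a2 a3]] := pol_pair f x; have [b1 [b2 b3]] := pol_pair f y.
move: (kk t x y) (kk t x (refl y)) => K L kl.
move: zx zy a1 a2 a3 b1 b2 b3; move: (pol f x) (pol f (refl x)) (pol f y) (pol f (refl y)) (f x) (f (refl x)) (f y) (f (refl y)).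
move=> A B C D a b c d zx zy a1 a2 a3 b1 b2 b3; rewrite -subr_ge0.
have -> : K * (a - c) ^+ 2 + L * (b - c) ^+ 2 + (L * (a - d) ^+ 2 + K * (b - d) ^+ 2) -
  (K * (A - C) ^+ 2 + L * (B - C) ^+ 2 + (L * (A - D) ^+ 2 + K * (B - D) ^+ 2)) =
  (K + L) * ((a ^+ 2 + b ^+ 2) - (A ^+ 2 + B ^+ 2) + ((c ^+ 2 + d ^+ 2) - (C ^+ 2 + D ^+ 2))) +
  (K - L) * ((A - B) * (C - D) - (a - b) * (c - d)) + (K + L) * ((A + B) * (C + D) - (a + b) * (c + d)) by ring.
rewrite a1 b1 a2 b2 !subrr addr0 !mulr0 add0r addr0.
have AB : (A - B) ^+ 2 = (a - b) ^+ 2.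
  have -> : (A - B) ^+ 2 = 2 * (A ^+ 2 + B ^+ 2) - (A + B) ^+ 2 by ring.
  by rewrite a1 a2; ring.
have CD : (C - D) ^+ 2 = (c - d) ^+ 2.
  have -> : (C - D) ^+ 2 = 2 * (C ^+ 2 + D ^+ 2) - (C + D) ^+ 2 by ring.
  by rewrite b1 b2; ring.
have nAB : `|A - B| = `|a - b| by rewrite -!sqrtr_sqr AB.
have nCD : `|C - D| = `|c - d| by rewrite -!sqrtr_sqr CD.
have [s0|s0] := eqVneq (side x * side y) 0.
  have /orP[/eqP/zx[-> ->]|/eqP/zy[-> ->]] : (side x == 0) || (side y == 0) by rewrite -mulf_eq0 s0.
    by rewrite !subrr !mul0r subrr mulr0.
  by rewrite !subrr !mulr0 subrr mulr0.
have pr : (side x * side y) * ((A - B) * (C - D)) = `|side x * side y| * `|(a - b) * (c - d)|.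
  by rewrite mulrACA a3 b3 mulrNN !normrM mulrACA.
have w : 0 <= (side x * side y) * ((A - B) * (C - D) - (a - b) * (c - d)).
  rewrite mulrBr pr subr_ge0 -normrM; exact: ler_norm.
have s2 : 0 < (side x * side y) ^+ 2 by rewrite lt_def sqr_ge0 andbT sqrf_eq0.
rewrite -(pmulr_rge0 _ s2).
have -> : forall u v z : R, u ^+ 2 * (v * z) = v * u * (u * z) by move=> u v z; ring.
exact: mulr_ge0.
Qed.

Lemma pol_L2 f : L2 mu f -> L2 mu (pol f) /\ nrm2 mu (pol f) = nrm2 mu f.
Proof.
move=> fL; have rL := minv_L2 minv_refl fL; have m := mpol fL.1.
have pL : L2 mu (pol f).
  split=> //; apply: ig_le (igD fL.2 rL.2); first exact: measurable_funX.
  by move=> x; rewrite ger0_norm ?sqr_ge0//= -(pol_pair f x).2.1 lerDl sqr_ge0.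
split=> //; have prL := minv_L2 minv_refl pL.
have e1 : II mu (fun x => pol f x ^+ 2 + (pol f \o refl) x ^+ 2) = 2 * nrm2 mu (pol f).
  by rewrite (IID pL.2 prL.2); move: (minv_nrm2 minv_refl m); rewrite /nrm2 => ->; rewrite mulr_natl mulr2n.
have e2 : II mu (fun x => f x ^+ 2 + (f \o refl) x ^+ 2) = 2 * nrm2 mu f.
  by rewrite (IID fL.2 rL.2); move: (minv_nrm2 minv_refl fL.1); rewrite /nrm2 => ->; rewrite mulr_natl mulr2n.
have : 2 * nrm2 mu (pol f) = 2 * nrm2 mu f.
  by rewrite -e1 -e2; congr (II mu); apply/funext => x; exact: (pol_pair f x).2.1.
by move/mulfI; apply.
Qed.

(** [minv_le2] is applied in x and then in y, which reduces the claim to the four-point inequality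
    [pol_dist]. *)
Lemma dn_pol t f : 0 < t -> L2 mu f -> dn t (pol f) <= dn t f.
Proof.
move=> t0 fL; have [pL _] := pol_L2 fL.
rewrite -lee_fin -(Dn_dn t0 pL) -(Dn_dn t0 fL) /Dn.
have mI (g : P -> R) : mf g -> measurable_fun setT (fun x => \int[mu]_y (kk t x y * (g x - g y) ^+ 2)%:E)%E.
  by move=> gm; apply: (msection_int (mDn t gm)) => z; exact: Dn_integrand_ge0.
have mS (g : P -> R) x : mf g -> measurable_fun setT (fun y : P => (kk t x y * (g x - g y) ^+ 2)%:E).
  by move=> gm; apply/measurable_EFinP; exact: (sect1 x (mDn t gm)).
have g0 (g : P -> R) x y : (0 <= (kk t x y * (g x - g y) ^+ 2)%:E)%E by rewrite lee_fin; exact: (Dn_integrand_ge0 t g (x, y)).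
apply: (minv_le2 minv_refl (mI _ pL.1) (mI _ fL.1)).
- by move=> x; exact: integral_ge0.
- by move=> x; exact: integral_ge0.
move=> x; have mr (g : P -> R) : mf g -> measurable_fun setT (fun y : P => (kk t x y * (g x - g y) ^+ 2)%:E + (kk t (refl x) y * (g (refl x) - g y) ^+ 2)%:E)%E.
  by move=> gm; apply: emeasurable_funD; exact: mS.
have S (g : P -> R) (gm : mf g) := ge0_integralD mu measurableT (fun y _ => g0 g x y) (mS g x gm)
  (fun y _ => g0 g (refl x) y) (mS g (refl x) gm).
rewrite -(S _ pL.1) -(S _ fL.1).
apply: (minv_le2 minv_refl (mr _ pL.1) (mr _ fL.1)).
- by move=> y; rewrite adde_ge0.
- by move=> y; rewrite adde_ge0.
by move=> y; rewrite -!EFinD lee_fin; exact: pol_dist.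
Qed.

Lemma HN_pol f N : HN f N -> exists2 M, HN (pol f) M & M <= N.
Proof.
move=> h; have fL := HN_L2 h; have [pL _] := pol_L2 fL.
pose t_ n : R := n.+1%:R^-1; have t0 n : 0 < t_ n by exact: harm_gt0.
apply: (@HN_bounded _ _ t_ (fun=> N)) => //; [exact: cvg_harmonic| |exact: sqC].
by move=> n; apply: le_trans (dn_pol (t0 n) fL) _; exact: HN_le.
Qed.

Lemma enorm_refl x : 0 < k -> side x < 0 -> enorm x < enorm (refl x).
Proof.
move=> k0 s; rewrite /enorm ltr_sqrt.
  rewrite -subr_gt0 /refl /=; set t := side x.
  have -> : (x.1 - 2 * t * n1) ^+ 2 + (x.2 - 2 * t * n2) ^+ 2 - (x.1 ^+ 2 + x.2 ^+ 2) =
    4 * t ^+ 2 * (n1 ^+ 2 + n2 ^+ 2) - 4 * t * (n1 * x.1 + n2 * x.2 - k) - 4 * t * k by ring.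
  by rewrite unit_n -/(side x) -/t mulr1 -mulrA -expr2 subrr sub0r -mulNr pmulr_lgt0// -mulrN pmulr_rgt0// oppr_gt0.
rewrite lt_def addr_ge0 ?sqr_ge0// andbT; apply/eqP => h.
have h1 : (refl x).1 = 0 by apply/eqP; rewrite -sqrf_eq0 eq_le sqr_ge0 andbT -h lerDl sqr_ge0.
have h2 : (refl x).2 = 0 by apply/eqP; rewrite -sqrf_eq0 eq_le sqr_ge0 andbT -h lerDr sqr_ge0.
have := side_refl x; rewrite {1}/side h1 h2 !mulr0 addr0 sub0r => e.
by move: s; rewrite -oppr_gt0 -e oppr_gt0 ltNge (ltW k0).
Qed.

(** The integrable counterpart of [minv_le2], with its equality case: a nonnegative integrand of
    zero integral vanishes almost everywhere. *)
Lemma minv_pairs (s : P -> P) (A B : P -> R) : minv mu s -> ig mu A -> ig mu B ->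
  {ae mu, forall x : P, A x + A (s x) <= B x + B (s x)} ->
  II mu A <= II mu B /\ (II mu B <= II mu A -> {ae mu, forall x : P, A x + A (s x) = B x + B (s x)}).
Proof.
move=> sm iA iB ae; have iD := igB iB iA; have iDs := minv_ig sm iD.
have iS := igD iD iDs; have iN := ig_norm iS.
have aen : {ae mu, forall x : P, B x - A x + (B (s x) - A (s x)) = `|B x - A x + (B (s x) - A (s x))|}.
  by apply: filterS ae => x h; rewrite ger0_norm// addrACA -opprD subr_ge0.
have E : II mu (fun x => `|B x - A x + (B (s x) - A (s x))|) = 2 * (II mu B - II mu A).
  have <- := ae_II (ig_mf iS) (ig_mf iN) aen; have -> := IID iD iDs.
  by rewrite (minv_II sm (ig_mf iD)) (IIB iB iA) mulr_natl mulr2n.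
have ge : II mu A <= II mu B.
  have := II_ge0 mu (fun x => normr_ge0 (B x - A x + (B (s x) - A (s x)))).
  by rewrite E pmulr_rge0// subr_ge0.
split=> // le; have z : II mu (fun x => `|B x - A x + (B (s x) - A (s x))|) = 0.
  by rewrite E (le_anti (introT andP (conj le ge))) subrr mulr0.
apply: filterS (II_eq0 iN (fun x => normr_ge0 _) z) => x /eqP.
by rewrite normr_eq0 addrACA -opprD subr_eq0 => /eqP.
Qed.

Lemma pair_power p (a b g h : R) : 1 < p -> 0 <= a -> 0 <= b -> 0 <= h -> h < g ->
  `|a + g| `^ p + `|b + h| `^ p <= `|Num.max a b + g| `^ p + `|Num.min b a + h| `^ p /\
  (a < b -> `|a + g| `^ p + `|b + h| `^ p < `|Num.max a b + g| `^ p + `|Num.min b a + h| `^ p).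
Proof.
move=> p1 a0 b0 h0 hg; have g0 := le_trans h0 (ltW hg).
have M0 : 0 <= Num.max a b by rewrite le_max a0.
have m0 : 0 <= Num.min b a by rewrite le_min a0 b0.
rewrite (ger0_norm (addr_ge0 a0 g0)) (ger0_norm (addr_ge0 b0 h0)).
rewrite (ger0_norm (addr_ge0 M0 g0)) (ger0_norm (addr_ge0 m0 h0)).
have [ab|ba] := ltP a b; last by split.
by have lt := powR_rearrange p1 a0 ab h0 hg; split=> // ; exact: ltW.
Qed.

(* Polarization moves mass of f towards the region where H is larger. *)
Lemma pol_power p (f H : P -> R) : 2 < p -> (forall x, 0 <= f x) -> (forall x, 0 <= H x) ->
  {ae mu, forall x : P, side x < 0 -> H (refl x) < H x} ->
  ig mu (fun x => `|f x + H x| `^ p) -> ig mu (fun x => `|pol f x + H x| `^ p) ->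
  pB p (fun x => f x + H x) <= pB p (fun x => pol f x + H x) /\
  (pB p (fun x => pol f x + H x) <= pB p (fun x => f x + H x) ->
   {ae mu, forall x : P, side x < 0 -> f (refl x) <= f x}).
Proof.
move=> p2 f0 H0 aeH iv iw; have p1 : 1 < p by lra.
have step (x : P) : side x < 0 -> H (refl x) < H x ->
    `|f x + H x| `^ p + `|f (refl x) + H (refl x)| `^ p <=
    `|pol f x + H x| `^ p + `|pol f (refl x) + H (refl x)| `^ p /\
    (f x < f (refl x) -> `|f x + H x| `^ p + `|f (refl x) + H (refl x)| `^ p <
    `|pol f x + H x| `^ p + `|pol f (refl x) + H (refl x)| `^ p).
  move=> s gg; have -> : pol f x = Num.max (f x) (f (refl x)) by rewrite /pol s.
  have -> : pol f (refl x) = Num.min (f (refl x)) (f x).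
    by rewrite /pol side_refl oppr_lt0 (lt_gtF s) reflK.
  exact: (pair_power p1 (f0 x) (f0 (refl x)) (H0 (refl x)) gg).
have aeH2 : {ae mu, forall x : P, (side x < 0 -> H (refl x) < H x) /\ (side (refl x) < 0 -> H (refl (refl x)) < H (refl x))}.
  by apply: filterS2 aeH (minv_ae minv_refl aeH) => x.
have [|le eq] := minv_pairs minv_refl iv iw.
  apply: filterS aeH2 => x [h1 h2]; have [s|s|s] := ltgtP (side x) 0.
  - exact: (step x s (h1 s)).1.
  - have s' : side (refl x) < 0 by rewrite side_refl oppr_lt0.
    have := (step _ s' (h2 s')).1; rewrite reflK.
    by rewrite [X in X <= _ -> _]addrC [X in _ <= X -> _]addrC.
  - have -> : pol f x = f x by rewrite /pol s ltxx (refl_fixed s) minxx.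
    by rewrite (refl_fixed s) /pol s ltxx (refl_fixed s) minxx.
split; first exact: le.
move=> /eq; apply: filterS2 aeH => x h e s.
by rewrite leNgt; apply/negP => /(step x s (h s)).2; rewrite e ltxx.
Qed.

End polarization.

(** * Radial profiles of polarized functions *)

Section radial_profile.
Context {R : realType}.
Local Notation P := (mplane R).
Local Notation mu := (leb2 R).
Let o : P := (0, 0).

Lemma enorm_sqr (x : P) : enorm x ^+ 2 = x.1 ^+ 2 + x.2 ^+ 2.
Proof. by rewrite sqr_sqrtr// addr_ge0 ?sqr_ge0. Qed.

Lemma enorm_ge0 (x : P) : 0 <= enorm x. Proof. exact: sqrtr_ge0. Qed.

(** The perpendicular bisector of x and y; the origin lies on the side of x because x is closer to
    it, which is the condition k > 0. *)
Lemma bisector (x y : P) : enorm x < enorm y -> exists n1 n2 k : R,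
  [/\ n1 ^+ 2 + n2 ^+ 2 = 1, 0 < k, refl n1 n2 k x = y & side n1 n2 k x < 0].
Proof.
move=> xy; have q : x.1 ^+ 2 + x.2 ^+ 2 < y.1 ^+ 2 + y.2 ^+ 2.
  by rewrite -!enorm_sqr ltr_pXn2r ?nnegrE ?enorm_ge0.
pose d := Num.sqrt ((y.1 - x.1) ^+ 2 + (y.2 - x.2) ^+ 2).
have e0 : 0 <= (y.1 - x.1) ^+ 2 + (y.2 - x.2) ^+ 2 by rewrite addr_ge0 ?sqr_ge0.
have d0 : 0 < d.
  rewrite sqrtr_gt0 lt_def e0 andbT; apply: contraTneq q => z.
  have z1 : y.1 - x.1 = 0 by apply/eqP; rewrite -sqrf_eq0 eq_le sqr_ge0 andbT -z lerDl sqr_ge0.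
  have z2 : y.2 - x.2 = 0 by apply/eqP; rewrite -sqrf_eq0 eq_le sqr_ge0 andbT -z lerDr sqr_ge0.
  by rewrite (subr0_eq z1) (subr0_eq z2) ltxx.
have dd : d ^+ 2 = (y.1 - x.1) ^+ 2 + (y.2 - x.2) ^+ 2 by rewrite sqr_sqrtr.
have dn := lt0r_neq0 d0.
exists ((y.1 - x.1) / d), ((y.2 - x.2) / d), ((y.1 ^+ 2 + y.2 ^+ 2 - (x.1 ^+ 2 + x.2 ^+ 2)) / (2 * d)).
have s : side ((y.1 - x.1) / d) ((y.2 - x.2) / d) ((y.1 ^+ 2 + y.2 ^+ 2 - (x.1 ^+ 2 + x.2 ^+ 2)) / (2 * d)) x = - (d / 2).
  rewrite /side.
  have -> : (y.1 - x.1) / d * x.1 + (y.2 - x.2) / d * x.2 - (y.1 ^+ 2 + y.2 ^+ 2 - (x.1 ^+ 2 + x.2 ^+ 2)) / (2 * d)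
    = - ((y.1 - x.1) ^+ 2 + (y.2 - x.2) ^+ 2) / (2 * d) by field; rewrite dn.
  by rewrite -dd; field; rewrite dn.
split.
- by rewrite !expr_div_n -mulrDl -dd divff// expf_neq0.
- by rewrite divr_gt0 ?subr_gt0// mulr_gt0.
- by rewrite /refl s; case: (x) (y) dn => a b [a' b'] /= dn; congr pair; field; rewrite dn.
- by rewrite s oppr_lt0 divr_gt0.
Qed.

Definition polarized (f : P -> R) := forall n1 n2 k : R, n1 ^+ 2 + n2 ^+ 2 = 1 -> 0 < k ->
  {ae mu, forall x : P, side n1 n2 k x < 0 -> f (refl n1 n2 k x) <= f x}.

(** Reflect in the bisector: on each pair of points f and the kernel centred at x are ordered alike,
    so exchanging x for y can only lower the integral. The null sets of [polarized] depend on the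
    half-plane; after integration the inequality holds for all x and y. *)
Lemma TT_decr t f (x y : P) : 0 < t -> L2 mu f -> polarized f -> enorm x < enorm y -> TT t f y <= TT t f x.
Proof.
move=> t0 fL pf xy; have [n1 [n2 [k [u k0 rx sx]]]] := bisector xy.
have ae := pf _ _ _ u k0; have rm := minv_refl k u.
have iy := L2_mul (L2_kk y t0) fL; have ix := L2_mul (L2_kk x t0) fL.
suff h : {ae mu, forall z : P, kk t y z * f z + kk t y (refl n1 n2 k z) * f (refl n1 n2 k z) <=
    kk t x z * f z + kk t x (refl n1 n2 k z) * f (refl n1 n2 k z)} by exact: (minv_pairs rm iy ix h).1.
have pt (z : P) (a b : R) : (side n1 n2 k z < 0 -> b <= a) -> (0 < side n1 n2 k z -> a <= b) -> (side n1 n2 k z = 0 -> a = b) ->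
    kk t y z * a + kk t y (refl n1 n2 k z) * b <= kk t x z * a + kk t x (refl n1 n2 k z) * b.
  move=> h1 h2 h3; rewrite -rx.
  have [e1 e2 e3] := kk_refl k u x z t0; rewrite e1 e2; move: e3.
  move: (kk t x (refl n1 n2 k z)) (kk t x z) => B A e3; rewrite -subr_ge0.
  have -> : A * a + B * b - (B * a + A * b) = (A - B) * (a - b) by ring.
  have [s|s|s] := ltgtP (side n1 n2 k z) 0; last by rewrite (h3 s) subrr mulr0.
    by apply: mulr_ge0; [rewrite -(pmulr_lge0 _ (_ : 0 < side n1 n2 k x * side n1 n2 k z))//; rewrite nmulr_rgt0|rewrite subr_ge0; exact: h1].
  rewrite -mulrNN; apply: mulr_ge0; last by rewrite opprB subr_ge0; exact: h2.
  rewrite oppr_ge0 -(nmulr_lge0 _ (_ : side n1 n2 k x * side n1 n2 k z < 0))//; by rewrite nmulr_rlt0.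
apply: filterS2 ae (minv_ae rm ae) => z hz hrz; apply: pt => s; first exact: hz.
  by move: hrz; rewrite (side_refl k u) (reflK k u) oppr_lt0; apply.
by rewrite refl_fixed.
Qed.

(** Equal radii are reached by dilating y by 1 + s and using the Lipschitz bound as s becomes
    small. *)
Lemma TT_decr_le t f (x y : P) : 0 < t -> L2 mu f -> polarized f -> y != o -> enorm x <= enorm y -> TT t f y <= TT t f x.
Proof.
move=> t0 fL pf y0 xy; have q0 : 0 < y.1 ^+ 2 + y.2 ^+ 2.
  rewrite lt_def addr_ge0 ?sqr_ge0// andbT; apply: contra y0 => /eqP z.
  have z1 : y.1 == 0 by rewrite -sqrf_eq0 eq_le sqr_ge0 andbT -z lerDl sqr_ge0.
  have z2 : y.2 == 0 by rewrite -sqrf_eq0 eq_le sqr_ge0 andbT -z lerDr sqr_ge0.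
  by case: (y) z1 z2 => a b /= /eqP -> /eqP ->.
have n0 := nrm2_ge0 mu f.
pose C := nrm2 mu f * ((y.1 ^+ 2 + y.2 ^+ 2) / (32 * pi * t ^+ 2)).
have c1 : 0 < 32 * pi * t ^+ 2 by rewrite !mulr_gt0 ?pi_gt0 ?exprn_gt0.
have C0 : 0 <= C by rewrite mulr_ge0// divr_ge0 ?ltW.
apply/ler_addgt0Pr => e e0; pose s := e / (1 + Num.sqrt C).
have k0 : 0 < 1 + Num.sqrt C by rewrite ltr_pwDl// sqrtr_ge0.
have s0 : 0 < s by rewrite divr_gt0.
pose y' : P := ((1 + s) * y.1, (1 + s) * y.2).
have lt : enorm x < enorm y'.
  apply: le_lt_trans xy _; rewrite /enorm ltr_sqrt.
    by rewrite /= !exprMn -mulrDr ltr_pMl// -[ltLHS](expr1n _ 2) ltr_pXn2r ?nnegrE ?addr_ge0 ?(ltW s0)// ltrDl.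
  by rewrite /= !exprMn -mulrDr mulr_gt0// exprn_gt0// addr_gt0.
have d := TT_lipschitz y' y t0 fL.
have dy : d2 y' y = s ^+ 2 * (y.1 ^+ 2 + y.2 ^+ 2) by rewrite /d2 /=; ring.
have dC : nrm2 mu f * (d2 y' y / (32 * pi * t ^+ 2)) = s ^+ 2 * C by rewrite dy /C; ring.
have : `|TT t f y' - TT t f y| <= s * Num.sqrt C.
  have sC0 : 0 <= s * Num.sqrt C := mulr_ge0 (ltW s0) (sqrtr_ge0 _).
  rewrite -ler_sqr ?nnegrE// real_normK ?num_real//.
  by rewrite exprMn sqr_sqrtr// -dC.
have sC : s * Num.sqrt C <= e.
  by rewrite /s mulrAC ler_pdivrMr// ler_pM2l// lerDr.
have := TT_decr t0 fL pf lt; rewrite ler_norml; move: (TT t f y') (TT t f y) (TT t f x) => a b c h /andP[h1 h2]; lra.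
Qed.

Lemma limn_esup_mono (u v : nat -> \bar R) : (forall n, (u n <= v n)%E) -> (limn_esup u <= limn_esup v)%E.
Proof.
move=> uv; rewrite !limn_esup_lim; apply: lee_lim; [exact: is_cvg_esups|exact: is_cvg_esups|].
apply: nearW => n; apply: ge_ereal_sup => _ [k nk <-].
by apply: le_trans (uv k) _; apply: ereal_sup_ubound; exists k.
Qed.

Lemma ae_point (Q : P -> Prop) (d : R) : 0 < d -> {ae mu, forall x : P, Q x} ->
  exists x : P, [/\ Q x, x != o & enorm x < d].
Proof.
move=> d0 [A [mA A0 sub]]; apply: contrapT => no.
have d2 : 0 < d / 2 by rewrite divr_gt0.
have rs : rect 0 (d / 2) 0 (d / 2) `<=` A.
  move=> x [/= x1 x2]; apply: sub => /= Qx; apply: no; exists x; move: x1 x2; rewrite !in_itv/= => /andP[a1 a2] /andP[b1 b2].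
  split=> //; first by apply: contraTneq a1 => ->; rewrite ltxx.
  have -> : d = Num.sqrt (d ^+ 2) by rewrite sqrtr_sqr gtr0_norm.
  rewrite /enorm ltr_sqrt ?exprn_gt0//.
  have l1 : x.1 ^+ 2 < (d / 2) ^+ 2 by rewrite ltr_pXn2r ?nnegrE ?(ltW a1) ?(ltW d2).
  have l2 : x.2 ^+ 2 < (d / 2) ^+ 2 by rewrite ltr_pXn2r ?nnegrE ?(ltW b1) ?(ltW d2).
  apply: lt_le_trans (ltrD l1 l2) _; rewrite -subr_ge0.
  have -> : d ^+ 2 - ((d / 2) ^+ 2 + (d / 2) ^+ 2) = d ^+ 2 / 2 by field.
  by rewrite divr_ge0 ?sqr_ge0.
have mr := measurable_rect 0 (d / 2) 0 (d / 2 : R).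
have : (mu (rect 0 (d / 2) 0 (d / 2)) <= mu A)%E by apply: le_measure; rewrite ?inE.
have mi : measurable (`]0%R, (d / 2)[%classic : set (measurableTypeR R)) by exact: measurable_itv.
have h := @product_measure1E _ _ (measurableTypeR R) (measurableTypeR R) R lebesgue_measure lebesgue_measure _ _ mi mi.
have l : @lebesgue_measure R `]0, d / 2[%classic = (d / 2)%:E.
  by rewrite lebesgue_measure_itv/= lte_fin d2 -EFinB subr0.
rewrite A0 (etrans h (congr2 (fun a b => (a * b)%E) l l) : mu (rect 0 (d / 2) 0 (d / 2)) = _).
by rewrite -EFinM lee_fin leNgt mulr_gt0.
Qed.

(** F is the upper limit of heat flows at times tending to 0: defined everywhere, it inherits their
    monotonicity and equals f almost everywhere. It is finite off the origin because the flows
    converge at some point closer to the origin. *)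
Lemma radial_representative f N : HN f N -> (forall x, 0 <= f x) -> polarized f ->
  exists F : P -> R, [/\ mf F, {ae mu, forall x : P, F x = f x}, forall x, 0 <= F x &
    forall x y : P, x != o -> y != o -> enorm x <= enorm y -> F y <= F x].
Proof.
move=> hN f0 pf; have fL := HN_L2 hN; have N0 := HN_ge0 hN.
(* These times make |f - u_n|^2 at most 8^-n / 4, hence the increments at most 8^-n as [fast_cauchy]
   requires. *)
pose t_ n : R := 8^-1 ^+ n / (8 * (N + 1)); have c0 : 0 < 8 * (N + 1) by rewrite mulr_gt0// ltr_wpDl.
have e0 n : 0 < (8^-1 : R) ^+ n by rewrite exprn_gt0.
have t0 n : 0 < t_ n by rewrite divr_gt0.
have [u uE] : exists u : nat -> P -> R, forall n, u n = TT (t_ n) f by exists (fun n => TT (t_ n) f).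
have uL n : L2 mu (u n) by rewrite uE; exact: L2_TT (t0 n) fL.
have uf n : nrm2 mu (fun x => f x - u n x) <= 8^-1 ^+ n / 4.
  rewrite uE; apply: le_trans (nrm2_sub_TT (t0 n) fL).2 (le_trans (HN_le hN (t0 n)) _).
  have -> : 2 * t_ n * N = 8^-1 ^+ n / 4 * (N / (N + 1)) by rewrite /t_; field; rewrite gt_eqF// ltr_wpDl.
  by rewrite ler_piMr ?divr_ge0 ?(ltW (e0 n))// ler_pdivrMr ?ltr_wpDl// mul1r lerDl.
have fuL n : L2 mu (fun x => f x - u n x) := L2B fL (uL n).
have du n : nrm2 mu (fun x => u n.+1 x - u n x) <= 8^-1 ^+ n.
  have -> : (fun x => u n.+1 x - u n x) = fun x => (f x - u n x) - (f x - u n.+1 x) by apply/funext => x; ring.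
  apply: le_trans (nrm2B_le (fuL n) (fuL n.+1)) _.
  have := uf n; have := uf n.+1; rewrite exprS; have := e0 n.
  move: (nrm2 _ _) (nrm2 _ _) (8^-1 ^+ n) => a b c; lra.
have m1 : mf (fun _ : P => 1 : R) by exact: measurable_cst.
have dint n : (\int[mu]_x (1 * (u n.+1 x - u n x) ^+ 2)%:E <= (8^-1 ^+ n)%:E)%E.
  have i : ig mu (fun x => 1 * (u n.+1 x - u n x) ^+ 2) by apply: igZ; exact: (L2B (uL n.+1) (uL n)).2.
  rewrite EFin_II// lee_fin; have -> : (fun x => 1 * (u n.+1 x - u n x) ^+ 2) = fun x => (u n.+1 x - u n x) ^+ 2.
    by apply/funext => x; rewrite mul1r.
  exact: du.
have [g [gm gae]] := fast_cauchy m1 (fun _ => ltr01) (fun n => (uL n).1) dint.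
have gf : {ae mu, forall x : P, f x - g x = 0}.
  have mg : mf (fun x => (f x - g x) ^+ 2) by apply: measurable_funX; apply: measurable_funB => //; exact: fL.1.
  have le : (\int[mu]_x ((f x - g x) ^+ 2)%:E <= 0%:E)%E.
    apply: (@fatou_ae _ _ _ _ (fun n x => (f x - u n x) ^+ 2) _ (fun n => 8^-1 ^+ n / 4)) => //.
    - by move=> n; apply: measurable_funX; exact: (fuL n).1.
    - by move=> n x; exact: sqr_ge0.
    - by move=> x; exact: sqr_ge0.
    - apply: filterS gae => x h; have k := sqB (sqC (f x)) h; have := sqM k k.
      by apply: sq_ext => n; rewrite -expr2.
    - by move=> n; rewrite EFin_II ?lee_fin; [exact: uf|exact: (fuL n).2].
    have : (fun n : nat => (8^-1 : R) ^+ n * 4^-1) @ \oo --> (0 : R) * 4^-1.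
      by apply: sqM (sqC _); apply: cvg_expr; rewrite ger0_norm// invf_lt1// ltr1n.
    by rewrite mul0r.
  have L : L2 mu (fun x => f x - g x).
    by apply: L2P; [apply: measurable_funB => //; exact: fL.1|apply: le_lt_trans le _; rewrite ltry].
  apply: (nrm2_eq0 L); apply/eqP; rewrite eq_le nrm2_ge0 andbT -lee_fin -(EFin_II L.2); exact: le.
pose E (x : P) : \bar R := limn_esup (fun n => (u n x)%:E).
have u0 n x : 0 <= u n x.
  by rewrite uE; apply: II_ge0 => z; apply: mulr_ge0 (kk_ge0 _ _ _) (f0 _).
have E0 x : (0 <= E x)%E.
  have : (limn_esup (fun _ : nat => 0%E) <= E x)%E by apply: limn_esup_mono => n; rewrite lee_fin.
  have c : (fun _ : nat => (0 : R)%:E) @ \oo --> (0 : R)%:E by apply: EFin_cvg; exact: sqC.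
  rewrite is_cvg_limn_esupE; last by apply/cvg_ex; exists 0%:E.
  by rewrite (cvg_lim _ c).
have Emono (x y : P) : x != o -> y != o -> enorm x <= enorm y -> (E y <= E x)%E.
  by move=> _ y0 xy; apply: limn_esup_mono => n; rewrite lee_fin uE; exact: TT_decr_le.
have Elim (x : P) l : u ^~ x @ \oo --> l -> E x = l%:E.
  move=> h; have c := EFin_cvg h; rewrite /E is_cvg_limn_esupE; first exact/cvg_lim.
  by apply/cvg_ex; exists l%:E.
have Efin (x : P) : x != o -> E x \is a fin_num.
  move=> x0; have ex : 0 < enorm x.
    rewrite lt_def enorm_ge0 andbT; apply: contra x0 => /eqP z.
    have : x.1 ^+ 2 + x.2 ^+ 2 = 0 by rewrite -enorm_sqr z expr0n.
    move=> z'; have z1 : x.1 == 0 by rewrite -sqrf_eq0 eq_le sqr_ge0 andbT -z' lerDl sqr_ge0.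
    have z2 : x.2 == 0 by rewrite -sqrf_eq0 eq_le sqr_ge0 andbT -z' lerDr sqr_ge0.
    by case: (x) z1 z2 => a b /= /eqP -> /eqP ->.
  have [y [hy y0 yx]] := ae_point ex gae.
  rewrite ge0_fin_numE//; apply: le_lt_trans (Emono _ _ y0 x0 (ltW yx)) _.
  by rewrite (Elim _ _ hy) ltry.
exists (fun x => fine (E x)); split.
- apply: measurableT_comp; first exact: fine_measurable.
  apply: measurable_fun_limn_esup => n; apply/measurable_EFinP; exact: (uL n).1.
- by apply: filterS2 gae gf => x h /eqP; rewrite subr_eq0 => /eqP e; rewrite (Elim _ _ h) e.
- by move=> x; exact: fine_ge0.
- by move=> x y x0 y0 xy; apply: fine_le; [exact: Efin|exact: Efin|exact: Emono].
Qed.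

End radial_profile.

(** The algebra behind [first_order], where [s2], [sp], [i] and [M] stand for s^2, s^p, 1/p and om
    m. *)
Lemma energy_increment (R : realFieldType) (s2 sp q B M A a e C b i : R) :
  s2 * q + M <= s2 * (A + 2 * a * e + C * e ^+ 2) -> sp * (A + e * b) * i <= sp * B * i ->
  A * (s2 / 2 - sp * i) <= A * (2^-1 - i) -> (A - M) / 2 - A * i <= s2 * q / 2 - sp * B * i ->
  sp * (e * b) * i <= s2 * (a * e + C * e ^+ 2 / 2).
Proof. by move=> h1 h2 h3 h4; lra. Qed.

(** * Ground states *)

Section minimizers.
Context {R : realType}.
Local Notation P := (mplane R).
Local Notation mu := (leb2 R).
Local Notation G a := (@Ga R a 0).
Let o : P := (0, 0).
Variables (al p m om A0 : R).
Hypotheses (p2 : 2 < p) (p4 : p < 4) (m0 : 0 < m) (A00 : 0 < A0) (om0 : 0 < om).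

Definition real_bound (E0 : R) := forall lam v c q, 0 < lam -> QF al lam v c q -> nrm2 mu v = m ->
  E0 <= q / 2 - pB p v / p.

Hypothesis ground : real_bound ((A0 - om * m) / 2 - A0 / p).

Lemma mass_gt0 (v : P -> R) : L2 mu v -> 0 < pB p v -> 0 < nrm2 mu v.
Proof.
move=> vL B; rewrite lt_def nrm2_ge0 andbT; apply/negP => /eqP z.
have mz : mf (fun _ : P => 0 : R) by exact: measurable_cst.
move: B; rewrite (pB_ae p vL.1 mz (nrm2_eq0 vL z)).
have -> : pB p (fun _ : P => 0 : R) = 0; last by rewrite ltxx.
rewrite /pB -[RHS](II0 mu); congr (II mu); apply/funext => x; rewrite normr0 powR0// gt_eqF//.
exact: lt_trans p2.
Qed.

Lemma optimal_state lam v c q : 0 < lam -> QF al lam v c q -> q + om * nrm2 mu v <= A0 -> A0 <= pB p v ->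
  [/\ nrm2 mu v = m, q + om * nrm2 mu v = A0 & pB p v = A0].
Proof.
move=> l0 h qA AB; have vL := QF_L2 l0 h; have v0 := mass_gt0 vL (lt_le_trans A00 AB).
have [s [s0 sm _ eq]] := scaled_energy p2 m0 A00 l0 h v0 qA AB; apply: eq.
by apply: ground l0 (QF_scale s l0 h) _; rewrite (nrm2Z s vL).
Qed.

Lemma state_at (f : P -> R) c N lam : 0 < lam -> HN f N -> exists q, QF al lam (fun x => f x + c * G lam x) c q /\
  q = N + lam * (nrm2 mu f - nrm2 mu (fun x => f x + c * G lam x)) + (al + theta lam) * c ^+ 2.
Proof.
move=> l0 h; have e : (fun x => f x + c * G lam x - c * G lam x) = f by apply/funext => x; rewrite addrK.
by eexists; split; [exists N; rewrite e; split; [exact: h|]|].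
Qed.

Lemma ground_polarized f N c : HN f N -> (forall x, 0 <= f x) -> 0 < c ->
  N + om * nrm2 mu f + (al + theta om) * c ^+ 2 = A0 -> pB p (fun x => f x + c * G om x) = A0 ->
  polarized f.
Proof.
move=> h f0 c0 AE BE n1 n2 k u k0; have [M hM MN] := HN_pol k u h; have fL := HN_L2 h.
have [pL pn] := pol_L2 k u fL.
have [q [hq qE]] := state_at c om0 hM.
have igs g K : HN g K -> ig mu (fun x => `|g x + c * G om x| `^ p).
  move=> hg; have [K1 hK] := pB_coercive p2 p4 om0 (nrm2_ge0 mu (fun x => g x + c * G om x)) (@ltr01 R).
  by have [] := hK _ _ c hg (lexx _).
have H0 x : 0 <= c * G om x by apply: mulr_ge0 (ltW c0) (Ga_ge0 _ _ _).
have aeH : {ae mu, forall x : P, side n1 n2 k x < 0 -> c * G om (refl n1 n2 k x) < c * G om x}.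
  apply: filterS ae_nonzero => x xo s; rewrite (ltr_pM2l c0).
  exact: Ga_decr om0 xo (enorm_refl u k0 s).
have [le eq] := pol_power u p2 f0 H0 aeH (igs _ _ h) (igs _ _ hM).
have AB : A0 <= pB p (fun x => pol n1 n2 k f x + c * G om x) by rewrite -BE.
have qA : q + om * nrm2 mu (fun x => pol n1 n2 k f x + c * G om x) <= A0.
  rewrite qE pn -AE; move: (nrm2 _ _) (nrm2 _ _) => a b; rewrite mulrBr.
  have -> : M + (om * b - om * a) + (al + theta om) * c ^+ 2 + om * a = M + om * b + (al + theta om) * c ^+ 2 by ring.
  by rewrite !lerD2r.
have [_ _ B'] := optimal_state om0 hq qA AB.
by apply: eq; rewrite B' BE.
Qed.

(** One-sided expansions suffice: if the action grows by at most 2 a e + O(e^2) and the power by at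
    least b e, minimality after rescaling to mass m gives a - b/p >= 0. *)
Lemma first_order lam (v w : P -> R) (c q : R -> R) (a b C : R) : 0 < lam -> L2 mu v -> L2 mu w ->
  nrm2 mu v = m -> 0 <= b -> 0 <= C ->
  (forall e, 0 < e <= 1 -> [/\ QF al lam (fun x => v x + e * w x) (c e) (q e),
     q e + om * nrm2 mu (fun x => v x + e * w x) <= A0 + 2 * a * e + C * e ^+ 2 &
     A0 + e * b <= pB p (fun x => v x + e * w x)]) -> b <= p * a.
Proof.
move=> l0 vL wL vm b0 C0 H; have p0 : 0 < p by exact: lt_trans p2.
pose D := 2 * `|ip mu v w| + nrm2 mu w.
have D0 : 0 <= D by rewrite addr_ge0 ?mulr_ge0// nrm2_ge0.
have key e : 0 < e <= 1 -> b * m <= p * (a + C * e / 2) * (m + D * e).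
  move=> /andP[e0 e1]; have [hq qA AB] := H e (introT andP (conj e0 e1)).
  have zL := QF_L2 l0 hq; set z := (fun x => v x + e * w x) in hq qA AB zL.
  have B0 : 0 < pB p z by apply: lt_le_trans AB; rewrite ltr_pwDl// mulr_ge0// ltW.
  have z0 := mass_gt0 zL B0.
  have zm : nrm2 mu z <= m + D * e.
    rewrite /z (nrm2_lin e vL wL) vm /D.
    have i1 : e * ip mu v w <= e * `|ip mu v w| by rewrite ler_pM2l// ler_norm.
    have i2 : e ^+ 2 * nrm2 mu w <= e * nrm2 mu w by apply: ler_wpM2r; [exact: nrm2_ge0|rewrite expr2 ger_pMl].
    by move: i1 i2; rewrite mulrDl; move: (ip _ _ _) (nrm2 _ _) (e ^+ 2 * _) => i n y i1 i2; lra.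
  pose s := Num.sqrt (m / nrm2 mu z).
  have s2 : s ^+ 2 = m / nrm2 mu z by rewrite sqr_sqrtr// divr_ge0// ltW.
  have s0 : 0 < s by rewrite sqrtr_gt0 divr_gt0.
  have sm : s ^+ 2 * nrm2 mu z = m by rewrite s2 divfK// gt_eqF.
  have le := ground l0 (QF_scale s l0 hq) (etrans (nrm2Z s zL) sm).
  rewrite (pBZ p zL.1 (ltW s0)) in le.
  have [mx _] := scaling_max p2 s0.
  have sq0 : 0 < s ^+ 2 by exact: exprn_gt0.
  have sp0 : 0 < s `^ p by exact: powR_gt0.
  have ip0 : 0 < p^-1 by rewrite invr_gt0.
  have h1 := ler_wpM2l (ltW sq0) qA; have h2 := ler_wpM2r (ltW ip0) (ler_wpM2l (ltW sp0) AB).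
  have h3 := ler_wpM2l (ltW A00) mx.
  have h4 : s `^ p * (e * b) / p <= s ^+ 2 * (a * e + C * e ^+ 2 / 2).
    have e5 : s ^+ 2 * (q e + om * nrm2 mu z) = s ^+ 2 * q e + om * m by rewrite -sm; ring.
    rewrite e5 in h1; exact: energy_increment h1 h2 h3 le.
  have h5 : s `^ (p - 2) * b <= p * (a + C * e / 2).
    have e6 : s `^ p = s `^ (p - 2) * s ^+ 2 by exact: powR_sub2 (ltW s0) p2.
    rewrite e6 in h4; rewrite -(ler_pM2l (mulr_gt0 sq0 (mulr_gt0 e0 ip0))).
    have -> : s ^+ 2 * (e / p) * (s `^ (p - 2) * b) = s `^ (p - 2) * s ^+ 2 * (e * b) / p by ring.
    have -> : s ^+ 2 * (e / p) * (p * (a + C * e / 2)) = s ^+ 2 * (a * e + C * e ^+ 2 / 2) by field; rewrite gt_eqF.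
    exact: h4.
  have w0 : 0 < m + D * e by rewrite ltr_pwDl// mulr_ge0// ltW.
  (* Since 0 <= p - 2 <= 2, s^(p - 2) is at least 1 or at least s^2, according to whether s >= 1. *)
  have h6 : m / (m + D * e) <= s `^ (p - 2).
    have [s1|s1] := leP 1 s.
      apply: (@le_trans _ _ 1); first by rewrite ler_pdivrMr// mul1r lerDl mulr_ge0// ltW.
      by have := ler_powR s1 (_ : 0 <= p - 2); rewrite powRr0; apply; rewrite subr_ge0 ltW.
    apply: (@le_trans _ _ (s ^+ 2)).
      by rewrite s2; apply: ler_wpM2l; [exact: ltW|rewrite lef_pV2].
    rewrite -(powR_mulrn 2 (ltW s0)); apply: ger_powR; first by rewrite s0 ltW.
    by rewrite lerBlDr; apply: ltW; apply: lt_le_trans p4 _; rewrite -natrD.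
  have h7 := le_trans (ler_wpM2r b0 h6) h5.
  by move: h7; rewrite mulrAC ler_pdivrMr// [m * b]mulrC.
rewrite leNgt; apply/negP => gap; have g0 : 0 < (b - p * a) * m by rewrite mulr_gt0// subr_gt0.
pose K := p * (`|a| * D + C * m / 2 + C * D / 2).
have K0 : 0 <= K by rewrite mulr_ge0 ?(ltW p0)// !addr_ge0 ?divr_ge0 ?mulr_ge0// ltW.
(* K collects the terms of order e in [key]; with this e they are at most half of the assumed
   gap. *)
pose e := Num.min 1 ((b - p * a) * m / (2 * (1 + K))).
have k1 : 0 < 2 * (1 + K) by rewrite mulr_gt0// ltr_pwDl.
have e0 : 0 < e by rewrite lt_min ltr01 divr_gt0.
have e1 : e <= 1 by rewrite ge_min lexx.
have eK : e * K <= (b - p * a) * m / 2.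
  apply: (@le_trans _ _ ((b - p * a) * m / (2 * (1 + K)) * K)).
    by apply: ler_wpM2r => //; rewrite ge_min lexx orbT.
  exact: half_ratio K0 (ltW g0).
have := key e (introT andP (conj e0 e1)).
have : p * (a + C * e / 2) * (m + D * e) <= p * a * m + e * K.
  rewrite /K.
  have -> : p * a * m + e * (p * (`|a| * D + C * m / 2 + C * D / 2)) =
    p * (a * m + e * (`|a| * D) + e * (C * m / 2) + e * (C * D / 2)) by ring.
  rewrite -mulrA ler_pM2l//.
  have -> : (a + C * e / 2) * (m + D * e) = a * m + e * (a * D) + e * (C * m / 2) + e ^+ 2 * (C * D / 2) by ring.
  apply: lerD.
    by rewrite lerD2r lerD2l ler_pM2l//; apply: ler_wpM2r => //; exact: ler_norm.
  apply: ler_wpM2r; first by rewrite divr_ge0 ?mulr_ge0.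
  by rewrite expr2 ger_pMl.
move: eK g0; rewrite mulrBl; move: (b * m) (p * a * m) (e * K) (p * _ * _) => x y z t; lra.
Qed.

(** The elementary bound (a + b)^p >= a^p + a^(p - 1) b, without the factor p, is enough since only
    the order of magnitude matters. *)
Lemma power_increment (v w : P -> R) : mf v -> mf w -> (forall x, 0 <= v x) -> (forall x, 0 <= w x) ->
  ig mu (fun x => `|v x + 1 * w x| `^ p) -> ig mu (fun x => v x `^ (p - 1) * w x) /\
  forall e, 0 < e <= 1 -> pB p v + e * II mu (fun x => v x `^ (p - 1) * w x) <= pB p (fun x => v x + e * w x).
Proof.
move=> mv mw v0 w0 i; have p0 : 0 < p by exact: lt_trans p2.
have inc (a b : R) : 0 <= a -> 0 <= b -> a `^ p + a `^ (p - 1) * b <= (a + b) `^ p.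
  move=> a0 b0; have ab := addr_ge0 a0 b0.
  rewrite -(mulr_powRB1 a0 p0) -(mulr_powRB1 ab p0) [a * _]mulrC -mulrDr mulrC.
  apply: ler_wpM2l => //; apply: powR_mono => //; last by rewrite lerDl.
  by rewrite subr_ge0 ltW// (lt_trans _ p2)// ltr1n.
have mm : mf (fun x => v x `^ (p - 1) * w x).
  apply: measurable_funM => //; have -> : (fun x => v x `^ (p - 1)) = fun x => `|v x| `^ (p - 1).
    by apply/funext => x; rewrite ger0_norm.
  exact: mpowR.
have i1 : ig mu (fun x => v x `^ (p - 1) * w x).
  apply: ig_le mm _ i => x; rewrite ger0_norm; last by apply: mulr_ge0 (powR_ge0 _ _) (w0 x).
  rewrite mul1r (ger0_norm (addr_ge0 (v0 x) (w0 x))); apply: le_trans (inc _ _ (v0 x) (w0 x)).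
  by rewrite lerDr powR_ge0.
split=> // e /andP[e0 e1].
have wle (x : P) (t : R) : 0 <= t <= 1 -> `|v x + t * w x| <= `|v x + 1 * w x|.
  move=> /andP[t0 t1]; have tw := mulr_ge0 t0 (w0 x).
  rewrite (ger0_norm (addr_ge0 (v0 x) tw)) mul1r (ger0_norm (addr_ge0 (v0 x) (w0 x))) lerD2l.
  by rewrite ler_piMl.
have ie : ig mu (fun x => `|v x + e * w x| `^ p).
  apply: ig_powR_le p2 _ _ i; first by apply: measurable_funD => //; exact: measurable_funM.
  by move=> x; apply: wle; rewrite (ltW e0).
have iv : ig mu (fun x => `|v x| `^ p).
  apply: ig_powR_le p2 mv _ i => x; have := wle x 0; rewrite mul0r addr0; apply.
  by rewrite lexx ler01.
rewrite /pB -(IIZ e i1) -(IID iv (igZ e i1)); apply: II_le ie _ => [|x].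
  exact: igD iv (igZ e i1).
have ew := mulr_ge0 (ltW e0) (w0 x).
rewrite (ger0_norm (v0 x)) (ger0_norm (addr_ge0 (v0 x) ew)) mulrCA; exact: inc.
Qed.

(** Adding e G at the frequency om changes the action only at order e^2, because regular part and
    charge are decoupled there, while the power gains e times the integral of f^(p - 1) G. This
    integral must vanish, and so must f since G > 0. *)
Lemma charge_neq0 f N : HN f N -> (forall x, 0 <= f x) -> nrm2 mu f = m -> N + om * m = A0 ->
  pB p f = A0 -> False.
Proof.
move=> h f0 fm AE BE; have fL := HN_L2 h; have GL := L2_Ga om0 (lexx 0).
have G0 x : 0 <= G om x by exact: Ga_ge0.
have ige e : ig mu (fun x => `|f x + e * G om x| `^ p).
  have [K1 hK] := pB_coercive p2 p4 om0 (nrm2_ge0 mu (fun x => f x + e * G om x)) (@ltr01 R).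
  by have [] := hK _ _ e h (lexx _).
have [i1 inc] := power_increment fL.1 GL.1 f0 G0 (ige 1).
pose b := II mu (fun x => f x `^ (p - 1) * G om x).
have pp x : 0 <= f x `^ (p - 1) * G om x by apply: mulr_ge0 (powR_ge0 _ _) (G0 x).
have b0 : 0 <= b by exact: II_ge0.
have bpos : b <= p * 0.
  pose q e := N + om * (nrm2 mu f - nrm2 mu (fun x => f x + e * G om x)) + (al + theta om) * e ^+ 2.
  apply: (@first_order om f (G om) id q 0 b `|al + theta om| om0 fL GL fm b0 (normr_ge0 _)) => e e01.
  split.
  - by have [q' [hq qE]] := state_at e om0 h; rewrite /q -qE.
  - have := ler_wpM2r (sqr_ge0 e) (ler_norm (al + theta om)).
    rewrite /q fm -AE mulr0 mul0r addr0; move: (nrm2 _ _) (_ * e ^+ 2) (_ * e ^+ 2) => x y z; rewrite mulrBr; lra.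
  by rewrite -BE; exact: inc.
rewrite mulr0 in bpos; have bz : b = 0 by apply/eqP; rewrite eq_le bpos b0.
have ae := II_eq0 i1 pp bz.
have f00 : {ae mu, forall x : P, f x = 0}.
  apply: filterS2 ae ae_nonzero => x /eqP; rewrite mulf_eq0 => /orP[/eqP/powR_eq0_eq0//|/eqP z xo].
  by have := Ga_gt0 om0 xo; rewrite z ltxx.
have mz : mf (fun _ : P => 0 : R) by exact: measurable_cst.
have : nrm2 mu f = 0.
  by rewrite (ae_nrm2 fL.1 mz f00) /nrm2 -[RHS](II0 mu); congr (II mu); apply/funext => x; rewrite expr0n.
by rewrite fm => z; have := m0; rewrite z ltxx.
Qed.

(** The positive part of a Gaussian minus its value at squared distance d; truncation is a
    contraction, hence preserves H^1. *)
Lemma truncation (d : R) : 0 < d -> exists psi M, [/\ HN psi M, forall x : P, 0 <= psi x,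
  forall x : P, psi x != 0 -> d2 o x <= d & forall x : P, d2 o x < d -> 0 < psi x].
Proof.
move=> d0; pose kap := (4 * pi * 1)^-1 * expR (- d / (4 * 1)) : R.
have [N hN _] := HN_kk (@ltr01 R); have kL := L2_kk o (@ltr01 R).
pose psi (x : P) : R := Num.max 0 (kk 1 o x - kap).
have psi0 x : 0 <= psi x by rewrite le_max lexx.
have kap0 : 0 <= kap by rewrite mulr_ge0 ?expR_ge0// invr_ge0 !mulr_ge0 ?pi_ge0.
have mpsi : mf psi.
  apply: measurable_maxr; first exact: measurable_cst.
  by apply: measurable_funB; [exact: mkk1|exact: measurable_cst].
have pL : L2 mu psi.
  apply: L2_le mpsi _ kL => x; rewrite (ger0_norm (psi0 x)) (ger0_norm (kk_ge0 _ _ _)).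
  by rewrite /psi ge_max kk_ge0 gerBl.
have lip x y : (psi x - psi y) ^+ 2 <= (kk 1 o x - kk 1 o y) ^+ 2 + (0 - 0) ^+ 2.
  rewrite subrr expr0n addr0 /psi; move: (kk 1 o x) (kk 1 o y) (kap) => a b k.
  rewrite -(real_normK (num_real (_ - _))) -[leRHS](real_normK (num_real (_ - _))).
  rewrite ler_pXn2r ?nnegrE//.
  have [h1|h1] := leP 0 (a - k); have [h2|h2] := leP 0 (b - k).
  - by rewrite opprB addrA subrK.
  - by rewrite subr0 ger0_norm// ger0_norm; lra.
  - have ab : a - b <= 0 by lra.
    by rewrite sub0r normrN (ger0_norm h2) (ler0_norm ab); lra.
  - by rewrite subrr normr0.
have [M hM _] := HN_contraction pL hN (@HN0 R) lip.
have c0 : 0 < (4 * pi * 1)^-1 :> R by rewrite invr_gt0 !mulr_gt0 ?pi_gt0.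
have cmp x : (kap < kk 1 o x) = (d2 o x < d).
  by rewrite /kap kkE// ltr_pM2l// ltr_expR !mulNr ltrN2 ltr_pM2r ?invr_gt0 ?mulr_gt0.
exists psi, M; split=> // x.
  by rewrite leNgt; apply: contra => h; rewrite /psi max_l// subr_le0 leNgt cmp -leNgt ltW.
by rewrite -cmp => h; rewrite lt_max subr_gt0 h orbT.
Qed.

(** A perturbation e psi changes the action of c G at first order by a multiple of (psi, G), and the
    power by at least the integral of (c G)^(p - 1) psi. For psi supported where c G is large the
    latter exceeds any given multiple of (psi, G). *)
Lemma regular_neq0 lam c : 0 < lam -> 0 < c -> c ^+ 2 * nrm2 mu (G lam) = m ->
  - lam * m + (al + theta lam) * c ^+ 2 + om * m = A0 -> pB p (fun x => c * G lam x) = A0 -> False.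
Proof.
move=> l0 c0 vm AE BE; have GL := L2_Ga l0 (lexx 0); have G0 x : 0 <= G lam x by exact: Ga_ge0.
have cG0 x : 0 <= c * G lam x by apply: mulr_ge0 (ltW c0) (G0 x).
(* Anything above p |om - lam| contradicts [first_order]; psi is supported where (c G)^(p - 2) >=
   L. *)
pose L := p * `|om - lam| + 1; have pos : 0 < p by exact: lt_trans p2.
have L0 : 0 < L by rewrite ltr_wpDl// mulr_ge0// ltW.
have q0 : 0 < p - 2 by rewrite subr_gt0.
have [d d0 Gd] := Ga_unbounded (L `^ (p - 2)^-1 / c) l0.
have [psi [M [hM psi0 supp ins]]] := truncation d0.
have pL := HN_L2 hM; have vL := L2Z c GL; have M0 := HN_ge0 hM.
have st e : HN (fun x => e * psi x) (e ^+ 2 * M) := HNZ e hM.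
have swap e : (fun x => c * G lam x + e * psi x) = (fun x => e * psi x + c * G lam x).
  by apply/funext => x; rewrite addrC.
have i : ig mu (fun x => `|c * G lam x + 1 * psi x| `^ p).
  have [K1 hK] := pB_coercive p2 p4 l0 (nrm2_ge0 mu (fun x => 1 * psi x + c * G lam x)) (@ltr01 R).
  have [j _] := hK _ _ c (st 1) (lexx _).
  by move: j; congr (ig mu _); apply/funext => x; rewrite addrC.
have [i1 inc] := power_increment vL.1 pL.1 cG0 psi0 i.
pose b := II mu (fun x => (c * G lam x) `^ (p - 1) * psi x).
pose a := (om - lam) * (c * ip mu psi (G lam)).
have b0 : 0 <= b by apply: II_ge0 => x; apply: mulr_ge0 (powR_ge0 _ _) (psi0 x).
have C0 : 0 <= M + om * nrm2 mu psi by apply: addr_ge0 => //; apply: mulr_ge0 (ltW om0) (nrm2_ge0 _ _).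
have ba : b <= p * a.
  pose q e := e ^+ 2 * M + lam * (nrm2 mu (fun x => e * psi x) - nrm2 mu (fun x => e * psi x + c * G lam x)) + (al + theta lam) * c ^+ 2.
  apply: (@first_order lam _ psi (fun=> c) q a b _ l0 vL pL (etrans (nrm2Z c GL) vm) b0 C0) => e e01.
  split.
  - by rewrite swap; have [q' [hq qE]] := state_at c l0 (st e); rewrite /q -qE.
  - rewrite swap /q (nrm2_lin c (L2Z e pL) GL) (nrm2Z e pL) vm (ipZl e pL GL) /a -AE.
    by move: (nrm2 mu psi) (ip mu psi _) (theta lam) => n j th; rewrite le_eqVlt; apply/orP; left; apply/eqP; ring.
  by rewrite -BE; exact: inc.
have igp : ig mu (fun x => psi x * G lam x) by exact: L2_mul.
have ipos : 0 < ip mu psi (G lam).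
  rewrite lt_def; have n0 : 0 <= ip mu psi (G lam) by apply: II_ge0 => x; apply: mulr_ge0.
  rewrite n0 andbT; apply/negP => /eqP z.
  have ae := II_eq0 igp (fun x => mulr_ge0 (psi0 x) (G0 x)) z.
  have sd : 0 < Num.sqrt d by rewrite sqrtr_gt0.
  have [x [hx xo xd]] := ae_point sd ae.
  have dx : d2 o x < d.
    have -> : d2 o x = enorm x ^+ 2 by rewrite enorm_sqr /d2 /= !sub0r !sqrrN.
    by rewrite -(sqr_sqrtr (ltW d0)) ltr_pXn2r ?nnegrE ?sqrtr_ge0.
  have := mulr_gt0 (ins x dx) (Ga_gt0 l0 xo); by rewrite hx ltxx.
have bge : L * (c * ip mu psi (G lam)) <= b.
  rewrite mulrA -(IIZ (L * c) igp); apply: (@le_trans _ _ (II mu (fun x => (c * G lam x) `^ (p - 1) * psi x))) => //.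
  have mz : mf (fun x => Num.min (L * c * (psi x * G lam x)) ((c * G lam x) `^ (p - 1) * psi x)).
    by apply: measurable_minr; [exact: ig_mf (igZ _ igp)|exact: ig_mf i1].
  have eae : {ae mu, forall x : P, L * c * (psi x * G lam x) = Num.min (L * c * (psi x * G lam x)) ((c * G lam x) `^ (p - 1) * psi x)}.
    apply: filterS ae_nonzero => x xo; rewrite min_l//.
    have [->|pn] := eqVneq (psi x) 0; first by rewrite mul0r !mulr0.
    have K := Gd x xo (supp x pn).
    have cK : L `^ (p - 2)^-1 <= c * G lam x by rewrite mulrC -ler_pdivrMr.
    have Lp : L <= (c * G lam x) `^ (p - 2).
      have := powR_mono (ltW q0) (powR_ge0 _ _) cK.
      by rewrite -powRrM mulVf ?gt_eqF// powRr1// ltW.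
    rewrite [psi x * _]mulrC mulrA; apply: ler_wpM2r => //.
    have gp : 0 < c * G lam x by rewrite mulr_gt0// Ga_gt0.
    have -> : (c * G lam x) `^ (p - 1) = (c * G lam x) `^ (p - 2) * (c * G lam x).
      rewrite -{3}(powRr1 (ltW gp)) -powRD ?(gt_eqF gp) ?implybT//; congr (_ `^ _); ring.
    by rewrite -mulrA; apply: ler_wpM2r => //; exact: ltW.
  rewrite (ae_II (ig_mf (igZ _ igp)) mz eae); apply: II_le => //.
    by apply: (ae_ig (ig_mf (igZ _ igp)) mz eae); exact: igZ.
  by move=> x; rewrite ge_min lexx orbT.
have X0 : 0 < c * ip mu psi (G lam) by rewrite mulr_gt0.
have : p * a <= p * `|om - lam| * (c * ip mu psi (G lam)).
  by rewrite /a mulrA ler_pM2r// ler_pM2l// ler_norm.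
move: ba bge; rewrite /L mulrDl mul1r; move: (p * a) (p * _ * _) X0 => x y; move: (c * _) => z; lra.
Qed.

End minimizers.

(** Equality in the triangle inequality for phi + q G with G > 0: the scalar product of phi and q is
    the product of their moduli, so their cross product vanishes and phi has the phase of q. *)
Lemma phase_alignment (R : realFieldType) (a b c1 c2 F g c : R) :
  (F + c * g) ^+ 2 = a ^+ 2 + b ^+ 2 -> F ^+ 2 = (a - c1 * g) ^+ 2 + (b - c2 * g) ^+ 2 ->
  c ^+ 2 = c1 ^+ 2 + c2 ^+ 2 -> 0 < c -> 0 < g ->
  a = c1 / c * (F + c * g) /\ b = c2 / c * (F + c * g).
Proof.
move=> ms fs cc c0 g0; have cn := lt0r_neq0 c0.
have dot : (a - c1 * g) * c1 + (b - c2 * g) * c2 = F * c.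
  apply: (mulfI (lt0r_neq0 (mulr_gt0 (ltr0Sn R 1) g0))).
  have -> : 2 * g * ((a - c1 * g) * c1 + (b - c2 * g) * c2) =
    a ^+ 2 + b ^+ 2 - ((a - c1 * g) ^+ 2 + (b - c2 * g) ^+ 2) - (c1 ^+ 2 + c2 ^+ 2) * g ^+ 2 by ring.
  by rewrite -ms -fs -cc; ring.
have cr : (a - c1 * g) * c2 - (b - c2 * g) * c1 = 0.
  apply/eqP; rewrite -sqrf_eq0.
  have -> : ((a - c1 * g) * c2 - (b - c2 * g) * c1) ^+ 2 = ((a - c1 * g) ^+ 2 + (b - c2 * g) ^+ 2) * (c1 ^+ 2 + c2 ^+ 2)
    - ((a - c1 * g) * c1 + (b - c2 * g) * c2) ^+ 2 by ring.
  by rewrite dot -fs -cc exprMn subrr.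
have ha : (a - c1 * g) * c ^+ 2 = F * c * c1.
  by rewrite cc -dot; transitivity ((a - c1 * g) * (c1 ^+ 2 + c2 ^+ 2) - c2 * ((a - c1 * g) * c2 - (b - c2 * g) * c1)); [rewrite cr; ring|ring].
have hb : (b - c2 * g) * c ^+ 2 = F * c * c2.
  by rewrite cc -dot; transitivity ((b - c2 * g) * (c1 ^+ 2 + c2 ^+ 2) + c1 * ((a - c1 * g) * c2 - (b - c2 * g) * c1)); [rewrite cr; ring|ring].
split.
  apply: (mulIf (expf_neq0 2 cn)); have -> : a * c ^+ 2 = (a - c1 * g) * c ^+ 2 + c1 * g * c ^+ 2 by ring.
  by rewrite ha; field; rewrite cn.
apply: (mulIf (expf_neq0 2 cn)); have -> : b * c ^+ 2 = (b - c2 * g) * c ^+ 2 + c2 * g * c ^+ 2 by ring.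
by rewrite hb; field; rewrite cn.
Qed.

(** * Ground states among complex functions *)

Section ground_states.
Context {R : realType}.
Local Notation P := (mplane R).
Local Notation mu := (leb2 R).
Local Notation G a := (@Ga R a 0).
Variables (al p m : R).
Hypotheses (p2 : 2 < p) (p4 : p < 4) (m0 : 0 < m).

Lemma energy_states u c1 q1 c2 q2 : states al u c1 q1 c2 q2 ->
  energy al p u = (q1 + q2) / 2 - pB p (modulus u) / p.
Proof.
move=> h; have [_ _ qE] := states_form h; have pos : 0 < p by exact: lt_trans p2.
by rewrite /energy qE Lp_norm_powR// mulrC [p^-1 * _]mulrC.
Qed.

Lemma modulus_real (v : P -> R) : modulus (cpx v (fun=> 0)) = fun x => `|v x|.
Proof. by apply/funext => x; rewrite modulusE /re /im /= expr0n addr0 sqrtr_sqr. Qed.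

Lemma pB_modulus_real (v : P -> R) : pB p (modulus (cpx v (fun=> 0))) = pB p v.
Proof. by rewrite modulus_real; apply: pB_abs => x; rewrite normr_id. Qed.

Lemma real_competitor lam (v : P -> R) c q : 0 < lam -> QF al lam v c q -> nrm2 mu v = m ->
  mass_constraint m (cpx v (fun=> 0)) /\ energy al p (cpx v (fun=> 0)) = q / 2 - pB p v / p.
Proof.
move=> l0 h vm; have st := real_states l0 h; have [es _ _] := states_form st.
have z : nrm2 mu (fun _ : P => 0 : R) = 0.
  by rewrite /nrm2 -[RHS](II0 mu); congr (II mu); apply/funext => x; rewrite expr0n.
split; first by split=> //; rewrite (states_mass st) z addr0.
by rewrite (energy_states st) addr0 pB_modulus_real.
Qed.

Lemma ground_real_bound u : ground_state al p m u -> real_bound al p m (energy al p u).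
Proof.
move=> [_ gl] lam v c q l0 h vm; have [mc e] := real_competitor l0 h vm.
by rewrite -lee_fin gl -e; apply: ereal_inf_lbound; exists (cpx v (fun=> 0)).
Qed.

Lemma ig_modulus u c1 q1 c2 q2 : states al u c1 q1 c2 q2 -> ig mu (fun x => `|modulus u x| `^ p).
Proof.
move=> [mu_ h1 h2]; have i1 := ig_powR_state p2 p4 h1; have i2 := ig_powR_state p2 p4 h2.
have [C C0 hC] := powR_split p2 p4 (@ltr01 R).
apply: ig_le (igD (igZ (1 + 1) i1) (igZ C i2)); first exact: mpowR (mmodulus mu_).
move=> x; rewrite (ger0_norm (powR_ge0 _ _)).
have := hC `|re u x| `|im u x|; rewrite !normr_id; apply: le_trans; apply: powR_mono => //.
  by apply: ltW; exact: lt_trans p2.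
rewrite (ger0_norm (modulus_ge0 _ _)) ger0_norm ?addr_ge0//.
rewrite -ler_sqr ?nnegrE ?addr_ge0 ?modulus_ge0// modulus_sqr sqrrD !real_normK ?num_real//.
by rewrite -addrA lerD2l lerDr mulrn_wge0// mulr_ge0.
Qed.

(* At the frequency om = (B - Q) / m, the action Q + om m equals B. *)
Lemma negative_state u c1 q1 c2 q2 : states al u c1 q1 c2 q2 -> Lp_norm 2 u ^+ 2 = m -> energy al p u < 0 ->
  let B := pB p (modulus u) in let om := (B - (q1 + q2)) / m in
  [/\ 0 < B, 0 < om, q1 + q2 + om * m = B & energy al p u = (B - om * m) / 2 - B / p].
Proof.
move=> st um neg B om; have pos : 0 < p by exact: lt_trans p2.
have e := energy_states st; have iB := ig_modulus st.
have omm : om * m = B - (q1 + q2) by rewrite /om divfK// gt_eqF.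
have [mu_ h1 h2] := st; have vL1 := QF_L2 ltr01 h1; have vL2 := QF_L2 ltr01 h2.
have mL : L2 mu (modulus u) /\ nrm2 mu (modulus u) = m.
  have [a b] := md_L2 vL1 vL2; have -> : modulus u = md (re u) (im u) by apply/funext => x; exact: modulusE.
  by split=> //; rewrite b -(states_mass st).
have B0 : 0 < B by apply: pB_gt0 => //; [exact: mL.1|rewrite mL.2].
split=> //; last by rewrite e omm subKr.
  rewrite divr_gt0// subr_gt0; move: neg; rewrite e -/B subr_lt0 => lt.
  have : B / p < B / 2 by rewrite ltr_pM2l// ltf_pV2 ?posrE.
  by move=> /(lt_trans lt); rewrite ltr_pM2r ?invr_gt0.
by rewrite omm addrC subrK.
Qed.

(** [real_minimizer] compares with real functions only. A complex competitor of negative energy is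
    first replaced by its modulus state at its own frequency and rescaled to mass m; one of
    nonnegative energy is not better anyway. *)
Lemma existence : exists u, ground_state al p m u.
Proof.
have [lam [f [N [c [l0 hN vm neg low]]]]] := real_minimizer al p2 p4 m0.
have [q [hq qE]] := state_at al c l0 hN.
have EEq : EE al p lam f N c = q / 2 - pB p (VV lam f c) / p by rewrite /EE qE.
have [mc e] := real_competitor l0 hq vm.
exists (cpx (VV lam f c) (fun=> 0)); split=> //; apply/eqP; rewrite eq_le; apply/andP; split; last first.
  by apply: ereal_inf_lbound; exists (cpx (VV lam f c) (fun=> 0)).
apply: le_ereal_inf_tmp => _ [v [ve vm'] <-]; rewrite lee_fin e -EEq.
have [v0|v0] := leP 0 (energy al p v); first by apply: le_trans v0; exact: ltW.
have [c1 [q1 [c2 [q2 st]]]] := form_states al ve.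
have [B0 om0 AE ->] := negative_state st vm' v0.
move: ((pB p (modulus v) - (q1 + q2)) / m) om0 AE => om om0 AE.
have [mv h1 h2] := st.
have [N1 [hN1 _]] := QF_at om0 h1; have [N2 [hN2 _]] := QF_at om0 h2.
have [K [r [hK hr iw _ le]]] := modulus_state p2 p4 om0 st hN1 hN2.
move: hr iw le; set w := (fun x => _ + _ * _); rewrite -(states_mass st) vm' AE => hr iw le.
have mle x : `|modulus v x| <= `|w x|.
  by rewrite (ger0_norm (modulus_ge0 v x)); apply: le_trans (ler_norm _); exact: modulus_le om0.
have [Bw _] := pB_le p2 (mmodulus mv) mle iw.
have w0 := mass_gt0 p2 (QF_L2 om0 hr) (lt_le_trans B0 Bw).
have [s [s0 sm les _]] := scaled_energy p2 m0 B0 om0 hr w0 le Bw.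
apply: le_trans les; have hs := QF_scale s om0 hr.
have [K' [hK' rE]] := QF_change om0 l0 hs.
have V : VV lam (fun x => s * w x - s * Num.sqrt (c1 ^+ 2 + c2 ^+ 2) * G lam x) (s * Num.sqrt (c1 ^+ 2 + c2 ^+ 2)) = fun x => s * w x.
  by apply/funext => x; rewrite /VV subrK.
have := low _ _ (s * Num.sqrt (c1 ^+ 2 + c2 ^+ 2)) hK'; rewrite [X in _ <= X]/EE V -rE; apply.
by rewrite (nrm2Z s (QF_L2 om0 hr)).
Qed.

Variable u : plane R -> R[i].
Hypothesis gu : ground_state al p m u.

Lemma structure : exists c1 q1 c2 q2, let om := m^-1 * (Lp_norm p u `^ p - quad_form al u) in
  let c := Num.sqrt (c1 ^+ 2 + c2 ^+ 2) in
  [/\ states al u c1 q1 c2 q2, 0 < om, 0 < c,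
   forall lam, 0 < lam -> ~ ae_eq2 (regular_part lam u) (fun=> 0) &
   exists f : P -> R, [/\ forall x, 0 <= f x, polarized f, exists N, HN f N &
     {ae mu, forall x : P, re u x = c1 / c * (f x + c * G om x) /\ im u x = c2 / c * (f x + c * G om x)}]].
Proof.
have [[ue um] gl] := gu; have rb := ground_real_bound gu.
have [g [L [hL gm gneg]]] := negative_energy p2 p4 m0.
have neg : energy al p u < 0.
  by apply: le_lt_trans gneg; apply: rb ltr01 (QF_H1 al 1 hL) gm.
have [c1 [q1 [c2 [q2 st]]]] := form_states al ue; exists c1, q1, c2, q2.
have pos : 0 < p by exact: lt_trans p2.
have [_ dE quE] := states_form st.
have [B0 om0' AE' EE'] := negative_state st um neg.
have omE : m^-1 * (Lp_norm p u `^ p - quad_form al u) = (pB p (modulus u) - (q1 + q2)) / m.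
  by rewrite Lp_norm_powR// quE mulrC.
move=> om c; rewrite -omE -/om in om0' AE' EE'; move: om om0' AE' EE' {omE} => om om0 AE E0.
rewrite E0 in rb.
have [mv h1 h2] := st; have vL1 := QF_L2 ltr01 h1; have vL2 := QF_L2 ltr01 h2.
have [N1 [hN1 _]] := QF_at om0 h1; have [N2 [hN2 _]] := QF_at om0 h2.
have [K [r [hK hr iw rE le]]] := modulus_state p2 p4 om0 st hN1 hN2.
rewrite -/c in hr iw rE le.
pose f := md (fun x => re u x - c1 * G om x) (fun x => im u x - c2 * G om x).
rewrite -/f in hK hr iw rE le.
rewrite -(states_mass st) um AE in le.
have mle x : `|modulus u x| <= `|f x + c * G om x|.
  by rewrite (ger0_norm (modulus_ge0 u x)); apply: le_trans (ler_norm _); exact: modulus_le om0.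
have [Bw eqw] := pB_le p2 (mmodulus mv) mle iw.
(* The modulus state cannot improve on u, so every comparison is an equality; in particular |u| = f
   + c G almost everywhere. *)
have [wm wA wB] := optimal_state p2 m0 B0 rb om0 hr le Bw.
have aem := eqw (ltac:(by rewrite wB)).
have f0 x : 0 <= f x := md_ge0 _ _ x.
have AE2 : K + om * nrm2 mu f + (al + theta om) * c ^+ 2 = pB p (modulus u).
  rewrite -wA rE; move: (nrm2 mu f) (nrm2 mu _) => a b; ring.
have c0 : 0 < c.
  rewrite lt_def sqrtr_ge0 andbT; apply/negP => /eqP cz.
  have wf : (fun x => f x + c * G om x) = f by apply/funext => x; rewrite cz mul0r addr0.
  rewrite wf in wm wB; rewrite cz expr0n mulr0 addr0 wm in AE2.
  exact: (charge_neq0 p2 p4 m0 B0 om0 rb hK f0 wm AE2 wB).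
have cc : c ^+ 2 = c1 ^+ 2 + c2 ^+ 2 by rewrite sqr_sqrtr// addr_ge0 ?sqr_ge0.
have pf := ground_polarized p2 p4 m0 B0 om0 rb hK f0 c0 AE2 wB.
split=> //.
- move=> lam l0; rewrite /regular_part dE => z.
  have [m1 m2 a1 a2] := minus_green_ae c1 c2 l0 mv.
  have mz : mf (fun _ : P => 0 : R) by exact: measurable_cst.
  have z1 : {ae mu, forall x : P, re u x - c1 * G lam x = 0}.
    by apply: filterS2 a1 z => x -> e; rewrite /re e.
  have z2 : {ae mu, forall x : P, im u x - c2 * G lam x = 0}.
    by apply: filterS2 a2 z => x -> e; rewrite /im e.
  have [M1 [hM1 r1]] := QF_at l0 h1; have [M2 [hM2 r2]] := QF_at l0 h2.
  have GL := L2_Ga l0 (lexx 0).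
  have nz : nrm2 mu (fun _ : P => 0 : R) = 0.
    by rewrite /nrm2 -[RHS](II0 mu); congr (II mu); apply/funext => x; rewrite expr0n.
  have M10 : M1 = 0 := HN_unique (HN_ae mz z1 hM1) (@HN0 R).
  have M20 : M2 = 0 := HN_unique (HN_ae mz z2 hM2) (@HN0 R).
  rewrite (ae_nrm2 (HN_L2 hM1).1 mz z1) nz M10 in r1; rewrite (ae_nrm2 (HN_L2 hM2).1 mz z2) nz M20 in r2.
  have n1 : nrm2 mu (re u) = c1 ^+ 2 * nrm2 mu (G lam).
    rewrite -(nrm2Z c1 GL); apply: (ae_nrm2 vL1.1 (L2Z c1 GL).1).
    by apply: filterS z1 => x /eqP; rewrite subr_eq0 => /eqP.
  have n2 : nrm2 mu (im u) = c2 ^+ 2 * nrm2 mu (G lam).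
    rewrite -(nrm2Z c2 GL); apply: (ae_nrm2 vL2.1 (L2Z c2 GL).1).
    by apply: filterS z2 => x /eqP; rewrite subr_eq0 => /eqP.
  have tot : c ^+ 2 * nrm2 mu (G lam) = m by rewrite -um (states_mass st) n1 n2 cc mulrDl.
  have A : - lam * m + (al + theta lam) * c ^+ 2 + om * m = pB p (modulus u).
    rewrite -AE r1 r2 -tot n1 n2 cc; move: (nrm2 mu _) (theta lam) => a b; ring.
  have Bc : pB p (fun x => c * G lam x) = pB p (modulus u).
    apply: pB_ae (L2Z c GL).1 (mmodulus mv) _.
    apply: filterS2 z1 z2 => x /eqP; rewrite subr_eq0 => /eqP e1' /eqP; rewrite subr_eq0 => /eqP e2'.
    rewrite modulusE e1' e2' !exprMn -mulrDl -cc -exprMn sqrtr_sqr ger0_norm//.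
    by apply: mulr_ge0 (ltW c0) (Ga_ge0 _ _ _).
  exact: (regular_neq0 p2 p4 m0 B0 om0 rb l0 c0 tot A Bc).
exists f; split=> //; first by exists K.
apply: filterS2 aem ae_nonzero => x e xo; have g0 := Ga_gt0 om0 xo; move: e.
rewrite (ger0_norm (modulus_ge0 u x)) (ger0_norm (addr_ge0 (f0 x) (mulr_ge0 (ltW c0) (ltW g0)))) => e.
have ms := modulus_sqr u x; have fs := md_sqr (fun x => re u x - c1 * G om x) (fun x => im u x - c2 * G om x) x.
rewrite -/f in fs; rewrite e in ms; exact: (phase_alignment ms fs cc c0 g0).
Qed.

End ground_states.

Local Open Scope complex_scope.

Theorem theorem1p5 (R : realType) (p alpha : R) (hp2 : 2 < p) (hp4 : p < 4)
    (mu : R) (hmu : 0 < mu) :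
  (exists u : plane R -> R[i], ground_state alpha p mu u) /\
  (forall u : plane R -> R[i], ground_state alpha p mu u ->
    (forall lam : R, 0 < lam ->
       ~ ae_eq2 (regular_part lam u) (fun=> 0) /\ delta_charge u != 0) /\
    (exists (z : R[i]) (w : plane R -> R[i]),
       [/\ `|z| = 1,
           cmeasurable w /\ ae_eq2 w u,
           pointwise_pos (fun x => z * w x),
           radial (fun x => z * w x) /\
             radially_decreasing (fun x => z * w x) &
           let omega := mu^-1 * (Lp_norm p u `^ p - quad_form alpha u) in
           forall lam : R, 0 < lam ->
             (lam = omega -> pointwise_nonneg (fun x => z * regular_part lam w x)) /\
             (omega < lam -> pointwise_pos (fun x => z * regular_part lam w x))])).
Proof.
split; first exact: existence hp2 hp4 hmu.
move=> u gu; have [c1 [q1 [c2 [q2 [st om0 c0 reg [f [f0 pf [N hN] aef]]]]]]] := structure hp2 hp4 hmu gu.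
move: (mu^-1 * _) om0 aef => om om0 aef.
have cc : Num.sqrt (c1 ^+ 2 + c2 ^+ 2) ^+ 2 = c1 ^+ 2 + c2 ^+ 2 by rewrite sqr_sqrtr// addr_ge0 ?sqr_ge0.
move: (Num.sqrt _) c0 cc aef => c c0 cc aef; have cn := lt0r_neq0 c0.
have [mv h1 h2] := st; have [_ dE _] := states_form st.
have d0 : (c1 +i* c2)%C != 0.
  apply/eqP => -[z1 z2]; move: cc; rewrite z1 z2 expr0n addr0 => /eqP.
  by rewrite sqrf_eq0 (negPf cn).
split; first by move=> lam l0; split; [exact: reg|rewrite dE].
have [F [mF Fae F0 Fd]] := radial_representative hN f0 pf.
have GL := L2_Ga om0 (lexx 0).
(* F is only nonnegative and nonincreasing; positivity and strict decrease come from c G. *)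
pose H (x : plane R) : R := F x + c * Ga om 0 x.
have mH : measurable_fun [set: mplane R] H.
  by apply: measurable_funD => //; exact: (L2Z c GL).1.
(* The conjugate of the phase of the charge, whose modulus is c. *)
pose z : R[i] := (c1 / c +i* - (c2 / c))%C.
pose w : plane R -> R[i] := cpx (fun x => c1 / c * H x) (fun x => c2 / c * H x).
have nz : (c1 / c) ^+ 2 + (c2 / c) ^+ 2 = 1.
  by rewrite !expr_div_n -mulrDl -cc divff// expf_neq0.
have zw x : z * w x = (H x)%:C.
  rewrite /z /w /cpx; apply/eqP; rewrite eq_complex /=; apply/andP; split; apply/eqP; last by ring.
  by rewrite -[RHS]mul1r -nz; ring.
have mw : cmeasurable w by split; apply: measurable_funM => //; exact: measurable_cst.
have aew : {ae leb2 R, forall x : mplane R, re u x = re w x /\ im u x = im w x}.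
  by apply: filterS2 aef Fae => x [e1 e2] e3; rewrite /re /im /w /cpx /H /= e3; split.
have sw : states alpha w c1 q1 c2 q2.
  split=> //; [apply: QF_ae ltr01 mw.1 _ h1|apply: QF_ae ltr01 mw.2 _ h2].
    by apply: filterS aew => x [].
  by apply: filterS aew => x [].
have [_ dw _] := states_form sw.
have zreg lam x : z * regular_part lam w x = (H x - c * green lam x)%:C.
  rewrite /regular_part dw /minus_green mulrBr zw; apply/eqP; rewrite eq_complex /=; apply/andP; split; apply/eqP; last by field.
  have -> : c * green lam x = (c1 ^+ 2 + c2 ^+ 2) / c * green lam x by rewrite -cc; congr (_ * _); field.
  by field.
have G0 x : x != 0 -> 0 < c * Ga om 0 x by move=> xo; rewrite mulr_gt0// Ga_gt0.
exists z, w; split.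
- rewrite normc_def /z /= sqrrN nz sqrtr1; exact/eqP.
- split=> //; apply: filterS aew => x [a b]; move: a b; rewrite /re /im.
  by case: (u x) (w x) => a b [a' b'] /= -> ->.
- by move=> x xo; rewrite zw ltcR; apply: ltr_wpDl (F0 x) (G0 x xo).
- split=> [x y xo yo xy|x y xo yo xy].
    rewrite !zw /H (Ga_radial om0 xo yo xy); congr (_ + _)%:C.
    by apply/eqP; rewrite eq_le !Fd ?xy.
  rewrite !zw ltcR; apply: ler_ltD; first by apply: Fd => //; exact: ltW.
  by rewrite ltr_pM2l//; exact: Ga_decr om0 xo xy.
(* Up to the phase, the regular part is F when lam = om and F + c (G_om - G_lam) otherwise; the
   Green function decreases strictly in its parameter. *)
move=> lam l0; split=> [lo|lo] x xo; rewrite zreg.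
  by rewrite lecR lo greenE// /H addrK.
rewrite ltcR greenE// /H -addrA -mulrBr; apply: ltr_wpDl (F0 x) _.
by rewrite mulr_gt0// subr_gt0; exact: Ga_mass_decr om0 lo xo.
Qed.
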